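(* There are universal constants $c_1,c_2>0$ such that for every graph $G$ as in the context and integer $r\ge2$: if $d\le c_1\,\Phi_{local}\sqrt{\log r}/\sqrt{\log n}$, then $G$ contains (routably) a $(2r,d,\lambda)$-spectral SSE flow with $\lambda\ge c_2(\log r)^{-5}$. Furthermore, a $(4r,d,\lambda')$-spectral SSE flow with $\lambda'\ge c_2(\log r)^{-5}$ can be found in polynomial time.
   Context: $G=(V,E)$ is an undirected graph on $n$ vertices with capacities $c_e\ge0$, regular with normalized degree 1. Expansion $\Phi(S)=\frac{\sum_{i\in S,j\notin S}c_{(i,j)}}{\min(|S|,n-|S|)}$; $\Phi_{local}$ is the minimum expansion of a set of size at most $n/r$. A multicommodity flow in $G$ assigns symmetric demands $\delta_{i,j}\ge0$ and routes $\delta_{i,j}$ units between $i,j$ along paths so that total flow on each edge $e$ is at most $c_e$. Its Laplacian is the Laplacian of the weighted graph with weights $\delta_{i,j}$. An $(r,d,\lambda)$-spectral SSE flow is a multicommodity flow whose vertex degrees $\sum_j\delta_{i,j}$ lie in $[d/2,d]$ and whose Laplacian has $r$-th smallest eigenvalue at least $d\lambda$. *)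

(* Defs.v *)
From mathcomp Require Import all_boot all_order all_algebra.
From mathcomp Require Import all_classical all_reals all_analysis.

Set Implicit Arguments.
Unset Strict Implicit.
Unset Printing Implicit Defensive.

Import Order.TTheory GRing.Theory Num.Theory.
Local Open Scope ring_scope.

(* A graph on the vertex set 'I_n is given by its symmetric matrix of
   capacities; {i, j} is an edge iff c i j > 0. An edge of capacity 0 carries
   no flow and does not count in any cut, so it is identified with a non-edge. *)
Definition regular_graph (R : numDomainType) (n : nat) (c : 'M[R]_n) : Prop :=
  [/\ forall i j, 0 <= c i j,
      forall i j, c i j = c j i,
      forall i, c i i = 0
    & forall i, \sum_j c i j = 1].

Definition expansion (R : realType) (n : nat) (c : 'M[R]_n) (S : {set 'I_n}) : R :=
  (\sum_(i in S) \sum_(j in ~: S) c i j) / (minn #|S| (n - #|S|))%:R.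

(* For r <= n this is the infimum of a nonempty finite set, hence a minimum.
   For r > n no set qualifies, and inf returns 0. *)
Definition phi_local (R : realType) (n : nat) (c : 'M[R]_n) (r : nat) : R :=
  inf [set expansion c S | S in
        [set S : {set 'I_n} | (0 < #|S|)%N /\ #|S|%:R <= n%:R / r%:R :> R]]%classic.

Definition simple_path (R : numDomainType) (n : nat) (c : 'M[R]_n)
    (p : seq 'I_n) : bool :=
  if p is x :: q then path (fun i j => 0 < c i j) x q && uniq p else false.

(* Endpoints and edges are unordered pairs. *)
Definition joins (n : nat) (p : seq 'I_n) (i j : 'I_n) : bool :=
  if p is x :: q then ((x, last x q) == (i, j)) || ((x, last x q) == (j, i))
  else false.

Definition traverses (n : nat) (p : seq 'I_n) (i j : 'I_n) : bool :=
  ((i, j) \in zip p (behead p)) || ((j, i) \in zip p (behead p)).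

(* A routing is a finite list of paths, each carrying an amount of flow. *)
Definition routing (R : Type) (n : nat) : Type := seq (seq 'I_n * R).

(* The demand of the unordered pair {i, j} is delta i j = delta j i, and it is
   routed once. A vertex has no demand to itself; otherwise the degree
   constraints below could be met by paths of length 0. *)
Definition multicommodity_flow (R : numDomainType) (n : nat) (c : 'M[R]_n)
    (delta : 'M[R]_n) (f : routing R n) : Prop :=
  [/\ [/\ forall i j, 0 <= delta i j,
          forall i j, delta i j = delta j i
        & forall i, delta i i = 0],
      forall pw, pw \in f -> simple_path c pw.1 /\ 0 <= pw.2,
      forall i j, \sum_(pw <- f | joins pw.1 i j) pw.2 = delta i j
    & forall i j, \sum_(pw <- f | traverses pw.1 i j) pw.2 <= c i j].

Definition laplacian (R : pzRingType) (n : nat) (w : 'M[R]_n) : 'M[R]_n :=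
  diag_mx (\row_i \sum_j w i j) - w.

(* s lists the eigenvalues of A with multiplicity, in nondecreasing order;
   such an s is unique, and it exists when A is real symmetric. *)
Definition spectrum (R : realType) (n : nat) (A : 'M[R]_n) (s : seq R) : Prop :=
  sorted <=%R s /\ char_poly A = \prod_(x <- s) ('X - x%:P).

(* The k-th smallest eigenvalue (k >= 1) is +oo when k > n, in accordance with
   the min over k-dimensional subspaces in the Courant-Fischer formula. *)
Definition kth_eigenvalue_ge (R : realType) (n : nat) (A : 'M[R]_n) (k : nat)
    (x : R) : Prop :=
  exists2 s : seq R, spectrum A s & (k <= n)%N -> x <= s`_k.-1.

Definition spectral_SSE_flow (R : realType) (n : nat) (c : 'M[R]_n) (k : nat)
    (d lambda : R) (delta : 'M[R]_n) (f : routing R n) : Prop :=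
  [/\ multicommodity_flow c delta f,
      forall i, d / 2 <= \sum_j delta i j <= d
    & kth_eigenvalue_ge (laplacian delta) k (d * lambda)].

Inductive move : Set := MoveLeft | MoveRight | Stay.

(* Deterministic machine with one two-way infinite tape. Its tape alphabet is
   the input/output alphabet A, the auxiliary symbols and a blank, None. The
   machine halts when tm_delta returns None. *)
Record turing_machine (A : Type) := TuringMachine {
  tm_state : finType;
  tm_aux : finType;
  tm_start : tm_state;
  tm_delta : tm_state -> option (A + tm_aux) ->
             option (tm_state * option (A + tm_aux) * move)
}.

(* A configuration (q, l, t): t is the tape from the head rightwards, l is the
   tape to the left of the head, nearest cell first; all other cells are
   blank. *)
Definition tm_config (A : Type) (M : turing_machine A) : Type :=
  (tm_state M * seq (option (A + tm_aux M)) * seq (option (A + tm_aux M)))%type.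

Definition tm_init (A : Type) (M : turing_machine A) (w : seq A) : tm_config M :=
  (tm_start M, [::], [seq Some (inl a) | a <- w]).

Definition tm_step (A : Type) (M : turing_machine A) (x : tm_config M) :
    option (tm_config M) :=
  let: (q, l, t) := x in
  if tm_delta q (head None t) is Some (q', b, m) then
    Some (match m with
          | MoveLeft => (q', behead l, head None l :: b :: behead t)
          | MoveRight => (q', b :: l, behead t)
          | Stay => (q', l, b :: behead t)
          end)
  else None.

(* The output is the longest word over A that starts at the head. *)
Fixpoint read_word (A B : Type) (t : seq (option (A + B))) : seq A :=
  if t is Some (inl a) :: t' then a :: read_word t' else [::].

(* The output, if the machine halts in at most k steps. *)
Fixpoint tm_run (A : Type) (M : turing_machine A) (k : nat) (x : tm_config M) :
    option (seq A) :=
  match tm_step x, k with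
  | None, _ => Some (read_word x.2)
  | Some _, 0%N => None
  | Some y, k'.+1 => tm_run k' y
  end.

(* The search problem "given an instance x promised to satisfy P, find some
   y : Y x with Q x y" is solved by a machine running in time polynomial in the length
   of the encoding of x. *)
Definition poly_time_solvable (A X : Type) (Y : X -> Type)
    (encX : X -> seq A) (encY : forall x, Y x -> seq A)
    (P : X -> Prop) (Q : forall x, Y x -> Prop) : Prop :=
  exists (M : turing_machine A) (p : {poly nat}), forall x, P x ->
    exists2 y : Y x, Q x y &
      tm_run p.[size (encX x)] (tm_init M (encX x)) = Some (encY x y).

(* Lists of naturals are words over {0, 1, #} = {Some false, Some true, None}:
   each number is written in binary, least significant bit first, and
   terminated by #. The length of the expansion of m is up_log 2 m.+1. *)
Definition encode_nat (m : nat) : seq (option bool) :=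
  rcons [seq Some (odd (m %/ 2 ^ i)) | i <- iota 0 (up_log 2 m.+1)] None.

Definition encode_nats (s : seq nat) : seq (option bool) :=
  flatten [seq encode_nat m | m <- s].

(* Used for nonnegative rationals only. *)
Definition rat_code (q : rat) : seq nat := [:: `|numq q|%N; `|denq q|%N].

Record instance := Instance {
  inst_n : nat;
  inst_c : 'M[rat]_inst_n;
  inst_r : nat;
  inst_d : rat
}.

Definition encode_instance (x : instance) : seq (option bool) :=
  encode_nats ([:: inst_n x; inst_r x] ++ rat_code (inst_d x) ++
    flatten [seq rat_code (inst_c x i j) | i <- enum 'I_(inst_n x),
                                           j <- enum 'I_(inst_n x)]).

Definition encode_routing (n : nat) (f : routing rat n) : seq (option bool) :=
  encode_nats (flatten
    [seq rat_code pw.2 ++ size pw.1 :: [seq val i | i <- pw.1] | pw <- f]).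

Definition real_routing (R : realType) (n : nat) (f : routing rat n) :
    routing R n :=
  [seq (pw.1, ratr pw.2) | pw <- f].

Definition admissible (R : realType) (c1 : R) (n : nat) (c : 'M[R]_n) (r : nat)
    (d : R) : Prop :=
  [/\ regular_graph c, (2 <= r)%N, 0 <= d
    & d <= c1 * phi_local c r * Num.sqrt (ln r%:R) / Num.sqrt (ln n%:R)].

(* Main.v *)
(* The flow is found by a Frank-Wolfe iteration which minimizes a potential
   penalizing congestion, vertex degrees above d, and the squared positive part
   of 1 - A, where A is the rescaled Laplacian of the demands. The gradient of
   the last term is given by the Gram matrix of vectors v_i in isotropic
   position, and a minimization step needs a path joining two vertices with
   far apart vectors which is short for the edge lengths of the congestion
   penalty. If no path makes progress, the lengths and the degree penalties
   dominate |v_i - v_j|^2. This is impossible: the separators of Arora, Rao and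
   Vazirani, in O(log r) rounds, cut V into clusters of nearly constant vectors.
   By isotropy the squared norms of a cluster add up to about 1 at most, and the
   total is 1.5 r. Fewer than r of the disjoint balls around the clusters have
   more than n / r vertices, and the coarea inequality in the other balls
   contradicts the local expansion. When the potential is small the trace of
   (1 - A)_+ is below 1.7 r, whence the eigenvalue bound. The projection
   (1 - A)_+ is approximated in integers by the Newton-Schulz iteration for the
   matrix sign; each edge also carries some demand between its own ends, which
   makes the degrees at least d / 2. The polynomial time bound comes from a
   small programming language over binary trees, compiled to Turing machines. *)
Require Import Defs.
From mathcomp Require Import all_boot all_order all_algebra.
From mathcomp Require Import all_classical all_reals all_analysis.
From mathcomp Require Import ring lra zify.
From mathcomp Require complex.

Set Implicit Arguments.
Unset Strict Implicit.
Unset Printing Implicit Defensive.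

(** * Structured programs on four stacks *)

(** In the theorem of Arora, Rao and Vazirani the vectors have unit length and obey exact triangle
    inequalities. Here the rows of the root of the projection have arbitrary norms, and path lengths
    bound |v_i - v_j|^2 only up to vertex terms from the degree penalty. Hence the vertices are
    classed by norm, each class is rescaled, and vertices with a large vertex term are dropped.
    Origin of the exponent 5: let l be the number of bits of r. Each of the O(l) rounds loses a mass
    of order 1/Q, so Q is of order l. With sigma = 4/Q and delta = 1/Q a chain may cover a squared
    distance of order 1/Q^3 and has about sqrt(l log n) links. As d is at most of order Phi sqrt(l /
    log n), links of squared length d / (Phi l^5) are short enough, whence the factor l^5 in the
    eigenvalue. The squared positive part has a Lipschitz gradient: after t steps the average of t
    paths has potential O(1/t), and a projection known to inverse polynomial precision suffices. The
    trace is tested at 1.6 r, between 1.5 r, which guarantees progress, and 1.7 r, which suffices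
    for the eigenvalue bound. *)

Inductive reg : Set := RA | RB | RC | RD.
Definition sym := option bool.

Record store := Store { stA : seq sym; stB : seq sym; stC : seq sym; stD : seq sym }.

Definition get (k : reg) (s : store) : seq sym :=
  match k with RA => stA s | RB => stB s | RC => stC s | RD => stD s end.

Definition set (k : reg) (w : seq sym) (s : store) : store :=
  let: Store a b c d := s in
  match k with
  | RA => Store w b c d | RB => Store a w c d | RC => Store a b w d | RD => Store a b c w
  end.

Lemma set_get k s : set k (get k s) s = s.
Proof. by case: s; case: k. Qed.

Inductive cmd : Type :=
| Skip
| Push of reg & sym
| Pop of reg
| Seq of cmd & cmd
| If of reg & (option sym -> bool) & cmd & cmd
| While of reg & (option sym -> bool) & cmd.

Inductive exec : cmd -> store -> store -> nat -> Prop :=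
| ExecSkip s : exec Skip s s 1
| ExecPush k a s : exec (Push k a) s (set k (a :: get k s) s) 1
| ExecPop k s : exec (Pop k) s (set k (behead (get k s)) s) 1
| ExecSeq c1 c2 s1 s2 s3 n1 n2 : exec c1 s1 s2 n1 -> exec c2 s2 s3 n2 ->
    exec (Seq c1 c2) s1 s3 (n1 + n2)
| ExecIf k (P : option sym -> bool) c1 c2 s s' n :
    exec (if P (ohead (get k s)) then c1 else c2) s s' n ->
    exec (If k P c1 c2) s s' n.+1
| ExecWhileF k (P : option sym -> bool) c s : P (ohead (get k s)) = false ->
    exec (While k P c) s s 1
| ExecWhileT k (P : option sym -> bool) c s1 s2 s3 n1 n2 : P (ohead (get k s1)) ->
    exec c s1 s2 n1 -> exec (While k P c) s2 s3 n2 ->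
    exec (While k P c) s1 s3 (n1 + n2).+1.

Definition height (s : store) := size (stA s) + size (stB s) + size (stC s) + size (stD s).

Lemma size_get k s : size (get k s) <= height s.
Proof. by case: s; case: k => *; rewrite /height /=; lia. Qed.

Lemma height_set k w s : height (set k w s) + size (get k s) = height s + size w.
Proof. by case: s; case: k => *; rewrite /height /=; lia. Qed.

(** Only [Push] adds a symbol, one per unit of time, so a time bound is also a space bound. *)
Lemma exec_height c s s' n : exec c s s' n -> height s' <= height s + n.
Proof.
elim=> {c s s' n} //=; try lia.
- by move=> k a s; have := height_set k (a :: get k s) s => /=; lia.
- by move=> k s; have := height_set k (behead (get k s)) s; rewrite size_behead; lia.
Qed.

(* The four stacks are four tracks of the tape, with the bottoms at the left
   end; an input letter is a cell of the first track. The auxiliary symbol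
   [None] marks the cell to the left of the tracks. *)
Definition quad := (option sym * option sym * option sym * option sym)%type.
Definition tsym := option (sym + option quad)%type.

Definition cget (k : reg) (c : quad) : option sym :=
  let: (a, b, c, d) := c in
  match k with RA => a | RB => b | RC => c | RD => d end.

Definition cset (k : reg) (w : option sym) (x : quad) : quad :=
  let: (a, b, c, d) := x in
  match k with
  | RA => (w, b, c, d) | RB => (a, w, c, d) | RC => (a, b, w, d) | RD => (a, b, c, w)
  end.

(** Cells that the simulation has not yet rewritten hold input letters or blanks. Reading them as
    columns spares a conversion pass over the input. *)
Definition dec (s : tsym) : option quad :=
  match s with
  | None => Some (None, None, None, None)
  | Some (inl a) => Some (Some a, None, None, None)
  | Some (inr x) => x
  end.

(** Position 0 is the marker. The reversal keeps the bottom of every stack at position 1, so that a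
    push or a pop changes a single cell. *)
Definition column (s : store) (i : nat) : option quad :=
  if i is j.+1 then
    Some (onth (rev (stA s)) j, onth (rev (stB s)) j, onth (rev (stC s)) j, onth (rev (stD s)) j)
  else None.

Arguments column : simpl never.

Lemma rep0 s : column s 0 = None.
Proof. by []. Qed.

Lemma cget_rep k s j : omap (cget k) (column s j.+1) = Some (onth (rev (get k s)) j).
Proof. by case: k. Qed.

(** The phases of a test: [None] seeks the top of the stack, [Some None] reads the topmost cell, and
    [Some (Some b)] carries the outcome [b] home. *)
Definition test_state := option (option bool).

Fixpoint cst (c : cmd) : finType :=
  match c with
  | Skip => unit
  | Push _ _ => bool
  | Pop _ => option bool
  | Seq c1 c2 => (cst c1 + cst c2)%type
  | If _ _ c1 c2 => (test_state + (cst c1 + cst c2))%type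
  | While _ _ c => (test_state + cst c)%type
  end.

Fixpoint cstart (c : cmd) : cst c :=
  match c with
  | Skip => tt
  | Push _ _ => true
  | Pop _ => None
  | Seq c1 c2 => inl (cstart c1)
  | If _ _ _ _ => inl None
  | While _ _ _ => inl None
  end.

Definition go_home (Q : Type) (q exit : Q) (x : option quad) : Q * option quad * move :=
  if x is Some _ then (q, x, MoveLeft) else (exit, x, MoveRight).

Definition seek (Q : Type) (k : reg) (q : Q) (x : option quad) (stop : quad -> Q * option quad * move) :=
  if x is Some y then if cget k y is Some _ then (q, x, MoveRight) else stop y
  else (q, x, MoveRight).

Definition test_step (Q : Type) (k : reg) (P : option sym -> bool) (inj : test_state -> Q)
    (exit : bool -> Q) (q : test_state) (x : option quad) : Q * option quad * move :=
  match q with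
  | None => seek k (inj None) x (fun y => (inj (Some None), x, MoveLeft))
  | Some None => if x is Some y then (inj (Some (Some (P (cget k y)))), x, MoveLeft)
                 else (exit (P None), x, MoveRight)
  | Some (Some b) => go_home (inj (Some (Some b))) (exit b) x
  end.

(** Subprograms share one control: [inj] embeds the states of the subprogram into those of the
    whole, and [exit] is the state that follows it. Every command starts and ends with the head on
    position 1. *)
Fixpoint cstep (c : cmd) (Q : Type) : (cst c -> Q) -> Q -> cst c -> option quad -> Q * option quad * move :=
  match c return (cst c -> Q) -> Q -> cst c -> option quad -> Q * option quad * move with
  | Skip => fun inj exit q x => (exit, x, Stay)
  | Push k a => fun inj exit q x =>
      if q then seek k (inj true) x (fun y => (inj false, Some (cset k (Some a) y), MoveLeft))
      else go_home (inj false) exit x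
  | Pop k => fun inj exit q x =>
      match q with
      | None => seek k (inj None) x (fun y => (inj (Some true), x, MoveLeft))
      | Some true => if x is Some y then (inj (Some false), Some (cset k None y), MoveLeft)
                     else (exit, x, MoveRight)
      | Some false => go_home (inj (Some false)) exit x
      end
  | Seq c1 c2 => fun inj exit q x =>
      match q with
      | inl q1 => cstep (inj \o inl) (inj (inr (cstart c2))) q1 x
      | inr q2 => cstep (inj \o inr) exit q2 x
      end
  | If k P c1 c2 => fun inj exit q x =>
      match q with
      | inl t => test_step k P (inj \o inl)
          (fun b => if b then inj (inr (inl (cstart c1))) else inj (inr (inr (cstart c2)))) t x
      | inr (inl q1) => cstep (inj \o inr \o inl) exit q1 x
      | inr (inr q2) => cstep (inj \o inr \o inr) exit q2 x
      end
  | While k P c => fun inj exit q x =>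
      match q with
      | inl t => test_step k P (inj \o inl)
          (fun b => if b then inj (inr (cstart c)) else exit) t x
      | inr q1 => cstep (inj \o inr) (inj (inl None)) q1 x
      end
  end.

(** * Simulation of stack programs by a Turing machine *)

Section Simulation.
Variables (Q : finType) (q0 : Q) (delta : Q -> tsym -> option (Q * tsym * move)).
Definition mach := @TuringMachine sym Q (option quad : finType) q0 delta.

Definition mach_reach (j : nat) (x y : tm_config mach) :=
  iter j (obind (@tm_step _ mach)) (Some x) = Some y.

Lemma mach_reach_trans i j x y z : mach_reach i x y -> mach_reach j y z -> mach_reach (i + j) x z.
Proof. by rewrite /mach_reach addnC iterD => ->. Qed.

Definition matches p (F : nat -> option quad) (l t : seq tsym) :=
  map dec l = rev (mkseq F p) /\ forall j, dec (nth None t j) = F (p + j).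

(** Runs between configurations known only up to decoding, that is by state, head position and the
    column at each position. Blank cells beyond the written part of the tape are thereby covered. *)
Definition areach j (x y : Q * nat * (nat -> option quad)) :=
  let: (q, p, F) := x in let: (q', p', F') := y in
  forall l t, matches p F l t ->
  exists l' t', mach_reach j (q, l, t) (q', l', t') /\ matches p' F' l' t'.

Arguments areach : simpl never.

Lemma areach_trans i j x y z : areach i x y -> areach j y z -> areach (i + j) x z.
Proof.
case: x => [[q p] F]; case: y => [[q' p'] F']; case: z => [[q'' p''] F''] xy yz l t m.
have [l' [t' [r1 m1]]] := xy l t m.
have [l'' [t'' [r2 m2]]] := yz l' t' m1.
by exists l'', t''; split=> //; exact: mach_reach_trans r2.
Qed.

Lemma areach0 x : areach 0 x x.
Proof. by case: x => [[q p] F] l t m; exists l, t. Qed.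

Definition updF (F : nat -> option quad) p w := fun i => if i == p then w else F i.

Lemma updF_id F p : updF F p (F p) = F.
Proof. by apply: funext => i; rewrite /updF; case: eqP => // ->. Qed.

Lemma mkseq_updF F p w : mkseq (updF F p w) p = mkseq F p.
Proof.
apply/eq_in_map => i; rewrite mem_iota add0n => /andP[_ ip].
by rewrite /updF ltn_eqF.
Qed.

Lemma mkseqS (F : nat -> option quad) p : mkseq F p.+1 = rcons (mkseq F p) (F p).
Proof. by rewrite /mkseq -addn1 iotaD map_cat /= add0n cats1. Qed.

Lemma nth_behead_dec t F p j : (forall j, dec (nth None t j) = F (p + j)) ->
  dec (nth None (behead t) j) = F (p.+1 + j).
Proof. by move=> h; rewrite nth_behead h addnS addSn. Qed.

(* The steps written by [delta] on the decoded symbol under the head. *)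
Definition obeys q (f : option quad -> Q * option quad * move) :=
  forall s, delta q s = let: (q', w, m) := f (dec s) in Some (q', Some (inr w), m).

Lemma astep q f p F : obeys q f ->
  match f (F p) with
  | (q', w, MoveRight) => areach 1 (q, p, F) (q', p.+1, updF F p w)
  | (q', w, MoveLeft) => 0 < p -> areach 1 (q, p, F) (q', p.-1, updF F p w)
  | (q', w, Stay) => areach 1 (q, p, F) (q', p, updF F p w)
  end.
Proof.
move=> ob; case E: (f (F p)) => [[q' w] m].
have st l t : matches p F l t -> delta q (head None t) = Some (q', Some (inr w), m).
  move=> [_ mt]; rewrite ob; have := mt 0; rewrite nth0 addn0 => ->.
  by rewrite E.
case: m E st => E st; rewrite /areach.
- case: p E st => // p E st _ l t m; move: (m); rewrite /matches mkseqS rev_rcons => -[].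
  case: l m => //= a l m [da ml] mt.
  exists l, (a :: Some (inr w) :: behead t); split.
    by rewrite /mach_reach /= /tm_step /= (st _ t m).
  split; first by rewrite ml /mkseq; congr rev; apply/eq_in_map => i; rewrite mem_iota /updF => /andP[_ ?]; rewrite ltn_eqF// (ltn_trans (_ : i < p)).
  case=> [|[|j]] /=.
  + by rewrite addn0 da /updF ltn_eqF.
  + by rewrite addn1 /updF eqxx.
  + rewrite (@nth_behead_dec t F p.+1)// /updF gtn_eqF ?addSn ?addnS//.
    by lia.
- move=> l t m; move: (m) => [ml mt].
  exists (Some (inr w) :: l), (behead t); split.
    by rewrite /mach_reach /= /tm_step /= (st l t m).
  split; first by rewrite mkseqS rev_rcons /= {1}/updF eqxx mkseq_updF ml.
  by move=> j; rewrite (@nth_behead_dec t F p)// /updF gtn_eqF//; lia.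
- move=> l t m; move: (m) => [ml mt].
  exists l, (Some (inr w) :: behead t); split.
    by rewrite /mach_reach /= /tm_step /= (st l t m).
  split; first by rewrite mkseq_updF.
  case=> [|j] /=; first by rewrite addn0 /updF eqxx.
  by rewrite (@nth_behead_dec t F p)// /updF gtn_eqF ?addSn ?addnS//; lia.
Qed.

Lemma awalk_left q exit F p : obeys q (go_home q exit) -> F 0 = None ->
  (forall i, i < p -> F i.+1 <> None) -> areach p.+1 (q, p, F) (exit, 1, F).
Proof.
move=> ob F0; elim: p => [|p IH] Fp.
  by have := astep 0 F ob; rewrite F0 /= -[in updF _ _ _]F0 updF_id.
have := astep p.+1 F ob; have := Fp p (ltnSn p); case E: (F p.+1) => [y|] // _.
rewrite /= -E updF_id => /(_ isT) r1; apply: (areach_trans r1 (IH _)).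
by move=> i ip; apply: Fp; exact: leqW.
Qed.

Lemma aseek k q stop s p : obeys q (fun x => seek k q x (stop x)) -> p <= size (get k s) ->
  areach p (q, 1, column s) (q, p.+1, column s).
Proof.
move=> ob; elim: p => [_|p IH hp]; first exact: areach0.
rewrite -addn1; apply: (areach_trans (IH (ltnW hp))).
have := astep p.+1 (column s) ob; have := cget_rep k s p.
case E: (column s p.+1) => [y|] //= [e].
move: e; case O: (onth _ _) => [z|] e; first by rewrite /= e -E updF_id addn1.
by have := onthTE (rev (get k s)) p; rewrite O size_rev hp.
Qed.

Lemma rep_top k s : omap (cget k) (column s (size (get k s)).+1) = Some None.
Proof. by rewrite cget_rep onth_default// size_rev. Qed.

Lemma rep_set k w s i : column (set k w s) i.+1 = omap (cset k (onth (rev w) i)) (column s i.+1).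
Proof. by case: s; case: k. Qed.

Lemma cset_cget k y : cset k (cget k y) y = y.
Proof. by case: y => [[[a b] c] d]; case: k. Qed.

Lemma rep_updF k w s i : (forall j, j != i -> onth (rev w) j = onth (rev (get k s)) j) ->
  updF (column s) i.+1 (omap (cset k (onth (rev w) i)) (column s i.+1)) = column (set k w s).
Proof.
move=> ne; apply: funext => -[|j]; rewrite /updF // eqSS rep_set.
case: eqP => [->//|/eqP ij]; rewrite ne//; have := cget_rep k s j.
by case E: (column s j.+1) => [y|] //= [<-]; rewrite cset_cget.
Qed.

Lemma rep_push k a s : let h := size (get k s) in
  updF (column s) h.+1 (omap (cset k (Some a)) (column s h.+1)) = column (set k (a :: get k s) s).
Proof.
move=> h; have e : onth (rev (a :: get k s)) h = Some a.
  by rewrite rev_cons -cats1 onth_cat size_rev ltnn subnn.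
rewrite -e; apply: rep_updF => j jh; rewrite rev_cons -cats1 onth_cat size_rev.
case: ltngtP jh => // hj _; rewrite !onth_default ?size_rev ?(ltnW hj)//=.
by rewrite subn_gt0.
Qed.

Lemma rep_pop k a w s : get k s = a :: w ->
  updF (column s) (size w).+1 (omap (cset k None) (column s (size w).+1)) = column (set k w s).
Proof.
move=> e; have e' : onth (rev w) (size w) = None by rewrite onth_default// size_rev.
rewrite -e'; apply: rep_updF => j jh; rewrite e rev_cons -cats1 onth_cat size_rev.
case: ltngtP jh => // hj _; rewrite !onth_default ?size_rev ?(ltnW hj)//=.
by rewrite subn_gt0.
Qed.

Lemma rep_topP k s a w : get k s = a :: w ->
  exists2 y, column s (size w).+1 = Some y & cget k y = Some a.
Proof.
move=> e; have := cget_rep k s (size w); case: (column s _) => [y|] //= [ey].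
exists y => //; rewrite ey e rev_cons -cats1 onth_cat size_rev ltnn subnn //.
Qed.

Lemma sim_push k a s q1 q2 exit :
  obeys q1 (fun x => seek k q1 x (fun y => (q2, Some (cset k (Some a) y), MoveLeft))) ->
  obeys q2 (go_home q2 exit) ->
  areach (size (get k s) + 1 + (size (get k s)).+1) (q1, 1, column s)
    (exit, 1, column (set k (a :: get k s) s)).
Proof.
move=> o1 o2; set h := size _.
apply: (@areach_trans _ _ _ (q2, h, column (set k (a :: get k s) s))); last first.
  by apply: awalk_left.
apply: (areach_trans (aseek o1 (leqnn h))).
have := astep h.+1 (column s) o1; have := rep_top k s.
rewrite -(rep_push k a s) -/h; case: (column s h.+1) => [y|] //= [e].
by rewrite e => /(_ isT).
Qed.

Lemma sim_pop k s q1 q2 q3 exit :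
  obeys q1 (fun x => seek k q1 x (fun y => (q2, x, MoveLeft))) ->
  obeys q2 (fun x => if x is Some y then (q3, Some (cset k None y), MoveLeft)
                     else (exit, x, MoveRight)) ->
  obeys q3 (go_home q3 exit) ->
  exists2 j, j <= 2 * size (get k s) + 4 & areach j (q1, 1, column s)
    (exit, 1, column (set k (behead (get k s)) s)).
Proof.
move=> o1 o2 o3; set h := size _.
have A1 : areach (h + 1) (q1, 1, column s) (q2, h, column s).
  apply: (areach_trans (aseek o1 (leqnn h))).
  have := astep h.+1 (column s) o1; have := rep_top k s.
  rewrite -/h; case E: (column s h.+1) => [y|] //= [e].
  by rewrite e -E updF_id => /(_ isT).
case E: (get k s) @h A1 => [|a w] /= A1.
  exists (0 + 1 + 1) => //; apply: (areach_trans A1).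
  have := astep 0 (column s) o2; rewrite rep0 /= -(rep0 s) updF_id.
  by rewrite -E set_get.
exists ((size w).+1 + 1 + (1 + (size w).+1)); first by lia.
apply: (areach_trans A1).
apply: (@areach_trans _ _ _ (q3, size w, column (set k w s))); last exact: awalk_left.
have A := fun F => astep (size w).+1 F o2; have [y ey _] := rep_topP E.
move: (A (column s)).
by rewrite -(rep_pop E) ey /= => /(_ isT).
Qed.

Lemma sim_test k P s (inj : test_state -> Q) (exit : bool -> Q) :
  (forall t, obeys (inj t) (test_step k P inj exit t)) ->
  exists2 j, j <= 2 * size (get k s) + 4 &
    areach j (inj None, 1, column s) (exit (P (ohead (get k s))), 1, column s).
Proof.
move=> o; set h := size _.
have A1 : areach (h + 1) (inj None, 1, column s) (inj (Some None), h, column s).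
  apply: (areach_trans (aseek (o None) (leqnn h))).
  have := astep h.+1 (column s) (o None); have := rep_top k s.
  rewrite -/h; case E: (column s h.+1) => [y|] //= [e].
  by rewrite e -E updF_id => /(_ isT).
case E: (get k s) @h A1 => [|a w] /= A1.
  exists (0 + 1 + 1) => //; apply: (areach_trans A1).
  by have := astep 0 (column s) (o (Some None)); rewrite rep0 /= -(rep0 s) updF_id.
exists ((size w).+1 + 1 + (1 + (size w).+1)); first by lia.
apply: (areach_trans A1).
apply: (@areach_trans _ _ _ (inj (Some (Some (P (Some a)))), size w, column s)); last first.
  exact: awalk_left (o (Some (Some _))) _ _.
have A := fun F => astep (size w).+1 F (o (Some None)); have [y ey ya] := rep_topP E.
move: (A (column s)).
by rewrite ey /= ya -ey updF_id => /(_ isT).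
Qed.

(** Each elementary step costs one trip along the tape and back. The stacks never exceed [H], which
    bounds the initial height plus the time, so the simulation is quadratic. *)
Lemma simulate c s s' n : exec c s s' n -> forall H (inj : cst c -> Q) (exit : Q),
  (forall q, obeys (inj q) (cstep inj exit q)) -> height s + n <= H ->
  exists2 j, j <= n * (2 * H + 5) & areach j (inj (cstart c), 1, column s) (exit, 1, column s').
Proof.
elim=> {c s s' n}.
- move=> s H inj exit o _; exists 1; first by lia.
  by have := astep 1 (column s) (o tt); rewrite /= updF_id.
- move=> k a s H inj exit o hH; exists (size (get k s) + 1 + (size (get k s)).+1).
    by have := size_get k s; lia.
  exact: sim_push (o true) (o false).
- move=> k s H inj exit o hH.
  have [j jh r] := sim_pop s (o None) (o (Some true)) (o (Some false)).
  by exists j => //; have := size_get k s; lia.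
- move=> c1 c2 s1 s2 s3 n1 n2 e1 IH1 e2 IH2 H inj exit o hH.
  have [|j1 h1 r1] := IH1 H (inj \o inl) (inj (inr (cstart c2))) (fun q => o (inl q)); first by lia.
  have [|j2 h2 r2] := IH2 H (inj \o inr) exit (fun q => o (inr q)).
    by have := exec_height e1; lia.
  by exists (j1 + j2); [lia | exact: areach_trans r1 r2].
- move=> k P c1 c2 s s' n e IH H inj exit o hH.
  have [j1 h1 r1] := @sim_test k P s (inj \o inl) _ (fun t => o (inl t)).
  have hs := size_get k s.
  case: (P (ohead (get k s))) e IH r1 => e IH r1.
    have [|j2 h2 r2] := IH H (inj \o inr \o inl) exit (fun q => o (inr (inl q))); first by lia.
    by exists (j1 + j2); [lia | exact: areach_trans r1 r2].
  have [|j2 h2 r2] := IH H (inj \o inr \o inr) exit (fun q => o (inr (inr q))); first by lia.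
  by exists (j1 + j2); [lia | exact: areach_trans r1 r2].
- move=> k P c s Pf H inj exit o hH.
  have [j1 h1] := @sim_test k P s (inj \o inl) _ (fun t => o (inl t)).
  rewrite Pf => r1; have hs := size_get k s; by exists j1 => //; lia.
- move=> k P c s1 s2 s3 n1 n2 Pt e1 IH1 e2 IH2 H inj exit o hH.
  have [j1 h1] := @sim_test k P s1 (inj \o inl) _ (fun t => o (inl t)).
  rewrite Pt => r1; have hs := size_get k s1.
  have [|j2 h2 r2] := IH1 H (inj \o inr) (inj (inl None)) (fun q => o (inr q)); first by lia.
  have [|j3 h3 r3] := IH2 H inj exit o.
    by have := exec_height e1; lia.
  exists (j1 + j2 + j3); first by lia.
  exact: areach_trans (areach_trans r1 r2) r3.
Qed.

End Simulation.

Section Machine.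
Variable c : cmd.

(** [S0] and [S1] write the marker to the left of the input. [F0] rewrites the first track as plain
    letters and ends it with a blank, [F1] walks back to the marker, and [F2] halts on the first
    letter. *)
Definition mstate : finType := (bool + option bool + cst c)%type.

Local Notation S0 := (inl (inl true) : mstate).
Local Notation S1 := (inl (inl false) : mstate).
Local Notation F0 := (inl (inr (Some true)) : mstate).
Local Notation F1 := (inl (inr (Some false)) : mstate).
Local Notation F2 := (inl (inr None) : mstate).

Definition mdelta (q : mstate) (s : tsym) : option (mstate * tsym * move) :=
  match q with
  | inl (inl true) => Some (S1, Some (inr (dec s)), MoveLeft)
  | inl (inl false) => Some (inr (cstart c), Some (inr None), MoveRight)
  | inl (inr (Some true)) =>
      if dec s is Some y then
        if cget RA y is Some a then Some (F0, Some (inl a), MoveRight)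
        else Some (F1, None, MoveLeft)
      else None
  | inl (inr (Some false)) =>
      if dec s is Some y then Some (F1, s, MoveLeft) else Some (F2, s, MoveRight)
  | inl (inr None) => None
  | inr q => let: (q', w, m) := cstep inr F0 q (dec s) in Some (q', Some (inr w), m)
  end.

Local Notation mreach := (@mach_reach mstate S0 mdelta).

Definition machine : turing_machine sym := mach S0 mdelta.

Lemma reach_run i k (x y : tm_config machine) : mreach i x y -> tm_step y = None ->
  i <= k -> tm_run k x = Some (read_word y.2).
Proof.
move=> + yN; elim: i k x => [|i IH] k x.
  by case=> -> _; case: k => [|k] /=; rewrite yN.
rewrite /mach_reach iterSr /=; case: k => // k; case E: (tm_step x) => [z|].
  by move=> r ik; rewrite /= E; apply: IH.
rewrite (_ : iter i _ None = None)//.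
by elim: (i) => //= j ->.
Qed.

Let g (a : sym) : tsym := Some (inl a).

Lemma init_matches w : mreach 2 (tm_init machine w)
    (inr (cstart c), [:: Some (inr None)], Some (inr (dec (head None (map g w)))) :: behead (map g w))
  /\ matches 1 (column (Store (rev w) [::] [::] [::]))
    [:: Some (inr None)] (Some (inr (dec (head None (map g w)))) :: behead (map g w)).
Proof.
split=> //; split=> // j; rewrite add1n /column /= revK.
have -> : onth [::] j = None :> option sym by rewrite onth_default.
case: w => [|a w]; case: j => [|j] //=; first by rewrite nth_nil.
rewrite onthE; elim: w j => [|b w IH] [|j] //=.
Qed.

Lemma fin_right w l t :
  (forall j, exists2 y, dec (nth None t j) = Some y & cget RA y = onth w j) ->
  exists t', mreach (size w).+1 (F0, l, t)
    (F1, behead (rev (map g w) ++ l), head None (rev (map g w) ++ l) :: None :: t').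
Proof.
elim: w l t => [|a w IH] l t h.
  exists (behead t); have [y] := h 0; rewrite nth0 /= => e1 e2.
  by rewrite /mach_reach /= /tm_step /= e1 e2.
have [y] := h 0; rewrite nth0 /= => e1 e2.
have [j|t' r] := IH (g a :: l) (behead t).
  by have := h j.+1; rewrite nth_behead.
exists t'; rewrite rev_cons -cats1 -catA /= -add1n; apply: mach_reach_trans r.
by rewrite /mach_reach /= /tm_step /= e1 e2.
Qed.

Lemma fin_left w x t : dec x = None ->
  mreach (size w).+1 (F1, behead (rev (map g w) ++ [:: x]), head None (rev (map g w) ++ [:: x]) :: t)
    (F2, [:: x], map g w ++ t).
Proof.
move=> dx; elim/last_ind: w t => [|w a IH] t.
  by rewrite /mach_reach /= /tm_step /= dx.
rewrite map_rcons rev_rcons size_rcons /= cat_rcons -add1n; apply: mach_reach_trans (IH _).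
by rewrite /mach_reach /= /tm_step /=.
Qed.

Lemma read_word_map w t : read_word (map g w ++ None :: t) = w.
Proof. by elim: w => //= a w ->. Qed.

(** Input and output are reversed on stack A because the first letter of a word lies at the bottom
    of the track. *)
Lemma machine_correct w s n k : exec c (Store (rev w) [::] [::] [::]) s n ->
  n * (2 * (size w + n) + 5) + 2 * (size w + n) + 6 <= k ->
  tm_run k (tm_init machine w) = Some (rev (stA s)).
Proof.
move=> e hk.
have hw : height (Store (rev w) [::] [::] [::]) = size w by rewrite /height /= size_rev !addn0.
have [i1 m1] := init_matches w.
have o q : obeys mdelta (inr q) (cstep inr F0 q) by [].
have [|j hj r] := @simulate mstate S0 mdelta _ _ _ _ e (size w + n) inr F0 o; first by rewrite hw.
have [l [t [r2 m2]]] := r _ _ m1.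
case: m2; rewrite /mkseq /= rep0; case: l r2 => [|x [|? ?]] //= r2 [dx] mt.
have [|t' r3] := @fin_right (rev (stA s)) [:: x] t.
  by move=> i; rewrite mt add1n; have := cget_rep RA s i; case: (column s i.+1) => // y [<-]; exists y.
have r4 := fin_left (rev (stA s)) (None :: t') dx.
have := reach_run (mach_reach_trans (mach_reach_trans (mach_reach_trans i1 r2) r3) r4).
move=> /(_ k erefl); rewrite read_word_map; apply.
have := exec_height e; rewrite hw; have := size_get RA s; rewrite /= size_rev; lia.
Qed.

End Machine.

(** * Polynomial-time functions *)

Inductive tree : Type := Leaf | Node of tree & tree.

(* Prefix code: a value on top of a stack is self-delimiting. *)
Fixpoint bits (x : tree) : seq sym :=
  if x is Node l r then Some true :: bits l ++ bits r else [:: Some false].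

Definition tsize (x : tree) : nat := size (bits x).

Lemma tsize_gt0 x : 0 < tsize x.
Proof. by case: x. Qed.

Lemma tsize_Node l r : tsize (Node l r) = (tsize l + tsize r).+1.
Proof. by rewrite /tsize /= size_cat. Qed.

Definition is1 (x : option sym) : bool := if x is Some (Some true) then true else false.
Definition isbit (x : option sym) : bool := if x is Some (Some _) then true else false.

Definition on_bit (k : reg) (c : sym -> cmd) : cmd :=
  If k is1 (Seq (Pop k) (c (Some true))) (Seq (Pop k) (c (Some false))).

Lemma exec_on_bit k c (b : bool) w s s' n : get k s = Some b :: w ->
  exec (c (Some b)) (set k w s) s' n -> exec (on_bit k c) s s' n.+2.
Proof.
move=> e ex; apply: ExecIf; rewrite e /=.
have p := ExecPop k s; rewrite e /= in p.
by case: b e ex => e ex; rewrite -add1n; apply: ExecSeq p ex.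
Qed.

(** Stack C holds one mark per subtree still to be read: an inner node adds a mark, a leaf removes
    one, and the value ends when no mark is left. *)
Definition move_body : cmd :=
  If RA is1 (Seq (Pop RA) (Seq (Push RB (Some true)) (Push RC (Some true))))
            (Seq (Pop RA) (Seq (Push RB (Some false)) (Pop RC))).

Lemma exec_move_body (x : tree) a b c d s' n :
  exec (While RC is1 move_body) (Store a (rev (bits x) ++ b) c d) s' n ->
  exec (While RC is1 move_body) (Store (bits x ++ a) b (Some true :: c) d) s'
    (5 * tsize x + n).
Proof.
elim: x a b c s' n => [|l IHl r IHr] a b c s' n ex /=.
  rewrite -[5 * _ + n]/((4 + n).+1); apply: ExecWhileT (ex) => //=.
  apply: (@ExecIf _ _ _ _ _ _ 3) => /=.
  apply: (@ExecSeq _ _ _ (Store a b (Some true :: c) d) _ 1 2); first exact: ExecPop.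
  by apply: (@ExecSeq _ _ _ (Store a (Some false :: b) (Some true :: c) d) _ 1 1); [exact: ExecPush|exact: ExecPop].
rewrite tsize_Node.
have -> : 5 * (tsize l + tsize r).+1 + n = (4 + (5 * tsize l + (5 * tsize r + n))).+1 by lia.
apply: (@ExecWhileT _ _ _ _ (Store (bits l ++ bits r ++ a) (Some true :: b) [:: Some true, Some true & c] d)) => //=.
  apply: (@ExecIf _ _ _ _ _ _ 3) => /=; rewrite catA.
  apply: (@ExecSeq _ _ _ (Store ((bits l ++ bits r) ++ a) b (Some true :: c) d) _ 1 2); first exact: ExecPop.
  by apply: (@ExecSeq _ _ _ (Store _ (Some true :: b) (Some true :: c) d) _ 1 1); exact: ExecPush.
apply: IHl; apply: IHr; move: ex.
by rewrite rev_cons rev_cat -!cats1 -!catA.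
Qed.

(* Move the value on top of A to B, reversed, above a separator. *)
Definition stash : cmd :=
  Seq (Push RB None) (Seq (Push RC None) (Seq (Push RC (Some true))
    (Seq (While RC is1 move_body) (Pop RC)))).

Lemma exec_stash x a b c d :
  exec stash (Store (bits x ++ a) b c d) (Store a (rev (bits x) ++ None :: b) c d) (5 * tsize x + 5).
Proof.
rewrite (_ : _ + 5 = 1 + (1 + (1 + ((5 * tsize x + 1) + 1)))); last by lia.
apply: (@ExecSeq _ _ _ (Store (bits x ++ a) (None :: b) c d)); first exact: ExecPush.
apply: (@ExecSeq _ _ _ (Store (bits x ++ a) (None :: b) (None :: c) d)); first exact: ExecPush.
apply: (@ExecSeq _ _ _ (Store (bits x ++ a) (None :: b) [:: Some true, None & c] d)); first exact: ExecPush.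
apply: (@ExecSeq _ _ _ (Store a (rev (bits x) ++ None :: b) (None :: c) d)); last exact: ExecPop.
by apply: (@exec_move_body x); exact: ExecWhileF.
Qed.

Definition all_bits (w : seq sym) := all isSome w.

Lemma all_bits_bits x : all_bits (bits x).
Proof. by elim: x => //= l IHl r IHr; rewrite /all_bits all_cat -/(all_bits _) IHl. Qed.

Definition clear_to_sep : cmd := Seq (While RB isbit (Pop RB)) (Pop RB).

Lemma exec_clear w a b c d : all_bits w ->
  exec clear_to_sep (Store a (w ++ None :: b) c d) (Store a b c d) (2 * size w + 2).
Proof.
move=> hw; rewrite (_ : _ + 2 = (2 * size w + 1) + 1); last by lia.
apply: (@ExecSeq _ _ _ (Store a (None :: b) c d)); last exact: ExecPop.
elim: w hw => [_|[y|] w IH //= hw]; first exact: ExecWhileF.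
rewrite (_ : 2 * _ + 1 = (1 + (2 * size w + 1)).+1); last by lia.
by apply: ExecWhileT (IH hw) => //; exact: ExecPop.
Qed.

Definition drop_value : cmd := Seq stash clear_to_sep.

Lemma exec_drop x a b c d :
  exec drop_value (Store (bits x ++ a) b c d) (Store a b c d) (7 * tsize x + 7).
Proof.
rewrite (_ : _ + 7 = (5 * tsize x + 5) + (2 * size (rev (bits x)) + 2)); last by rewrite size_rev -/(tsize x); lia.
apply: ExecSeq (exec_stash _ _ _ _ _) (exec_clear _ _ _ _ _).
by rewrite /all_bits all_rev; exact: all_bits_bits.
Qed.

Definition unstash : cmd :=
  Seq (While RB isbit (on_bit RB (fun s => Push RA s))) (Pop RB).

Lemma exec_unstash w a b c d : all_bits w ->
  exec unstash (Store a (w ++ None :: b) c d) (Store (rev w ++ a) b c d) (4 * size w + 2).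
Proof.
move=> hw; rewrite (_ : _ + 2 = (4 * size w + 1) + 1); last by lia.
apply: (@ExecSeq _ _ _ (Store (rev w ++ a) (None :: b) c d)); last exact: ExecPop.
elim: w a hw => [|[y|] w IH //=] a hw; first exact: ExecWhileF.
rewrite (_ : 4 * _ + 1 = (3 + (4 * size w + 1)).+1); last by lia.
apply: (@ExecWhileT _ _ _ _ (Store (Some y :: a) (w ++ None :: b) c d)) => //.
  by apply: (@exec_on_bit _ _ y (w ++ None :: b)) => //; exact: (ExecPush RA (Some y) (Store _ _ _ _)).
by rewrite rev_cons -cats1 -catA; exact: IH.
Qed.

(* Copy the value on top of A to B, reversed, above a separator. *)
Definition save : cmd :=
  Seq stash (Seq (Push RD None)
   (Seq (While RB isbit (on_bit RB (fun s => Seq (Push RA s) (Push RD s))))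
   (Seq (While RD isbit (on_bit RD (fun s => Push RB s))) (Pop RD)))).

Lemma exec_save x a b c d :
  exec save (Store (bits x ++ a) b c d) (Store (bits x ++ a) (rev (bits x) ++ None :: b) c d)
    (14 * tsize x + 9).
Proof.
set w := rev (bits x).
have hw : all_bits w by rewrite /all_bits all_rev; exact: all_bits_bits.
have sw : size w = tsize x by rewrite size_rev.
have -> : bits x = rev w by rewrite revK.
rewrite (_ : _ + 9 = (5 * tsize x + 5) + (1 + ((5 * size w + 1) + ((4 * size (rev w) + 1) + 1)))); last by rewrite size_rev sw; lia.
apply: (@ExecSeq _ _ _ (Store a (w ++ None :: b) c d)); first by rewrite {1}/w revK; exact: exec_stash.
apply: (@ExecSeq _ _ _ (Store a (w ++ None :: b) c (None :: d))); first exact: ExecPush.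
apply: (@ExecSeq _ _ _ (Store (rev w ++ a) (None :: b) c (rev w ++ None :: d))).
  move: (None :: d) => d'; elim: (w) a d' hw => [|[y|] u IH //=] a' d' hw; first exact: ExecWhileF.
  rewrite (_ : 5 * _ + 1 = (4 + (5 * size u + 1)).+1); last by lia.
  apply: (@ExecWhileT _ _ _ _ (Store (Some y :: a') (u ++ None :: b) c (Some y :: d'))) => //.
    apply: (@exec_on_bit _ _ y (u ++ None :: b)) => //.
    by apply: (@ExecSeq _ _ _ (Store (Some y :: a') (u ++ None :: b) c d') _ 1 1); exact: ExecPush.
  by rewrite rev_cons -cats1 -!catA; exact: IH.
apply: (@ExecSeq _ _ _ (Store (rev w ++ a) (w ++ None :: b) c (None :: d))); last exact: ExecPop.
have hw' : all_bits (rev w) by rewrite /all_bits all_rev.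
move: (rev w ++ a) (None :: b) => a' b'; rewrite -{2}[w]revK.
elim: (rev w) b' hw' => [|[y|] u IH //=] b' hu; first exact: ExecWhileF.
rewrite (_ : 4 * _ + 1 = (3 + (4 * size u + 1)).+1); last by lia.
apply: (@ExecWhileT _ _ _ _ (Store a' (Some y :: b') c (u ++ None :: d))) => //.
  by apply: (@exec_on_bit _ _ y (u ++ None :: d)) => //; exact: (ExecPush RB (Some y) (Store _ _ _ _)).
by rewrite rev_cons -cats1 -catA; exact: IH.
Qed.

Definition runs (p : cmd) (x y : tree) (n : nat) := forall a b c d,
  exec p (Store (bits x ++ a) b c d) (Store (bits y ++ a) b c d) n.

Lemma runs_size p x y n : runs p x y n -> tsize y <= tsize x + n.
Proof.
move=> /(_ [::] [::] [::] [::]) /exec_height.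
by rewrite /height /= !cats0 !addn0 -!/(tsize _).
Qed.

Lemma runs_skip x : runs Skip x x 1.
Proof. by move=> *; exact: ExecSkip. Qed.

Lemma runs_seq p q x y z m n : runs p x y m -> runs q y z n -> runs (Seq p q) x z (m + n).
Proof. by move=> h1 h2 a b c d; apply: ExecSeq (h1 _ _ _ _) (h2 _ _ _ _). Qed.

Definition fst_cmd : cmd := Seq (Pop RA) (Seq stash (Seq drop_value unstash)).
Definition snd_cmd : cmd := Seq (Pop RA) drop_value.

Lemma runs_fst x y : runs fst_cmd (Node x y) x (9 * tsize x + 7 * tsize y + 15).
Proof.
move=> a b c d; rewrite /= -catA.
rewrite (_ : _ + 15 = 1 + ((5 * tsize x + 5) + ((7 * tsize y + 7) + (4 * size (rev (bits x)) + 2)))); last by rewrite size_rev -/(tsize x); lia.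
apply: (@ExecSeq _ _ _ (Store (bits x ++ bits y ++ a) b c d)); first exact: (ExecPop RA (Store _ _ _ _)).
apply: ExecSeq (exec_stash _ _ _ _ _) _; apply: ExecSeq (exec_drop _ _ _ _ _) _.
rewrite -[in Store (bits x ++ a)](revK (bits x)); apply: exec_unstash.
by rewrite /all_bits all_rev; exact: all_bits_bits.
Qed.

Lemma runs_snd x y : runs snd_cmd (Node x y) y (7 * tsize x + 8).
Proof.
move=> a b c d; rewrite /= -catA (_ : _ + 8 = 1 + (7 * tsize x + 7)); last by lia.
apply: (@ExecSeq _ _ _ (Store (bits x ++ bits y ++ a) b c d)); first exact: (ExecPop RA (Store _ _ _ _)).
exact: exec_drop.
Qed.

Definition push_word (w : seq sym) : cmd := foldr (fun s p => Seq p (Push RA s)) Skip w.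

Lemma exec_push_word w a b c d :
  exec (push_word w) (Store a b c d) (Store (w ++ a) b c d) (size w + 1).
Proof.
elim: w => [|s w IH] /=; first exact: ExecSkip.
have -> : size (s :: w) + 1 = (size w + 1) + 1 by rewrite /= !addn1.
exact: ExecSeq IH (ExecPush RA s (Store _ _ _ _)).
Qed.

Definition const_cmd (y : tree) := Seq drop_value (push_word (bits y)).

Lemma runs_const x y : runs (const_cmd y) x y (7 * tsize x + 7 + (tsize y + 1)).
Proof.
by move=> a b c d; apply: ExecSeq (exec_drop _ _ _ _ _) (exec_push_word _ _ _ _ _).
Qed.

Definition pair_cmd (p q : cmd) : cmd :=
  Seq save (Seq q (Seq unstash (Seq p (Push RA (Some true))))).

Lemma runs_pair p q x y z m n : runs p x y m -> runs q x z n ->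
  runs (pair_cmd p q) x (Node y z) (18 * tsize x + 12 + m + n).
Proof.
move=> hp hq a b c d.
rewrite (_ : _ + n = (14 * tsize x + 9) + (n + ((4 * size (rev (bits x)) + 2) + (m + 1)))); last by rewrite size_rev -/(tsize x); lia.
apply: ExecSeq (exec_save _ _ _ _ _) _; apply: ExecSeq (hq _ _ _ _) _.
apply: ExecSeq (exec_unstash _ _ _ _ _) _; first by rewrite /all_bits all_rev; exact: all_bits_bits.
rewrite revK; apply: ExecSeq (hp _ _ _ _) _; rewrite /= -catA.
exact: (ExecPush RA _ (Store _ _ _ _)).
Qed.

Definition if_cmd (t p q : cmd) : cmd :=
  Seq save (Seq t (If RA is1 (Seq drop_value (Seq unstash p)) (Seq drop_value (Seq unstash q)))).

Definition is_node (x : tree) := if x is Node _ _ then true else false.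

Lemma runs_if t p q x u y m n : runs t x u m -> runs (if is_node u then p else q) x y n ->
  runs (if_cmd t p q) x y (18 * tsize x + 7 * tsize u + 19 + m + n).
Proof.
move=> ht hp a b c d.
rewrite (_ : _ + n = (14 * tsize x + 9) + (m + ((7 * tsize u + 7) + ((4 * size (rev (bits x)) + 2) + n)).+1)); last by rewrite size_rev -/(tsize x); lia.
apply: ExecSeq (exec_save _ _ _ _ _) _; apply: ExecSeq (ht _ _ _ _) _.
apply: ExecIf; have un r : runs r x y n -> exec (Seq drop_value (Seq unstash r))
    (Store (bits u ++ a) (rev (bits x) ++ None :: b) c d) (Store (bits y ++ a) b c d)
    (7 * tsize u + 7 + (4 * size (rev (bits x)) + 2 + n)).
  move=> hr; apply: ExecSeq (exec_drop _ _ _ _ _) _.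
  apply: ExecSeq (exec_unstash _ _ _ _ _) _; first by rewrite /all_bits all_rev; exact: all_bits_bits.
  by rewrite revK; exact: hr.
have -> : is1 (ohead (get RA (Store (bits u ++ a) (rev (bits x) ++ None :: b) c d))) = is_node u by case: (u).
by case: is_node hp => hp; exact: un.
Qed.

(* A list is the right comb [Node x1 (Node x2 (.. Leaf))]; its spine is the
   loop counter, kept in unary on D. *)
Fixpoint spine (x : tree) : nat := if x is Node _ r then (spine r).+1 else 0.

Definition iter_cmd (p : cmd) : cmd :=
  Seq (Pop RA) (Seq (Push RD None)
   (Seq (While RA is1 (Seq (Pop RA) (Seq drop_value (Push RD (Some true)))))
   (Seq (Pop RA) (Seq (While RD isbit (Seq (Pop RD) p)) (Pop RD))))).

Lemma runs_iter p (f : nat -> tree) x m :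
  (forall i, i < spine x -> exists2 k, k <= m & runs p (f i) (f i.+1) k) ->
  exists2 n, n <= 10 * tsize x + spine x * (m + 2) + 10 &
    runs (iter_cmd p) (Node x (f 0)) (f (spine x)) n.
Proof.
move=> hp.
have H k : k <= spine x -> exists2 n, n <= k * (m + 2) + 1 &
    forall a b c d, exec (While RD isbit (Seq (Pop RD) p))
      (Store (bits (f (spine x - k)) ++ a) b c (nseq k (Some true) ++ None :: d))
      (Store (bits (f (spine x)) ++ a) b c (None :: d)) n.
  elim: k => [_|k IH kx]; first by exists 1 => // *; rewrite subn0; exact: ExecWhileF.
  have [n hn en] := IH (ltnW kx); have [|j hj rj] := hp (spine x - k.+1); first by lia.
  have e : (spine x - k.+1).+1 = spine x - k by lia.
  rewrite e in rj; exists ((1 + j) + n).+1; first by nia.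
  move=> a b c d; apply: ExecWhileT (en _ _ _ _) => //.
  by apply: ExecSeq (rj _ _ _ _); exact: (ExecPop RD (Store _ _ _ _)).
have [n hn en] := H _ (leqnn _).
have [j hj ej] : exists2 j, j <= 9 * tsize x + 1 & forall a b c d,
    exec (While RA is1 (Seq (Pop RA) (Seq drop_value (Push RD (Some true)))))
      (Store (bits x ++ a) b c d) (Store (Some false :: a) b c (nseq (spine x) (Some true) ++ d)) j.
  elim: (x) => [|l _ r [j hj ej]].
    by exists 1; [lia | move=> *; exact: ExecWhileF].
  exists ((1 + ((7 * tsize l + 7) + 1)) + j).+1; first by rewrite tsize_Node; have := tsize_gt0 l; lia.
  move=> a b c d; apply: (@ExecWhileT _ _ _ _ (Store (bits r ++ a) b c (Some true :: d))) => //.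
    rewrite /= -catA; apply: (@ExecSeq _ _ _ (Store (bits l ++ bits r ++ a) b c d)).
      exact: (ExecPop RA (Store _ _ _ _)).
    by apply: ExecSeq (exec_drop _ _ _ _ _) _; exact: (ExecPush RD _ (Store _ _ _ _)).
  have -> : nseq (spine (Node l r)) (Some true) ++ d = nseq (spine r) (Some true) ++ Some true :: d.
    by rewrite /= -cat_rcons -[_ :: _ ++ _]/((_ :: _) ++ _); congr (_ ++ _); elim: (spine r) => //= k <-.
  exact: ej.
exists (1 + (1 + (j + (1 + (n + 1))))); first by lia.
move=> a b c d; rewrite /= -catA.
apply: (@ExecSeq _ _ _ (Store (bits x ++ bits (f 0) ++ a) b c d)); first exact: (ExecPop RA (Store _ _ _ _)).
apply: (@ExecSeq _ _ _ (Store (bits x ++ bits (f 0) ++ a) b c (None :: d))); first exact: (ExecPush RD _ (Store _ _ _ _)).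
apply: ExecSeq (ej _ _ _ _) _.
apply: (@ExecSeq _ _ _ (Store (bits (f 0) ++ a) b c (nseq (spine x) (Some true) ++ None :: d))); first exact: (ExecPop RA (Store _ _ _ _)).
apply: (@ExecSeq _ _ _ (Store (bits (f (spine x)) ++ a) b c (None :: d))); last exact: (ExecPop RD (Store _ _ _ _)).
by have := en a b c d; rewrite subnn.
Qed.

Class Enc (T : Type) := encode : T -> tree.

Definition sz {T} {E : Enc T} (x : T) : nat := tsize (encode x).

(** With a base of at least 2, raising the exponent absorbs sums and constants. *)
Definition poly_bounded {X} {E : Enc X} (t : X -> nat) :=
  exists k, forall x, t x <= (sz x + 2) ^ k.

Definition PT {X Y} {EX : Enc X} {EY : Enc Y} (f : X -> Y) :=
  exists p (t : X -> nat), poly_bounded t /\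
    forall x, exists2 n, n <= t x & runs p (encode x) (encode (f x)) n.

Section PolyBounded.
Context {X : Type} {EX : Enc X}.
Implicit Types t u : X -> nat.

Lemma sz_gt0 (x : X) : 0 < sz x. Proof. exact: tsize_gt0. Qed.

Lemma pb_le t u : (forall x, t x <= u x) -> poly_bounded u -> poly_bounded t.
Proof. by move=> h [k hk]; exists k => x; apply: leq_trans (hk x). Qed.

Lemma pb_cst n : poly_bounded (fun _ : X => n).
Proof.
exists n => x; apply: leq_trans (ltnW (ltn_expl n (ltnSn 1))) _.
by case: n => // n; rewrite leq_exp2r// leq_addl.
Qed.

Lemma pb_sz : poly_bounded (fun x : X => sz x).
Proof. by exists 1 => x; rewrite expn1 leq_addr. Qed.

Lemma pb_mul t u : poly_bounded t -> poly_bounded u -> poly_bounded (fun x => t x * u x).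
Proof. by move=> [k hk] [l hl]; exists (k + l) => x; rewrite expnD leq_mul. Qed.

Lemma pb_add t u : poly_bounded t -> poly_bounded u -> poly_bounded (fun x => t x + u x).
Proof.
move=> [k hk] [l hl]; exists (k + l).+1 => x.
have p1 : 0 < (sz x + 2) ^ k by rewrite expn_gt0 addn2.
have p2 : 0 < (sz x + 2) ^ l by rewrite expn_gt0 addn2.
move: (hk x) (hl x); rewrite expnS expnD; set a := _ ^ k in p1 *; set b := _ ^ l in p2 *.
by move=> ? ?; apply: leq_trans (_ : a + b <= _); [exact: leq_add | nia].
Qed.

Lemma pb_exp t k : poly_bounded t -> poly_bounded (fun x => t x ^ k).
Proof.
move=> ht; elim: k => [|k IH]; first exact: pb_cst.
by apply: pb_le (pb_mul ht IH) => x; rewrite expnS.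
Qed.

End PolyBounded.

Lemma pb_comp {X Y} {EX : Enc X} {EY : Enc Y} (t : Y -> nat) (f : X -> Y) :
  poly_bounded t -> poly_bounded (fun x => sz (f x)) -> poly_bounded (fun x => t (f x)).
Proof.
move=> [k hk] hf; apply: (pb_le (u := fun x => (sz (f x) + 2) ^ k)); first by move=> x.
by apply: pb_exp; apply: pb_add => //; exact: pb_cst.
Qed.

Section PTClosure.
Context {X Y Z : Type} {EX : Enc X} {EY : Enc Y} {EZ : Enc Z}.

Lemma PT_size (f : X -> Y) : PT f -> poly_bounded (fun x => sz (f x)).
Proof.
move=> [p [t [pt h]]]; apply: pb_le (pb_add (@pb_sz X _) pt) => x.
by have [n nt /runs_size hs] := h x; apply: leq_trans hs _; rewrite leq_add2l.
Qed.

Lemma eq_PT (f g : X -> Y) : f =1 g -> PT f -> PT g.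
Proof. by move=> e [p [t [pt h]]]; exists p, t; split=> // x; rewrite -e. Qed.

Lemma PT_comp (g : Y -> Z) (f : X -> Y) : PT g -> PT f -> PT (fun x => g (f x)).
Proof.
move=> [q [u [pu hq]]] hf; have sf := PT_size hf; case: hf => p [t [pt hp]].
exists (Seq p q), (fun x => t x + u (f x)); split; first by apply: pb_add => //; exact: pb_comp.
move=> x; have [m mt r1] := hp x; have [n nu r2] := hq (f x).
by exists (m + n); [exact: leq_add | exact: runs_seq r1 r2].
Qed.

End PTClosure.

Instance enc_tree : Enc tree := fun x => x.
Instance enc_unit : Enc unit := fun _ => Leaf.
Instance enc_bool : Enc bool := fun b => if b then Node Leaf Leaf else Leaf.
Instance enc_prod {X Y} {EX : Enc X} {EY : Enc Y} : Enc (X * Y) :=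
  fun p => Node (encode p.1) (encode p.2).
Instance enc_option {X} {EX : Enc X} : Enc (option X) :=
  fun o => if o is Some x then Node (encode x) Leaf else Leaf.
Instance enc_seq {X} {EX : Enc X} : Enc (seq X) :=
  fix f s := if s is x :: s' then Node (encode x) (f s') else Leaf.

Lemma sz_pair {X Y} {EX : Enc X} {EY : Enc Y} (x : X) (y : Y) : sz (x, y) = (sz x + sz y).+1.
Proof. exact: tsize_Node. Qed.

Section PTBase.
Context {X Y Z : Type} {EX : Enc X} {EY : Enc Y} {EZ : Enc Z}.

(* Functions with the same encoding are computed by the same program. *)
Lemma PT_coerce (f : X -> Y) : (forall x, encode (f x) = encode x) -> PT f.
Proof.
move=> h; exists Skip, (fun=> 1); split; first exact: pb_cst.
by move=> x; exists 1 => //; rewrite h; exact: runs_skip.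
Qed.

Lemma PT_cst (y : Y) : PT (fun _ : X => y).
Proof.
exists (const_cmd (encode y)), (fun x => 7 * sz x + 7 + (tsize (encode y) + 1)); split.
  by do !(apply: pb_add || apply: pb_mul || exact: pb_cst || exact: pb_sz).
by move=> x; exists (7 * sz x + 7 + (tsize (encode y) + 1)) => //; exact: runs_const.
Qed.

Lemma PT_pair (f : X -> Y) (g : X -> Z) : PT f -> PT g -> PT (fun x => (f x, g x)).
Proof.
move=> [p [t [pt hp]]] [q [u [pu hq]]]; exists (pair_cmd p q), (fun x => 18 * sz x + 12 + t x + u x).
split; first by do !(apply: pb_add || apply: pb_mul || exact: pb_cst || exact: pb_sz || assumption).
move=> x; have [m mt r1] := hp x; have [n nu r2] := hq x.
exists (18 * sz x + 12 + m + n); last exact: runs_pair.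
by rewrite !leq_add.
Qed.

Lemma PT_fst (f : X -> Y * Z) : PT f -> PT (fun x => (f x).1).
Proof.
apply: (@PT_comp _ _ _ _ _ _ (fun p : Y * Z => p.1)).
exists fst_cmd, (fun p => 9 * sz p.1 + 7 * sz p.2 + 15); split; last first.
  by move=> [y z]; exists (9 * sz y + 7 * sz z + 15) => //; exact: runs_fst.
apply: (pb_le (u := fun p => 16 * sz p + 15)) => [[y z]|].
  by rewrite sz_pair /=; lia.
by do !(apply: pb_add || apply: pb_mul || exact: pb_cst || exact: pb_sz).
Qed.

Lemma PT_snd (f : X -> Y * Z) : PT f -> PT (fun x => (f x).2).
Proof.
apply: (@PT_comp _ _ _ _ _ _ (fun p : Y * Z => p.2)).
exists snd_cmd, (fun p => 7 * sz p.1 + 8); split; last first.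
  by move=> [y z]; exists (7 * sz y + 8) => //; exact: runs_snd.
apply: (pb_le (u := fun p => 7 * sz p + 8)) => [[y z]|].
  by rewrite sz_pair /=; lia.
by do !(apply: pb_add || apply: pb_mul || exact: pb_cst || exact: pb_sz).
Qed.

Lemma PT_if (t : X -> bool) (f g : X -> Z) : PT t -> PT f -> PT g ->
  PT (fun x => if t x then f x else g x).
Proof.
move=> ht hf hg.
have [p [u [pu h]]] := ht.
have ht' : PT (EY := enc_tree) (fun x => encode (t x)) by exists p, u.
move: ht' => [r [w [pw hr]]]; case: hf => f' [m [pm hp]]; case: hg => g' [n [pn hq]].
exists (if_cmd r f' g'), (fun x => 18 * sz x + 7 * 3 + 19 + w x + (m x + n x)).
split; first by do !(apply: pb_add || apply: pb_mul || exact: pb_cst || exact: pb_sz || assumption).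
move=> x; have [i iu r1] := hr x; have [j jm r2] := hp x; have [k kn r3] := hq x.
exists (18 * sz x + 7 * tsize (encode (t x)) + 19 + i + if t x then j else k).
  have : tsize (encode (t x)) <= 3 by case: (t x).
  by case: (t x) => /=; lia.
by apply: runs_if r1 _; case: (t x).
Qed.

End PTBase.

Lemma sz_cons {X} {EX : Enc X} (x : X) s : sz (x :: s) = (sz x + sz s).+1.
Proof. exact: tsize_Node. Qed.

Lemma spine_seq {X} {EX : Enc X} (s : seq X) : spine (encode s) = size s.
Proof. by elim: s => //= x s ->. Qed.

Lemma size_le_sz {X} {EX : Enc X} (s : seq X) : size s <= sz s.
Proof. by elim: s => // x s IH; rewrite sz_cons /= ltnS (leq_trans IH)// leq_addl. Qed.

(** The loop counter is a list, whose encoding has the right spine that [iter_cmd] consumes. The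
    bound on the intermediate values is essential: a polynomial-time step may square the size, and
    its iteration would then be exponential. *)
Lemma PT_iter {E A B} {EE : Enc E} {EA : Enc A} {EB : Enc B} (f : A -> A) (a : E -> A) (l : E -> seq B) :
  PT f -> PT a -> PT l ->
  (exists2 t : E -> nat, poly_bounded t & forall e j, j <= size (l e) -> sz (iter j f (a e)) <= t e) ->
  PT (fun e => iter (size (l e)) f (a e)).
Proof.
move=> hf ha hl [t pt ht].
have pl := PT_size hl.
have [p [u [[k hk] hp]]] := hf.
have [q [w [pw hq]]] := PT_pair hl ha.
exists (Seq q (iter_cmd p)), (fun e => w e + (10 * sz (l e) + sz (l e) * ((t e + 2) ^ k + 2) + 10)).
split.
  by do !(apply: pb_add || apply: pb_mul || apply: pb_exp || exact: pb_cst || exact: pb_sz || assumption).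
move=> e; have [i iw r1] := hq e.
have [|n hn r2] := @runs_iter p (fun i => encode (iter i f (a e))) (encode (l e)) ((t e + 2) ^ k).
  rewrite spine_seq => j jl; have [m mu r] := hp (iter j f (a e)).
  exists m; last by rewrite iterS.
  apply: leq_trans mu (leq_trans (hk _) _).
  by case: (k) => // k'; rewrite leq_exp2r// leq_add2r ht// ltnW.
exists (i + n); last by rewrite spine_seq in r2; exact: runs_seq r1 r2.
apply: leq_add => //; apply: leq_trans hn _; rewrite spine_seq -/(sz (l e)).
by rewrite leq_add2r leq_add2l leq_mul2r size_le_sz orbT.
Qed.

(** * Lists *)

Ltac pb := do !(apply: pb_add || apply: pb_mul || apply: pb_exp || exact: pb_cst ||
  exact: pb_sz || assumption || (apply: PT_size; assumption)).

Lemma PT_id {X} {EX : Enc X} : PT (fun x : X => x).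
Proof. exact: PT_coerce. Qed.

Lemma PT_comp2 {E X Y Z} {EE : Enc E} {EX : Enc X} {EY : Enc Y} {EZ : Enc Z}
    (g : X -> Y -> Z) (f : E -> X) (h : E -> Y) :
  PT (fun p : X * Y => g p.1 p.2) -> PT f -> PT h -> PT (fun e => g (f e) (h e)).
Proof. by move=> hg hf hh; exact: (PT_comp hg (PT_pair hf hh)). Qed.

Lemma PT_comp3 {E X Y Z W} {EE : Enc E} {EX : Enc X} {EY : Enc Y} {EZ : Enc Z} {EW : Enc W}
    (g : X -> Y -> Z -> W) (f : E -> X) (h : E -> Y) (k : E -> Z) :
  PT (fun p : X * Y * Z => g p.1.1 p.1.2 p.2) -> PT f -> PT h -> PT k ->
  PT (fun e => g (f e) (h e) (k e)).
Proof. by move=> hg hf hh hk; exact: (PT_comp hg (PT_pair (PT_pair hf hh) hk)). Qed.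

Section Match.
Context {E T W Z : Type} {EE : Enc E} {ET : Enc T} {EW : Enc W} {EZ : Enc Z}.

(** Lists and options are encoded alike, by [Leaf] or by a node that pairs the components. Matching
    is thus the test for a node, and the encoding of the scrutinee serves as that of the
    components. *)
Lemma PT_match (t : E -> T) (u : E -> option W) (f : E -> Z) (g : E -> W -> Z) :
  (forall e, encode (t e) = if u e is Some w then encode w else Leaf) ->
  (forall w : W, is_node (encode w)) -> PT t -> PT f -> PT (fun p : E * W => g p.1 p.2) ->
  PT (fun e => if u e is Some w then g e w else f e).
Proof.
move=> tu nw ht [q [n [pn hq]]] [r [m [[k pm] hr]]].
have pt := PT_size ht; have pp := PT_size (PT_pair (@PT_id E _) ht).
case: (PT_pair (@PT_id E _) ht) => p [v [pv hp]]; case: ht => c [w [pw hc]].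
exists (if_cmd c (Seq p r) q), (fun e => 18 * sz e + 7 * sz (t e) + 19 + w e +
  (n e + (v e + (sz (e, t e) + 2) ^ k))); split; first by pb.
move=> e; have [i iw r1] := hc e; have [j jv r2] := hp e; have [l ln r3] := hq e.
have := tu e; case: (u e) => [y|] ty.
  have [j1 hj1 r4] := hr (e, y).
  have eq1 : sz (e, y) = sz (e, t e) by rewrite !sz_pair /sz ty.
  exists (18 * sz e + 7 * sz (t e) + 19 + i + (j + j1)).
    have := pm (e, y); rewrite eq1; move: (_ ^ k) => z; lia.
  apply: runs_if r1 _; rewrite ty nw; apply: runs_seq r2 _.
  by move: r4; rewrite /encode /= -/(encode _) /enc_prod /= ty.
exists (18 * sz e + 7 * sz (t e) + 19 + i + l); first by lia.
by apply: runs_if r1 _; rewrite ty.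
Qed.

End Match.

(** A hook, redefined as more functions are shown to be polynomial-time, so that [pts] decomposes
    ever larger terms along their syntax. *)
Ltac pt_user := fail.
Ltac pt_hyp := match goal with
  | hf : PT (fun p => ?f p.1 p.2) |- PT (fun x => ?f (@?u x) (@?v x)) =>
      apply: (PT_comp2 (g := f) (f := u) (h := v) hf)
  | hf : PT (fun p => ?f p.1.1 p.1.2 p.2) |- PT (fun x => ?f (@?u x) (@?v x) (@?w x)) =>
      apply: (PT_comp3 (g := f) (f := u) (h := v) (k := w) hf)
  | hf : PT ?f |- PT (fun x => ?f (@?u x)) => apply: (PT_comp (g := f) (f := u) hf)
  end.
Ltac pt_step := cbn beta; lazymatch goal with
  | |- PT (fun x => x) => exact: PT_id
  | |- PT (fun _ => ?c) => exact: (PT_cst c)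
  | |- PT (fun x => (@?f x, @?g x)) => apply: (PT_pair (f := f) (g := g))
  | |- PT (@fst _ _) => exact: (PT_fst PT_id)
  | |- PT (@snd _ _) => exact: (PT_snd PT_id)
  | |- PT (fun x => fst (@?f x)) => apply: (PT_fst (f := f))
  | |- PT (fun x => snd (@?f x)) => apply: (PT_snd (f := f))
  | _ => first [pt_hyp | pt_user | apply: PT_if]
  end.
Ltac pts := repeat (assumption || pt_step).

Section MatchInstances.
Context {E X Z : Type} {EE : Enc E} {EX : Enc X} {EZ : Enc Z}.

Lemma PT_match_seq (l : E -> seq X) (f : E -> Z) (g : E -> X -> seq X -> Z) :
  PT l -> PT f -> PT (fun p : E * (X * seq X) => g p.1 p.2.1 p.2.2) ->
  PT (fun e => if l e is x :: s then g e x s else f e).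
Proof.
move=> hl hf hg.
apply: (eq_PT _ (@PT_match _ _ _ _ _ _ _ _ l
  (fun e => if l e is x :: s then Some (x, s) else None) f (fun e w => g e w.1 w.2) _ _ hl hf hg)) => //.
  by move=> e; case: (l e).
by move=> e; case: (l e).
Qed.

Lemma PT_match_option (o : E -> option X) (f : E -> Z) (g : E -> X -> Z) :
  PT o -> PT f -> PT (fun p : E * X => g p.1 p.2) ->
  PT (fun e => if o e is Some x then g e x else f e).
Proof.
move=> hl hf hg.
have hg' : PT (fun p : E * (X * unit) => g p.1 p.2.1).
  apply: (PT_comp2 (g := g)) => //; first exact: PT_fst PT_id.
  by apply: PT_fst; apply: PT_snd; exact: PT_id.
apply: (eq_PT _ (@PT_match _ _ _ _ _ _ _ _ o
  (fun e => if o e is Some x then Some (x, tt) else None) f (fun e w => g e w.1) _ _ hl hf hg')) => //.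
  by move=> e; case: (o e).
by move=> e; case: (o e).
Qed.

Lemma PT_cons (f : E -> X) (g : E -> seq X) : PT f -> PT g -> PT (fun e => f e :: g e).
Proof.
move=> hf hg; apply: (PT_comp (g := fun p : X * seq X => p.1 :: p.2)) (PT_pair hf hg).
by apply: PT_coerce => -[x s].
Qed.

Lemma PT_some (f : E -> X) : PT f -> PT (fun e => Some (f e)).
Proof.
move=> hf; apply: (PT_comp (g := fun p : X * unit => Some p.1)) (PT_pair hf (PT_cst tt)).
by apply: PT_coerce => -[x []].
Qed.

End MatchInstances.

Section Bool.
Context {E : Type} {EE : Enc E}.
Implicit Types f g : E -> bool.

Lemma PT_andb f g : PT f -> PT g -> PT (fun e => f e && g e).
Proof. by move=> hf hg; apply: PT_if => //; exact: PT_cst. Qed.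

Lemma PT_orb f g : PT f -> PT g -> PT (fun e => f e || g e).
Proof. by move=> hf hg; apply: PT_if => //; exact: PT_cst. Qed.

Lemma PT_negb f : PT f -> PT (fun e => ~~ f e).
Proof. by move=> hf; apply: (PT_if hf); exact: PT_cst. Qed.

Lemma PT_eqb f g : PT f -> PT g -> PT (fun e => f e == g e).
Proof.
move=> hf hg; apply: (eq_PT (f := fun e => if f e then g e else ~~ g e)).
  by move=> e; case: (f e); case: (g e).
by apply: PT_if => //; exact: PT_negb.
Qed.

End Bool.

Ltac pt_user ::= lazymatch goal with
  | |- PT (fun x => @?f x :: @?g x) => apply: (PT_cons (f := f) (g := g))
  | |- PT (fun x => Some (@?f x)) => apply: (PT_some (f := f))
  | |- PT (fun x => @?f x && @?g x) => apply: (PT_andb (f := f) (g := g))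
  | |- PT (fun x => @?f x || @?g x) => apply: (PT_orb (f := f) (g := g))
  | |- PT (fun x => ~~ @?f x) => apply: (PT_negb (f := f))
  end.

Section Fold.
Context {E A X : Type} {EE : Enc E} {EA : Enc A} {EX : Enc X}.

Lemma sz_drop (s : seq X) i : sz (drop i s) <= sz s.
Proof. by elim: s i => [|x s IH] [|i] //=; apply: leq_trans (IH i) _; rewrite sz_cons; lia. Qed.

Lemma PT_foldl (f : E -> A -> X -> A) (a : E -> A) (l : E -> seq X) :
  PT (fun p : E * A * X => f p.1.1 p.1.2 p.2) -> PT a -> PT l ->
  (exists2 t : E -> nat, poly_bounded t &
     forall e j, j <= size (l e) -> sz (foldl (f e) (a e) (take j (l e))) <= t e) ->
  PT (fun e => foldl (f e) (a e) (l e)).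
Proof.
move=> hf ha hl [t pt ht].
pose step (p : E * A * seq X) : E * A * seq X :=
  if p.2 is x :: s then (p.1.1, f p.1.1 p.1.2 x, s) else p.
have hstep : PT step.
  apply: (PT_match_seq (g := fun p x s => (p.1.1, f p.1.1 p.1.2 x, s))); pts.
have it e j : j <= size (l e) -> iter j step (e, a e, l e) =
    (e, foldl (f e) (a e) (take j (l e)), drop j (l e)).
  elim: j => [_|j IH jl]; first by rewrite take0 drop0.
  rewrite iterS IH ?(ltnW jl)// /step /=.
  have [x0 _] : exists x0 : X, True by case: (l e) jl => // x; exists x.
  by rewrite (drop_nth x0 jl) (take_nth x0 jl) foldl_rcons.
have := PT_iter hstep (PT_pair (PT_pair PT_id ha) hl) hl.
move=> H; apply: (eq_PT (f := fun e => (iter (size (l e)) step (e, a e, l e)).1.2)).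
  by move=> e; rewrite it// take_size.
apply: PT_snd; apply: PT_fst; apply: H.
exists (fun e => sz e + t e + sz (l e) + 2); first by pb.
move=> e j jl; rewrite it// !sz_pair; have := ht e j jl; have := sz_drop (l e) j; lia.
Qed.

(** An increment that does not depend on the accumulator makes its size grow at most linearly in the
    number of steps, so the size condition of [PT_foldl] holds. *)
Lemma PT_foldl_incr (f : E -> A -> X -> A) (a : E -> A) (l : E -> seq X) :
  PT (fun p : E * A * X => f p.1.1 p.1.2 p.2) -> PT a -> PT l ->
  (exists2 t : E * X -> nat, poly_bounded t & forall e b x, sz (f e b x) <= sz b + t (e, x)) ->
  PT (fun e => foldl (f e) (a e) (l e)).
Proof.
move=> hf ha hl [t [k pt] ht]; apply: PT_foldl => //.
have pa := PT_size ha; have pl := PT_size hl.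
exists (fun e => sz (a e) + sz (l e) * (sz e + sz (l e) + 3) ^ k); first by pb.
move=> e j jl.
apply: (@leq_trans (sz (a e) + j * (sz e + sz (l e) + 3) ^ k)); last first.
  by rewrite leq_add2l leq_mul2r (leq_trans jl) ?size_le_sz ?orbT.
elim: j jl  => [|j IH] jl; first by rewrite take0 mul0n addn0.
have [x0 _] : exists x0 : X, True by case: (l e) jl => // x; exists x.
rewrite (take_nth x0 jl) foldl_rcons; apply: leq_trans (ht _ _ _) _.
rewrite mulSn addnA addnAC; apply: leq_add; first exact: IH (ltnW jl).
apply: leq_trans (pt _) _; case: (k) => // k'; rewrite leq_exp2r// sz_pair.
have : sz (nth x0 (l e) j) <= sz (l e).
  elim: (l e) j jl {IH} => // x s IH [|j] jl /=; rewrite sz_cons; first by lia.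
  by have := IH j jl; lia.
lia.
Qed.

End Fold.

Section Lists.
Context {E X Y Z : Type} {EE : Enc E} {EX : Enc X} {EY : Enc Y} {EZ : Enc Z}.

Lemma PT_rev (l : E -> seq X) : PT l -> PT (fun e => rev (l e)).
Proof.
move=> hl; apply: (eq_PT (f := fun e => foldl (fun s x => x :: s) [::] (l e))).
  move=> e; rewrite -[RHS]cats0; elim: (l e) [::] => //= x s IH a.
  by rewrite IH rev_cons cat_rcons.
apply: PT_foldl_incr => //; pts; exists (fun p => sz p + 2); first by pb.
by move=> e b x; rewrite sz_cons sz_pair; lia.
Qed.

Lemma PT_foldr_incr {A} {EA : Enc A} (f : E -> X -> A -> A) (a : E -> A) (l : E -> seq X) :
  PT (fun p : E * A * X => f p.1.1 p.2 p.1.2) -> PT a -> PT l ->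
  (exists2 t : E * X -> nat, poly_bounded t & forall e b x, sz (f e x b) <= sz b + t (e, x)) ->
  PT (fun e => foldr (f e) (a e) (l e)).
Proof.
move=> hf ha hl ht; apply: (eq_PT (f := fun e => foldl (fun b x => f e x b) (a e) (rev (l e)))).
  by move=> e; rewrite foldl_rev.
by apply: PT_foldl_incr => //; exact: PT_rev.
Qed.

Lemma PT_map (f : E -> X -> Y) (l : E -> seq X) :
  PT (fun p : E * X => f p.1 p.2) -> PT l -> PT (fun e => map (f e) (l e)).
Proof.
move=> hf hl; apply: (eq_PT (f := fun e => foldr (fun x s => f e x :: s) [::] (l e))).
  by move=> e; elim: (l e) => //= x s ->.
have pf := PT_size hf.
apply: PT_foldr_incr => //; pts.
exists (fun p => sz (f p.1 p.2) + 1); first by pb.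
by move=> e b x; rewrite sz_cons /=; lia.
Qed.

Lemma PT_filter (f : E -> X -> bool) (l : E -> seq X) :
  PT (fun p : E * X => f p.1 p.2) -> PT l -> PT (fun e => [seq x <- l e | f e x]).
Proof.
move=> hf hl; apply: (eq_PT (f := fun e => foldr (fun x s => if f e x then x :: s else s) [::] (l e))).
  by move=> e; elim: (l e) => //= x s ->.
apply: PT_foldr_incr => //; pts.
exists (fun p => sz p + 2); first by pb.
by move=> e b x; case: ifP => _; rewrite ?sz_cons ?sz_pair; lia.
Qed.

Lemma sz_cat (s t : seq X) : (sz (s ++ t)).+1 = sz s + sz t.
Proof. by elim: s => [|x s IH] /=; rewrite ?sz_cons; [rewrite add1n | lia]. Qed.

Lemma PT_cat (f g : E -> seq X) : PT f -> PT g -> PT (fun e => f e ++ g e).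
Proof.
move=> hf hg; apply: (eq_PT (f := fun e => foldr cons (g e) (f e))).
  by move=> e; elim: (f e) => //= x s ->.
apply: PT_foldr_incr => //; pts; exists (fun p => sz p + 2); first by pb.
by move=> e b x; rewrite sz_cons sz_pair; lia.
Qed.

End Lists.

Section Lists.
Context {E X Y Z : Type} {EE : Enc E} {EX : Enc X} {EY : Enc Y} {EZ : Enc Z}.

Lemma PT_zip (f : E -> seq X) (g : E -> seq Y) : PT f -> PT g -> PT (fun e => zip (f e) (g e)).
Proof.
move=> hf hg.
pose step (e : E) (p : seq (X * Y) * seq Y) (x : X) :=
  if p.2 is y :: t then ((x, y) :: p.1, t) else (p.1, p.2).
apply: (eq_PT (f := fun e => rev (foldl (step e) ([::], g e) (f e)).1)).
  move=> e; have H s t a : rev (foldl (step e) (a, t) s).1 = rev a ++ zip s t.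
    elim: s t a => [|x s IH] [|y t] a /=; rewrite ?cats0 ?IH//.
      by case: (s) => [|? ?]; rewrite cats0.
    by rewrite rev_cons cat_rcons.
  by rewrite H.
apply: PT_rev; apply: PT_fst; apply: (PT_foldl_incr (f := step)); pts.
  apply: (PT_match_seq (l := fun p : E * (seq (X * Y) * seq Y) * X => p.1.2.2)
   (f := fun p => (p.1.2.1, p.1.2.2)) (g := fun p y t => ((p.2, y) :: p.1.2.1, t))); pts.
exists (fun p => sz p + 3); first by pb.
move=> e [a t] x; rewrite /step; case: t => [|y t] /=; rewrite !(sz_pair, sz_cons); lia.
Qed.

Lemma PT_flatten (f : E -> seq (seq X)) : PT f -> PT (fun e => flatten (f e)).
Proof.
move=> hf; apply: (eq_PT (f := fun e => foldr cat [::] (f e))) => //.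
apply: (PT_foldr_incr (f := fun _ x s => cat x s)) => //; pts.
  by apply: (PT_cat (f := fun p => p.2) (g := fun p => p.1.2)); pts.
exists (fun p => sz p + 2); first by pb.
by move=> e b x; rewrite -ltnS sz_cat sz_pair; lia.
Qed.

Lemma PT_all (f : E -> X -> bool) (l : E -> seq X) :
  PT (fun p : E * X => f p.1 p.2) -> PT l -> PT (fun e => all (f e) (l e)).
Proof.
move=> hf hl; apply: (eq_PT (f := fun e => foldr (fun x s => f e x && s) true (l e))).
  by move=> e; elim: (l e) => //= x s ->.
apply: PT_foldr_incr => //; pts.
exists (fun=> 3); first by pb.
by move=> e b x; case: (_ && _); case: (b).
Qed.

Lemma PT_has (f : E -> X -> bool) (l : E -> seq X) :
  PT (fun p : E * X => f p.1 p.2) -> PT l -> PT (fun e => has (f e) (l e)).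
Proof.
move=> hf hl; apply: (eq_PT (f := fun e => ~~ all (fun x => ~~ f e x) (l e))).
  by move=> e; rewrite -has_predC; apply: eq_has => x /=; rewrite negbK.
by apply: PT_negb; apply: (PT_all (f := fun e x => ~~ f e x)) => //; exact: PT_negb.
Qed.

Lemma PT_is_nil (l : E -> seq X) : PT l -> PT (fun e => nilp (l e)).
Proof.
move=> hl; apply: (eq_PT (f := fun e => if l e is x :: s then false else true)).
  by move=> e; case: (l e).
by apply: (PT_match_seq (g := fun _ _ _ => false)); pts.
Qed.

End Lists.

(** * Binary arithmetic *)

Ltac pt_list := lazymatch goal with
  | |- PT (fun x => @?f x :: @?g x) => apply: (PT_cons (f := f) (g := g))
  | |- PT (fun x => Some (@?f x)) => apply: (PT_some (f := f))
  | |- PT (fun x => @?f x && @?g x) => apply: (PT_andb (f := f) (g := g))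
  | |- PT (fun x => @?f x || @?g x) => apply: (PT_orb (f := f) (g := g))
  | |- PT (fun x => ~~ @?f x) => apply: (PT_negb (f := f))
  | |- PT (fun x => rev (@?f x)) => apply: (PT_rev (l := f))
  | |- PT (fun x => @?f x ++ @?g x) => apply: (PT_cat (f := f) (g := g))
  | |- PT (fun x => zip (@?f x) (@?g x)) => apply: (PT_zip (f := f) (g := g))
  | |- PT (fun x => flatten (@?f x)) => apply: (PT_flatten (f := f))
  | |- PT (fun x => nilp (@?f x)) => apply: (PT_is_nil (l := f))
  | |- PT (fun x => map (@?f x) (@?l x)) => apply: (PT_map (f := f) (l := l))
  | |- PT (fun x => all (@?f x) (@?l x)) => apply: (PT_all (f := f) (l := l))
  | |- PT (fun x => has (@?f x) (@?l x)) => apply: (PT_has (f := f) (l := l))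
  | |- PT (fun x => seq.filter (@?f x) (@?l x)) => apply: (PT_filter (f := f) (l := l))
  end.
Ltac pt_user ::= first [pt_list].

(** The same digits as in [encode_nat], least significant first, so that reading and writing words
    needs no conversion. *)
Definition bin (n : nat) : seq bool := [seq odd (n %/ 2 ^ i) | i <- iota 0 (up_log 2 n.+1)].

Definition unbin (s : seq bool) : nat := foldr (fun (b : bool) n => b + n.*2) 0 s.

Lemma unbin_mkseq n k : unbin [seq odd (n %/ 2 ^ i) | i <- iota 0 k] = n %% 2 ^ k.
Proof.
elim: k n => [|k IH] n; first by rewrite modn1.
rewrite /= -[1]addn0 iotaDl -map_comp.
rewrite (eq_map (g := fun i => odd (n./2 %/ 2 ^ i))) => [|i /=]; last first.
  by rewrite expnS divnMA divn2.
rewrite IH expn0 divn1 expnS -{3}[n]odd_double_half -[n./2.*2]muln2 [_ * 2]mulnC.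
have h : 0 < 2 ^ k by rewrite expn_gt0.
have lt := ltn_pmod n./2 h; have e := divn_eq n./2 (2 ^ k).
have -> : odd n + 2 * n./2 = n./2 %/ 2 ^ k * (2 * 2 ^ k) + (odd n + 2 * (n./2 %% 2 ^ k)).
  by rewrite {1}e mulnDr mulnCA addnCA.
have lt2 : odd n + 2 * (n./2 %% 2 ^ k) < 2 * 2 ^ k by case: (odd n); lia.
by rewrite modnMDl (modn_small lt2) mul2n.
Qed.

Lemma binK : cancel bin unbin.
Proof.
move=> n; rewrite unbin_mkseq modn_small//; exact: up_logP.
Qed.

Lemma size_bin n : size (bin n) = up_log 2 n.+1.
Proof. by rewrite size_map size_iota. Qed.

Lemma ltn_bin n : n < 2 ^ size (bin n).
Proof. by rewrite size_bin; exact: up_logP. Qed.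

Lemma unbin_lt s : unbin s < 2 ^ size s.
Proof. by elim: s => //= b s IH; rewrite expnS; case: b => /=; lia. Qed.

Lemma unbin_rcons s (b : bool) : unbin (rcons s b) = unbin s + b * 2 ^ size s.
Proof. by elim: s => [|c s IH] /=; [case: b | rewrite IH expnS; case: (b); lia]. Qed.

Lemma unbin_inj s t : size s = size t -> unbin s = unbin t -> s = t.
Proof.
elim: s t => [|b s IH] [|c t] //= [st] e.
have bc : b = c by have := congr1 odd e; rewrite !oddD !odd_double !addbF; case: b {e}; case: c.
by congr (_ :: _) => //; apply: IH => //; move: e; rewrite bc => /addnI /double_inj.
Qed.

(* Without leading zeros (which are last in the list). *)
Definition strip (s : seq bool) : seq bool := foldr (fun (b : bool) t => if b || ~~ nilp t then b :: t else [::]) [::] s.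

Lemma bin_unbin s : bin (unbin s) = strip s.
Proof.
have e1 : unbin (strip s) = unbin s.
  elim: s => //= b s <-; case: ifP => //= /negbT; rewrite negb_or negbK => /andP[/negbTE-> /nilP->].
  by [].
apply: unbin_inj; last by rewrite binK e1.
rewrite size_bin -e1.
have [->//|] : strip s = [::] \/ exists t, strip s = rcons t true.
  elim: s {e1} => [|b s IH]; first by left.
  rewrite /=; case: IH => [->|[t ->]].
    by case: b => /=; [right; exists [::] | left].
  by right; exists (b :: t); rewrite /nilp size_rcons /= orbT.
move=> [t ->]; apply/eqP; rewrite eqn_leq; apply/andP; split.
  by apply: up_log_min => //; exact: unbin_lt.
rewrite size_rcons ltnNge; apply/negP => h.
have := leq_trans (up_logP _ (ltnSn 1)) (leq_pexp2l (isT : 0 < 2) h).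
by rewrite unbin_rcons mul1n; move: (2 ^ _) => k; lia.
Qed.

Instance enc_nat : Enc nat := fun n => encode (bin n).

Lemma PT_bin {E} {EE : Enc E} (f : E -> nat) : PT f -> PT (fun e => bin (f e)).
Proof. exact/(PT_comp (g := bin))/PT_coerce. Qed.

Lemma PT_strip {E} {EE : Enc E} (f : E -> seq bool) : PT f -> PT (fun e => strip (f e)).
Proof.
move=> hf; apply: (PT_foldr_incr (f := fun _ (b : bool) t => if b || ~~ nilp t then b :: t else [::])); pts.
exists (fun=> 5); first by pb.
move=> _ b x; case: ifP => _; last by rewrite addnC.
by rewrite sz_cons addnC -addnS leq_add2l; case: (x).
Qed.

(** A number is encoded by its digits without leading zeros, so evaluating a list of digits amounts
    to [strip]. *)
Lemma PT_unbin {E} {EE : Enc E} (f : E -> seq bool) : PT f -> PT (fun e => unbin (f e)).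
Proof.
move=> hf; apply: (eq_PT (f := fun e => unbin (strip (f e)))).
  by move=> e; rewrite -bin_unbin binK.
have h : forall s, encode (unbin (strip s)) = encode (strip s).
  by move=> s; rewrite /encode /enc_nat /= -bin_unbin binK.
have [p [t [pt hp]]] := PT_strip hf.
by exists p, t; split=> // e; rewrite h.
Qed.

Lemma sz_nat_ge n : size (bin n) <= sz n.
Proof. exact: size_le_sz. Qed.

Lemma sz_bool (b : bool) : sz b <= 3. Proof. by case: b. Qed.

Lemma sz_nat_le n : sz n <= 4 * size (bin n) + 1.
Proof.
rewrite /sz /encode /enc_nat -/(sz _); elim: (bin n) => // b s IH.
by rewrite sz_cons /=; have := sz_bool b; lia.
Qed.

Lemma size_bin_leP n k : (size (bin n) <= k) = (n < 2 ^ k).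
Proof.
rewrite size_bin; apply/idP/idP => h; last exact: up_log_min.
by apply: leq_trans (up_logP n.+1 (ltnSn 1)) _; rewrite leq_exp2l.
Qed.

Lemma sz_nat_bound n k : n < 2 ^ k -> sz n <= 4 * k + 1.
Proof. by rewrite -size_bin_leP => h; have := sz_nat_le n; lia. Qed.

Lemma ltn_sz (n : nat) : n < 2 ^ sz n.
Proof. by apply: leq_trans (ltn_bin n) _; rewrite leq_exp2l// sz_nat_ge. Qed.

Lemma PT_head {E X} {EE : Enc E} {EX : Enc X} (x : X) (f : E -> seq X) : PT f -> PT (fun e => head x (f e)).
Proof.
move=> hf; apply: (eq_PT (f := fun e => if f e is y :: s then y else x)); first by move=> e; case: (f e).
by apply: (PT_match_seq (g := fun _ y _ => y)); pts.
Qed.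

Lemma PT_behead {E X} {EE : Enc E} {EX : Enc X} (f : E -> seq X) : PT f -> PT (fun e => behead (f e)).
Proof.
move=> hf; apply: (eq_PT (f := fun e => if f e is y :: s then s else [::])); first by move=> e; case: (f e).
by apply: (PT_match_seq (g := fun _ _ s => s)); pts.
Qed.

Lemma unbin_head_behead s : unbin s = head false s + (unbin (behead s)).*2.
Proof. by case: s => //= b s. Qed.

Lemma PT_addb {E} {EE : Enc E} (f g : E -> bool) : PT f -> PT g -> PT (fun e => f e (+) g e).
Proof.
move=> hf hg; apply: (eq_PT (f := fun e => if f e then ~~ g e else g e)); last by pts.
by move=> e; case: (f e).
Qed.

Ltac pt_bits := lazymatch goal with
  | |- PT (fun x => bin (@?f x)) => apply: (PT_bin (f := f))
  | |- PT (fun x => unbin (@?f x)) => apply: (PT_unbin (f := f))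
  | |- PT (fun x => strip (@?f x)) => apply: (PT_strip (f := f))
  | |- PT (fun x => head ?c (@?f x)) => apply: (PT_head c (f := f))
  | |- PT (fun x => behead (@?f x)) => apply: (PT_behead (f := f))
  | |- PT (fun x => addb (@?f x) (@?g x)) => apply: (PT_addb (f := f) (g := g))
  end.
Ltac pt_user ::= first [pt_list | pt_bits].

(** The majority of [s], [t], [c] is the carry of an addition; with [s] negated it is the borrow of
    a subtraction. *)
Definition adigit (sub s t c : bool) : bool := if sub (+) s then t || c else t && c.

Definition digit (sub : bool) (p : seq bool * seq bool * bool * seq bool) (b : bool) :=
  (behead p.1.1.1, behead p.1.1.2, adigit sub (head false p.1.1.1) (head false p.1.1.2) p.1.2,
   (head false p.1.1.1 (+) head false p.1.1.2 (+) p.1.2) :: p.2).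

(** The list under the fold is only a clock, one tick longer than both operands together: the last
    carry of an addition is then absorbed, and a final borrow means that the difference is
    negative. *)
Definition arith (sub : bool) (s t : seq bool) : bool * seq bool :=
  let p := foldl (digit sub) (s, t, false, [::]) (true :: s ++ t) in (p.1.2, rev p.2).

Lemma arithP sub s t (p := arith sub s t) :
  size p.2 = (size s + size t).+1 /\
  if sub then unbin p.2 + unbin t = unbin s + p.1 * 2 ^ size p.2
  else unbin p.2 + p.1 * 2 ^ size p.2 = unbin s + unbin t.
Proof.
have H (l : seq bool) s0 t0 c0 a0 (q := foldl (digit sub) (s0, t0, c0, a0) l) :
  [/\ q.1.1 = (drop (size l) s0, drop (size l) t0), size q.2 = size a0 + size l &
  if sub then unbin (rev q.2) + 2 ^ size q.2 * unbin q.1.1.1 + 2 ^ size a0 * (unbin t0 + c0) =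
     unbin (rev a0) + 2 ^ size a0 * unbin s0 + 2 ^ size q.2 * (unbin q.1.1.2 + q.1.2)
  else unbin (rev q.2) + 2 ^ size q.2 * (unbin q.1.1.1 + unbin q.1.1.2 + q.1.2) =
     unbin (rev a0) + 2 ^ size a0 * (unbin s0 + unbin t0 + c0)].
  rewrite {}/q; elim: l s0 t0 c0 a0 => [|b l IH] s0 t0 c0 a0 /=.
    by rewrite !drop0 addn0; split=> //; case: (sub); lia.
  have := IH (behead s0) (behead t0) (adigit sub (head false s0) (head false t0) c0)
    ((head false s0 (+) head false t0 (+) c0) :: a0).
  rewrite -/(digit sub (s0, t0, c0, a0) b); move: (foldl _ _ _) => q [-> eq2 e].
  rewrite -!drop1 !drop_drop addn1 eq2 /= addSnnS; split=> //; move: e; rewrite eq2 /= addSnnS.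
  rewrite (unbin_head_behead s0) (unbin_head_behead t0) rev_cons unbin_rcons size_rev.
  rewrite expnS; move: (2 ^ size a0) (2 ^ size _) (unbin _) => x y z.
  have a2 (w : seq bool) : drop (size l).+1 w = drop (size l) (behead w) by rewrite -drop1 drop_drop addn1.
  rewrite !a2 /adigit; move: (2 ^ (_ + _)) (unbin (drop _ _)) (unbin (drop _ _)) => x' u u'.
  by case: (sub) => /=; case: (head _ s0); case: (head _ t0); case: (c0) => /=; lia.
have [] := H (true :: s ++ t) s t false [::].
rewrite /p /arith; case: foldl => [[[s' t'] c] a] /= [-> ->].
rewrite add0n size_cat size_rev !drop_oversize/= ?addn0 ?muln0; [|lia|lia] => -> e.
by split=> //; move: e; case: (sub); rewrite !mul1n; lia.
Qed.

Lemma addn_arith m n : m + n = unbin (arith false (bin m) (bin n)).2.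
Proof.
have [e h] := arithP false (bin m) (bin n); rewrite !binK in h; rewrite -h.
have := ltn_bin m; have := ltn_bin n; move: h; rewrite e expnS expnD.
case: (_.1) => /=; last by rewrite addn0.
move: (2 ^ _) (2 ^ _) => x y; nia.
Qed.

Lemma subn_arith m n : m - n = let p := arith true (bin m) (bin n) in if p.1 then 0 else unbin p.2.
Proof.
have [e h] := arithP true (bin m) (bin n); rewrite !binK in h.
by move: h (unbin_lt (arith true (bin m) (bin n)).2); cbv zeta; case: (arith _ _ _) => -[] x /=; move: (2 ^ _) (unbin _) => ? ?; lia.
Qed.

Section Arithmetic.
Context {E : Type} {EE : Enc E}.
Implicit Types f g : E -> nat.

Lemma PT_arith sub (f g : E -> seq bool) : PT f -> PT g -> PT (fun e => arith sub (f e) (g e)).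
Proof.
move=> hf hg; rewrite /arith.
have h : PT (fun e => foldl (digit sub) (f e, g e, false, [::]) (true :: f e ++ g e)).
  apply: (PT_foldl_incr (f := fun _ => digit sub)); pts.
    rewrite /digit /adigit; pts.
  exists (fun=> 10); first by pb.
  move=> _ [[[s t] c] a] b; rewrite /digit !sz_pair sz_cons /=.
  have := sz_bool c; have := sz_bool (adigit sub (head false s) (head false t) c).
  have := sz_bool (head false s (+) head false t (+) c).
  have h (u : seq bool) : sz (behead u) <= sz u by rewrite -drop1 sz_drop.
  have := h s; have := h t; have : 0 < sz c by case: (c).
  lia.
by pts.
Qed.

Lemma PT_addn f g : PT f -> PT g -> PT (fun e => f e + g e).
Proof.
move=> hf hg; apply: (eq_PT (f := fun e => unbin (arith false (bin (f e)) (bin (g e))).2)).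
  by move=> e; rewrite -addn_arith.
by apply: PT_unbin; apply: PT_snd; apply: PT_arith; exact: PT_bin.
Qed.

End Arithmetic.

Ltac pt_add := lazymatch goal with
  | |- PT (fun x => arith ?b (@?f x) (@?g x)) => apply: (PT_arith b (f := f) (g := g))
  | |- PT (fun x => @?f x + @?g x) => apply: (PT_addn (f := f) (g := g))
  end.
Ltac pt_user ::= first [pt_list | pt_bits | pt_add].

Section Arithmetic.
Context {E : Type} {EE : Enc E}.
Implicit Types f g : E -> nat.

Lemma PT_subn f g : PT f -> PT g -> PT (fun e => f e - g e).
Proof.
move=> hf hg; have h : PT (fun e => arith true (bin (f e)) (bin (g e))).
  by apply: PT_arith; exact: PT_bin.
apply: (eq_PT (f := fun e => let p := arith true (bin (f e)) (bin (g e)) in if p.1 then 0 else unbin p.2)).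
  by move=> e; rewrite -subn_arith.
by cbv zeta; pts.
Qed.

Lemma PT_eqn0 f : PT f -> PT (fun e => f e == 0).
Proof.
move=> hf; apply: (eq_PT (f := fun e => nilp (bin (f e)))); last by apply: PT_is_nil; exact: PT_bin.
move=> e; case: (f e) => // n; rewrite /nilp; apply/negbTE.
by have := ltn_bin n.+1; case: size.
Qed.

End Arithmetic.

Ltac pt_sub := lazymatch goal with
  | |- PT (fun x => @?f x - @?g x) => apply: (PT_subn (f := f) (g := g))
  | |- PT (fun x => @?f x == 0) => apply: (PT_eqn0 (f := f))
  end.
Ltac pt_user ::= first [pt_list | pt_bits | pt_add | pt_sub].

Section Arithmetic.
Context {E : Type} {EE : Enc E}.
Implicit Types f g : E -> nat.

Lemma PT_leq f g : PT f -> PT g -> PT (fun e => f e <= g e).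
Proof. by move=> hf hg; apply: PT_eqn0; exact: PT_subn. Qed.

Lemma PT_eqn f g : PT f -> PT g -> PT (fun e => f e == g e).
Proof.
move=> hf hg; apply: (eq_PT (f := fun e => (f e <= g e) && (g e <= f e))); first by move=> e; rewrite -eqn_leq.
by pts; exact: PT_leq.
Qed.

End Arithmetic.

(** Multiplication by Horner's rule, most significant digit first, which takes only doublings and
    additions. *)
Definition horner_bin n (u : seq bool) := foldl (fun a (b : bool) => a + a + if b then n else 0) 0 u.

Lemma horner_binE n u : horner_bin n u = unbin (rev u) * n.
Proof.
elim/last_ind: u => // u b IH; rewrite /horner_bin foldl_rcons -/(horner_bin _ _) IH rev_rcons /=.
by case: b; lia.
Qed.

Section Arithmetic.
Context {E : Type} {EE : Enc E}.
Implicit Types f g : E -> nat.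

Lemma PT_muln f g : PT f -> PT g -> PT (fun e => f e * g e).
Proof.
move=> hf hg; apply: (eq_PT (f := fun e => horner_bin (g e) (rev (bin (f e))))).
  by move=> e; rewrite horner_binE revK binK.
apply: (PT_foldl (f := fun e a (b : bool) => a + a + if b then g e else 0)).
- apply: (PT_addn (f := fun p : E * nat * bool => p.1.2 + p.1.2)).
    by apply: PT_addn; pts.
  by apply: PT_if; pts.
- by pts.
- by apply: PT_rev; exact: PT_bin.
have pf := PT_size hf; have pg := PT_size hg.
exists (fun e => 4 * (sz (f e) + sz (g e)) + 1); first by pb.
move=> e j _; apply: sz_nat_bound; rewrite -/(horner_bin _ _) horner_binE.
rewrite expnD; have := unbin_lt (rev (take j (rev (bin (f e))))); have := ltn_sz (g e).
have : 2 ^ size (rev (take j (rev (bin (f e))))) <= 2 ^ sz (f e).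
  rewrite leq_exp2l// size_rev size_take_min size_rev (leq_trans (geq_minr _ _))//.
  exact: sz_nat_ge.
move: (2 ^ _) (2 ^ _) (2 ^ _) => x y z; nia.
Qed.

End Arithmetic.

Ltac pt_nat := lazymatch goal with
  | |- PT (fun x => @?f x <= @?g x) => apply: (PT_leq (f := f) (g := g))
  | |- PT (fun x => @?f x * @?g x) => apply: (PT_muln (f := f) (g := g))
  | |- PT (fun x => @?f x == @?g x) => first [apply: (PT_eqn (f := f) (g := g)) | apply: (PT_eqb (f := f) (g := g))]
  end.
Ltac pt_arith := first [pt_list | pt_bits | pt_add | pt_sub | pt_nat].
Ltac pt_user ::= pt_arith.

(** * Words *)

Definition on_sym (k : reg) (c : sym -> cmd) : cmd :=
  If k is1 (Seq (Pop k) (c (Some true)))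
    (If k isbit (Seq (Pop k) (c (Some false))) (Seq (Pop k) (c None))).

Lemma exec_on_sym k c x w s s' n : get k s = x :: w -> exec (c x) (set k w s) s' n ->
  exists2 n', n' <= n + 3 & exec (on_sym k c) s s' n'.
Proof.
move=> e ex; have p := ExecPop k s; rewrite e /= in p.
case: x e ex => [[]|] e ex.
- by exists (1 + n).+1; [lia | apply: ExecIf; rewrite e; exact: ExecSeq p ex].
- exists (1 + n).+2; first by lia.
  by apply: ExecIf; rewrite e /=; apply: ExecIf; rewrite e; exact: ExecSeq p ex.
- exists (1 + n).+2; first by lia.
  by apply: ExecIf; rewrite e /=; apply: ExecIf; rewrite e; exact: ExecSeq p ex.
Qed.

Definition nonempty (x : option sym) : bool := x.

Lemma exec_drain k (c : sym -> cmd) (step : sym -> store -> store) t w s :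
  (forall x u s, get k s = x :: u -> get k (step x (set k u s)) = u) ->
  (forall x s, exists2 n, n <= t & exec (c x) s (step x s) n) -> get k s = w ->
  exists2 n, n <= size w * (t + 4) + 1 &
    exec (While k nonempty (on_sym k c)) s (foldl (fun s x => step x (set k (behead (get k s)) s)) s w) n.
Proof.
move=> hk hc; elim: w s => [|x w IH] s e; first by exists 1 => //; apply: ExecWhileF; rewrite e.
have [n nt ex] := hc x (set k w s).
have [n' nt' ex'] := exec_on_sym e ex.
have [|m mt ex2] := IH (step x (set k w s)); first exact: hk.
exists (n' + m).+1; first by rewrite /= mulSn; lia.
apply: (ExecWhileT _ ex'); first by rewrite e.
by move: ex2; rewrite /= e.
Qed.

Definition load : cmd :=
  Seq (While RA nonempty (on_sym RA (Push RB)))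
    (Seq (Push RA (Some false))
       (While RB nonempty (on_sym RB (fun x => push_word (Some true :: bits (encode x)))))).

Lemma exec_load w : exists2 n, n <= 20 * size w + 10 &
  exec load (Store (rev w) [::] [::] [::]) (Store (bits (encode (rev w))) [::] [::] [::]) n.
Proof.
have [|||n1 h1 e1] := @exec_drain RA (Push RB) (fun x s => set RB (x :: get RB s) s) 1 (rev w)
  (Store (rev w) [::] [::] [::]) => //.
- by move=> x u [].
- by move=> x s; exists 1 => //; exact: ExecPush.
have [|||n2 h2 e2] := @exec_drain RB (fun x => push_word (Some true :: bits (encode x)))
   (fun x s => set RA ((Some true :: bits (encode x)) ++ get RA s) s) 8 w
   (Store [:: Some false] w [::] [::]) => //.
- by move=> x u [].
- move=> x [a b c d]; exists (size (Some true :: bits (encode x)) + 1); first by case: x => [[]|].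
  exact: exec_push_word.
exists (n1 + (1 + n2)); first by move: h1; rewrite size_rev; lia.
have f1 u a b : foldl (fun s x => set RB (x :: get RB (set RA (behead (get RA s)) s)) (set RA (behead (get RA s)) s))
   (Store (u ++ a) b [::] [::]) u = Store a (rev u ++ b) [::] [::].
  by elim: u a b => [|x u IH] a b //=; rewrite IH rev_cons cat_rcons.
have f2 u a b : foldl (fun s x => set RA ((Some true :: bits (encode x)) ++ get RA (set RB (behead (get RB s)) s)) (set RB (behead (get RB s)) s))
   (Store (bits (encode a)) (u ++ b) [::] [::]) u = Store (bits (encode (rev u ++ a))) b [::] [::].
  elim: u a b => [|x u IH] a b //=; rewrite rev_cons cat_rcons.
  exact: (IH (x :: a)).
move: e1; have := f1 (rev w) [::] [::]; rewrite !cats0 revK => -> e1.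
move: e2; have := f2 w [::] [::]; rewrite !cats0 => -> e2.
apply: ExecSeq e1 _; apply: ExecSeq e2.
exact: (ExecPush RA (Some false) (Store _ _ _ _)).
Qed.

Definition pop_many (n : nat) : cmd := iter n (Seq (Pop RA)) Skip.

Lemma exec_pop_many n s : exec (pop_many n) s (set RA (drop n (get RA s)) s) (n + 1).
Proof.
elim: n s => [|n IH] s; first by rewrite drop0 set_get; exact: ExecSkip.
apply: ExecSeq (ExecPop RA s) _; have := IH (set RA (behead (get RA s)) s).
by case: s => -[|x a] b c d.
Qed.

(* A letter is encoded in 1, 4 or 6 bits, after the bit of its list cell. *)
Definition unload : cmd :=
  Seq (While RA is1 (Seq (Pop RA)
     (If RA is1 (Seq (Pop RA) (If RA is1 (Seq (pop_many 4) (Push RB (Some true))) (Seq (pop_many 2) (Push RB (Some false)))))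
        (Seq (Pop RA) (Push RB None)))))
  (Seq (Pop RA) (While RB nonempty (on_sym RB (Push RA)))).

Lemma exec_unload (w : seq sym) : exists2 n, n <= 20 * size w + 10 &
  exec unload (Store (bits (encode w)) [::] [::] [::]) (Store w [::] [::] [::]) n.
Proof.
have /(_ [::]) [n1 h1 e1] : forall b0, exists2 n, n <= 12 * size w + 1 & exec (While RA is1 (Seq (Pop RA)
     (If RA is1 (Seq (Pop RA) (If RA is1 (Seq (pop_many 4) (Push RB (Some true))) (Seq (pop_many 2) (Push RB (Some false)))))
        (Seq (Pop RA) (Push RB None))))) (Store (bits (encode w)) b0 [::] [::]) (Store [:: Some false] (rev w ++ b0) [::] [::]) n.
  elim: w => [|x w IH] b.
    by exists 1 => //; exact: ExecWhileF.
  have [n hn ex] := IH (x :: b).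
  have [m hm ex2] : exists2 m, m <= 11 & exec (Seq (Pop RA)
     (If RA is1 (Seq (Pop RA) (If RA is1 (Seq (pop_many 4) (Push RB (Some true))) (Seq (pop_many 2) (Push RB (Some false)))))
        (Seq (Pop RA) (Push RB None)))) (Store (bits (encode (x :: w))) b [::] [::]) (Store (bits (encode w)) (x :: b) [::] [::]) m.
    case: x {ex} => [[]|].
    - exists (1 + (1 + (5 + 1).+1).+1) => //; apply: ExecSeq (ExecPop RA (Store _ _ _ _)) _; apply: ExecIf => /=.
      apply: ExecSeq (ExecPop RA (Store _ _ _ _)) _; apply: ExecIf => /=.
      by apply: ExecSeq (exec_pop_many 4 (Store _ _ _ _)) _; rewrite /= drop0; exact: (ExecPush RB _ (Store _ _ _ _)).
    - exists (1 + (1 + (3 + 1).+1).+1) => //; apply: ExecSeq (ExecPop RA (Store _ _ _ _)) _; apply: ExecIf => /=.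
      apply: ExecSeq (ExecPop RA (Store _ _ _ _)) _; apply: ExecIf => /=.
      by apply: ExecSeq (exec_pop_many 2 (Store _ _ _ _)) _; rewrite /= drop0; exact: (ExecPush RB _ (Store _ _ _ _)).
    - exists (1 + (1 + 1).+1) => //; apply: ExecSeq (ExecPop RA (Store _ _ _ _)) _; apply: ExecIf => /=.
      by apply: ExecSeq (ExecPop RA (Store _ _ _ _)) _; exact: (ExecPush RB _ (Store _ _ _ _)).
  exists (m + n).+1; first by rewrite /=; lia.
  by apply: ExecWhileT ex2 _ => //; rewrite rev_cons cat_rcons.
have [|||n2 h2 e2] := @exec_drain RB (Push RA) (fun x s => set RA (x :: get RA s) s) 1 (rev w)
  (Store [::] (rev w) [::] [::]) => //.
- by move=> x u [].
- by move=> x s; exists 1 => //; exact: ExecPush.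
have f1 u a b : foldl (fun s x => set RA (x :: get RA (set RB (behead (get RB s)) s)) (set RB (behead (get RB s)) s))
   (Store a (u ++ b) [::] [::]) u = Store (rev u ++ a) b [::] [::].
  by elim: u a b => [|x u IH] a b //=; rewrite IH rev_cons cat_rcons.
move: e2; have := f1 (rev w) [::] [::]; rewrite !cats0 revK => -> e2; rewrite cats0 in e1.
exists (n1 + (1 + n2)); first by move: h2; rewrite size_rev; lia.
apply: ExecSeq e1 _; apply: ExecSeq e2; exact: (ExecPop RA (Store _ _ _ _)).
Qed.

Definition poly_fun (f : nat -> nat) := exists p : {poly nat}, forall N, p.[N]%R = f N.

Lemma pf_cst k : poly_fun (fun=> k).
Proof. by exists k%:P%R => N; rewrite hornerC. Qed.

Lemma pf_id : poly_fun (fun N => N).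
Proof. by exists 'X%R => N; rewrite hornerX. Qed.

Lemma pf_add f g : poly_fun f -> poly_fun g -> poly_fun (fun N => f N + g N).
Proof. by move=> [p hp] [q hq]; exists (p + q)%R => N; rewrite hornerD hp hq. Qed.

Lemma pf_mul f g : poly_fun f -> poly_fun g -> poly_fun (fun N => f N * g N).
Proof. by move=> [p hp] [q hq]; exists (p * q)%R => N; rewrite hornerM hp hq. Qed.

Lemma pf_exp f k : poly_fun f -> poly_fun (fun N => f N ^ k).
Proof.
move=> hf; elim: k => [|k IH]; first exact: pf_cst.
by have [p hp] := pf_mul hf IH; exists p => N; rewrite hp expnS.
Qed.

(** Stack A shows the input reversed and the output is read off reversed, so the program on the
    stacks computes [F] conjugated by [rev]. The polynomial [W] majorizes the time of loading,
    running and unloading, inserted into the quadratic bound of the simulation. *)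
Lemma poly_time_word (F : seq (option bool) -> seq (option bool)) : PT F ->
  exists (M : turing_machine (option bool)) (p : {poly nat}), forall w,
    tm_run p.[size w]%R (tm_init M w) = Some (F w).
Proof.
move=> hF; have : PT (fun w => rev (F (rev w))) by pts.
move=> [c [t [[k tk] hc]]].
exists (machine (Seq load (Seq c unload))).
pose T N := 20 * N + 10 + ((6 * N + 3) ^ k + (20 * ((6 * N + 1) + (6 * N + 3) ^ k) + 10)).
pose W N := T N * (2 * (N + T N) + 5) + 2 * (N + T N) + 6.
have [p pE] : poly_fun W.
  by rewrite /W /T; do !(apply: pf_add || apply: pf_mul || apply: pf_exp || exact: pf_cst || exact: pf_id).
exists p => w; rewrite pE.
have [n1 h1 e1] := exec_load w.
have [n2 h2 e2] := hc (rev w).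
rewrite revK in e2; have [n3 h3 e3] := exec_unload (rev (F w)).
have szw (u : seq sym) : sz u <= 6 * size u + 1.
  elim: u => // x u IH; rewrite sz_cons /=; have : sz x <= 5 by case: (x) => [[]|].
  by lia.
have h2' : n2 <= (6 * size w + 3) ^ k.
  apply: leq_trans h2 _; apply: leq_trans (tk _) _; case: (k) => // k'.
  rewrite leq_exp2r//; apply: leq_trans (leq_add (szw (rev w)) (leqnn 2)) _.
  by rewrite size_rev -addnA.
have hs : size (rev (F w)) <= (6 * size w + 1) + (6 * size w + 3) ^ k.
  apply: leq_trans (size_le_sz _) _; apply: leq_trans (runs_size e2) _.
  by apply: leq_add h2'; have := szw (rev w); rewrite size_rev.
have := @machine_correct (Seq load (Seq c unload)) w (Store (rev (F w)) [::] [::] [::]) (n1 + (n2 + n3)) (W (size w)).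
move=> H; rewrite H /= ?revK//.
  apply: ExecSeq e1 _; apply: ExecSeq e3.
  by have := e2 [::] [::] [::] [::]; rewrite !cats0.
have : n1 + (n2 + n3) <= T (size w).
  apply: leq_add h1 (leq_add h2' (leq_trans h3 _)).
  by rewrite leq_add2r leq_mul2l hs.
move: (n1 + (n2 + n3)) => a ab; rewrite /W.
have h : size w + a <= size w + T (size w) by rewrite leq_add2l.
by rewrite leq_add// leq_add// ?leq_mul2l ?h ?orbT// leq_mul// leq_add// leq_mul2l h.
Qed.

Import Order.TTheory GRing.Theory Num.Theory.

(** * Integers *)

Definition zsplit (z : int) : bool * nat := match z with Posz m => (false, m) | Negz m => (true, m) end.

Instance enc_int : Enc int := fun z => encode (zsplit z).

(** Every integer is [zdiff] of [zpos] and [zneg], which reduces the arithmetic and the order of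
    integers to those of naturals. *)
Definition zpos (z : int) : nat := if z is Posz m then m else 0.
Definition zneg (z : int) : nat := if z is Negz m then m + 1 else 0.
Definition zdiff (a b : nat) : int := (a%:Z - b%:Z)%R.

Lemma zdiffE a b : zdiff a b = if b <= a then Posz (a - b) else Negz (b - a - 1).
Proof. by rewrite /zdiff; case: leqP => h; [rewrite subzn | rewrite NegzE; lia]. Qed.

Lemma zpos_neg z : z = zdiff (zpos z) (zneg z).
Proof. by case: z => m; rewrite /zdiff /=; [lia | rewrite NegzE; lia]. Qed.

Lemma sz_int_bound (z : int) k : `|z| <= 2 ^ k -> sz z <= 4 * k + 9.
Proof.
case: z => m h; rewrite /sz /encode /enc_int /= -/(sz _) sz_pair.
  have hm : m < 2 ^ k.+1 by rewrite expnS; lia.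
  by have := sz_nat_bound hm; have := sz_bool false; lia.
have hm : m < 2 ^ k by move: h; rewrite NegzE abszN; lia.
by have := sz_nat_bound hm; have := sz_bool true; lia.
Qed.

Lemma absz_sz (z : int) : `|z| <= 2 ^ sz z.
Proof.
have e : sz z = sz (zsplit z) by [].
have h (b : bool) (m : nat) : m < 2 ^ (sz b + sz m).+1.
  by apply: leq_trans (ltn_sz m) _; rewrite leq_exp2l// -addSn leq_addl.
case: z e => m /= ->; rewrite sz_pair; first exact: ltnW (h _ _).
exact: h.
Qed.

Section IntOps.
Context {E : Type} {EE : Enc E}.
Implicit Types (f g : E -> int).

Lemma PT_zsplit f : PT f -> PT (fun e => zsplit (f e)).
Proof. exact/(PT_comp (g := zsplit))/PT_coerce. Qed.

Lemma PT_zjoin (h : E -> bool * nat) : PT h -> PT (fun e => if (h e).1 then Negz (h e).2 else Posz (h e).2).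
Proof.
apply: (PT_comp (g := fun p : bool * nat => if p.1 then Negz p.2 else Posz p.2)).
by apply: PT_coerce => -[[] m].
Qed.

Lemma PT_zpos f : PT f -> PT (fun e => zpos (f e)).
Proof.
move=> /PT_zsplit hf; apply: (eq_PT (f := fun e => if (zsplit (f e)).1 then 0 else (zsplit (f e)).2)).
  by move=> e; case: (f e).
by pts.
Qed.

Lemma PT_zneg f : PT f -> PT (fun e => zneg (f e)).
Proof.
move=> /PT_zsplit hf; apply: (eq_PT (f := fun e => if (zsplit (f e)).1 then (zsplit (f e)).2 + 1 else 0)).
  by move=> e; case: (f e).
by pts.
Qed.

Lemma PT_zdiff (a b : E -> nat) : PT a -> PT b -> PT (fun e => zdiff (a e) (b e)).
Proof.
move=> ha hb; pose h e := if b e <= a e then (false, a e - b e) else (true, b e - a e - 1).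
apply: (eq_PT (f := fun e => if (h e).1 then Negz (h e).2 else Posz (h e).2)).
  by move=> e; rewrite zdiffE /h; case: (b e <= a e).
by apply: (PT_zjoin (h := h)); rewrite /h; pts.
Qed.

End IntOps.

Ltac pt_z0 := lazymatch goal with
  | |- PT (fun x => zpos (@?f x)) => apply: (PT_zpos (f := f))
  | |- PT (fun x => zneg (@?f x)) => apply: (PT_zneg (f := f))
  | |- PT (fun x => zdiff (@?f x) (@?g x)) => apply: (PT_zdiff (a := f) (b := g))
  end.
Ltac pt_user ::= first [pt_arith | pt_z0].

Section IntOps.
Context {E : Type} {EE : Enc E}.
Implicit Types (f g : E -> int).

Lemma PT_addz f g : PT f -> PT g -> PT (fun e => (f e + g e)%R).
Proof.
move=> hf hg; apply: (eq_PT (f := fun e => zdiff (zpos (f e) + zpos (g e)) (zneg (f e) + zneg (g e)))).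
  by move=> e; rewrite [f e in RHS]zpos_neg [g e in RHS]zpos_neg /zdiff; lia.
by pts.
Qed.

Lemma PT_oppz f : PT f -> PT (fun e => (- f e)%R).
Proof.
move=> hf; apply: (eq_PT (f := fun e => zdiff (zneg (f e)) (zpos (f e)))).
  by move=> e; rewrite [f e in RHS]zpos_neg /zdiff; lia.
by pts.
Qed.

Lemma PT_mulz f g : PT f -> PT g -> PT (fun e => (f e * g e)%R).
Proof.
move=> hf hg; apply: (eq_PT (f := fun e => zdiff (zpos (f e) * zpos (g e) + zneg (f e) * zneg (g e))
   (zpos (f e) * zneg (g e) + zneg (f e) * zpos (g e)))).
  by move=> e; rewrite [f e in RHS]zpos_neg [g e in RHS]zpos_neg /zdiff; move: (zpos _) (zneg _) (zpos _) (zneg _) => a b c d; nia.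
by pts.
Qed.

Lemma PT_lez f g : PT f -> PT g -> PT (fun e => (f e <= g e)%R).
Proof.
move=> hf hg; apply: (eq_PT (f := fun e => zpos (f e) + zneg (g e) <= zpos (g e) + zneg (f e))).
  by move=> e; rewrite [f e in RHS]zpos_neg [g e in RHS]zpos_neg /zdiff; lia.
by pts.
Qed.

Lemma PT_ltz f g : PT f -> PT g -> PT (fun e => (f e < g e)%R).
Proof.
move=> hf hg; apply: (eq_PT (f := fun e => zpos (f e) + zneg (g e) + 1 <= zpos (g e) + zneg (f e))).
  by move=> e; rewrite [f e in RHS]zpos_neg [g e in RHS]zpos_neg /zdiff; lia.
by pts.
Qed.

Lemma PT_natz (f : E -> nat) : PT f -> PT (fun e => Posz (f e)).
Proof.
move=> hf; apply: (eq_PT (f := fun e => zdiff (f e) 0)); first by move=> e; rewrite /zdiff; lia.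
by pts.
Qed.

End IntOps.

Definition sumz (l : seq int) : int := foldl (fun a x => a + x)%R 0%R l.

Lemma sumzE l : sumz l = (\sum_(x <- l) x)%R.
Proof.
suff H (a : int) : foldl (fun a x => a + x)%R a l = (a + \sum_(x <- l) x)%R by rewrite /sumz H add0r.
elim: l a => [|x l IH] a; first by rewrite big_nil addr0.
by rewrite big_cons addrA; exact: IH.
Qed.

(** An entry is at most 2 to the power of its size, and the sizes of the entries add up along the
    list, so all partial sums have linear size. *)
Lemma sumz_bound (l : seq int) : `|sumz l| < 2 ^ sz l.
Proof.
rewrite sumzE; elim: l => [|x l IH]; first by rewrite big_nil absz0 expn_gt0.
rewrite big_cons sz_cons expnS expnD; have := absz_sz x.
have : 0 < 2 ^ sz x by rewrite expn_gt0.
move: (2 ^ _) (2 ^ _) (\sum_(_ <- _) _)%R IH => a b y IH h1 h2.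
have h : `|(x + y)%R| <= `|x| + `|y| by lia.
by apply: leq_ltn_trans h _; nia.
Qed.

Lemma sz_take {X} {EX : Enc X} (l : seq X) j : sz (take j l) <= sz l.
Proof. by elim: l j => [|x l IH] [|j] //=; rewrite !sz_cons ?leq_add2l ?ltnS ?leq_add2l//; have := IH j; lia. Qed.

Lemma PT_sumz {E} {EE : Enc E} (f : E -> seq int) : PT f -> PT (fun e => sumz (f e)).
Proof.
move=> hf; have pf := PT_size hf.
apply: (PT_foldl (f := fun _ a x => a + x)%R); [by apply: PT_addz; pts | by pts | by [] |].
exists (fun e => 4 * sz (f e) + 9); first by pb.
move=> e j _; rewrite -/(sumz _); apply: sz_int_bound.
by apply: leq_trans (ltnW (sumz_bound _)) _; rewrite leq_exp2l// sz_take.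
Qed.

Definition sumn_pt (l : seq nat) : nat := zpos (sumz (map Posz l)).

Lemma sumnE_pt l : sumn_pt l = sumn l.
Proof.
rewrite /sumn_pt sumzE; have -> : (\sum_(x <- map Posz l) x)%R = Posz (sumn l) by elim: l => [|x l IH]; rewrite ?big_nil// big_cons IH.
by [].
Qed.

Section NatLists.
Context {E : Type} {EE : Enc E}.

Lemma PT_sumn (f : E -> seq nat) : PT f -> PT (fun e => sumn (f e)).
Proof.
move=> hf; apply: (eq_PT (f := fun e => zpos (sumz (map Posz (f e))))).
  by move=> e; rewrite -sumnE_pt.
apply: PT_zpos; apply: PT_sumz; apply: (PT_map (f := fun _ => Posz)) => //.
by apply: PT_natz; pts.
Qed.

Lemma PT_sizen {X} {EX : Enc X} (f : E -> seq X) : PT f -> PT (fun e => size (f e)).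
Proof.
move=> hf; apply: (eq_PT (f := fun e => sumn (map (fun=> 1) (f e)))).
  by move=> e; elim: (f e) => //= x s ->.
by apply: PT_sumn; pts.
Qed.

Lemma PT_count {X} {EX : Enc X} (a : E -> X -> bool) (l : E -> seq X) :
  PT (fun p : E * X => a p.1 p.2) -> PT l -> PT (fun e => count (a e) (l e)).
Proof.
move=> ha hl; apply: (eq_PT (f := fun e => size (seq.filter (a e) (l e)))).
  by move=> e; rewrite size_filter.
by apply: PT_sizen; pts.
Qed.

Lemma PT_mem (x : E -> nat) (s : E -> seq nat) : PT x -> PT s -> PT (fun e => x e \in s e).
Proof.
move=> hx hs; apply: (eq_PT (f := fun e => has (fun y => y == x e) (s e))).
  by move=> e; rewrite has_pred1.
by apply: (PT_has (f := fun e y => y == x e)); pts.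
Qed.

(** The counter starts at [i + 1] and picks the element met at 1. Truncated subtraction then keeps
    it at 0, so that no later element is picked. *)
Definition nth_step {X} (p : nat * X) (x : X) : nat * X := (p.1 - 1, if p.1 == 1 then x else p.2).

Lemma nth_foldl {X} (d : X) l i : nth d l i = (foldl nth_step (i + 1, d) l).2.
Proof.
have H k (r : X) l' : (foldl nth_step (k, r) l').2 = if k is k'.+1 then nth r l' k' else r.
  elim: l' k r => [|x l' IH] k r /=; first by case: k => // k; rewrite nth_nil.
  rewrite /nth_step /= IH; by case: k => [|[|k]] //=; rewrite ?subSS ?subn0.
by rewrite H addn1.
Qed.

Lemma PT_nth {X} {EX : Enc X} (d : X) (l : E -> seq X) (i : E -> nat) :
  PT l -> PT i -> PT (fun e => nth d (l e) (i e)).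
Proof.
move=> hl hi; apply: (eq_PT (f := fun e => (foldl nth_step (i e + 1, d) (l e)).2)).
  by move=> e; rewrite nth_foldl.
have pl := PT_size hl; have pi := PT_size hi.
apply: PT_snd; apply: (PT_foldl (f := fun _ => nth_step)); rewrite /nth_step; pts.
exists (fun e => 4 * (sz (i e) + 1) + 1 + (sz d + sz (l e)) + 1); first by pb.
move=> e j jl; have : exists k r, [/\ foldl nth_step (i e + 1, d) (take j (l e)) = (k, r), k <= i e + 1 & sz r <= sz d + sz (l e)].
  elim: j jl => [|j IH] jl; first by rewrite take0; exists (i e + 1), d; split=> //; rewrite leq_addr.
  have [k [r [er kr sr]]] := IH (ltnW jl).
  rewrite (take_nth d jl) foldl_rcons er /nth_step /=.
  exists (k - 1), (if k == 1 then nth d (l e) j else r); split=> //; first by lia.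
  case: ifP => // _; apply: leq_trans (leq_addl _ _).
  elim: (l e) j jl {IH er sr} => // x s IH [|j] jl /=; rewrite sz_cons; first by lia.
  by have := IH j jl; lia.
move=> [k [r [-> kr sr]]]; rewrite sz_pair.
have hk : k < 2 ^ (sz (i e) + 1) by have := ltn_sz (i e); rewrite addn1 expnS; lia.
by have := sz_nat_bound hk; lia.
Qed.

End NatLists.

Ltac pt_z1 := lazymatch goal with
  | |- PT (fun x => GRing.add (@?f x) (@?g x)) => apply: (PT_addz (f := f) (g := g))
  | |- PT (fun x => GRing.opp (@?f x)) => apply: (PT_oppz (f := f))
  | |- PT (fun x => GRing.mul (@?f x) (@?g x)) => apply: (PT_mulz (f := f) (g := g))
  | |- PT (fun x => Order.le (@?f x) (@?g x)) => apply: (PT_lez (f := f) (g := g))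
  | |- PT (fun x => Order.lt (@?f x) (@?g x)) => apply: (PT_ltz (f := f) (g := g))
  | |- PT (fun x => Posz (@?f x)) => apply: (PT_natz (f := f))
  | |- PT (fun x => sumz (@?f x)) => apply: (PT_sumz (f := f))
  | |- PT (fun x => sumn (@?f x)) => apply: (PT_sumn (f := f))
  | |- PT (fun x => size (@?f x)) => apply: (PT_sizen (f := f))
  | |- PT (fun x => count (@?f x) (@?g x)) => apply: (PT_count (a := f) (l := g))
  | |- PT (fun x => nth ?d (@?f x) (@?g x)) => apply: (PT_nth d (l := f) (i := g))
  | |- PT (fun x => in_mem (@?f x) (mem (@?g x))) => apply: (PT_mem (x := f) (s := g))
  end.
Ltac pt_int := first [pt_arith | pt_z0 | pt_z1].
Ltac pt_user ::= pt_int.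

(** * The flow algorithm *)

Definition tab {X} (idx : seq nat) (f : nat -> nat -> X) : seq (seq X) :=
  [seq [seq f i j | j <- idx] | i <- idx].
Definition entry {X} (d : X) (t : seq (seq X)) (i j : nat) : X := nth d (nth [::] t i) j.

Definition links (p : seq nat) (i j : nat) : bool := (head 0 p == i) && (last 0 p == j).
Definition crosses (p : seq nat) (i j : nat) : bool :=
  has (fun e => (e.1 == i) && (e.2 == j)) (zip p (behead p)).
Definition pair_count (st : seq (seq nat)) (i j : nat) : nat :=
  count (fun p => links p i j || links p j i) st.
Definition edge_count (st : seq (seq nat)) (i j : nat) : nat :=
  count (fun p => crosses p i j || crosses p j i) st.
Definition deg_count (idx : seq nat) (st : seq (seq nat)) (i : nat) : nat :=
  sumn [seq if j == i then 0 else pair_count st i j | j <- idx].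

(* A path is a list of vertices; the list of chosen paths may contain [::],
   which routes nothing. The matrices below are scaled to be integral. *)
Definition base_mx (idx : seq nat) (lam : nat) (st : seq (seq nat)) : seq (seq int) :=
  tab idx (fun i j => if i == j
    then (Posz (16 * size st) - Posz (size idx * lam * deg_count idx st i))%R
    else Posz (size idx * lam * pair_count st i j)).
(** A bound for the spectral norm of [base_mx]. The quotient has its spectrum in [-1, 1], where the
    Newton-Schulz iteration tends to the sign. *)
Definition base_den (idx : seq nat) (lam : nat) (st : seq (seq nat)) : int :=
  Posz (16 * size st + 2 * (size idx * size idx) * lam * size st).

Definition dot (u v : seq int) : int := sumz [seq (p.1 * p.2)%R | p <- zip u v].
(** The product with the transpose of [B] avoids access to columns; it is applied to symmetric
    matrices. *)
Definition mul_tr (idx : seq nat) (A B : seq (seq int)) : seq (seq int) :=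
  tab idx (fun i j => dot (nth [::] A i) (nth [::] B j)).

(** For X = Z / D this is the map from X to X (3 - X^2) / 2, with numerator 3 D^2 Z - Z^3 and
    denominator 2 D^3. *)
Definition ns_step (idx : seq nat) (s : seq (seq int) * int) : seq (seq int) * int :=
  (tab idx (fun i j => (3 * s.2 * s.2 * entry 0 s.1 i j -
     entry 0 (mul_tr idx (mul_tr idx s.1 s.1) s.1) i j)%R), (2 * s.2 * s.2 * s.2)%R).

Definition ns_iter (idx : seq nat) (lam : nat) (kk : seq unit) (st : seq (seq nat)) :=
  foldl (fun s _ => ns_step idx s) (base_mx idx lam st, base_den idx lam st) kk.

(** The positive part of S is S (1 + sign S) / 2. The factor 32 in the denominator is the 2 of this
    formula times the 16 in the scaling of [base_mx]. *)
Definition proj_num idx lam kk st : seq (seq int) :=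
  tab idx (fun i j => ((ns_iter idx lam kk st).2 * entry 0 (base_mx idx lam st) i j +
    entry 0 (mul_tr idx (base_mx idx lam st) (ns_iter idx lam kk st).1) i j)%R).
Definition proj_den idx lam kk st : int := (Posz (32 * size st) * (ns_iter idx lam kk st).2)%R.

(** Truncated subtraction takes the positive part. Up to scaling the excess is the derivative of the
    squared congestion penalty, and it serves as the edge length. *)
Definition edge_excess idx big q st : seq (seq nat) :=
  tab idx (fun i j => edge_count st i j * size idx * big - 4 * size st * entry 0 q i j).
Definition deg_excess idx st (i : nat) : nat := deg_count idx st i * size idx - 2 * size st.

Definition path_cost (w : seq (seq nat)) (p : seq nat) : nat :=
  sumn [seq entry 0 w e.1 e.2 | e <- zip p (behead p)].

(* [::] stands for an unreachable vertex. *)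
Definition shorter (w : seq (seq nat)) (p p' : seq nat) : seq nat :=
  if nilp p then p' else if nilp p' then p else
  if path_cost w p <= path_cost w p' then p else p'.
(** One Bellman-Ford round. The table keeps at [j] a walk from [j] to the source rather than a
    distance. *)
Definition relax idx q w (tbl : seq (seq nat)) : seq (seq nat) :=
  [seq foldl (shorter w) (nth [::] tbl j)
     [seq j :: nth [::] tbl k | k <- [seq k <- idx | ~~ nilp (nth [::] tbl k) && (1 <= entry 0 q j k)]]
  | j <- idx].
Definition paths_from idx q w (i : nat) : seq (seq nat) :=
  foldl (fun tbl _ => relax idx q w tbl) [seq if j == i then [:: i] else [::] | j <- idx] idx.

Definition cut_to (x : nat) (s : seq nat) : seq nat :=
  rev (foldl (fun a y => if (y == x) || ~~ nilp a then y :: a else a) [::] s).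
(** Edges without excess have length 0, so a shortest walk may revisit vertices, whereas a routing
    consists of simple paths. *)
Definition erase_loops (p : seq nat) : seq nat :=
  foldr (fun x s => if x \in s then cut_to x s else x :: s) [::] p.

Definition candidates idx q w : seq (seq nat) :=
  flatten [seq [seq erase_loops p | p <- paths_from idx q w i] | i <- idx].

(** The estimated rate of decrease of the potential when demand is added along [p]: the squared
    distance of the end vectors minus the length and the degree penalties, over a common
    denominator. The empty path adds no demand and scores 0. *)
Definition score idx lam big st (X : seq (seq int)) (Xd : int) w (p : seq nat) : int :=
  if nilp p then 0%R else
  (Posz (lam * size st) * (entry 0 X (head 0 p) (head 0 p) + entry 0 X (last 0 p) (last 0 p) -
     2 * entry 0 X (head 0 p) (last 0 p)) -
   Posz (2 * size idx * big * path_cost w p) * Xd -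
   Posz (8 * size idx * (deg_excess idx st (head 0 p) + deg_excess idx st (last 0 p))) * Xd)%R.

Definition best_path idx lam big st X Xd w (ps : seq (seq nat)) : seq nat :=
  foldl (fun b p => if (score idx lam big st X Xd w b < score idx lam big st X Xd w p)%R
                    then p else b) [::] ps.

(** The trace is compared with 1.6 r: an error of 1/10 in the computed trace leaves a true trace of
    at most 1.7 r if the test succeeds and of at least 1.5 r if it fails. The other tests let the
    scaled congestion and degrees exceed their bounds by 1. *)
Definition finished idx r big q st (X : seq (seq int)) (Xd : int) : bool :=
  [&& (10 * sumz [seq entry 0 X i i | i <- idx] <= Posz (16 * r) * Xd)%R,
      all (fun i => all (fun j => edge_count st i j * size idx * big <=
        4 * size st * entry 0 q i j + 4 * size st) idx) idx
    & all (fun i => deg_count idx st i * size idx <= 4 * size st) idx].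

Definition fw_step idx r lam big q kk st : seq (seq nat) :=
  if finished idx r big q st (proj_num idx lam kk st) (proj_den idx lam kk st) then st
  else best_path idx lam big st (proj_num idx lam kk st) (proj_den idx lam kk st)
         (edge_excess idx big q st) (candidates idx q (edge_excess idx big q st)) :: st.

(** The iterate is the average over the list, so adding a path to t others is a step of length 1/(t
    + 1). The initial empty path keeps t positive. As [fw_step] fixes finished states, the number of
    ticks can be set in advance. *)
Definition frank_wolfe idx r lam big q kk (ticks : seq unit) : seq (seq nat) :=
  foldl (fun st _ => fw_step idx r lam big q kk st) [:: [::]] ticks.

(** * Running time of the flow algorithm *)

Lemma PT_last {E X} {EE : Enc E} {EX : Enc X} (x : X) (f : E -> seq X) : PT f -> PT (fun e => last x (f e)).
Proof.
move=> hf; apply: (eq_PT (f := fun e => head x (rev (f e)))); last by pts.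
by move=> e; case/lastP: (f e) => // s y; rewrite rev_rcons last_rcons.
Qed.

Lemma PT_entry {E X} {EE : Enc E} {EX : Enc X} (d : X) (t : E -> seq (seq X)) (i j : E -> nat) :
  PT t -> PT i -> PT j -> PT (fun e => entry d (t e) (i e) (j e)).
Proof. by move=> ht hi hj; rewrite /entry; pts. Qed.

Lemma PT_tab {E X} {EE : Enc E} {EX : Enc X} (idx : E -> seq nat) (f : E -> nat -> nat -> X) :
  PT idx -> PT (fun p : E * nat * nat => f p.1.1 p.1.2 p.2) -> PT (fun e => tab (idx e) (f e)).
Proof. by move=> hi hf; rewrite /tab; pts. Qed.

Lemma PT_dot {E} {EE : Enc E} (u v : E -> seq int) : PT u -> PT v -> PT (fun e => dot (u e) (v e)).
Proof. by move=> hu hv; rewrite /dot; pts. Qed.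

Ltac pt_t0 := lazymatch goal with
  | |- PT (fun x => last ?d (@?f x)) => apply: (PT_last d (f := f))
  | |- PT (fun x => entry ?d (@?f x) (@?i x) (@?j x)) => apply: (PT_entry d (t := f) (i := i) (j := j))
  | |- PT (fun x => tab (@?i x) (@?f x)) => apply: (PT_tab (idx := i) (f := f))
  | |- PT (fun x => dot (@?f x) (@?g x)) => apply: (PT_dot (u := f) (v := g))
  end.
Ltac pt_user ::= first [pt_int | pt_t0].

Section Counts.
Context {E : Type} {EE : Enc E}.
Implicit Types (st : E -> seq (seq nat)) (i j : E -> nat).

Lemma PT_pair_count st i j : PT st -> PT i -> PT j -> PT (fun e => pair_count (st e) (i e) (j e)).
Proof. by move=> *; rewrite /pair_count /links; pts. Qed.

Lemma PT_edge_count st i j : PT st -> PT i -> PT j -> PT (fun e => edge_count (st e) (i e) (j e)).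
Proof. by move=> *; rewrite /edge_count /crosses; pts. Qed.

End Counts.

Ltac pt_t1 := lazymatch goal with
  | |- PT (fun x => pair_count (@?s x) (@?i x) (@?j x)) => apply: (PT_pair_count (st := s) (i := i) (j := j))
  | |- PT (fun x => edge_count (@?s x) (@?i x) (@?j x)) => apply: (PT_edge_count (st := s) (i := i) (j := j))
  end.
Ltac pt_user ::= first [pt_int | pt_t0 | pt_t1].

Lemma PT_deg_count {E} {EE : Enc E} (idx : E -> seq nat) (st : E -> seq (seq nat)) (i : E -> nat) :
  PT idx -> PT st -> PT i -> PT (fun e => deg_count (idx e) (st e) (i e)).
Proof. by move=> hidx hst hi; rewrite /deg_count; pts. Qed.

Ltac pt_t2 := lazymatch goal with
  | |- PT (fun x => deg_count (@?d x) (@?s x) (@?i x)) => apply: (PT_deg_count (idx := d) (st := s) (i := i))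
  end.
Ltac pt_user ::= first [pt_int | pt_t0 | pt_t1 | pt_t2].

Section Matrices.
Context {E : Type} {EE : Enc E}.
Implicit Types (idx : E -> seq nat) (lam : E -> nat) (st : E -> seq (seq nat)).

Lemma PT_base_mx idx lam st : PT idx -> PT lam -> PT st -> PT (fun e => base_mx (idx e) (lam e) (st e)).
Proof. by move=> *; rewrite /base_mx; pts. Qed.

Lemma PT_base_den idx lam st : PT idx -> PT lam -> PT st -> PT (fun e => base_den (idx e) (lam e) (st e)).
Proof. by move=> *; rewrite /base_den; pts. Qed.

Lemma PT_mul_tr idx (A B : E -> seq (seq int)) : PT idx -> PT A -> PT B -> PT (fun e => mul_tr (idx e) (A e) (B e)).
Proof. by move=> *; rewrite /mul_tr; pts. Qed.

End Matrices.

Ltac pt_t3 := lazymatch goal with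
  | |- PT (fun x => base_mx (@?d x) (@?l x) (@?s x)) => apply: (PT_base_mx (idx := d) (lam := l) (st := s))
  | |- PT (fun x => base_den (@?d x) (@?l x) (@?s x)) => apply: (PT_base_den (idx := d) (lam := l) (st := s))
  | |- PT (fun x => mul_tr (@?d x) (@?a x) (@?b x)) => apply: (PT_mul_tr (idx := d) (A := a) (B := b))
  end.
Ltac pt_user ::= first [pt_int | pt_t0 | pt_t1 | pt_t2 | pt_t3].

Lemma PT_ns_step {E} {EE : Enc E} (idx : E -> seq nat) (s : E -> seq (seq int) * int) :
  PT idx -> PT s -> PT (fun e => ns_step (idx e) (s e)).
Proof. by move=> hidx hs; rewrite /ns_step; pts. Qed.

Section Paths.
Context {E : Type} {EE : Enc E}.
Implicit Types (idx p : E -> seq nat) (q w : E -> seq (seq nat)).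

Lemma PT_path_cost w p : PT w -> PT p -> PT (fun e => path_cost (w e) (p e)).
Proof. by move=> *; rewrite /path_cost; pts. Qed.

(** The fold only selects among values already present, so no intermediate value is larger than the
    inputs. *)
Lemma PT_foldl_pick {X Y} {EX : Enc X} {EY : Enc Y} (g : Y -> X -> X -> X) (y : E -> Y) (a : E -> X) (l : E -> seq X) :
  PT (fun p : Y * X * X => g p.1.1 p.1.2 p.2) -> (forall y a b, g y a b = a \/ g y a b = b) ->
  PT y -> PT a -> PT l -> PT (fun e => foldl (g (y e)) (a e) (l e)).
Proof.
move=> hg pick hy ha hl; have pa := PT_size ha; have pl := PT_size hl.
apply: (PT_foldl (f := fun e => g (y e))) => //.
  by pts.
exists (fun e => sz (a e) + sz (l e)); first by pb.
move=> e j _; apply: leq_trans (_ : sz (a e) + sz (take j (l e)) <= _); last by rewrite leq_add2l sz_take.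
elim: (take j (l e)) (a e) => [|x s IH] b /=; first by rewrite leq_addr.
apply: leq_trans (IH _) _; rewrite sz_cons; case: (pick (y e) b x) => ->; lia.
Qed.

End Paths.

Ltac pt_t4 := lazymatch goal with
  | |- PT (fun x => ns_step (@?d x) (@?s x)) => apply: (PT_ns_step (idx := d) (s := s))
  | |- PT (fun x => path_cost (@?d x) (@?s x)) => apply: (PT_path_cost (w := d) (p := s))
  end.
Ltac pt_user ::= first [pt_int | pt_t0 | pt_t1 | pt_t2 | pt_t3 | pt_t4].

Lemma sz_nil {X} {EX : Enc X} : sz ([::] : seq X) = 1. Proof. by []. Qed.

Section Paths.
Context {E : Type} {EE : Enc E}.
Implicit Types (idx p : E -> seq nat) (q w : E -> seq (seq nat)).

Lemma shorter_pick (w' : seq (seq nat)) a b : shorter w' a b = a \/ shorter w' a b = b.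
Proof. by rewrite /shorter; case: (nilp a); [right|case: (nilp b); [left|case: leqP; [left|right]]]. Qed.

Lemma PT_relax idx q w (tbl : E -> seq (seq nat)) : PT idx -> PT q -> PT w -> PT tbl -> PT (fun e => relax (idx e) (q e) (w e) (tbl e)).
Proof.
move=> hidx hq hw ht; rewrite /relax.
apply: (PT_map (f := fun e j => foldl (shorter (w e)) (nth [::] (tbl e) j)
     [seq j :: nth [::] (tbl e) k | k <- [seq k <- idx e | ~~ nilp (nth [::] (tbl e) k) && (1 <= entry 0 (q e) j k)]])) => //.
apply: (PT_foldl_pick (g := shorter) (y := fun p : E * nat => w p.1)); pts; last exact: shorter_pick.
Qed.

Lemma PT_cut_to (x : E -> nat) (s : E -> seq nat) : PT x -> PT s -> PT (fun e => cut_to (x e) (s e)).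
Proof.
move=> hx hs; rewrite /cut_to; apply: PT_rev.
apply: (PT_foldl_incr (f := fun e a y => if (y == x e) || ~~ nilp a then y :: a else a)); pts.
exists (fun p : E * nat => sz p + 1); first by pb.
move=> e b y; move: (_ || _) => c; rewrite sz_pair; case: c; last by lia.
by rewrite [X in X <= _](sz_cons (X := nat)) [sz e + _]addnC; move: (sz _) (sz _) (sz _) => u v u'; lia.
Qed.

Lemma cut_toE x s : cut_to x s = if x \in s then drop (index x s) s else [::].
Proof.
rewrite /cut_to; have H (a l : seq nat) : ~~ nilp a ->
    rev (foldl (fun (a : seq nat) (y : nat) => if (y == x) || ~~ nilp a then y :: a else a) a l) = rev a ++ l.
  elim: l a => [|y l IH] a ha /=; first by rewrite cats0.
  by rewrite ha orbT IH// rev_cons cat_rcons.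
elim: s => //= y s IH; rewrite orbF inE eq_sym; case: eqVneq => [xy|xy] /=; last by rewrite IH.
by rewrite H.
Qed.

Lemma sz_cut_to x s : sz (cut_to x s) <= sz s.
Proof. by rewrite cut_toE; case: ifP => _; [exact: sz_drop | rewrite sz_nil sz_gt0]. Qed.

Lemma sz_erase_loops (p : seq nat) : sz (erase_loops p) <= sz p.
Proof.
elim: p => //= x s IH; case: ifP => _; rewrite ?sz_cons; last by rewrite ltnS leq_add2l.
by apply: leq_trans (sz_cut_to _ _) _; lia.
Qed.

End Paths.

Definition max_sz (tbl : seq (seq nat)) : nat := foldr (fun p m => maxn (sz p) m) 1 tbl.

Lemma max_sz_nth tbl i : sz (nth [::] tbl i) <= max_sz tbl.
Proof.
elim: tbl i => [|p tbl IH] [|i] //=; rewrite leq_max ?leqnn//.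
by rewrite IH orbT.
Qed.

Lemma max_szP tbl m : 0 < m -> (forall p, p \in tbl -> sz p <= m) -> max_sz tbl <= m.
Proof.
move=> m0; elim: tbl => //= p tbl IH h; rewrite geq_max h ?mem_head//=.
by apply: IH => p' hp; apply: h; rewrite inE hp orbT.
Qed.

Lemma sz_le_max (tbl : seq (seq nat)) : sz tbl <= size tbl * (max_sz tbl + 1) + 1.
Proof.
elim: tbl => [|p tbl IH] //=; rewrite sz_cons.
have : sz p <= maxn (sz p) (max_sz tbl) by exact: leq_maxl.
have : max_sz tbl <= maxn (sz p) (max_sz tbl) by exact: leq_maxr.
move: (maxn _ _) => m h2 h1; have : size tbl * (max_sz tbl + 1) <= size tbl * (m + 1) by rewrite leq_mul2l leq_add2r h2 orbT.
rewrite mulSn; lia.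
Qed.

Lemma sz_in_idx (d : seq nat) j : j \in d -> sz j <= sz d.
Proof.
elim: d => //= x d IH; rewrite inE sz_cons => /orP[/eqP->|/IH]; lia.
Qed.

Lemma max_sz_init d i : max_sz [seq if j == i then [:: i] else [::] | j <- d] <= sz i + 2.
Proof.
have h (b : bool) : sz (if b then [:: i] else [::]) <= sz i + 2.
  by case: b; rewrite ?sz_cons sz_nil ?addn2 ?addn1.
by apply: max_szP => [|p /mapP[j _ ->]]; [rewrite addn2 | exact: h].
Qed.

Lemma foldl_shorter_sz (w' : seq (seq nat)) (a : seq nat) l m : sz a <= m -> (forall p, p \in l -> sz p <= m) ->
  sz (foldl (shorter w') a l) <= m.
Proof.
elim: l a => //= p l IH a ha hl; apply: IH => [|p' hp]; last by apply: hl; rewrite inE hp orbT.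
by case: (shorter_pick w' a p) => ->//; apply: hl; rewrite mem_head.
Qed.

(** A round puts at most one more vertex in front of a stored walk, so the sizes grow additively
    over the rounds. *)
Lemma max_sz_relax d q' w' tbl : max_sz (relax d q' w' tbl) <= max_sz tbl + (sz d + 1).
Proof.
apply: max_szP => [|p /mapP[j jd ->]]; first by rewrite addn1 addnS.
apply: foldl_shorter_sz => [|p' /mapP[k _ ->]].
  by apply: leq_trans (max_sz_nth _ _) _; rewrite leq_addr.
rewrite (sz_cons (X := nat)); have := max_sz_nth tbl k; have := sz_in_idx jd.
by move: (sz _) (sz _) (sz _) (max_sz _) => a b c m; lia.
Qed.

Lemma max_sz_paths d q' w' i : max_sz (paths_from d q' w' i) <= sz i + 2 + size d * (sz d + 1).
Proof.
rewrite /paths_from; have h0 := max_sz_init d i.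
move: [seq _ | _ <- _] h0 => tbl h0.
have H (l : seq nat) tb : max_sz (foldl (fun t _ => relax d q' w' t) tb l) <= max_sz tb + size l * (sz d + 1).
  elim: l tb => [|x l IH] tb /=; first by rewrite mul0n addn0.
  by apply: leq_trans (IH _) _; have := max_sz_relax d q' w' tb; rewrite mulSn; lia.
by apply: leq_trans (H _ _) _; rewrite leq_add2r.
Qed.

Ltac pt_t5 := lazymatch goal with
  | |- PT (fun x => relax (@?d x) (@?q x) (@?w x) (@?t x)) => apply: (PT_relax (idx := d) (q := q) (w := w) (tbl := t))
  | |- PT (fun x => cut_to (@?d x) (@?s x)) => apply: (PT_cut_to (x := d) (s := s))
  end.
Ltac pt_user ::= first [pt_int | pt_t0 | pt_t1 | pt_t2 | pt_t3 | pt_t4 | pt_t5].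

Section Search.
Context {E : Type} {EE : Enc E}.
Implicit Types (idx : E -> seq nat) (q w : E -> seq (seq nat)).

Lemma PT_paths_from idx q w (i : E -> nat) : PT idx -> PT q -> PT w -> PT i ->
  PT (fun e => paths_from (idx e) (q e) (w e) (i e)).
Proof.
move=> hidx hq hw hi; rewrite /paths_from; have pd := PT_size hidx; have pi := PT_size hi.
apply: (PT_foldl (f := fun e tbl (_ : nat) => relax (idx e) (q e) (w e) tbl)); pts.
exists (fun e => (sz (idx e) + 1) * (sz (i e) + 2 + sz (idx e) * (sz (idx e) + 1) + 1) + 1); first by pb.
move=> e j _; set d := idx e.
set t0 := map _ _; have h0 : max_sz t0 <= sz (i e) + 2 := max_sz_init d (i e).
have s0 : size t0 = size d by rewrite size_map.
have H (l : seq nat) tb : size tb = size d -> max_sz (foldl (fun t _ => relax d (q e) (w e) t) tb l) <= max_sz tb + size l * (sz d + 1) /\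
    size (foldl (fun t _ => relax d (q e) (w e) t) tb l) = size d.
  elim: l tb => [|x l IH] tb stb /=; first by rewrite mul0n addn0.
  have [h1 h2] := IH (relax d (q e) (w e) tb) (size_map _ _); split=> //.
  by apply: leq_trans h1 _; have := max_sz_relax d (q e) (w e) tb; rewrite mulSn; lia.
have [h1 h2] := H (take j d) t0 s0.
apply: leq_trans (sz_le_max _) _; rewrite h2 leq_add2r; apply: leq_mul.
  by apply: leq_trans (size_le_sz _) _; rewrite leq_addr.
rewrite leq_add2r; apply: leq_trans h1 _; apply: leq_add => //.
by rewrite leq_mul2r size_take_min (leq_trans (geq_minr _ _)) ?size_le_sz ?orbT.
Qed.

Lemma PT_erase_loops (p : E -> seq nat) : PT p -> PT (fun e => erase_loops (p e)).
Proof.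
move=> hp; apply: (PT_foldr_incr (f := fun _ x (s : seq nat) => if x \in s then cut_to x s else x :: s)); pts.
exists (fun p : E * nat => sz p + 2); first by pb.
move=> e b x; rewrite sz_pair; case: ifP => _; last by rewrite sz_cons; lia.
by apply: leq_trans (sz_cut_to _ _) _; rewrite leq_addr.
Qed.

End Search.

Ltac pt_t6 := lazymatch goal with
  | |- PT (fun x => paths_from (@?d x) (@?q x) (@?w x) (@?t x)) => apply: (PT_paths_from (idx := d) (q := q) (w := w) (i := t))
  | |- PT (fun x => erase_loops (@?d x)) => apply: (PT_erase_loops (p := d))
  end.
Ltac pt_user ::= first [pt_int | pt_t0 | pt_t1 | pt_t2 | pt_t3 | pt_t4 | pt_t5 | pt_t6].

Section Score.
Context {E : Type} {EE : Enc E}.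
Implicit Types (idx p : E -> seq nat) (w st : E -> seq (seq nat)) (lam big : E -> nat).

Lemma PT_score idx lam big st (X : E -> seq (seq int)) (Xd : E -> int) w p :
  PT idx -> PT lam -> PT big -> PT st -> PT X -> PT Xd -> PT w -> PT p ->
  PT (fun e => score (idx e) (lam e) (big e) (st e) (X e) (Xd e) (w e) (p e)).
Proof. by move=> *; rewrite /score /deg_excess; pts. Qed.

End Score.

Ltac pt_t7 := lazymatch goal with
  | |- PT (fun x => score (@?a x) (@?b x) (@?c x) (@?d x) (@?f x) (@?g x) (@?w x) (@?p x)) =>
      apply: (PT_score (idx := a) (lam := b) (big := c) (st := d) (X := f) (Xd := g) (w := w) (p := p))
  end.
Ltac pt_user ::= first [pt_int | pt_t0 | pt_t1 | pt_t2 | pt_t3 | pt_t4 | pt_t5 | pt_t6 | pt_t7].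

Section Step.
Context {E : Type} {EE : Enc E}.
Implicit Types (idx : E -> seq nat) (q w st : E -> seq (seq nat)) (lam big r : E -> nat).

Lemma PT_candidates idx q w : PT idx -> PT q -> PT w -> PT (fun e => candidates (idx e) (q e) (w e)).
Proof. by move=> *; rewrite /candidates; pts. Qed.

Lemma PT_edge_excess idx big q st : PT idx -> PT big -> PT q -> PT st ->
  PT (fun e => edge_excess (idx e) (big e) (q e) (st e)).
Proof. by move=> *; rewrite /edge_excess; pts. Qed.

Lemma PT_best_path idx lam big st X Xd w ps : PT idx -> PT lam -> PT big -> PT st -> PT X -> PT Xd -> PT w -> PT ps ->
  PT (fun e => best_path (idx e) (lam e) (big e) (st e) (X e) (Xd e) (w e) (ps e)).
Proof.
move=> hidx hlam hbig hst hX hXd hw hps; rewrite /best_path.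
apply: (PT_foldl_pick (g := fun (y : seq nat * nat * nat * seq (seq nat) * seq (seq int) * int * seq (seq nat)) b p =>
  if (score y.1.1.1.1.1.1 y.1.1.1.1.1.2 y.1.1.1.1.2 y.1.1.1.2 y.1.1.2 y.1.2 y.2 b <
      score y.1.1.1.1.1.1 y.1.1.1.1.1.2 y.1.1.1.1.2 y.1.1.1.2 y.1.1.2 y.1.2 y.2 p)%R then p else b)
  (y := fun e => (idx e, lam e, big e, st e, X e, Xd e, w e))); pts.
by move=> y a b; case: ifP => _; [right|left].
Qed.

Lemma PT_finished idx r big q st X Xd : PT idx -> PT r -> PT big -> PT q -> PT st -> PT X -> PT Xd ->
  PT (fun e => finished (idx e) (r e) (big e) (q e) (st e) (X e) (Xd e)).
Proof. by move=> *; rewrite /finished; pts. Qed.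

End Step.

Lemma abszD (x y : int) : `|(x + y)%R| <= `|x| + `|y|.
Proof. lia. Qed.

Lemma dot_bound u v a b : (forall k, `|nth 0%R u k| <= a) -> (forall k, `|nth 0%R v k| <= b) ->
  `|dot u v| <= size u * (a * b).
Proof.
rewrite /dot sumzE big_map; elim: u v => [|x u IH] [|y v] ha hb /=; rewrite ?big_nil ?absz0//.
rewrite big_cons mulSn /=.
have h := IH v (fun k => ha k.+1) (fun k => hb k.+1).
have hx : `|(x * y)%R| <= a * b by rewrite abszM leq_mul ?(ha 0) ?(hb 0).
by apply: leq_trans (abszD _ _) _; exact: leq_add hx h.
Qed.

Lemma entry_tab {X} (d : X) idx f i j :
  entry d (tab idx f) i j = if (i < size idx) && (j < size idx) then f (nth 0 idx i) (nth 0 idx j) else d.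
Proof.
rewrite /entry /tab; case: ltnP => hi /=.
  by rewrite (nth_map 0)//; case: ltnP => hj; [rewrite (nth_map 0) | rewrite nth_default// size_map].
by rewrite (nth_default _ (n := i)) ?size_map// nth_nil.
Qed.

Lemma size_row_tab {X} idx (f : nat -> nat -> X) i : size (nth [::] (tab idx f) i) <= size idx.
Proof.
case: (ltnP i (size idx)) => hi; first by rewrite (nth_map 0)// size_map.
by rewrite nth_default// size_map.
Qed.

Definition bounded (t : seq (seq int)) (n B : nat) :=
  (forall i, size (nth [::] t i) <= n) /\ forall i j, `|entry 0%R t i j| <= B.

Lemma bounded_tab idx f B : (forall i j, i \in idx -> j \in idx -> `|f i j| <= B) ->
  bounded (tab idx f) (size idx) B.
Proof.
move=> h; split=> [i|i j]; first exact: size_row_tab.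
rewrite entry_tab; case: andP => [[hi hj]|_]; last by rewrite absz0.
by apply: h; exact: mem_nth.
Qed.

Lemma bounded_mul idx A B a b : bounded A (size idx) a -> bounded B (size idx) b ->
  bounded (mul_tr idx A B) (size idx) (size idx * (a * b)).
Proof.
move=> [sA hA] [_ hB]; apply: bounded_tab => i j _ _.
apply: leq_trans (dot_bound (hA i) (hB j)) _.
by rewrite leq_mul2r sA orbT.
Qed.

Lemma bounded_ns idx s b : bounded s.1 (size idx) (2 ^ b) -> `|s.2| <= 2 ^ b ->
  bounded (ns_step idx s).1 (size idx) (2 ^ (3 * b + 2 * size idx + 2)) /\
  `|(ns_step idx s).2| <= 2 ^ (3 * b + 2 * size idx + 2).
Proof.
move=> hs hd; have hn := ltn_expl (size idx) (ltnSn 1).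
have h2 := bounded_mul hs hs; have h3 := bounded_mul h2 hs.
have p1 : 0 < 2 ^ b by rewrite expn_gt0.
have p2 : 0 < 2 ^ size idx by rewrite expn_gt0.
have hE : 2 ^ (3 * b + 2 * size idx + 2) = 4 * (2 ^ b * 2 ^ b * 2 ^ b) * (2 ^ size idx * 2 ^ size idx).
  by rewrite 2!expnD (mulnC 3) (mulnC 2) !expnM !expnS !expn0; lia.
rewrite hE /=; move: (2 ^ b) (2 ^ size idx) p1 p2 hn hs hd h2 h3 => B N p1 p2 hn hs hd h2 h3.
have B3 : B * B * B <= B * B * B * (N * N) by rewrite leq_pmulr// muln_gt0 p2.
split; last first.
  rewrite !abszM; apply: leq_trans (_ : 2 * (B * B * B) <= _); last by lia.
  have hd2 := leq_mul hd hd; have hd3 := leq_mul hd2 hd; lia.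
apply: bounded_tab => i j _ _.
have e1 := (h3.2 i j); have e2 := hs.2 i j.
have e3 : `|(3 * s.2 * s.2 * entry 0 s.1 i j)%R| <= 3 * (B * B * B).
  rewrite !abszM; have hd2 := leq_mul hd hd; have hd3 := leq_mul hd2 e2; lia.
have e4 : size idx * (size idx * (B * B) * B) <= B * B * B * (N * N).
  have := leq_mul (leq_mul (ltnW hn) (ltnW hn)) (leqnn (B * B * B)); lia.
move: (entry _ (mul_tr _ _ _) i j) (3 * _ * _ * _)%R e1 e3 => u v e1 e3.
apply: leq_trans (_ : `|v| + `|u| <= _); first by lia.
lia.
Qed.

Lemma sz_in_map {X} {EX : Enc X} (g : nat -> X) (l : seq nat) i : i \in l -> sz (g i) <= sz (map g l).
Proof.
elim: l => //= x l IH; rewrite inE sz_cons => /orP[/eqP->|/IH]; lia.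
Qed.

Lemma sz_map_le {X} {EX : Enc X} (g : nat -> X) (l : seq nat) m : (forall i, i \in l -> sz (g i) <= m) ->
  sz (map g l) <= size l * (m + 1) + 1.
Proof.
elim: l => //= x l IH h; rewrite sz_cons mulSn.
have := h x (mem_head _ _); have : sz (map g l) <= size l * (m + 1) + 1.
  by apply: IH => i il; apply: h; rewrite inE il orbT.
lia.
Qed.

Lemma sz_tab_bound idx f b : (forall i j, i \in idx -> j \in idx -> `|f i j| <= 2 ^ b) ->
  sz (tab idx f) <= size idx * (size idx * (4 * b + 10) + 2) + 1.
Proof.
move=> h; apply: leq_trans (sz_map_le (m := size idx * (4 * b + 10) + 1) _) _; last first.
  by rewrite -addnA.
move=> i hi; apply: leq_trans (sz_map_le (m := 4 * b + 9) _) _; last by rewrite -addnA.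
by move=> j hj; apply: sz_int_bound; exact: h.
Qed.

(** A step cubes the entries, so it triples the number of bits up to an additive term. The growth by
    3^j stays polynomial because the number of steps is logarithmic. *)
Fixpoint ns_bits (n b j : nat) : nat := if j is j'.+1 then 3 * ns_bits n b j' + 2 * n + 2 else b.

Lemma ns_bits_le n b j : ns_bits n b j <= 3 ^ j * (b + n + 1).
Proof.
suff : ns_bits n b j + n + 1 <= 3 ^ j * (b + n + 1) by lia.
by elim: j => [|j IH] /=; [rewrite expn0; lia | rewrite expnS; lia].
Qed.

Lemma ns_iter_bounded idx lam kk st (b := ns_bits (size idx) (sz (base_mx idx lam st) + sz (base_den idx lam st)) (size kk))
    (s := ns_iter idx lam kk st) :
  [/\ bounded s.1 (size idx) (2 ^ b), `|s.2| <= 2 ^ b &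
    sz s <= size idx * (size idx * (4 * b + 10) + 2) + 4 * b + 11].
Proof.
have Z f t i j : t = tab idx f -> i \in idx -> j \in idx -> sz (f i j) <= sz t.
  move=> -> hi hj; apply: leq_trans (sz_in_map (fun i => [seq f i j | j <- idx]) hi).
  exact: (sz_in_map (f i) hj).
have [f [ef hf hd]] : exists f, [/\ s.1 = tab idx f, forall i j, i \in idx -> j \in idx -> `|f i j| <= 2 ^ b & `|s.2| <= 2 ^ b].
  rewrite {}/s {}/b /ns_iter; elim/last_ind: kk => [|kk x IH] /=.
    eexists; split; first reflexivity.
      move=> i j hi hj; apply: leq_trans (absz_sz _) _; rewrite leq_exp2l//.
      by apply: leq_trans (leq_addr _ _); apply: (Z _ _ _ _ erefl hi hj).
    by apply: (leq_trans (absz_sz (base_den idx lam st))); rewrite leq_exp2l// leq_addl.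
  rewrite foldl_rcons size_rcons /=; move: IH; set s' := foldl _ _ _; set b' := ns_bits _ _ _.
  move=> [f [ef hf hd]]; have hs : bounded s'.1 (size idx) (2 ^ b') by rewrite ef; exact: bounded_tab.
  have [h1 h2] := bounded_ns hs hd.
  eexists; split; [reflexivity | | exact: h2].
  move=> i j hi hj; have := h1.2 (index i idx) (index j idx).
  by rewrite entry_tab !index_mem hi hj /= !nth_index.
split=> //; first by rewrite ef; exact: bounded_tab.
rewrite (surjective_pairing s) sz_pair ef; have := sz_tab_bound hf; have := sz_int_bound hd.
by move: (sz s.2) (sz (tab idx f)) (size idx * _) => x y z; lia.
Qed.

Section NewtonSchulz.
Context {E : Type} {EE : Enc E}.
Implicit Types (idx : E -> seq nat) (st q : E -> seq (seq nat)) (lam r big : E -> nat) (kk : E -> seq unit).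

Lemma PT_ns_iter idx lam kk st : PT idx -> PT lam -> PT kk -> PT st ->
  poly_bounded (fun e => 3 ^ size (kk e)) ->
  PT (fun e => ns_iter (idx e) (lam e) (kk e) (st e)).
Proof.
move=> hidx hlam hkk hst pk; rewrite /ns_iter.
have hm : PT (fun e => base_mx (idx e) (lam e) (st e)) by pts.
have hd : PT (fun e => base_den (idx e) (lam e) (st e)) by pts.
have pm := PT_size hm; have pd := PT_size hd; have pi := PT_size hidx.
apply: (PT_foldl (f := fun e s (_ : unit) => ns_step (idx e) s)); pts.
have [b [pbb eb]] : exists b : E -> nat, poly_bounded b /\ forall e, 3 ^ size (kk e) * (sz (base_mx (idx e) (lam e) (st e)) + sz (base_den (idx e) (lam e) (st e)) + sz (idx e) + 1) <= b e.
  by eexists; split; [|move=> e; exact: leqnn]; pb.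
exists (fun e => sz (idx e) * (sz (idx e) * (4 * b e + 10) + 2) + 4 * b e + 11); first by pb.
move=> e j jl; have [_ _ h] := ns_iter_bounded (idx e) (lam e) (take j (kk e)) (st e).
apply: leq_trans h _; set b1 := ns_bits _ _ _.
have hb : b1 <= b e.
  apply: leq_trans (ns_bits_le _ _ _) _; apply: leq_trans (eb e); apply: leq_mul.
    by rewrite leq_exp2l// size_take_min geq_minr.
  by rewrite leq_add2r leq_add2l size_le_sz.
assert (uv : size (idx e) <= sz (idx e)) by exact: size_le_sz.
set u := size _ in uv *; set v := sz _ in uv *.
have h1 : u * (u * (4 * b1 + 10) + 2) <= v * (v * (4 * b e + 10) + 2).
  by apply: leq_mul => //; rewrite leq_add2r; apply: leq_mul => //; rewrite leq_add2r leq_mul2l hb.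
lia.
Qed.

End NewtonSchulz.

Ltac pt_t8 := lazymatch goal with
  | |- PT (fun x => ns_iter (@?a x) (@?b x) (@?c x) (@?d x)) =>
      apply: (PT_ns_iter (idx := a) (lam := b) (kk := c) (st := d))
  end.
Ltac pt_flow := first [pt_int | pt_t0 | pt_t1 | pt_t2 | pt_t3 | pt_t4 | pt_t5 | pt_t6 | pt_t7 | pt_t8].
Ltac pt_user ::= pt_flow.

Lemma pb_fst {X Y} {EX : Enc X} {EY : Enc Y} (t : X -> nat) :
  poly_bounded t -> poly_bounded (fun p : X * Y => t p.1).
Proof. by move=> ht; apply: (pb_comp ht); apply: PT_size; exact: PT_fst PT_id. Qed.

Section Step.
Context {E : Type} {EE : Enc E}.
Implicit Types (idx : E -> seq nat) (st q : E -> seq (seq nat)) (lam r big : E -> nat) (kk : E -> seq unit).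

Lemma PT_proj_num idx lam kk st : PT idx -> PT lam -> PT kk -> PT st ->
  poly_bounded (fun e => 3 ^ size (kk e)) ->
  PT (fun e => proj_num (idx e) (lam e) (kk e) (st e)).
Proof.
move=> hidx hlam hkk hst pk; rewrite /proj_num.
by pts; apply: (pb_fst (t := fun p : E * nat => 3 ^ size (kk p.1))); apply: (pb_fst (t := fun e => 3 ^ size (kk e))).
Qed.

Lemma PT_proj_den idx lam kk st : PT idx -> PT lam -> PT kk -> PT st ->
  poly_bounded (fun e => 3 ^ size (kk e)) ->
  PT (fun e => proj_den (idx e) (lam e) (kk e) (st e)).
Proof. by move=> hidx hlam hkk hst pk; rewrite /proj_den; pts. Qed.

Lemma PT_fw_step idx r lam big q kk st : PT idx -> PT r -> PT lam -> PT big -> PT q -> PT kk -> PT st ->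
  poly_bounded (fun e => 3 ^ size (kk e)) ->
  PT (fun e => fw_step (idx e) (r e) (lam e) (big e) (q e) (kk e) (st e)).
Proof.
move=> hidx hr hlam hbig hq hkk hst pk; rewrite /fw_step.
have h1 := PT_proj_num hidx hlam hkk hst pk; have h2 := PT_proj_den hidx hlam hkk hst pk.
have h3 := PT_edge_excess hidx hbig hq hst; have h4 := PT_candidates hidx hq h3.
by apply: PT_if; [exact: PT_finished | | apply: PT_cons => //; exact: PT_best_path].
Qed.

End Step.

Lemma best_path_mem idx lam big st X Xd w ps :
  best_path idx lam big st X Xd w ps = [::] \/ best_path idx lam big st X Xd w ps \in ps.
Proof.
rewrite /best_path; elim/last_ind: ps => [|ps p IH]; first by left.
rewrite foldl_rcons mem_rcons inE; case: ifP => _; first by right; rewrite eqxx.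
by case: IH => [->|->]; [left|right; rewrite orbT].
Qed.

Lemma mem_max_sz tbl p : p \in tbl -> sz p <= max_sz tbl.
Proof. by move=> h; rewrite -(nth_index [::] h); exact: max_sz_nth. Qed.

(** A tick adds at most one path, of a size bounded in terms of [idx] alone. The integers of the
    projection are recomputed at every tick and are not part of the state. *)
Lemma PT_frank_wolfe {E} {EE : Enc E} (idx : E -> seq nat) (q : E -> seq (seq nat)) (lam r big : E -> nat)
    (kk ticks : E -> seq unit) : PT idx -> PT r -> PT lam -> PT big -> PT q -> PT kk -> PT ticks ->
  poly_bounded (fun e => 3 ^ size (kk e)) ->
  PT (fun e => frank_wolfe (idx e) (r e) (lam e) (big e) (q e) (kk e) (ticks e)).
Proof.
move=> hidx hr hlam hbig hq hkk ht pk; rewrite /frank_wolfe.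
apply: (PT_foldl_incr (f := fun e st (_ : unit) => fw_step (idx e) (r e) (lam e) (big e) (q e) (kk e) st)).
- apply: (PT_fw_step (idx := fun p => idx p.1.1) (r := fun p => r p.1.1) (lam := fun p => lam p.1.1)
    (big := fun p => big p.1.1) (q := fun p => q p.1.1) (kk := fun p => kk p.1.1) (st := fun p => p.1.2)); pts.
  by apply: (pb_fst (t := fun p : E * seq (seq nat) => 3 ^ size (kk p.1))); apply: (pb_fst (t := fun e => 3 ^ size (kk e))).
- by pts.
- by [].
have pi := PT_size hidx; exists (fun p => sz (idx p.1) + 2 + sz (idx p.1) * (sz (idx p.1) + 1) + 2).
  by apply: (pb_fst (t := fun e => sz (idx e) + 2 + sz (idx e) * (sz (idx e) + 1) + 2)); pb.
move=> e st _ /=; rewrite /fw_step; case: ifP => _; first exact: leq_addr.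
rewrite sz_cons; set p := best_path _ _ _ _ _ _ _ _.
assert (hp : sz p <= sz (idx e) + 2 + sz (idx e) * (sz (idx e) + 1)); last first.
  by move: hp; move: (sz p) (sz st) (_ + _ * _) => x y z; lia.
have [ep|] : p = [::] \/ p \in candidates (idx e) (q e) (edge_excess (idx e) (big e) (q e) st) by exact: best_path_mem.
  by rewrite ep sz_nil; lia.
move=> /flatten_mapP[i hi /mapP[p' hp' ep]]; rewrite ep; apply: leq_trans (sz_erase_loops _) _.
apply: leq_trans (mem_max_sz hp') _; apply: leq_trans (max_sz_paths _ _ _ _) _.
assert (h1 : sz i <= sz (idx e)) by exact: sz_in_idx.
assert (h2 : size (idx e) <= sz (idx e)) by exact: size_le_sz.
by rewrite leq_add// ?leq_mul2r ?h2 ?orbT// leq_add2r.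
Qed.

(** * Shortest walks *)

Section Walks.
Variables (n : nat) (q w : seq (seq nat)).
Implicit Types (p s : seq nat) (i j x y : nat).
Notation idx := (iota 0 n).

Definition adj i j : bool := 1 <= entry 0 q i j.
Definition walk p : bool := if p is x :: s then all (fun v => v < n) p && path adj x s else false.

Lemma path_cost_cons x y s : path_cost w (x :: y :: s) = entry 0 w x y + path_cost w (y :: s).
Proof. by []. Qed.

Lemma path_cost1 x : path_cost w [:: x] = 0.
Proof. by []. Qed.

Lemma path_cost_cat x s y s' : path_cost w (x :: s ++ y :: s') =
  path_cost w (rcons (x :: s) y) + path_cost w (y :: s').
Proof.
elim: s x => [|z s IH] x; first by rewrite /= path_cost_cons [path_cost w [:: x; y]]path_cost_cons path_cost1 addn0.
by rewrite [x :: _ ++ _]/= path_cost_cons IH [rcons _ _]/= path_cost_cons addnA.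
Qed.

Lemma walk_drop x s k : walk (x :: s) -> k <= size s -> walk (drop k (x :: s)).
Proof.
move=> /= /andP[/andP[hx hs] hp]; elim: k x s hx hs hp => [|k IH] x [|y s] hx hs hp hk //=.
- by rewrite hx.
- by rewrite hx /=; move: hs hp => /= -> ->.
- by move: hs hp => /= /andP[hy hs] /andP[_ hp]; exact: IH.
Qed.

Lemma path_cost_drop p k : path_cost w (drop k p) <= path_cost w p.
Proof.
elim: k p => [|k IH] p; first by rewrite drop0.
case: p => [|x [|y s]] //.
by apply: leq_trans (IH (y :: s)) _; rewrite path_cost_cons leq_addl.
Qed.

Lemma last_drop (x : nat) s k : k <= size s -> last 0 (drop k (x :: s)) = last x s.
Proof. by elim: k x s => [|k IH] x [|y s] //= hk; exact: IH. Qed.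

Lemma erase_loops_cons x s : erase_loops (x :: s) =
  if x \in erase_loops s then cut_to x (erase_loops s) else x :: erase_loops s.
Proof. by []. Qed.

Lemma erase_loopsP p : walk p ->
  [/\ walk (erase_loops p), uniq (erase_loops p), head 0 (erase_loops p) = head 0 p,
      last 0 (erase_loops p) = last 0 p & path_cost w (erase_loops p) <= path_cost w p].
Proof.
case: p => // x s; elim: s x => [|y s IH] x; first by [].
move=> hw; have hw' : walk (y :: s) by exact: (walk_drop (k := 1) hw isT).
have [h1 h2 h3 h4 h5] := IH y hw'.
have exy : adj x y by move: hw => /= /andP[_ /andP[]].
have hx : x < n by move: hw => /= /andP[/andP[]].
rewrite (erase_loops_cons x).
case: (erase_loops (y :: s)) h1 h2 h3 h4 h5 => // z t h1 h2 /= h3 h4 h5.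
rewrite h3 in h1 h2 h4 h5 *.
case: ifP => hin.
  rewrite cut_toE hin; have hk : index x (y :: t) <= size t by rewrite -ltnS -[(size t).+1]/(size (y :: t)) index_mem.
  split.
  - exact: walk_drop.
  - exact: drop_uniq.
  - by rewrite -nth0 nth_drop addn0 nth_index.
  - by rewrite last_drop.
  - apply: leq_trans (path_cost_drop _ _) _; apply: leq_trans h5 _.
    by rewrite path_cost_cons leq_addl.
split=> //=.
- by rewrite hx exy; move: h1 => /= /andP[-> ->].
- by rewrite -[~~ _ && _]/(uniq [:: x, y & t]) /= hin.
- by rewrite !path_cost_cons leq_add2l.
Qed.

Lemma foldl_shorterP a (l : seq (seq nat)) (b := foldl (shorter w) a l) :
  (b = a \/ b \in l) /\ forall p, p \in a :: l -> ~~ nilp p -> ~~ nilp b && (path_cost w b <= path_cost w p).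
Proof.
rewrite {}/b; elim: l a => [|p l IH] a /=.
  by split=> [|p']; [left | rewrite inE => /eqP -> ->; rewrite leqnn].
have [h1 h2] := IH (shorter w a p); split.
  case: h1 => [->|h1]; last by right; rewrite inE h1 orbT.
  by case: (shorter_pick w a p) => ->; [left | right; rewrite mem_head].
move=> p' hp' np'; have := h2 (shorter w a p) (mem_head _ _).
move: hp'; rewrite !inE => /or3P[/eqP e|/eqP e|hl]; last by move=> _; apply: h2 => //; rewrite inE hl orbT.
- rewrite {}e in np' *; rewrite /shorter (negbTE np'); case: (boolP (nilp p)) => np; first by apply.
  case: leqP => hc; first by apply.
  by move=> /(_ np)/andP[-> h]; exact: leq_trans h (ltnW hc).
- rewrite {}e in np' *; rewrite /shorter (negbTE np'); case: (boolP (nilp a)) => na; first by apply.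
  case: leqP => hc; last by apply.
  by move=> /(_ na)/andP[-> h]; exact: leq_trans h hc.
Qed.

Section Source.
Variable i : nat.
Hypothesis hi : i < n.

Definition table_ok (m : nat) (tbl : seq (seq nat)) :=
  forall j, j < n ->
   (~~ nilp (nth [::] tbl j) -> [/\ walk (nth [::] tbl j), head 0 (nth [::] tbl j) = j & last 0 (nth [::] tbl j) = i]) /\
   (forall s, walk (j :: s) -> last j s = i -> size s <= m ->
      ~~ nilp (nth [::] tbl j) && (path_cost w (nth [::] tbl j) <= path_cost w (j :: s))).

Lemma table_ok0 : table_ok 0 [seq if j == i then [:: i] else [::] | j <- idx].
Proof.
move=> j hj; rewrite (nth_map 0) ?size_iota// nth_iota// add0n; split.
  by case: eqVneq => // ->; rewrite /= hi.
by case=> // /= _ -> _; rewrite eqxx.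
Qed.

Lemma table_okS m tbl : table_ok m tbl -> table_ok m.+1 (relax idx q w tbl).
Proof.
move=> ok j hj; rewrite /relax (nth_map 0) ?size_iota// nth_iota// add0n.
set l := map _ _; have [pick best] := foldl_shorterP (nth [::] tbl j) l.
have [okj1 okj2] := ok j hj; split.
  move=> nb; case: pick nb => [->|]; first exact: okj1.
  move=> /mapP[k]; rewrite mem_filter mem_iota add0n => /andP[/andP[nk adjk] /andP[_ kn]] -> _.
  have [wk hk lk] := (ok k kn).1 nk.
  case: (nth [::] tbl k) wk hk lk nk => // z t /= /andP[ha hp] ez lk _.
  by move: ha hp lk; rewrite ez => -> -> ->; rewrite hj /adj adjk.
case=> [|k s] hw hl hs.
  have /andP[n1 c1] := okj2 [::] hw hl isT.
  by have /andP[-> c2] := best _ (mem_head _ _) n1; rewrite (leq_trans c2).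
have hk : k < n by move: hw => /= /andP[/and3P[]].
have wk : walk (k :: s) by exact: (walk_drop (k := 1) hw isT).
have ajk : adj j k by move: hw => /= /andP[_ /andP[]].
have /andP[n1 c1] := (ok k hk).2 s wk hl hs.
have inl : j :: nth [::] tbl k \in nth [::] tbl j :: l.
  by rewrite inE; apply/orP; right; apply: map_f; rewrite mem_filter mem_iota n1 add0n hk /= andbT; exact: ajk.
have /andP[-> c2] := best _ inl isT; apply: leq_trans c2 _.
have [_ hdk _] := (ok k hk).1 n1.
case: (nth [::] tbl k) hdk n1 c1 => // z t /= ez _ c1; rewrite ez in c1 *.
by rewrite !path_cost_cons leq_add2l.
Qed.

Lemma paths_from_ok : table_ok n (paths_from idx q w i).
Proof.
suff H (l : seq nat) : table_ok (size l) (foldl (fun tbl _ => relax idx q w tbl)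
    [seq if j == i then [:: i] else [::] | j <- idx] l) by have := H idx; rewrite size_iota.
elim/last_ind: l => [|l x IH]; first exact: table_ok0.
by rewrite foldl_rcons size_rcons; exact: table_okS.
Qed.

End Source.

Definition route i j : seq nat := nth [::] (paths_from idx q w i) j.
Definition routed i j : bool := ~~ nilp (route i j).
Definition dst i j : nat := path_cost w (route i j).

Lemma routeP i j : i < n -> j < n -> routed i j ->
  [/\ walk (route i j), head 0 (route i j) = j & last 0 (route i j) = i].
Proof. by move=> hi hj; have [h _] := paths_from_ok hi hj. Qed.

Lemma walk_size_uniq p : walk p -> uniq p -> size p <= n.
Proof.
case: p => // x s /andP[ha _] hu; rewrite -(size_iota 0 n); apply: uniq_leq_size => // y hy.
by rewrite mem_iota add0n; exact: (allP ha).
Qed.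

(** Erasing loops leaves at most n vertices and does not raise the cost, so the walks found in n
    rounds compete with walks of any length. *)
Lemma walk_reach i j p : walk p -> head 0 p = j -> last 0 p = i -> routed i j && (dst i j <= path_cost w p).
Proof.
move=> hw hh hl; have [w1 u1 h1 l1 c1] := erase_loopsP hw.
have hi : i < n.
  by case: p hw hl {hh w1 u1 h1 l1 c1} => // x s /andP[ha _] /= <-; apply: (allP ha); exact: mem_last.
have hj : j < n by case: p hw hh {hl w1 u1 h1 l1 c1} => // x s /andP[/andP[hx _] _] /= <-.
have sz := walk_size_uniq w1 u1.
case: (erase_loops p) w1 u1 h1 l1 c1 sz => // x s w1 _ /= h1 l1 c1 sz.
rewrite h1 hh in w1 c1; rewrite h1 hh hl in l1.
have [_ h] := paths_from_ok hi hj; have /andP[r1 r2] := h s w1 l1 (ltnW sz).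
by rewrite /routed r1 /=; exact: leq_trans r2 c1.
Qed.

Lemma reach_refl i : i < n -> routed i i && (dst i i == 0).
Proof.
move=> hi; have /andP[-> h] : routed i i && (dst i i <= path_cost w [:: i]).
  by apply: walk_reach => //=; rewrite hi.
by rewrite -leqn0 (leq_trans h).
Qed.

Lemma adj_reach i j : i < n -> j < n -> adj j i -> routed i j && (dst i j <= entry 0 w j i).
Proof.
move=> hi hj hq; have /andP[-> h] : routed i j && (dst i j <= path_cost w [:: j; i]).
  by apply: walk_reach => //=; rewrite hj hi hq.
by apply: leq_trans h _; rewrite path_cost_cons path_cost1 addn0.
Qed.

Lemma routed_trans i j k : i < n -> j < n -> k < n -> routed i j -> routed j k ->
  routed i k && (dst i k <= dst i j + dst j k).
Proof.
move=> hi hj hk r1 r2; have [w1 h1 l1] := routeP hi hj r1; have [w2 h2 l2] := routeP hj hk r2.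
rewrite /dst; case: (route i j) w1 h1 l1 {r1} => // x s w1 /= h1 l1; rewrite {}h1 in w1 l1 *.
case: (route j k) w2 h2 l2 {r2} => // y t w2 /= h2 l2; rewrite {}h2 in w2 l2 *.
have -> : path_cost w (j :: s) + path_cost w (k :: t) = path_cost w (k :: t ++ s).
  case: s {w1 l1} => [|z s]; first by rewrite cats0 path_cost1.
  elim: t k {w2 hk} l2 => [|u t IH] k' /= l2; first by rewrite l2 path_cost1 addn0.
  by rewrite !path_cost_cons addnCA IH.
apply: walk_reach => //=; last by rewrite last_cat l2.
move: w1 w2 => /= /andP[/andP[_ a1] p1] /andP[/andP[-> a2] p2].
by rewrite all_cat a2 a1 cat_path p2 l2 p1.
Qed.

Hypothesis symq : forall i j, entry 0 q i j = entry 0 q j i.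
Hypothesis symw : forall i j, entry 0 w i j = entry 0 w j i.

Lemma path_cost_rev p : path_cost w (rev p) = path_cost w p.
Proof.
case: p => // x s; elim: s x => [|y s IH] x //.
rewrite rev_cons path_cost_cons -IH rev_cons.
case/lastP: (rev s) => [|t z]; first by rewrite /= !path_cost_cons !path_cost1 symw addn0.
case: t => [|u t].
  by rewrite /= !path_cost_cons !path_cost1 (symw x y); lia.
have -> : rcons (rcons (rcons (u :: t) z) y) x = u :: rcons t z ++ [:: y; x] by rewrite -!cats1 /= -!catA.
by rewrite path_cost_cat path_cost_cons path_cost1 addn0 (symw y x) addnC.
Qed.

Lemma walk_rev p : walk p -> walk (rev p).
Proof.
case: p => // x s /andP[ha hp]; have hr : rev (x :: s) = last x s :: rev (belast x s).
  by rewrite lastI rev_rcons.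
rewrite hr /walk -hr all_rev ha /= rev_path; apply: sub_path hp => a b.
by rewrite /adj symq.
Qed.

Lemma reach_sym i j : i < n -> j < n -> routed i j -> routed j i && (dst j i <= dst i j).
Proof.
move=> hi hj r; have [w1 h1 l1] := routeP hi hj r.
have -> : dst i j = path_cost w (rev (route i j)) by rewrite path_cost_rev.
apply: walk_reach; first exact: walk_rev.
  by rewrite -[RHS]l1; case/lastP: (route i j) => // s z; rewrite rev_rcons last_rcons.
by rewrite -[RHS]h1; case: (route i j) => // z s; rewrite rev_cons last_rcons.
Qed.

End Walks.

Lemma best_pathP idx lam big st X Xd w ps (b := best_path idx lam big st X Xd w ps) :
  (b = [::] \/ b \in ps) /\
  forall p, p \in [::] :: ps -> (score idx lam big st X Xd w p <= score idx lam big st X Xd w b)%R.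
Proof.
rewrite {}/b /best_path; elim/last_ind: ps => [|ps p [IH1 IH2]].
  by split=> [|p]; [left | rewrite inE => /eqP ->].
rewrite foldl_rcons; split.
  case: ifP => _; first by right; rewrite mem_rcons mem_head.
  by case: IH1 => [->|h]; [left|right; rewrite mem_rcons inE h orbT].
move=> p'; rewrite inE mem_rcons inE orbCA => h.
case: Order.TotalTheory.ltP => hlt.
  case/orP: h => [/eqP->//|h]; apply: Order.POrderTheory.le_trans (Order.POrderTheory.ltW hlt).
  by apply: IH2; rewrite inE.
by case/orP: h => [/eqP->//|h]; apply: IH2; rewrite inE.
Qed.

Local Open Scope ring_scope.

(** * Concentration on the cube *)

Section Average.
Variables (R : realType) (T : finType).
Implicit Types f g : T -> R.

Definition avg f : R := (\sum_x f x) / #|T|%:R.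

Lemma avgD f g : avg (fun x => f x + g x) = avg f + avg g.
Proof. by rewrite /avg big_split mulrDl. Qed.

Lemma avgZ a f : avg (fun x => a * f x) = a * avg f.
Proof. by rewrite /avg -mulr_sumr mulrA. Qed.

Lemma avgN f : avg (fun x => - f x) = - avg f.
Proof. by rewrite /avg sumrN mulNr. Qed.

Lemma eq_avg f g : f =1 g -> avg f = avg g.
Proof. by move=> e; rewrite /avg (eq_bigr g). Qed.

Lemma le_avg f g : (forall x, f x <= g x) -> avg f <= avg g.
Proof. by move=> h; rewrite ler_wpM2r ?invr_ge0 ?ler0n// ler_sum. Qed.

Lemma avg_ge0 f : (forall x, 0 <= f x) -> 0 <= avg f.
Proof. by move=> h; rewrite mulr_ge0 ?invr_ge0 ?ler0n// sumr_ge0. Qed.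

Lemma avg_sum (I : Type) (r : seq I) (P : pred I) (F : I -> T -> R) :
  avg (fun x => \sum_(i <- r | P i) F i x) = \sum_(i <- r | P i) avg (F i).
Proof. by rewrite /avg exchange_big mulr_suml. Qed.

Lemma avg_reindex (h : T -> T) f : involutive h -> avg (fun x => f (h x)) = avg f.
Proof.
by move=> hK; rewrite /avg [in RHS](reindex_inj (can_inj hK)).
Qed.

Hypothesis T_gt0 : (0 < #|T|)%N.

Lemma avg_cst a : avg (fun=> a) = a.
Proof. by rewrite /avg sumr_const -[a *+ _]mulr_natr mulfK// pnatr_eq0 -lt0n. Qed.

Lemma avg_witness f a : avg f <= a -> exists x, f x <= a.
Proof.
move=> h; apply: contrapT => /forallNP nex.
have {nex}nex x : a < f x by rewrite ltNge; apply/negP/nex.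
move: T_gt0 => /card_gt0P[x0 _].
suff : avg (fun=> a) < avg f by rewrite avg_cst ltNge h.
rewrite ltr_pM2r ?invr_gt0 ?ltr0n//.
by apply: ltr_sum => //; apply/hasP; exists x0; rewrite ?mem_index_enum.
Qed.

End Average.

Section Cube.
Variables (R : realType) (N : nat).
Definition cube := {ffun 'I_N -> bool}.
Implicit Types (u : cube) (f : cube -> R) (k : 'I_N) (a : 'I_N -> R).

Definition sgn u k : R := if u k then 1 else -1.
Definition flip k u : cube := [ffun l => if l == k then ~~ u l else u l].
Definition opp u : cube := [ffun l => ~~ u l].
Definition lin a u : R := \sum_k a k * sgn u k.

Lemma card_cube : (0 < #|{: cube}|)%N.
Proof. by apply/card_gt0P; exists [ffun=> true]. Qed.

Lemma flipK k : involutive (flip k).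
Proof. by move=> u; apply/ffunP => l; rewrite !ffunE; case: eqP; rewrite ?negbK. Qed.

Lemma flipC k l u : flip k (flip l u) = flip l (flip k u).
Proof. by apply/ffunP => m; rewrite !ffunE; do 2 case: eqP. Qed.

Lemma oppK : involutive opp.
Proof. by move=> u; apply/ffunP => l; rewrite !ffunE negbK. Qed.

Lemma sgn_sq u k : sgn u k * sgn u k = 1.
Proof. by rewrite /sgn; case: ifP; rewrite ?mulr1 ?mulrNN ?mulr1. Qed.

Lemma sgn_flip k u l : sgn (flip k u) l = if l == k then - sgn u l else sgn u l.
Proof. by rewrite /sgn !ffunE; case: eqP => // _; case: (u l); rewrite ?opprK. Qed.

Lemma lin_opp a u : lin a (opp u) = - lin a u.
Proof.
rewrite /lin -sumrN; apply: eq_bigr => k _.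
by rewrite /sgn ffunE; case: (u k); rewrite /= ?mulrN ?opprK.
Qed.

Lemma linB a b u : lin (fun k => a k - b k) u = lin a u - lin b u.
Proof. by rewrite /lin -sumrB; apply: eq_bigr => k _; rewrite mulrBl. Qed.

Lemma lin_flip a k u : lin a (flip k u) = lin a u - 2 * (a k * sgn u k).
Proof.
rewrite /lin (bigD1 k)//= [in RHS](bigD1 k)//= sgn_flip eqxx.
rewrite (eq_bigr (fun l => a l * sgn u l)) ?mulrN; first by ring.
by move=> l /negPf nlk; rewrite sgn_flip nlk.
Qed.

Definition half_avg k f u : R := (f u + f (flip k u)) / 2.

Lemma avg_half k f : avg (half_avg k f) = avg f.
Proof.
rewrite /half_avg (eq_avg (g := fun u => 2^-1 * (f u + f (flip k u)))); last first.
  by move=> u; rewrite mulrC.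
by rewrite avgZ avgD (avg_reindex _ (flipK k)); field.
Qed.

Definition half_avgs f (s : seq 'I_N) := foldr half_avg f s.

Lemma half_avgs_flip f k s u :
  k \in s -> half_avgs f s (flip k u) = half_avgs f s u.
Proof.
elim: s u => //= l s IH u; rewrite inE /half_avg; case: (eqVneq k l) => /= [->|_ ks].
  by rewrite flipK addrC.
by rewrite flipC !IH.
Qed.

(** Averaging over every coordinate gives a function invariant under all flips; [mix] passes from
    one point to another one coordinate at a time. *)
Lemma half_avgs_enum f u : half_avgs f (enum 'I_N) u = avg f.
Proof.
set g := half_avgs f _.
have gflip k v : g (flip k v) = g v by apply: half_avgs_flip; rewrite mem_enum.
pose mix (s : seq 'I_N) (v w : cube) : cube := [ffun l => if l \in s then v l else w l].
have gmix s v w : uniq s -> g (mix s v w) = g w.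
  elim: s => [_|k s IH /= /andP[ks us]]; first by congr g; apply/ffunP => l; rewrite ffunE.
  rewrite -{}[RHS]IH//; case: (eqVneq (v k) (w k)) => vw.
    congr g; apply/ffunP => l; rewrite !ffunE inE; case: eqP => // ->.
    by rewrite (negPf ks).
  rewrite -(gflip k); congr g; apply/ffunP => l; rewrite !ffunE inE.
  by case: eqP => // ->; rewrite (negPf ks); case: (v k) (w k) vw => [] [].
have gc v : g v = g u.
  rewrite -(gmix (enum 'I_N) v u) ?enum_uniq//; congr g; apply/ffunP => l.
  by rewrite ffunE mem_enum.
have -> : avg f = avg g.
  by rewrite /g; elim: (enum _) => //= k s IH; rewrite avg_half.
by rewrite (eq_avg gc) avg_cst// card_cube.
Qed.

Definition disc k f u : R := f u - f (flip k u).

Lemma sq_half k f : avg (fun u => f u ^+ 2) =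
  avg (fun u => half_avg k f u ^+ 2) + avg (fun u => disc k f u ^+ 2) / 4.
Proof.
rewrite mulrC -avgZ -avgD.
by rewrite -[LHS](avg_half k); apply: eq_avg => u; rewrite /half_avg /disc; field.
Qed.

Lemma sq_half_le k f : avg (fun u => half_avg k f u ^+ 2) <= avg (fun u => f u ^+ 2).
Proof.
by rewrite (sq_half k f) lerDl divr_ge0// avg_ge0// => u; exact: sqr_ge0.
Qed.

Lemma disc_half k l f u : disc k (half_avg l f) u = half_avg l (disc k f) u.
Proof. by rewrite /disc /half_avg flipC; field. Qed.

Lemma disc_half_avgs k f s :
  avg (fun u => disc k (half_avgs f s) u ^+ 2) <= avg (fun u => disc k f u ^+ 2).
Proof.
elim: s => //= l s IH; apply: le_trans IH.
rewrite (eq_avg (g := fun u => half_avg l (disc k (half_avgs f s)) u ^+ 2)).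
  exact: sq_half_le.
by move=> u; rewrite disc_half.
Qed.

(** By [sq_half], averaging out coordinate k costs a quarter of the mean square of the discrete
    derivative in direction k, and earlier averagings only shrink that derivative. Telescoping leads
    from f to its mean. *)
Lemma efron_stein f : avg (fun u => (f u - avg f) ^+ 2) <=
  (\sum_k avg (fun u => disc k f u ^+ 2)) / 4.
Proof.
have -> : avg (fun u => (f u - avg f) ^+ 2) = avg (fun u => f u ^+ 2) - avg f ^+ 2.
  rewrite (eq_avg (g := fun u => f u ^+ 2 + (- 2 * avg f * f u + avg f ^+ 2))).
    by rewrite !avgD avgZ (avg_cst card_cube); ring.
  by move=> u; ring.
have H s : avg (fun u => f u ^+ 2) <= avg (fun u => half_avgs f s u ^+ 2) +
    (\sum_(k <- s) avg (fun u => disc k f u ^+ 2)) / 4.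
  elim: s => [|k s IH /=]; first by rewrite big_nil mul0r addr0.
  apply: le_trans IH _; rewrite big_cons (sq_half k (half_avgs f s)).
  by have := disc_half_avgs k f s; lra.
rewrite lerBlDl (le_trans (H (enum 'I_N)))// big_enum/= lerD2r.
by rewrite (eq_avg (g := fun=> avg f ^+ 2)) ?(avg_cst card_cube)// => u;
  rewrite half_avgs_enum.
Qed.

(* A maximum of linear forms satisfies the hypothesis, with the linear form
   attaining the maximum at u as a witness. *)
Lemma subgradient_variance f B :
  (forall u, exists2 a, \sum_k a k ^+ 2 <= B &
    lin a u = f u /\ forall w, lin a w <= f w) ->
  avg (fun u => (f u - avg f) ^+ 2) <= 2 * B.
Proof.
move=> H; have {H}/choice[a /all_and3[aB af fa]] : forall u, exists a,
    [/\ \sum_k a k ^+ 2 <= B, lin a u = f u & forall w, lin a w <= f w].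
  by move=> u; have [a ? []] := H u; exists a.
apply: le_trans (efron_stein f) _.
have dk k : avg (fun u => disc k f u ^+ 2) <= 8 * avg (fun u => a u k ^+ 2).
  rewrite -[leLHS]/(avg (fun u => disc k f u ^+ 2)).
  (* Of the two ends of an edge only the higher one has a positive difference, and there the
     subgradient bounds the drop by [2 * (a u k * sgn u k)]. *)
  pose p u := Num.max 0 (disc k f u) ^+ 2.
  have -> : avg (fun u => disc k f u ^+ 2) = 2 * avg p.
    rewrite -[in RHS](avg_half k) -avgZ; apply: eq_avg => u.
    rewrite /half_avg /p /disc flipK.
    by case: (leP (f u) (f (flip k u))) => h; rewrite /Num.max; do 2 case: ltP => ?; nra.
  suff : avg p <= 4 * avg (fun u => a u k ^+ 2) by lra.
  rewrite -avgZ; apply: le_avg => u; rewrite /p.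
  have h1 : disc k f u <= 2 * (a u k * sgn u k).
    by rewrite /disc -af; have := fa u (flip k u); rewrite lin_flip; lra.
  have h2 : (a u k * sgn u k) ^+ 2 = a u k ^+ 2.
    by rewrite exprMn [sgn u k ^+ 2]expr2 sgn_sq mulr1.
  rewrite -h2; move: h1; set z := _ * sgn _ _; rewrite /Num.max; case: ltP => ?; nra.
have : \sum_k avg (fun u => disc k f u ^+ 2) <= \sum_k 8 * avg (fun u => a u k ^+ 2).
  exact: ler_sum.
rewrite -mulr_sumr.
suff : \sum_k avg (fun u => a u k ^+ 2) <= B by lra.
by rewrite -avg_sum -[leRHS](avg_cst card_cube); apply: le_avg.
Qed.

(** Moments of Rademacher sums. The fourth moment makes the truncated second moment in [round_split]
    comparable to the full one. *)
Lemma lin_moments (a : 'I_N -> R) :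
  avg (fun u => lin a u ^+ 2) = \sum_k a k ^+ 2 /\
  avg (fun u => lin a u ^+ 4) <= 3 * (\sum_k a k ^+ 2) ^+ 2.
Proof.
pose y (s : seq 'I_N) u := \sum_(k <- s) a k * sgn u k.
pose V (s : seq 'I_N) := \sum_(k <- s) a k ^+ 2.
have H s : uniq s -> avg (fun u => y s u ^+ 2) = V s /\ avg (fun u => y s u ^+ 4) <= 3 * V s ^+ 2.
  elim: s => [_|k s IH /= /andP[ks us]].
    rewrite /V big_nil; split.
      rewrite (eq_avg (g := fun=> 0)) ?(avg_cst card_cube)// => u.
      by rewrite /y big_nil expr0n.
    rewrite (eq_avg (g := fun=> 0)) ?(avg_cst card_cube) ?expr0n ?mulr0// => u.
    by rewrite /y big_nil expr0n.
  have [IH2 IH4] := IH us.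
  have yE u : y (k :: s) u = a k * sgn u k + y s u by rewrite /y big_cons.
  have yF u : y s (flip k u) = y s u.
    apply: eq_big_seq => l ls; rewrite sgn_flip; case: eqP => // lk.
    by rewrite -lk ls in ks.
  have sF u : sgn (flip k u) k = - sgn u k by rewrite sgn_flip eqxx.
  have VE : V (k :: s) = a k ^+ 2 + V s by rewrite /V big_cons.
  rewrite -(avg_half k (fun u => y (k :: s) u ^+ 2)) -(avg_half k (fun u => y (k :: s) u ^+ 4)).
  rewrite (@eq_avg _ _ _ (fun u => a k ^+ 2 + y s u ^+ 2)); last first.
    by move=> u; rewrite /half_avg !yE yF sF; have := sgn_sq u k; set z := sgn u k => zz; field: zz.
  rewrite (@eq_avg _ _ (half_avg _ _) (fun u => a k ^+ 4 + (6 * a k ^+ 2 * y s u ^+ 2 + y s u ^+ 4))); last first.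
    by move=> u; rewrite /half_avg !yE yF sF; have := sgn_sq u k; set z := sgn u k => zz; field: zz.
  rewrite !avgD avgZ !(avg_cst card_cube) VE IH2; split=> //.
  have : 0 <= a k ^+ 4 by rewrite (exprM _ 2 2) sqr_ge0.
  by move: IH4; rewrite (exprM (a k) 2 2); set A := a k ^+ 2; nra.
have := H (index_enum 'I_N) (index_enum_uniq _).
by rewrite /y /V.
Qed.

Lemma cosh_small (h : R) : h ^+ 2 <= 2^-1 -> expR h + expR (- h) <= 2 * expR (2 * h ^+ 2).
Proof.
move=> hh.
have h1 : -1 < h < 1 by apply/andP; split; nra.
case/andP: h1 => hl hu.
have e1 : expR h <= (1 - h)^-1.
  by rewrite -[h in expR h]opprK expRN lef_pV2 ?posrE ?expR_gt0 ?subr_gt0// expR_ge1Dx.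
have e2 : expR (- h) <= (1 + h)^-1.
  by rewrite expRN lef_pV2 ?posrE ?expR_gt0 ?expR_ge1Dx//; lra.
have e3 : 1 + 2 * h ^+ 2 <= expR (2 * h ^+ 2) := expR_ge1Dx _.
have e4 : (1 - h)^-1 + (1 + h)^-1 = 2 / (1 - h ^+ 2).
  by field; apply/andP; split; [|apply/andP; split]; apply: lt0r_neq0; nra.
have e5 : (1 - h ^+ 2)^-1 <= 1 + 2 * h ^+ 2.
  by rewrite -[leLHS]mul1r ler_pdivrMr; nra.
by nra.
Qed.

(** Halving x until it is small reduces to [cosh_small]. On the way back, a b = 1 gives a^2 + b^2 =
    (a + b)^2 - 2 <= 4 c^2 - 2 <= 2 c^4. *)
Lemma cosh_le (x : R) : expR x + expR (- x) <= 2 * expR (2 * x ^+ 2).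
Proof.
have [m hm] : exists m : nat, (x / 2 ^+ m) ^+ 2 <= 2^-1.
  exists (Num.bound (x ^+ 2)).
  have := archi_boundP (sqr_ge0 x); set m := Num.bound _ => hm.
  have h2 : m%:R + 1 <= (2 : R) ^+ m.
    elim: (m) => [|j IH]; first by rewrite add0r expr0.
    by rewrite exprS -natr1; have : 0 <= (j%:R : R) by []; lra.
  rewrite expr_div_n -exprM ler_pdivrMr ?exprn_gt0// muln2 -addnn exprD.
  by have := sqr_ge0 x; nra.
elim: m x hm => [|m IH] x; first by rewrite expr0 divr1; exact: cosh_small.
move=> h; have {IH} := IH (x / 2).
have -> : x / 2 / 2 ^+ m = x / 2 ^+ m.+1 by rewrite exprS; field; rewrite expf_neq0.
move=> /(_ h) {h} IH.
have -> : expR x = expR (x / 2) ^+ 2 by rewrite -expRM_natl; congr expR; field.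
have -> : expR (- x) = expR (- (x / 2)) ^+ 2 by rewrite -expRM_natl; congr expR; field.
have -> : expR (2 * x ^+ 2) = expR (2 * (x / 2) ^+ 2) ^+ 4 by rewrite -expRM_natl; congr expR; field.
have : expR (x / 2) * expR (- (x / 2)) = 1 by rewrite -expRD subrr expR0.
move: IH (expR_gt0 (x / 2)) (expR_gt0 (- (x / 2))).
set a := expR _; set b := expR _; set c := expR _ => hab a0 b0 ab1.
have y1 : (a + b) ^+ 2 <= (2 * c) ^+ 2 by apply: lerXn2r; rewrite ?nnegrE; lra.
have -> : a ^+ 2 + b ^+ 2 = (a + b) ^+ 2 - 2 by ring: ab1.
have -> : c ^+ 4 = (c ^+ 2) ^+ 2 by rewrite -exprM.
by move: y1; rewrite exprMn; set z := c ^+ 2; have := sqr_ge0 (z - 1); nra.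
Qed.

Lemma lin_mgf (a : 'I_N -> R) :
  avg (fun u => expR (lin a u)) <= expR (2 * \sum_k a k ^+ 2).
Proof.
have e u : expR (lin a u) = \prod_k expR (a k * (if u k then 1 else -1)).
  by rewrite /lin /sgn expR_sum.
rewrite (eq_avg e) /avg -(bigA_distr_bigA (fun k (b : bool) => expR (a k * (if b then 1 else -1)))).
rewrite card_ffun card_bool card_ord natrX mulr_sumr expR_sum.
rewrite ler_pdivrMr ?exprn_gt0//.
have -> : (2 : R) ^+ N = \prod_(k < N) 2 by rewrite prodr_const card_ord.
rewrite -big_split/=; apply: ler_prod => k _.
rewrite big_bool/= mulr1 mulrN1 addr_ge0 ?expR_ge0//=.
by rewrite mulrC cosh_le.
Qed.

(** Jensen's inequality for exp, the union bound and [lin_mgf]. The function [f] only has to agree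
    at each point with one of the forms, so maxima attained at varying indices are covered. *)
Lemma lin_max_le (I : finType) (P : pred I) (a : I -> 'I_N -> R) (f : cube -> R) B s :
  0 < s -> (forall i, P i -> \sum_k a i k ^+ 2 <= B) ->
  (forall u, exists2 i, P i & f u = lin (a i) u) ->
  s * avg f <= ln #|I|%:R + 2 * s ^+ 2 * B.
Proof.
move=> s0 aB fa.
have /card_gt0P I0 : exists i : I, i \in I by have [i] := fa [ffun=> true]; exists i.
rewrite -ler_expR expRD lnK ?posrE ?ltr0n//.
have jensen : expR (s * avg f) <= avg (fun u => expR (s * f u)).
  set c := s * avg f.
  have : avg (fun u => expR c * (1 + (s * f u - c))) <= avg (fun u => expR (s * f u)).
    apply: le_avg => u; rewrite (_ : expR (s * f u) = expR c * expR (s * f u - c)).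
      by rewrite ler_wpM2l ?expR_ge0// expR_ge1Dx.
    by rewrite -expRD; congr expR; ring.
  rewrite avgZ avgD (avg_cst card_cube) avgD avgZ (avg_cst card_cube) -/c.
  by rewrite subrr addr0 mulr1.
apply: le_trans jensen _.
apply: (@le_trans _ _ (avg (fun u => \sum_(i | P i) expR (lin (fun k => s * a i k) u)))).
  apply: le_avg => u; have [i Pi ->] := fa u.
  rewrite (bigD1 i)//= (_ : lin (fun k => s * a i k) u = s * lin (a i) u).
    by rewrite lerDl sumr_ge0// => *; exact: expR_ge0.
  by rewrite /lin mulr_sumr; apply: eq_bigr => k _; rewrite mulrA.
rewrite avg_sum mulr_natl -[X in _ *+ X]/(#|{: I}|).
rewrite -sumr_const [leRHS](bigID P)/= -[leLHS]addr0 lerD ?sumr_ge0//.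
apply: ler_sum => i Pi; apply: le_trans (lin_mgf _) _.
rewrite ler_expR -mulrA ler_pM2l//.
under eq_bigr do rewrite exprMn.
by rewrite -mulr_sumr ler_wpM2l ?sqr_ge0// aB.
Qed.

End Cube.

(** * Maximal matchings and chains of stretched pairs *)

Section MaximalMatching.
Variable V : finType.
Implicit Types (H : rel V) (m : {ffun V -> V}).

(** The fixed points of the involution [m] are the unmatched vertices. *)
Definition matching H m :=
  [forall i, m (m i) == i] && [forall i, (m i != i) ==> H i (m i)].

Definition maximal_matching H m :=
  matching H m && [forall i, forall j, H i j ==> (m i != i) || (m j != j)].

(** The choice depends on the relation alone. Opposite points of the cube stretch the same pairs and
    so receive the same matching, which [eps_avg] exploits. *)
Definition mate H : {ffun V -> V} :=
  odflt [ffun i => i] [pick m | maximal_matching H m].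

Lemma mateP H : symmetric H -> irreflexive H ->
  [/\ forall i, mate H (mate H i) = i,
      forall i, mate H i != i -> H i (mate H i)
    & forall i j, H i j -> mate H i != i \/ mate H j != j].
Proof.
move=> Hs Hi; rewrite /mate; case: pickP => [m|nex] /=.
  move=> /andP[/andP[/forallP a /forallP b] /forallP c]; split.
  - by move=> i; apply/eqP.
  - by move=> i; apply/implyP.
  - by move=> i j; move: (c i) => /forallP/(_ j)/implyP h /h /orP.
exfalso.
have id_m : matching H [ffun i => i].
  by apply/andP; split; apply/forallP => i; rewrite !ffunE ?eqxx.
case: (@arg_maxnP _ [ffun i => i] (matching H) (fun m => #|[pred i | m i != i]|) id_m) => m mm mmax.
have := nex m; rewrite /maximal_matching mm /= => /negbT/forallPn[i /forallPn[j]].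
rewrite negb_imply negb_or !negbK => /and3P[Hij /eqP mi /eqP mj].
have nij : i != j by apply: contraTneq Hij => ->; rewrite Hi.
have nji : (j == i) = false by rewrite eq_sym (negPf nij).
pose m' : {ffun V -> V} := [ffun l => if l == i then j else if l == j then i else m l].
move: (mm) => /andP[/forallP mK /forallP mH].
have mi' l : m l == i = (l == i).
  by apply/eqP/eqP => [e|->//]; rewrite -[l](eqP (mK l)) e mi.
have mj' l : m l == j = (l == j).
  by apply/eqP/eqP => [e|->//]; rewrite -[l](eqP (mK l)) e mj.
have mm' : matching H m'.
  apply/andP; split; apply/forallP => l; rewrite !ffunE.
    case: (eqVneq l i) => [->|li]; first by rewrite ?eqxx nji eqxx.
    case: (eqVneq l j) => [->|lj]; first by rewrite ?eqxx ?nji ?eqxx.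
    by rewrite mi' mj' (negPf li) (negPf lj); exact: mK.
  case: (eqVneq l i) => [->|li]; first by rewrite Hij implybT.
  case: (eqVneq l j) => [->|lj]; first by rewrite Hs Hij implybT.
  exact: mH.
have := mmax _ mm'; rewrite /geq /= leqNgt => /negP; apply.
apply: proper_card; apply/properP; split.
  apply/fintype.subsetP => l; rewrite !inE ffunE => ml.
  case: (eqVneq l i) => [->|_]; first by rewrite nji.
  by case: (eqVneq l j) => [->|//].
by exists i; rewrite !inE ?mi ?eqxx// ffunE eqxx eq_sym.
Qed.

End MaximalMatching.

Definition pseudometric (R : realType) (V : Type) (D : V -> V -> R) :=
  [/\ forall i, D i i = 0, forall i j, D i j = D j i
    & forall i j k, D i k <= D i j + D j k].

Lemma pseudometric_ge0 (R : realType) (V : Type) (D : V -> V -> R) i j :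
  pseudometric D -> 0 <= D i j.
Proof. by move=> [D0 Ds Dt]; have := Dt i j i; rewrite D0 (Ds j i); lra. Qed.

Section StretchedMatching.
Variables (R : realType) (N : nat) (V : finType) (v : V -> 'I_N -> R).
Variables (D : V -> V -> R) (U : {set V}) (eta Delta sigma : R).

Definition sqd i j : R := \sum_k (v i k - v j k) ^+ 2.

Hypothesis Dm : pseudometric D.
Hypothesis vD : {in U &, forall i j, sqd i j <= D i j + 2 * eta}.
Hypothesis Delta_ge0 : 0 <= Delta.
Hypothesis sigma_gt0 : 0 < sigma.

Let y i (u : cube N) := lin (v i) u.

(** These pairs are the obstruction to separating by projection: close in [D], yet with distant
    projections. *)
Definition stretched (u : cube N) : rel V := fun i j =>
  [&& i \in U, j \in U, D i j <= Delta & sigma <= `|lin (v i) u - lin (v j) u|].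

Let m u := mate (stretched u).

Definition matched u : {set V} := [set i | mate (stretched u) i != i].

Lemma stretched_sym u : symmetric (stretched u).
Proof.
have [_ Ds _] := Dm.
by move=> i j; rewrite /stretched Ds distrC; case: (i \in U); case: (j \in U).
Qed.

Lemma stretched_irr u : irreflexive (stretched u).
Proof.
by move=> i; rewrite /stretched subrr normr0 [sigma <= _]leNgt sigma_gt0 !andbF.
Qed.

Let mP u := mateP (@stretched_sym u) (@stretched_irr u).

Lemma mate_opp u : m (opp u) = m u.
Proof.
rewrite /m; congr mate; apply: funext => i; apply: funext => j.
by rewrite /stretched !lin_opp -opprD normrN.
Qed.

Lemma mate_in u i : m u i != i -> [/\ i \in U, m u i \in U,
  D i (m u i) <= Delta & sigma <= `|y i u - y (m u i) u|].
Proof. by move=> h; have [_ /(_ i h) /and4P[]] := mP u. Qed.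

Let tail u i := (m u i != i) && (y i u < y (m u i) u).
Let head u i := (m u i != i) && (y (m u i) u < y i u).

Lemma tail_mate u i : tail u (m u i) = head u i.
Proof. by have [mK _ _] := mP u; rewrite /tail /head mK eq_sym. Qed.

Lemma matched_tail_head u i : (m u i != i) = tail u i || head u i.
Proof.
rewrite /tail /head; case: eqP => //= /eqP /mate_in[_ _ _ h].
by case: ltgtP => // e; move: h; rewrite e subrr normr0 leNgt sigma_gt0.
Qed.

Let near k i := fun j => (j \in U) && (D i j <= k%:R * Delta).

Let Yarg k i u := [arg max_(j > i | near k i j) y j u]%O.
(** As a maximum of linear forms of squared norm at most B it has variance at most 2 B, so that on
    average little height is lost when a chain passes along a matched pair. *)
Definition reach k i u := lin (v (Yarg k i u)) u - lin (v i) u.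

Lemma near_refl k i : i \in U -> near k i i.
Proof. by case: Dm => D0 _ _ iU; rewrite /near iU D0 mulr_ge0. Qed.

Lemma reach_spec k i u : i \in U -> near k i (Yarg k i u) /\
  forall j, near k i j -> y j u - y i u <= reach k i u.
Proof.
move=> iU; rewrite /reach /Yarg; case: arg_maxP; first exact: near_refl.
by move=> j nj jmax; split=> // l /jmax; rewrite lerD2r.
Qed.

Lemma reach_ge0 k i u : i \in U -> 0 <= reach k i u.
Proof.
by move=> iU; have [_ /(_ i (near_refl k iU))] := reach_spec k u iU; rewrite subrr.
Qed.

Lemma reach_mono k i u : i \in U -> reach k i u <= reach k.+1 i u.
Proof.
move=> iU; have [/andP[h1 h2] _] := reach_spec k u iU.
have [_] := reach_spec k.+1 u iU; apply; rewrite /near h1 (le_trans h2)//.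
by rewrite ler_wpM2r// ler_nat.
Qed.

Lemma reach_step k i u : tail u i -> reach k (m u i) u + sigma <= reach k.+1 i u.
Proof.
move=> /andP[/mate_in[iU mU Dim yim] lt].
have [/andP[h1 h2] _] := reach_spec k u mU.
have [_ /(_ (Yarg k (m u i) u))] := reach_spec k.+1 u iU.
have [_ _ Dt] := Dm.
have nj : near k.+1 i (Yarg k (m u i) u).
  by rewrite /near h1 (le_trans (Dt _ (m u i) _))// -natr1 mulrDl mul1r addrC lerD.
move=> /(_ nj); apply: le_trans; rewrite /reach -/(y _ u) -/(y _ u).
by move: yim; rewrite distrC gtr0_norm ?subr_gt0// /y; lra.
Qed.

Let eps u i : R := (head u i)%:R - (tail u i)%:R.

Lemma head_tail u i : head u i && tail u i = false.
Proof. by rewrite /head /tail; case: (ltgtP (y (m u i) u)); rewrite ?andbF. Qed.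

Lemma sum_tail u (F : V -> R) :
  \sum_(i in U) (tail u i)%:R * F (m u i) = \sum_(i in U) (head u i)%:R * F i.
Proof.
have [mK _ _] := mP u.
rewrite [LHS](reindex_inj (can_inj mK))/=.
rewrite [LHS](bigID (fun i => m u i != i)) [RHS](bigID (fun i => m u i != i))/=.
have z1 : \sum_(i | (m u i \in U) && ~~ (m u i != i)) (tail u (m u i))%:R * F (m u (m u i)) = 0.
  by apply: big1 => i /andP[_ /negbTE h]; rewrite tail_mate /head h mul0r.
have z2 : \sum_(i in U | ~~ (m u i != i)) (head u i)%:R * F i = 0.
  by apply: big1 => i /andP[_ /negbTE h]; rewrite /head h mul0r.
rewrite z1 z2; congr (_ + _); apply: eq_big => i.
  by case: eqP; rewrite ?andbF// => /eqP/mate_in[-> -> _ _].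
by rewrite tail_mate mK.
Qed.

(** At a tail, [reach] is compared with that of its mate, which lies sigma higher; elsewhere it
    merely does not decrease. Re-indexing the tails by their mates yields the sum with [eps], and
    each pair gives sigma once, that is sigma / 2 per matched vertex. *)
Lemma reach_sum_step k u : \sum_(i in U) reach k i u + \sum_(i in U) eps u i * reach k i u
  + sigma / 2 * #|matched u|%:R <= \sum_(i in U) reach k.+1 i u.
Proof.
have -> : #|matched u|%:R = \sum_(i in U) ((tail u i)%:R + (head u i)%:R) :> R.
  rewrite -sum1_card natr_sum [RHS](bigID (fun i => i \in matched u))/=.
  rewrite [X in _ = _ + X]big1 ?addr0; last first.
    by move=> i /andP[_]; rewrite inE matched_tail_head negb_or => /andP[/negPf-> /negPf->]; rewrite addr0.
  apply: eq_big => i.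
    rewrite inE; case: eqP; rewrite ?andbF// => /eqP/mate_in[-> _ _ _]//.
  rewrite inE matched_tail_head; have := head_tail u i.
  by case: (tail u i); case: (head u i); rewrite ?addr0 ?add0r.
have th : \sum_(i in U) (tail u i)%:R = \sum_(i in U) (head u i)%:R :> R.
  have := sum_tail u (fun=> 1).
  by under eq_bigr do rewrite mulr1; under [RHS]eq_bigr do rewrite mulr1.
have -> : sigma / 2 * \sum_(i in U) ((tail u i)%:R + (head u i)%:R) =
    \sum_(i in U) (tail u i)%:R * sigma.
  by rewrite -mulr_suml big_split/= -th; field.
have -> : \sum_(i in U) eps u i * reach k i u =
    \sum_(i in U) (tail u i)%:R * reach k (m u i) u - \sum_(i in U) (tail u i)%:R * reach k i u.
  by rewrite (sum_tail u (fun j => reach k j u)) -sumrB; apply: eq_bigr => i _; rewrite /eps mulrBl.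
rewrite -sumrB -!big_split/=; apply: ler_sum => i iU.
have := @reach_step k i u; have := reach_mono k u iU.
by case: (tail u i) => h /(_ _) h'; rewrite ?(mul0r, mul1r); [have := h' isT|]; lra.
Qed.

Section Chain.
Variables (K : nat) (B : R).
Hypothesis KB : K%:R * Delta + 2 * eta <= B.

Lemma sqd_near k i j : (k <= K)%N -> i \in U -> near k i j ->
  \sum_l (v j l - v i l) ^+ 2 <= B.
Proof.
move=> kK iU /andP[jU Dij]; have [_ Ds _] := Dm.
apply: le_trans (vD jU iU) _; rewrite Ds.
have kK' : (k%:R : R) <= K%:R by rewrite ler_nat.
by have := ler_wpM2r Delta_ge0 kK'; move: KB Dij; lra.
Qed.

Lemma reach_var k i : (k <= K)%N -> i \in U ->
  avg (fun u => (reach k i u - avg (reach k i)) ^+ 2) <= 2 * B.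
Proof.
move=> kK iU; apply: subgradient_variance => u.
have [nj _] := reach_spec k u iU.
exists (fun l => v (Yarg k i u) l - v i l); first exact: sqd_near nj.
split; first by rewrite linB.
by move=> w; rewrite linB; have [_] := reach_spec k w iU; apply.
Qed.

Lemma reach_upper k i s : (k <= K)%N -> i \in U -> 0 < s ->
  s * avg (reach k i) <= ln #|V|%:R + 2 * s ^+ 2 * B.
Proof.
move=> kK iU s0.
apply: (@lin_max_le _ _ _ (near k i) (fun j l => v j l - v i l)) => // [j nj|u].
  exact: sqd_near nj.
have [nj _] := reach_spec k u iU; exists (Yarg k i u) => //.
by rewrite linB.
Qed.

Let EM : R := avg (fun u => #|matched u|%:R).

(** Opposite points exchange the heads and the tails of the same matching, so [eps] changes its
    sign. *)
Lemma eps_avg i : avg (fun u => eps u i) = 0.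
Proof.
have : avg (fun u => eps (opp u) i) = avg (fun u => eps u i) by exact: (avg_reindex (fun u => eps u i) (@oppK N)).
rewrite (@eq_avg _ _ _ (fun u => - eps u i)) ?avgN; first by lra.
by move=> u; rewrite /eps /head /tail mate_opp /y !lin_opp !ltrN2 opprB.
Qed.

(** Since [eps] has mean 0, [reach] may be replaced by its deviation a from the mean. On matched
    vertices |eps a| <= sigma / 4 + a^2 / sigma, and the variance bound controls the last term. *)
Lemma reach_avg_step k : (k < K)%N ->
  \sum_(i in U) avg (reach k i) + (sigma / 4 * EM - #|U|%:R * (2 * B) / sigma)
  <= \sum_(i in U) avg (reach k.+1 i).
Proof.
move=> kK.
have : avg (fun u => \sum_(i in U) reach k i u + \sum_(i in U) eps u i * reach k i u
  + sigma / 2 * #|matched u|%:R) <= avg (fun u => \sum_(i in U) reach k.+1 i u).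
  by apply: le_avg => u; exact: reach_sum_step.
rewrite !avgD avgZ !avg_sum -/EM; apply: le_trans.
rewrite -addrA lerD2l.
have -> : \sum_(i in U) avg (fun u => eps u i * reach k i u) =
   \sum_(i in U) avg (fun u => eps u i * (reach k i u - avg (reach k i))).
  apply: eq_bigr => i iU.
  rewrite [RHS](@eq_avg _ _ _ (fun u => eps u i * reach k i u + (- avg (reach k i)) * eps u i)).
    by rewrite avgD avgZ eps_avg mulr0 addr0.
  by move=> u; ring.
have h : \sum_(i in U) - avg (fun u => (i \in matched u)%:R * (sigma / 4) +
     sigma^-1 * (reach k i u - avg (reach k i)) ^+ 2) <=
   \sum_(i in U) avg (fun u => eps u i * (reach k i u - avg (reach k i))).
  apply: ler_sum => i iU; rewrite -avgN; apply: le_avg => u.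
  set a := reach k i u - _.
  rewrite inE matched_tail_head /eps; have := head_tail u i.
  pose b := 2 * a / sigma.
  have -> : sigma^-1 * a ^+ 2 = sigma / 4 * b ^+ 2.
    by rewrite /b; field; rewrite lt0r_neq0.
  have {1}-> : a = sigma / 4 * (2 * b) by rewrite /b; field; rewrite lt0r_neq0.
  have s4 : 0 < sigma / 4 by rewrite divr_gt0.
  rewrite [_%:R * (sigma / 4)]mulrC -mulrDr -mulrN mulrCA ler_pM2l//.
  move: (sqr_ge0 (b - 1)) (sqr_ge0 (b + 1)) (sqr_ge0 b) => q1 q2 q3.
  by case: (tail u i); case: (head u i) => //= _; rewrite ?add0r ?subr0 ?mul1r ?mul0r; nra.
rewrite [leRHS]addrC -lerBlDl; apply: le_trans h.
rewrite sumrN; under eq_bigr do rewrite avgD avgZ.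
rewrite big_split/= -avg_sum.
have -> : avg (fun u => \sum_(i in U) (i \in matched u)%:R * (sigma / 4)) = sigma / 4 * EM.
  rewrite -avgZ; apply: eq_avg => u; rewrite -mulr_suml mulrC; congr (_ * _).
  rewrite -[in RHS]sum1_card natr_sum [LHS](bigID (fun i => i \in matched u))/=.
  rewrite [X in _ + X = _]big1 ?addr0; last by move=> i /andP[_ /negPf->].
  apply: eq_big => [i|i /andP[_ ->]//].
  by rewrite inE; case: eqP; rewrite ?andbF// => /eqP/mate_in[-> _ _ _].
have : \sum_(i in U) sigma^-1 * avg (fun u => (reach k i u - avg (reach k i)) ^+ 2) <=
   \sum_(i in U) sigma^-1 * (2 * B).
  apply: ler_sum => i iU; rewrite ler_wpM2l ?invr_ge0 ?(ltW sigma_gt0)//.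
  by apply: reach_var => //; exact: ltnW.
rewrite sumr_const -[_ *+ _]mulr_natl.
have -> : #|U|%:R * (sigma^-1 * (2 * B)) = #|U|%:R * (2 * B) / sigma by ring.
by set a := \sum_(i in U) _; set b := _ / sigma; lra.
Qed.

Lemma reach_avg_lower : K%:R * (sigma / 4 * EM - #|U|%:R * (2 * B) / sigma) <=
  \sum_(i in U) avg (reach K i).
Proof.
set c := _ - _.
suff H k : (k <= K)%N -> k%:R * c <= \sum_(i in U) avg (reach k i) by exact: H.
elim: k => [_|k IH kK].
  by rewrite mul0r sumr_ge0// => i iU; apply: avg_ge0 => u; exact: reach_ge0.
have h1 := reach_avg_step kK; rewrite -/c in h1.
have h2 := IH (ltnW kK).
by rewrite -natr1 mulrDl mul1r; lra.
Qed.

(* Chaining K stretched edges would produce vertices at squared distance about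
   K * Delta whose projections differ by a multiple of K * sigma * delta,
   which the bound on the maximum of #|V| projections forbids. *)
Lemma matched_le (delta : R) : (0 < K)%N -> 0 < delta ->
  B = sigma ^+ 2 * delta / 32 -> 8 * ln #|V|%:R <= K%:R ^+ 2 * delta ->
  avg (fun u => #|matched u|%:R) <= delta * #|U|%:R.
Proof.
move=> K0 d0 Bd Kln; rewrite -/EM leNgt; apply/negP => EMd.
have Kr : 0 < (K%:R : R) by rewrite ltr0n.
(* This choice turns every term into a multiple of K^2. If the claim failed, more than (4 - 1)/16 of
   K^2 delta per vertex of [U] would be at most (2 + 1)/16 of it. *)
pose s := K%:R / sigma.
have s0 : 0 < s by rewrite divr_gt0.
have Up : s * (\sum_(i in U) avg (reach K i)) <= #|U|%:R * (ln #|V|%:R + 2 * s ^+ 2 * B).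
  rewrite mulr_sumr mulr_natl -sumr_const; apply: ler_sum => i iU.
  exact: reach_upper.
have Lo := reach_avg_lower.
have {Lo Up} := le_trans (ler_wpM2l (ltW s0) Lo) Up.
rewrite /s Bd.
have -> : K%:R / sigma * (K%:R * (sigma / 4 * EM - #|U|%:R * (2 * (sigma ^+ 2 * delta / 32)) / sigma)) =
   K%:R ^+ 2 / 4 * EM - #|U|%:R * (K%:R ^+ 2 * delta / 16).
  by field; rewrite lt0r_neq0.
have -> : 2 * (K%:R / sigma) ^+ 2 * (sigma ^+ 2 * delta / 32) = K%:R ^+ 2 * delta / 16.
  by field; rewrite lt0r_neq0.
move: Kln EMd; set kk := K%:R ^+ 2; set L := ln _; set W := #|U|%:R.
have kk0 : 0 < kk by rewrite exprn_gt0.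
have W0 : 0 <= W by rewrite /W ler0n.
move=> h1 h2 h3.
have h4 : kk * (delta * W) < kk * EM by rewrite ltr_pM2l.
by nra.
Qed.

End Chain.
End StretchedMatching.

(** * Random separators *)

Section IntegerCells.
Variable q : nat.
Local Notation Q := q.+1.

Definition cell (z : int) (t : 'I_Q) : int := ((z + t%:Z) %/ Q%:Z)%Z.

Lemma cell_addQ z t : cell (z + Q%:Z) t = cell z t + 1.
Proof.
rewrite /cell (_ : z + Q%:Z + t%:Z = 1 * Q%:Z + (z + t%:Z)); last by ring.
by rewrite divzMDl// addrC.
Qed.

Lemma cell_mono z w t : z <= w -> cell z t <= cell w t.
Proof. by move=> zw; apply: lez_pdiv2r => //; rewrite lerD2r. Qed.

(** A form of Hermite's identity: when z grows by 1, exactly one of the Q shifts sees a new cell. *)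
Lemma sum_cell_add z k :
  \sum_t cell (z + k%:Z) t = \sum_t cell z t + k%:Z.
Proof.
elim: k => [|k IH]; first by rewrite !addr0.
have -> : k.+1%:Z = k%:Z + 1 by rewrite -addn1 PoszD.
rewrite addrA [RHS]addrA -IH; set w := z + k%:Z.
rewrite [LHS]big_ord_recr [in RHS]big_ord_recl/= [RHS]addrAC [LHS]addrC.
congr (_ + _).
  by rewrite -cell_addQ /cell/= addr0 -addrA -PoszD add1n.
by apply: eq_bigr => i _; rewrite /cell/= -addrA -PoszD.
Qed.

Lemma card_split_cells z k :
  (minn k Q <= #|[set t : 'I_Q | cell z t != cell (z + k%:Z)%R t]|)%N.
Proof.
have [kQ|Qk] := leqP k Q; last first.
  rewrite -[X in (X <= _)%N]card_ord -cardsT; apply/subset_leq_card/fintype.subsetP => t _.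
  rewrite inE lt_eqF// -lezD1 -cell_addQ; apply: cell_mono.
  by rewrite lerD2l lez_nat ltnW.
have := sum_cell_add z k; rewrite -lez_nat => e.
have {1}-> : k%:Z = \sum_t (cell (z + k%:Z) t - cell z t) by rewrite sumrB e addrAC subrr add0r.
rewrite [leRHS](_ : _ = \sum_(t | cell z t != cell (z + k%:Z) t) 1); last first.
  rewrite (eq_bigl (fun t => t \in [set t | cell z t != cell (z + k%:Z) t])).
    by rewrite sumr_const natz.
  by move=> t; rewrite inE.
rewrite [leLHS](bigID (fun t => cell z t != cell (z + k%:Z) t))/=.
rewrite [X in _ + X]big1 ?addr0; last by move=> t /negPn/eqP->; rewrite subrr.
apply: ler_sum => t _; rewrite lerBlDr [leRHS]addrC -cell_addQ; apply: cell_mono.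
by rewrite lerD2l lez_nat.
Qed.

Lemma card_boundary z : #|[set t : 'I_Q | ((z + t%:Z) %% Q%:Z)%Z == 0]| = 1%N.
Proof.
have Qp : 0 < Q%:Z by [].
pose r := ((- z) %% Q%:Z)%Z.
have r0 : 0 <= r by rewrite modz_ge0.
have rQ : r < Q%:Z by rewrite ltz_pmod.
have [k kr] : exists k : nat, r = k%:Z by exists `|r|%N; rewrite gez0_abs.
have kQ : (k < Q)%N by rewrite -ltz_nat -kr.
have zr : ((z + k%:Z) %% Q%:Z)%Z = 0 by rewrite -kr /r modzDmr addrN mod0z.
apply/eqP/cards1P; exists (Ordinal kQ); apply/setP => t; rewrite !inE.
apply/eqP/eqP => [h|-> //]; apply: val_inj => /=.
have : (t%:Z = k%:Z %[mod Q%:Z])%Z.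
  by apply/eqP; rewrite -(eqz_modDl z) h zr.
by rewrite !modz_small ?lez_nat ?ltz_nat ?ltn_ord// => -[].
Qed.

End IntegerCells.

Lemma avg_pair (R : realType) (S T : finType) (f : S * T -> R) :
  avg f = avg (fun s => avg (fun t => f (s, t))).
Proof.
rewrite /avg card_prod natrM invfM mulrA -mulr_suml; rewrite mulrAC; congr (_ / _ / _).
by rewrite (pair_big xpredT xpredT (fun s t => f (s, t)))/=; apply: eq_bigr => -[].
Qed.

Section Rounds.
Variables (R : realType) (N : nat) (V J : finType).
Variables (v : V -> 'I_N -> R) (D : V -> V -> R) (A0 : {set V}).
Variables (cl : V -> J) (g : J -> R).
Variables (eta Delta sigma delta eps : R) (K q : nat).

Definition nrm i : R := \sum_k v i k ^+ 2.
(** Within a class the squared norms agree up to a factor 4, so after division by the scale of the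
    class one threshold [sigma] fits all classes. *)
Definition vhat i k : R := v i k / g (cl i).
Definition far i j := eps * g (cl i) ^+ 2 <= sqd v i j.

Hypothesis Dm : pseudometric D.
Hypothesis g_gt0 : forall c, 0 < g c.
Hypothesis nrm_lb : {in A0, forall i, g (cl i) ^+ 2 <= nrm i}.
Hypothesis nrm_ub : {in A0, forall i, nrm i <= 4 * g (cl i) ^+ 2}.
Hypothesis vD : {in A0 &, forall i j, cl i = cl j ->
  sqd v i j <= D i j + 2 * eta * g (cl i) ^+ 2}.
Hypothesis Delta_ge0 : 0 <= Delta.
Hypothesis sigma_gt0 : 0 < sigma.
Hypothesis delta_gt0 : 0 < delta.
Hypothesis K_gt0 : (0 < K)%N.
Hypothesis Kln : 8 * ln #|V|%:R <= K%:R ^+ 2 * delta.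
Hypothesis KDelta : K%:R * Delta + 2 * eta <= sigma ^+ 2 * delta / 32.
Local Notation Q := q.+1.
Hypothesis Qsigma : Q%:R * sigma = 4.

Let U c : {set V} := [set i in A0 | cl i == c].
Let Dc c i j := D i j / g c ^+ 2.
Let mtch c u := matched vhat (Dc c) (U c) Delta sigma u.

Lemma g2 c : 0 < g c ^+ 2.
Proof. by rewrite exprn_gt0. Qed.

Lemma Dc_pseudometric c : pseudometric (Dc c).
Proof.
have [D0 Ds Dt] := Dm; split=> [i|i j|i j k]; rewrite /Dc ?D0 ?mul0r//.
  by rewrite Ds.
by rewrite -mulrDl ler_wpM2r// invr_ge0 (ltW (g2 c)).
Qed.

Lemma sqd_vhat i j : cl i = cl j -> sqd vhat i j = sqd v i j / g (cl i) ^+ 2.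
Proof.
move=> e; rewrite /sqd mulr_suml; apply: eq_bigr => k _.
by rewrite /vhat -e -mulrBl expr_div_n.
Qed.

Lemma vhat_Dc c : {in U c &, forall i j, sqd vhat i j <= Dc c i j + 2 * eta}.
Proof.
move=> i j; rewrite !inE => /andP[iA /eqP ic] /andP[jA /eqP jc].
have ij : cl i = cl j by rewrite ic jc.
rewrite sqd_vhat// ic /Dc -(mulfK (lt0r_neq0 (g2 c)) (2 * eta)) -mulrDl.
by rewrite ler_wpM2r ?invr_ge0 ?(ltW (g2 c))// -ic vD.
Qed.

Lemma matched_class_le c : avg (fun u => #|mtch c u|%:R) <= delta * #|U c|%:R.
Proof.
exact: (@matched_le _ _ _ _ _ _ eta _ _ (Dc_pseudometric c) (@vhat_Dc c)
  Delta_ge0 sigma_gt0 K _ KDelta).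
Qed.

Definition floor_proj u i : int := Num.floor (lin (vhat i) u / sigma).

(** The first slab of each cell goes, and so do the matched vertices. Survivors in different cells
    have projections at least sigma apart, and by maximality of the matching they are not stretched,
    which leaves only a large distance. *)
Definition removed (w : cube N * 'I_Q) i : bool :=
  (((floor_proj w.1 i + w.2%:Z) %% Q%:Z)%Z == 0) || (i \in mtch (cl i) w.1).

Definition rcell (w : cube N * 'I_Q) i : int := cell (floor_proj w.1 i) w.2.

Lemma card_rounds : (0 < #|{: cube N * 'I_Q}|)%N.
Proof. by rewrite card_prod muln_gt0 card_cube card_ord. Qed.

(** Floors that differ by 1 may come from arbitrarily close reals. As the first slab of the upper
    cell is excluded, the floors differ by at least 2. *)
Lemma cell_gap (a b : R) (t : 'I_Q) : ((Num.floor b + t%:Z) %% Q%:Z)%Z != 0 ->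
  cell (Num.floor a) t < cell (Num.floor b) t -> 1 <= b - a.
Proof.
rewrite /cell => nb lt.
set za := Num.floor a in lt *; set zb := Num.floor b in nb lt *.
have Qp : 0 < Q%:Z by [].
have : za + 1 + 1 <= zb + 0.
  have eb := divz_eq (zb + t%:Z) Q%:Z; have ea := divz_eq (za + t%:Z) Q%:Z.
  have ub := ltz_pmod (za + t%:Z) Qp.
  have lb : 0 < ((zb + t%:Z) %% Q%:Z)%Z by rewrite lt_neqAle eq_sym nb modz_ge0.
  move: nb lt eb ea ub lb; rewrite -lezD1.
  set qa := (_ %/ _)%Z; set qb := (_ %/ _)%Z; set ra := (_ %% _)%Z; set rb := (_ %% _)%Z.
  move=> nb lt eb ea ub lb.
  have : (qa + 1) * Q%:Z <= qb * Q%:Z by rewrite ler_pM2r.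
  by lia.
rewrite addr0 -(ler_int R) !rmorphD/= => h.
have := Num.Theory.floor_le b; have := Num.Theory.floorD1_gt a.
by rewrite -/za -/zb rmorphD/=; lra.
Qed.

Lemma round_sep w : {in A0 &, forall i j, cl i = cl j -> ~~ removed w i -> ~~ removed w j ->
  rcell w i != rcell w j -> Delta * g (cl i) ^+ 2 < D i j}.
Proof.
case: w => u t i j iA jA ij; rewrite /removed/= !negb_or => /andP[ri mi] /andP[rj mj] cij.
rewrite ltNge; apply/negP => Dij.
have [_ _ /(_ i j)] := mateP
  (@stretched_sym R N V vhat (Dc (cl i)) (U (cl i)) Delta sigma (Dc_pseudometric _) u)
  (@stretched_irr R N V vhat (Dc (cl i)) (U (cl i)) Delta sigma sigma_gt0 u).
have -> : stretched vhat (Dc (cl i)) (U (cl i)) Delta sigma u i j.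
  rewrite /stretched !inE iA jA -ij eqxx/= ler_pdivrMr ?g2// Dij/=.
  have gap a b : rcell (u, t) a < rcell (u, t) b ->
      ((floor_proj u b + t%:Z) %% Q%:Z)%Z != 0 -> sigma <= lin (vhat b) u - lin (vhat a) u.
    move=> h1 h2; have := cell_gap h2 h1.
    by rewrite -mulrBl ler_pdivlMr// mul1r.
  move: cij; rewrite neq_lt => /orP[h|h].
    by rewrite distrC; apply: le_trans (ler_norm _); exact: gap.
  by apply: le_trans (ler_norm _); exact: gap.
move=> /(_ isT) [h|h]; first by move: mi; rewrite inE h.
by move: mj; rewrite /mtch -ij inE h.
Qed.

(** For each vertex exactly one shift out of Q hits its slab. The matched part is bounded in number
    of vertices, and the factor 4 pays for the variation of the norms within a class. *)
Lemma round_removed : avg (fun w => \sum_(i in A0) nrm i * (removed w i)%:R) <=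
  (Q%:R^-1 + 4 * delta) * \sum_(i in A0) nrm i.
Proof.
have nrm_ge0 i : 0 <= nrm i by apply: sumr_ge0 => *; exact: sqr_ge0.
apply: (@le_trans _ _ (avg (fun w : cube N * 'I_Q =>
   \sum_(i in A0) nrm i * (((floor_proj w.1 i + w.2%:Z) %% Q%:Z)%Z == 0)%:R +
   \sum_(i in A0) nrm i * (i \in mtch (cl i) w.1)%:R))).
  apply: le_avg => w; rewrite -big_split/=; apply: ler_sum => i _.
  rewrite -mulrDr ler_wpM2l// /removed.
  by case: (_ == 0); case: (_ \in _); rewrite /= ?addr0 ?add0r// lerDl.
rewrite avgD mulrDl lerD//.
  rewrite avg_pair -[leRHS](avg_cst (card_cube N)); apply: le_avg => u.
  rewrite avg_sum mulr_sumr; apply: ler_sum => i _; rewrite avgZ mulrC ler_wpM2r//.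
  rewrite /avg card_ord/= -natr_sum.
  have -> : (\sum_(x : 'I_Q) (((floor_proj u i + x%:Z) %% Q%:Z)%Z == 0) = 1)%N.
    rewrite -(card_boundary q (floor_proj u i)) -sum1dep_card [RHS]big_mkcond/=.
    by apply: eq_bigr => x _; case: (_ == _).
  by rewrite mul1r.
rewrite avg_pair.
rewrite (@eq_avg _ _ _ (fun u => \sum_(i in A0) nrm i * (i \in mtch (cl i) u)%:R)); last first.
  by move=> u; rewrite /= avg_cst// card_ord.
rewrite (@eq_avg _ _ _ (fun u => \sum_c \sum_(i in A0 | cl i == c) nrm i * (i \in mtch (cl i) u)%:R)); last first.
  by move=> u; rewrite (partition_big cl xpredT).
rewrite avg_sum (partition_big cl xpredT)//= mulr_sumr; apply: ler_sum => c _.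
apply: (@le_trans _ _ (avg (fun u => 4 * g c ^+ 2 * #|mtch c u|%:R))).
  apply: le_avg => u.
  rewrite -sum1_card natr_sum mulr_sumr big_mkcond [leRHS]big_mkcond/=.
  apply: ler_sum => i _; case: ifP => [/andP[iA /eqP ic]|_].
    by rewrite ic; case: ifP => _; rewrite ?mulr1 ?mulr0// -ic nrm_ub.
  by case: ifP => // _; rewrite mulr1 mulr_ge0// (ltW (g2 c)).
rewrite avgZ; apply: le_trans (ler_wpM2l _ (matched_class_le c)) _.
  by rewrite mulr_ge0// (ltW (g2 c)).
have : #|U c|%:R * g c ^+ 2 <= \sum_(i in A0 | cl i == c) nrm i.
  rewrite -sum1_card natr_sum mulr_suml.
  rewrite (eq_bigl (fun i => (i \in A0) && (cl i == c))); last by move=> i; rewrite inE.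
  by apply: ler_sum => i /andP[iA /eqP <-]; rewrite mul1r nrm_lb.
by have := ltW delta_gt0; nra.
Qed.

(** A cell has width Q sigma = 4, so a pair with projections 4 |y| apart is split with probability
    about min(1, |y|), which is at least y^2 - y^4/4. For S = |vhat i - vhat j|^2 <= 16 the moments
    of linear forms bound the mean of this from below by S/16 - 3 S^2/1024 >= S/64. *)
Lemma round_split : {in A0 &, forall i j, cl i = cl j -> far i j ->
  eps / 64 - Q%:R^-1 <= avg (fun w => (rcell w i != rcell w j)%:R)}.
Proof.
move=> i j iA jA ij fij; rewrite avg_pair.
have Qr : 0 < (Q%:R : R) by rewrite ltr0n.
pose y u := (lin (vhat i) u - lin (vhat j) u) / 4.
have step u : y u ^+ 2 - y u ^+ 4 / 4 - Q%:R^-1 <= avg (fun t => (rcell (u, t) i != rcell (u, t) j)%:R).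
  rewrite /avg card_ord -natr_sum.
  have -> : (\sum_(t : 'I_Q) (rcell (u, t) i != rcell (u, t) j) =
     #|[set t : 'I_Q | cell (floor_proj u i) t != cell (floor_proj u j) t]|)%N.
    by rewrite -sum1dep_card [RHS]big_mkcond/=; apply: eq_bigr => x _; rewrite /rcell/=; case: (_ != _).
  have [k hk1 hk2] : exists2 k : nat, (minn k Q <= #|[set t : 'I_Q | cell (floor_proj u i) t != cell (floor_proj u j) t]|)%N
      & `|y u| <= (k%:R + 1) / Q%:R.
    have wl a b : (floor_proj u a <= floor_proj u b) ->
      exists2 k : nat, (minn k Q <= #|[set t : 'I_Q | cell (floor_proj u a) t != cell (floor_proj u b) t]|)%N
      & lin (vhat b) u / 4 - lin (vhat a) u / 4 <= (k%:R + 1) / Q%:R.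
      move=> ab; have [k kE] : exists k : nat, floor_proj u b = floor_proj u a + k%:Z.
        by exists `|floor_proj u b - floor_proj u a|%N; rewrite gez0_abs ?subr_ge0// subrKC.
      exists k; first by rewrite kE card_split_cells.
      have e x : x / 4 = x / sigma / Q%:R by rewrite -Qsigma invfM mulrA mulrAC.
      rewrite !e -mulrBl ler_pM2r ?invr_gt0//.
      have := Num.Theory.floor_le (lin (vhat a) u / sigma).
      have := Num.Theory.floorD1_gt (lin (vhat b) u / sigma).
      by rewrite -/(floor_proj u a) -/(floor_proj u b) kE !rmorphD/= -pmulrn; lra.
    have [ab|/ltW ab] := leP (floor_proj u i) (floor_proj u j).
      have [k h1 h2] := wl _ _ ab.
      have [k' h1' h2'] : exists2 k', k = k' & True by exists k.
      have [yle|ygt] := leP (y u) 0.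
        by exists k => //; rewrite ler0_norm// /y mulrBl opprB.
      exists k => //; rewrite gtr0_norm//; apply: le_trans (_ : Q%:R^-1 <= _).
        have : lin (vhat i) u / sigma - lin (vhat j) u / sigma <= 1.
          have := Num.Theory.floor_le (lin (vhat j) u / sigma).
          have := Num.Theory.floorD1_gt (lin (vhat i) u / sigma).
          have : ((floor_proj u i)%:~R : R) <= (floor_proj u j)%:~R by rewrite ler_int.
          by rewrite /floor_proj rmorphD/=; lra.
        rewrite /y -mulrBl -Qsigma ler_pdivrMr// mul1r => h.
        by rewrite invfM mulrA mulrAC ler_piMl ?invr_ge0// ler_pdivrMr// mul1r.
      by rewrite -[leLHS]mul1r ler_pM2r ?invr_gt0// lerDr.
    have [k h1 h2] := wl _ _ ab; exists k.
      by apply: leq_trans h1 _; apply: subset_leq_card; apply/fintype.subsetP => t; rewrite !inE eq_sym.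
    have [yle|ygt] := leP 0 (y u).
      by rewrite ger0_norm// /y mulrBl.
    rewrite ltr0_norm//; apply: le_trans (_ : Q%:R^-1 <= _).
      have : lin (vhat j) u / sigma - lin (vhat i) u / sigma <= 1.
        have := Num.Theory.floor_le (lin (vhat i) u / sigma).
        have := Num.Theory.floorD1_gt (lin (vhat j) u / sigma).
        have : ((floor_proj u j)%:~R : R) <= (floor_proj u i)%:~R by rewrite ler_int.
        by rewrite /floor_proj rmorphD/=; lra.
      move=> h0; rewrite (_ : - y u = (lin (vhat j) u - lin (vhat i) u) / 4); last by rewrite /y; ring.
      move: h0; rewrite -mulrBl -Qsigma ler_pdivrMr// mul1r => h.
      by rewrite invfM mulrA mulrAC ler_piMl ?invr_ge0// ler_pdivrMr// mul1r.
    by rewrite -[leLHS]mul1r ler_pM2r ?invr_gt0// lerDr.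
  have b1 : y u ^+ 2 - y u ^+ 4 / 4 <= 1.
    by rewrite (exprM _ 2 2); have := sqr_ge0 (y u ^+ 2 / 2 - 1); nra.
  have b2 : y u ^+ 2 - y u ^+ 4 / 4 <= `|y u|.
    have [yle|ygt] := leP `|y u| 1; last exact: le_trans b1 (ltW ygt).
    have : y u ^+ 2 <= `|y u| by rewrite -real_normK ?num_real// expr2 ler_piMl.
    have : 0 <= y u ^+ 4 by rewrite (exprM _ 2 2) sqr_ge0.
    lra.
  have qi : 0 < (Q%:R^-1 : R) by rewrite invr_gt0.
  set c := #|_| in hk1 *.
  have [kQ|Qk] := leqP k Q.
    have : k%:R / Q%:R <= c%:R / Q%:R :> R.
      by rewrite ler_pM2r// ler_nat; move: hk1; rewrite (minn_idPl kQ).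
    by move=> hc; rewrite lerBlDr; apply: le_trans b2 (le_trans hk2 _); rewrite mulrDl mul1r lerD2r.
  have : 1 <= c%:R / Q%:R :> R.
    by rewrite ler_pdivlMr// mul1r ler_nat; move: hk1; rewrite (minn_idPr (ltnW Qk)).
  by apply: le_trans; rewrite lerBlDr (le_trans b1)// lerDl ltW.
apply: le_trans (le_avg step).
pose a k := vhat i k - vhat j k.
have S16 : sqd vhat i j <= 16.
  rewrite sqd_vhat// ler_pdivrMr ?g2// (@le_trans _ _ (2 * (nrm i + nrm j)))//.
    rewrite /sqd /nrm -big_split/= mulr_sumr; apply: ler_sum => k _.
    by have := sqr_ge0 (v i k + v j k); nra.
  by have := nrm_ub iA; have := nrm_ub jA; rewrite -ij; lra.
have Seps : eps <= sqd vhat i j by rewrite sqd_vhat// ler_pdivlMr ?g2.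
have S0 : 0 <= sqd vhat i j by apply: sumr_ge0 => *; exact: sqr_ge0.
rewrite (@eq_avg _ _ _ (fun u => 16^-1 * lin a u ^+ 2 + (- 1024^-1 * lin a u ^+ 4 + (- Q%:R^-1)))); last first.
  by move=> u; rewrite /y /a linB; field.
rewrite !avgD !avgZ (avg_cst (card_cube N)).
have [-> m4] := lin_moments a.
move: m4; rewrite -[\sum_k a k ^+ 2]/(sqd vhat i j).
move: (avg _) (Q%:R^-1) S16 Seps S0 => M iQ.
set S := sqd _ _ _ => h1 h2 h3 h4.
have : S ^+ 2 <= 16 * S by nra.
by lra.
Qed.

Let rho := Q%:R^-1 + 4 * delta.
Let p := eps / 64 - Q%:R^-1.
Let m := \sum_(i in A0) nrm i.

Hypothesis p_gt0 : 0 < p.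
Hypothesis p_lt1 : p < 1.
Hypothesis m_gt0 : 0 < m.

Lemma nrm_ge0 i : 0 <= nrm i.
Proof. by apply: sumr_ge0 => *; exact: sqr_ge0. Qed.

(** [id] records the cells of all rounds so far. The pairs counted are those still to be separated:
    far apart, of one class, with equal records. *)
Definition far_mass (A : {set V}) (id : V -> seq int) : R :=
  \sum_(i in A) \sum_(j in A | (cl i == cl j) && far i j && (id i == id j)) nrm i * nrm j.

Lemma far_mass_ge0 A id : 0 <= far_mass A id.
Proof. by do 2! apply: sumr_ge0 => ? _; rewrite mulr_ge0 ?nrm_ge0. Qed.

(** A first moment argument for one combination of the two nonnegative quantities. Giving up half of
    the expected decrease p of the far mass costs a factor 2/p in the removed mass. *)
Lemma round_exists (A : {set V}) (id : V -> seq int) W : A \subset A0 ->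
  0 < W -> far_mass A id <= W ->
  exists w, let A' := [set i in A | ~~ removed w i] in
   far_mass A' (fun i => rcell w i :: id i) <= (1 - p / 2) * W /\
   \sum_(i in A :\: A') nrm i <= 2 / p * rho * m.
Proof.
move=> AA0 Wp WA.
have rho0 : 0 < rho by rewrite /rho addr_gt0 ?invr_gt0 ?mulr_gt0.
pose A' w := [set i in A | ~~ removed w i].
pose rem w := \sum_(i in A :\: A' w) nrm i.
pose W' w := far_mass (A' w) (fun i => rcell w i :: id i).
have rem_avg : avg rem <= rho * m.
  apply: le_trans round_removed; apply: le_avg => w.
  rewrite /rem big_mkcond [leRHS]big_mkcond/=; apply: ler_sum => i _.
  rewrite !inE; case: ifP => [/andP[h iA]|_].
    rewrite (fintype.subsetP AA0 _ iA); move: h; rewrite iA/= negbK => ->.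
    by rewrite mulr1.
  by case: ifP => // _; rewrite mulr_ge0 ?nrm_ge0.
have W_avg : avg W' <= (1 - p) * W.
  apply: (@le_trans _ _ (avg (fun w => \sum_(i in A)
     \sum_(j in A | (cl i == cl j) && far i j && (id i == id j))
        nrm i * nrm j * (1 - (rcell w i != rcell w j)%:R)))).
    apply: le_avg => w; rewrite /W' /far_mass.
    rewrite big_mkcond [leRHS]big_mkcond/=; apply: ler_sum => i _.
    rewrite inE; case: (boolP (i \in A)) => //= iA.
    case: ifP => _; last first.
      apply: sumr_ge0 => j _; rewrite !mulr_ge0 ?nrm_ge0// subr_ge0.
      by case: (_ != _).
    rewrite big_mkcond [leRHS]big_mkcond/=; apply: ler_sum => j _.
    rewrite inE eqseq_cons; case: (boolP (j \in A)) => //= jA.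
    case: (cl i == cl j) => /=; rewrite ?andbF//.
    case: (far i j) => /=; rewrite ?andbF//.
    case: (id i == id j) => /=; rewrite ?andbF// ?andbT.
    case: eqP => /= _; rewrite ?andbF ?subr0 ?mulr1 ?subrr ?mulr0//.
    by case: ifP => // _; rewrite mulr_ge0 ?nrm_ge0.
  have q0 : 0 <= 1 - p by rewrite subr_ge0 ltW.
  apply: le_trans (ler_wpM2l q0 WA).
  rewrite avg_sum /far_mass mulr_sumr; apply: ler_sum => i iA.
  rewrite avg_sum mulr_sumr; apply: ler_sum => j /andP[jA /andP[/andP[/eqP cij fij] _]].
  rewrite avgZ mulrC ler_wpM2r ?mulr_ge0 ?nrm_ge0//.
  rewrite -[X in X <= _]/(avg (fun w => 1 + - (rcell w i != rcell w j)%:R)) avgD avgN (avg_cst card_rounds) lerD2l lerN2.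
  by apply: round_split => //; exact: (fintype.subsetP AA0).
have rem0 w : 0 <= rem w by apply: sumr_ge0 => *; exact: nrm_ge0.
have W'0 w : 0 <= W' w := far_mass_ge0 _ _.
have Fm : 0 < rho * m by rewrite mulr_gt0.
have : avg (fun w => rho * m * W' w + W * (p / 2) * rem w) <= (1 - p / 2) * W * (rho * m).
  rewrite avgD !avgZ.
  have := ler_wpM2l (ltW Fm) W_avg.
  have := ler_wpM2l (mulr_ge0 (ltW Wp) (divr_ge0 (ltW p_gt0) (ler0n R 2))) rem_avg.
  by rewrite -/p; set a := _ * avg rem; set b := _ * avg W'; lra.
move=> /(avg_witness card_rounds)[w hw]; exists w; split.
  have : rho * m * W' w <= rho * m * ((1 - p / 2) * W).
    apply: le_trans (_ : _ <= (1 - p / 2) * W * (rho * m)) _; last by rewrite mulrC.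
    apply: le_trans hw; rewrite lerDl !mulr_ge0// ?(ltW Wp) ?(ltW p_gt0)//.
  by rewrite ler_pM2l.
have p2 : 0 < p / 2 by rewrite divr_gt0.
have : W * (p / 2) * rem w <= W * (rho * m).
  have : W * (p / 2) * rem w <= (1 - p / 2) * W * (rho * m).
    by apply: le_trans hw; rewrite lerDr !mulr_ge0// ltW.
  have : 0 <= (p / 2) * W * (rho * m) by rewrite !mulr_ge0 ?(ltW p2) ?(ltW Fm)// ltW.
  by lra.
rewrite -mulrA ler_pM2l// => h.
have -> : 2 / p * rho * m = (rho * m) / (p / 2) by field; rewrite lt0r_neq0.
by rewrite ler_pdivlMr// mulrC.
Qed.

Lemma rounds t : exists (A : {set V}) (id : V -> seq int),
  [/\ A \subset A0,
   {in A &, forall i j, cl i = cl j -> id i != id j -> Delta * g (cl i) ^+ 2 < D i j},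
   far_mass A id <= (1 - p / 2) ^+ t * m ^+ 2
   & \sum_(i in A0 :\: A) nrm i <= t%:R * (2 / p * rho * m)].
Proof.
elim: t => [|t [A [id [AA0 sep fm rem]]]].
  exists A0, (fun=> [::]); split=> //; last by rewrite finset.setDv big_set0 mul0r.
  rewrite expr0 mul1r expr2 {1}/m mulr_suml; apply: ler_sum => i iA.
  rewrite -mulr_sumr ler_wpM2l ?nrm_ge0// /m big_mkcond [leRHS]big_mkcond/=.
  apply: ler_sum => j _; case: (j \in A0) => //=.
  by case: ifP => // _; rewrite nrm_ge0.
have q0 : 0 < 1 - p / 2 by move: p_lt1; lra.
have W0 : 0 < (1 - p / 2) ^+ t * m ^+ 2 by rewrite mulr_gt0 ?exprn_gt0.
have [w /= [fm' rem']] := round_exists AA0 W0 fm.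
set A' := [set i in A | _] in fm' rem'.
have A'A : A' \subset A by apply/fintype.subsetP => i; rewrite inE => /andP[].
exists A', (fun i => rcell w i :: id i); split.
- exact: fintype.subset_trans AA0.
- move=> i j; rewrite !inE => /andP[iA ri] /andP[jA rj] cij.
  rewrite eqseq_cons negb_and => /orP[|]; last exact: sep.
  by apply: round_sep => //; exact: (fintype.subsetP AA0).
- by rewrite exprS -mulrA.
- rewrite -natr1 mulrDl mul1r; apply: le_trans (lerD rem rem').
  rewrite (bigID (fun i => i \in A))/= addrC lerD//.
    rewrite big_mkcond [leRHS]big_mkcond/=; apply: ler_sum => i _; rewrite !inE.
    case: (i \in A) => //=; rewrite ?andbF// ?andbT.
    by rewrite lexx.
  rewrite big_mkcond [leRHS]big_mkcond/=; apply: ler_sum => i _; rewrite !inE.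
  case: (i \in A) => //=; rewrite ?andbF// ?andbT.
  by do 2 case: ifP => //; rewrite ?nrm_ge0// => -> // /andP[->].
Qed.

End Rounds.

(** * Clusters *)

Section Coarea.
Variables (R : realType) (V : finType) (c : V -> V -> R).
Hypothesis c_ge0 : forall i j, 0 <= c i j.

Definition cut (S : {set V}) : R := \sum_(i in S) \sum_(j in ~: S) c i j.

Lemma cut_pair (S : {set V}) a :
  \sum_i \sum_j c i j * (a * ((i \in S) && (j \notin S))%:R) = a * cut S.
Proof.
rewrite /cut mulr_sumr [RHS]big_mkcond; apply: eq_bigr => i _.
case: (i \in S) => /=; last by apply: big1 => j _; rewrite !mulr0.
rewrite mulr_sumr [RHS]big_mkcond; apply: eq_bigr => j _.
by rewrite inE; case: (j \notin S); rewrite ?mulr1 ?mulr0// mulrC.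
Qed.

Lemma coarea (f : V -> R) (h a : R) : 0 <= h -> (forall x, 0 <= f x <= h) ->
  (forall t, 0 < t <= h -> a <= cut [set x | f x < t]) ->
  h * a <= \sum_x \sum_y c x y * Num.max 0 (f y - f x).
Proof.
move: {2}(#|[set x | 0 < f x < h]|) (leqnn #|[set x | 0 < f x < h]|) => k.
elim: k f h => [|k IH] f h + h0 fh fcut.
  rewrite leqn0 cards_eq0 => /eqP/setP e.
  have [->|hN] := eqVneq h 0.
    rewrite mul0r; do 2! apply: sumr_ge0 => ? _.
    by rewrite mulr_ge0// le_max lexx.
  have hp : 0 < h by rewrite lt_def hN.
  have hh : 0 < h <= h by rewrite hp lexx.
  apply: le_trans (ler_wpM2l h0 (fcut h hh)) _.
  rewrite -cut_pair; apply: ler_sum => i _; apply: ler_sum => j _; rewrite ler_wpM2l//.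
  rewrite !inE -leNgt; case: (ltP (f i) h) => //= [fi|_]; last by rewrite mulr0 le_max lexx.
  case: (leP h (f j)) => /= [fj|_]; last by rewrite mulr0 le_max lexx.
  rewrite mulr1 le_max; apply/orP; right.
  move: (fh i) (e i) => /andP[fi0 _]; rewrite !inE fi andbT.
  by move=> /negbT; rewrite -leNgt => ?; lra.
case: (set_0Vmem [set x | 0 < f x < h]) => [e _|[x0 x0P] card].
  by apply: IH => //; rewrite e cards0.
case: (@arg_minP _ _ _ x0 (fun x => x \in [set x | 0 < f x < h]) f x0P) => x1.
rewrite inE => /andP[m0 mh] mmin; set m := f x1 in m0 mh mmin.
pose f' x := Num.max (f x - m) 0.
have f'h x : 0 <= f' x <= h - m.
  by case/andP: (fh x) => ? ?; rewrite /f' ge_max le_max lexx orbT subr_ge0 (ltW mh) lerD2r; apply/and3P.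
have IHf : (h - m) * a <= \sum_x \sum_y c x y * Num.max 0 (f' y - f' x).
  apply: IH => //; last 1 first.
  - move=> t /andP[t0 th]; rewrite (_ : [set x | f' x < t] = [set x | f x < t + m]).
      by apply: fcut; lra.
    by apply/setP => x; rewrite !inE /f' gt_max t0 andbT ltrBlDr.
  - rewrite -ltnS; apply: leq_trans card; apply: proper_card; apply/properP; split.
      apply/fintype.subsetP => x; rewrite !inE /f' => /andP[].
      by rewrite lt_max ltxx orbF gt_max => ? /andP[? ?]; apply/andP; split; lra.
    exists x1; first by rewrite inE m0.
    by rewrite inE /f' subrr maxxx ltxx.
  - by rewrite subr_ge0 ltW.
have mm : 0 < m <= h by rewrite m0 ltW.
have := ler_wpM2l (ltW m0) (fcut m mm); rewrite -cut_pair => Hm.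
have -> : h * a = (h - m) * a + m * a by ring.
apply: le_trans (lerD IHf Hm) _; rewrite -big_split/=; apply: ler_sum => x _.
rewrite -big_split/=; apply: ler_sum => y _; rewrite -mulrDr ler_wpM2l//.
rewrite !inE -leNgt.
have fz z : f z < m -> f z = 0.
  move=> fz; apply/eqP; rewrite eq_le; case/andP: (fh z) => -> _; rewrite andbT leNgt.
  apply/negP => fz0; have /mmin : z \in [set x | 0 < f x < h].
    by rewrite inE fz0 (lt_trans fz mh).
  by rewrite leNgt fz.
case: (ltP (f x) m) => /= fx.
  case: (leP m (f y)) => /= fy.
    have hm : - m <= 0 by rewrite oppr_le0 ltW.
    rewrite mulr1 (fz _ fx) /f' (fz _ fx) sub0r (max_r hm).
    have h1 : 0 <= f y - m by rewrite subr_ge0.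
    have h2 : 0 <= f y by case/andP: (fh y).
    by rewrite (max_l h1) !subr0 (max_r h1) (max_r h2) subrK.
  by rewrite mulr0 addr0 /f' (fz _ fx) (fz _ fy) !subrr.
rewrite mulr0 addr0 /f' [Num.max (f x - m) 0]max_l ?subr_ge0// !ge_max le_max lexx/=.
rewrite /Num.max; do 2! case: ltP => ?; lra.
Qed.

End Coarea.

(** * Classes of vectors of comparable norm *)

Section Scales.
Variables (R : realType) (N : nat) (V : finType).
Variables (v : V -> 'I_N -> R) (s : V -> R) (eta : R).
Local Notation nrm := (nrm v).

Hypothesis eta_gt0 : 0 < eta.
Hypothesis s_ge0 : forall i, 0 <= s i.

Lemma expR1_le4 : expR 1 <= (4 : R).
Proof.
have -> : (1 : R) = 2^-1 + 2^-1 by field.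
rewrite expRD; have h : expR (2^-1) <= (2 : R).
  rewrite -[2^-1 in X in X <= _]opprK expRN -[leRHS]invrK lef_pV2 ?posrE ?expR_gt0 ?invr_gt0//.
  by have := expR_ge1Dx (- 2^-1 : R); lra.
by have := expR_gt0 (2^-1 : R); nra.
Qed.

(** Young's inequality with parameter 1/200: as 201/200 times 100/101 is 201/202, a share G/202 is
    left for the squared distance. The ratio 100/101 bounds exp(-1/100), the gap made by a removed
    residue class. *)
Lemma sqd_norm_gap i j (G : R) : nrm i <= 100 / 101 * G -> G <= nrm j ->
  G <= 500 * 100 * sqd v i j.
Proof.
move=> hi hj.
have H : nrm j <= (1 + 1 / 200) * nrm i + 201 * sqd v i j.
  rewrite /nrm /sqd !mulr_sumr -big_split/=; apply: ler_sum => k _.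
  by have := sqr_ge0 (v i k / 200 + (v i k - v j k)); nra.
have : 0 <= sqd v i j by apply: sumr_ge0 => *; exact: sqr_ge0.
by lra.
Qed.

(* The classes group the vertices by the integer part of 100 ln (nrm i), and
   the removed residue class modulo 100 leaves a gap between the norms in
   distinct classes. *)
Lemma scale_classes : exists (A0 : {set V}) (cl : V -> V) (g : V -> R),
  [/\ forall x, 0 < g x,
      {in A0, forall i, g (cl i) ^+ 2 <= nrm i <= 4 * g (cl i) ^+ 2},
      {in A0, forall i, s i <= eta * g (cl i) ^+ 2},
      {in A0 &, forall i j, cl i != cl j -> g (cl i) <= g (cl j) ->
         g (cl j) ^+ 2 <= 500 * 100 * sqd v i j}
    & \sum_(i in ~: A0) nrm i <=
        (\sum_i nrm i) / 100 + 4 / eta * \sum_i s i].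
Proof.
have nrm_ge0 i : 0 <= nrm i by apply: sumr_ge0 => *; exact: sqr_ge0.
pose k i : int := Num.floor (100 * ln (nrm i)).
have [t ht] : exists t : 'I_100, \sum_i nrm i * (((k i + t%:Z) %% 100)%Z == 0)%:R <=
    (\sum_i nrm i) / 100.
  apply: avg_witness; rewrite ?card_ord// avg_sum mulr_suml; apply: ler_sum => i _.
  rewrite avgZ ler_wpM2l// /avg card_ord -natr_sum.
  have -> : (\sum_(x : 'I_100) (((k i + x%:Z) %% 100)%Z == 0) = 1)%N.
    rewrite -[RHS](card_boundary 99 (k i)) -sum1dep_card [RHS]big_mkcond/=.
    by apply: eq_bigr => x _; case: (_ == _).
  by rewrite mul1r.
pose cl0 i := cell (k i) t.
(* The integer class is named by one of its vertices, since the classes have to form a finite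
   type. *)
pose cl i := odflt i [pick j | cl0 j == cl0 i].
have cl0_cl i : cl0 (cl i) = cl0 i.
  by rewrite /cl; case: pickP => [j /eqP//|/(_ i)]; rewrite eqxx.
have clE i j : cl0 i = cl0 j -> cl i = cl j.
  by move=> e; rewrite /cl e; case: pickP => // /(_ j); rewrite eqxx.
(* The lower end of the logarithms that remain in the class. They span 99/100, and e <= 4 gives the
   factor 4 between the squared norms. *)
pose lg i : R := (100 * cl0 i + 1 - t%:Z)%:~R / 100.
pose g i := expR (lg i / 2).
have g2 i : g (cl i) ^+ 2 = expR (lg i).
  by rewrite /g -expRM_natl /lg cl0_cl; congr expR; field.
(* The last condition drops vertices whose slack is not small against their norm; the mass lost is
   at most 4 / eta times the total slack. *)
pose A0 := [set i | [&& 0 < nrm i, ((k i + t%:Z) %% 100)%Z != 0 & s i <= eta * g (cl i) ^+ 2]].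
have kP i : ((k i + t%:Z) %% 100)%Z != 0 -> 100 * cl0 i + 1 <= k i + t%:Z <= 100 * cl0 i + 99.
  move=> nz.
  have e := divz_eq (k i + t%:Z) 100.
  have u := ltz_pmod (k i + t%:Z) (isT : 0 < 100%:Z).
  have l : 0 <= ((k i + t%:Z) %% 100)%Z by rewrite modz_ge0.
  move: nz e u l; rewrite -/(cell (k i) t) -/(cl0 i).
  by set r := (_ %% _)%Z; move=> /eqP nz e u l; apply/andP; split; lia.
have lnP' i : ((k i + t%:Z) %% 100)%Z != 0 -> lg i <= ln (nrm i) < lg i + 99 / 100.
  move=> iA; have /andP[k1 k2] := kP i iA.
  have := Num.Theory.floor_le (100 * ln (nrm i)); have := Num.Theory.floorD1_gt (100 * ln (nrm i)).
  rewrite -/(k i) rmorphD/= => f1 f2.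
  have h1 : ((100 * cl0 i + 1 - t%:Z)%:~R : R) <= (k i)%:~R by rewrite ler_int; lia.
  have h2 : ((k i)%:~R : R) <= (100 * cl0 i + 1 - t%:Z + 98)%:~R by rewrite ler_int; lia.
  move: h2; rewrite rmorphD/= -pmulrn => h2; rewrite /lg; apply/andP; split; lra.
have lnP i : i \in A0 -> lg i <= ln (nrm i) < lg i + 99 / 100.
  by rewrite inE => /and3P[_ nz _]; exact: lnP'.
have gP i : 0 < nrm i -> ((k i + t%:Z) %% 100)%Z != 0 -> g (cl i) ^+ 2 <= nrm i <= 4 * g (cl i) ^+ 2.
  move=> n0 nz; have /andP[l1 l2] := lnP' i nz.
  rewrite g2 -[nrm i]lnK ?posrE// ler_expR l1/=.
  apply: (@le_trans _ _ (expR (lg i + 1))); first by rewrite ler_expR; lra.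
  by rewrite expRD mulrC ler_wpM2r ?expR_ge0// expR1_le4.
exists A0, cl, g; split.
- by move=> x; exact: expR_gt0.
- by move=> i; rewrite inE => /and3P[n0 nz _]; exact: gP.
- by move=> i; rewrite inE => /and3P[].
- move=> i j iA jA cij gij.
  have /andP[i1 i2] := lnP i iA; have /andP[j1 j2] := lnP j jA.
  have ij : cl0 i < cl0 j.
    rewrite lt_neqAle; apply/andP; split; first by apply: contra cij => /eqP /clE ->.
    move: gij; rewrite /g ler_expR /lg !cl0_cl ler_pM2r// ler_pM2r// ler_int.
    by move: (cl0 i) (cl0 j) (t%:Z); clear => a b w; lia.
  have lij : lg i + 1 <= lg j.
    have : ((100 * cl0 i + 1 - t%:Z + 100)%:~R : R) <= (100 * cl0 j + 1 - t%:Z)%:~R.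
      by rewrite ler_int; move: (cl0 i) (cl0 j) (t%:Z) ij; clear => a b w ?; lia.
    by rewrite [X in X <= _]rmorphD/= -pmulrn /lg; lra.
  apply: sqd_norm_gap; rewrite g2.
    move: iA; rewrite inE => /and3P[n0 _ _].
    rewrite -[nrm i]lnK ?posrE//.
    apply: (@le_trans _ _ (expR (lg j - 1 / 100))); first by rewrite ler_expR; lra.
    rewrite expRD mulrC ler_wpM2r ?expR_ge0// expRN.
    have := expR_ge1Dx (1 / 100 : R) => h.
    have -> : 100 / 101 = (101 / 100)^-1 :> R by field.
    by rewrite lef_pV2 ?posrE ?expR_gt0//; lra.
  move: jA; rewrite inE => /and3P[n0 _ _].
  by rewrite -[nrm j]lnK ?posrE// ler_expR.
- apply: le_trans (_ : _ <= \sum_i nrm i * (((k i + t%:Z) %% 100)%Z == 0)%:R + \sum_i 4 / eta * s i) _; last first.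
    by rewrite mulr_sumr lerD2r.
  rewrite -big_split/= big_mkcond/=; apply: ler_sum => i _.
  have s4 : 0 <= 4 / eta * s i by rewrite !mulr_ge0 ?invr_ge0 ?(ltW eta_gt0).
  rewrite !inE; case: ltP => /= n0; last first.
    by apply: le_trans n0 _; rewrite addr_ge0// mulr_ge0.
  case: eqP => /= nz; first by rewrite mulr1 lerDl.
  rewrite mulr0 add0r -ltNge; case: ltP => // sb.
  have /andP[_ nb] := gP i n0 (introN eqP nz); apply: le_trans nb _.
  by rewrite mulrAC -mulrA ler_pM2l// ler_pdivlMr// mulrC ltW.
Qed.

End Scales.

(** * Local expansion against clusters of nearly constant vectors *)

Section Core.
Variables (R : realType) (N : nat) (V : finType).
Variables (c : V -> V -> R) (Phi : R) (r : nat).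
Variables (v : V -> 'I_N -> R) (D : V -> V -> R) (s : V -> R).
Local Notation nrm := (nrm v).
Local Notation sqd := (sqd v).

Hypothesis c_ge0 : forall i j, 0 <= c i j.
Hypothesis Phi_ge0 : 0 <= Phi.
Hypothesis expanding : forall S : {set V}, S != finset.set0 -> (#|S| * r <= #|V|)%N ->
  Phi * #|S|%:R <= cut c S.
Hypothesis r_gt0 : (0 < r)%N.
Hypothesis isotropic : forall x : 'I_N -> R,
  \sum_i (\sum_k v i k * x k) ^+ 2 <= \sum_k x k ^+ 2.
Hypothesis Dm : pseudometric D.
Hypothesis s_ge0 : forall i, 0 <= s i.
Hypothesis vD : forall i j, sqd i j <= s i + s j + D i j.

Let m := \sum_i nrm i.

(** Isotropy tested on [v i] itself. For j near i the inner product (|v_i|^2 + |v_j|^2 - |v_i -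
    v_j|^2) / 2 is at least (1 - e/2) |v_i| |v_j|, and the squares of all inner products with [v i]
    sum up to at most |v_i|^2. *)
Lemma near_mass (A : {set V}) (e : R) i : 0 <= e <= 1 ->
  (forall j, j \in A -> sqd i j <= e * nrm i /\ sqd i j <= e * nrm j) ->
  (1 - e / 2) ^+ 2 * \sum_(j in A) nrm j <= 1 \/ nrm i = 0.
Proof.
move=> /andP[e0 e1] near; have n0 j : 0 <= nrm j by exact: nrm_ge0.
have [->|ni] := eqVneq (nrm i) 0; [by right|left].
have nip : 0 < nrm i by rewrite lt_def ni n0.
have inner j : \sum_k v j k * v i k = (nrm i + nrm j - sqd i j) / 2.
  by rewrite /nrm /sqd -big_split/= -sumrB mulr_suml; apply: eq_bigr => k _; field.
have := isotropic (v i); rewrite -[leRHS]/(nrm i) => iso.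
rewrite -(ler_pM2r nip) mul1r.
apply: le_trans iso.
rewrite -mulrA mulr_suml mulr_sumr big_mkcond/=; apply: ler_sum => j _.
case: ifP => jA; last exact: sqr_ge0.
have [d1 d2] := near j jA; rewrite inner.
have h1 : (nrm i + nrm j) / 2 * (1 - e / 2) <= (nrm i + nrm j - sqd i j) / 2.
  by move: d1 d2; lra.
have h2 : 0 <= (nrm i + nrm j) / 2 * (1 - e / 2).
  apply: mulr_ge0; first by rewrite divr_ge0 ?addr_ge0.
  by rewrite subr_ge0 ler_pdivrMr// mul1r (le_trans e1)// ler1n.
apply: (@le_trans _ _ (((nrm i + nrm j) / 2 * (1 - e / 2)) ^+ 2)).
  rewrite exprMn [leRHS]mulrC ler_wpM2l ?sqr_ge0//.
  by have := sqr_ge0 (nrm i - nrm j); nra.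
by rewrite lerXn2r ?nnegrE// (le_trans h2 h1).
Qed.

Section Clusters.
Variables (K : eqType) (A : {set V}) (key : V -> K) (h : V -> R) (M1 Mloss : R).

Definition cluster x : {set V} := [set y in A | key y == key x].

Hypothesis h_gt0 : forall i, 0 < h i.
Hypothesis h_key : {in A &, forall i j, key i = key j -> h i = h j}.
Hypothesis separated : {in A &, forall i j, key i != key j -> h i + h j <= D i j}.
Hypothesis light : {in A, forall i, \sum_(j in cluster i) nrm j <= M1}.
Hypothesis heavy : m - Mloss <= \sum_(i in A) nrm i.

(** Starting the minimum at [h i] truncates the distance. Outside the ball the function is constant
    and maximal, so only edges leaving a vertex of the ball show an increase. *)
Definition dist_cluster i x : R := \big[Num.min/h i]_(j in cluster i) D j x.
Definition ball i : {set V} := [set x | dist_cluster i x < h i].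

Lemma dist_cluster_range i x : 0 <= dist_cluster i x <= h i.
Proof.
apply/andP; split; last by rewrite /dist_cluster; elim/big_rec: _ => // j y _; rewrite ge_min orbC => ->.
rewrite /dist_cluster; elim/big_rec: _ => [|j y _ y0]; first exact: ltW.
by rewrite le_min y0 pseudometric_ge0.
Qed.

Lemma dist_cluster_lip i x y : dist_cluster i y <= dist_cluster i x + D x y.
Proof.
have Dxy : 0 <= D x y by exact: pseudometric_ge0.
have [_ _ Dt] := Dm.
rewrite /dist_cluster; elim/big_rec2: _ => [|j a b _ ab]; first by rewrite lerDl.
rewrite ge_min; have h1 := Dt j x y.
by case: (leP (D j x) a) => _; rewrite ?h1 ?ab ?orbT.
Qed.

Lemma ballP i x : x \in ball i -> exists2 j, j \in cluster i & D j x < h i.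
Proof.
rewrite inE /dist_cluster => h0.
have : \big[Num.min/h i]_(j in cluster i) D j x < h i ->
  exists2 j, j \in cluster i & D j x < h i.
  elim/big_rec: _ => [|j a jc IH]; first by rewrite ltxx.
  by rewrite gt_min => /orP[?|/IH//]; exists j.
exact.
Qed.

Lemma ball_disjoint i j x : i \in A -> j \in A -> x \in ball i -> x \in ball j ->
  key i = key j.
Proof.
move=> iA jA /ballP[a]; rewrite inE => /andP[aA /eqP ka] Da.
move=> /ballP[b]; rewrite inE => /andP[bA /eqP kb] Db.
apply/eqP; apply: contraT => kij.
have := separated aA bA; rewrite ka kb kij => /(_ isT).
rewrite (h_key aA iA)// (h_key bA jA)//.
by have [_ Ds Dt] := Dm; have := Dt a x b; rewrite (Ds x b); lra.
Qed.

Definition rep x := odflt x [pick y in cluster x].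
Definition reps : {set V} := [set i in A | rep i == i].

Lemma rep_in x : x \in A -> rep x \in cluster x.
Proof. by move=> xA; rewrite /rep; case: pickP => //= /(_ x); rewrite !inE xA eqxx. Qed.

Lemma rep_key x y : x \in A -> key x = key y -> rep x = rep y.
Proof.
move=> xA e; have ce : cluster x = cluster y by apply/setP => z; rewrite !inE e.
rewrite /rep ce; case: pickP => // /(_ x); by rewrite inE xA e eqxx.
Qed.

Lemma rep_reps x : x \in A -> rep x \in reps.
Proof.
move=> xA; have := rep_in xA; rewrite !inE => /andP[-> /eqP k].
by rewrite -(rep_key xA (esym k)) eqxx.
Qed.

Lemma sum_reps (F : V -> R) : \sum_(x in A) F x = \sum_(i in reps) \sum_(x in cluster i) F x.
Proof.
rewrite (partition_big rep (fun i => i \in reps)) => [|x xA]; last exact: rep_reps.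
apply: eq_bigr => i; rewrite inE => /andP[iA /eqP ri]; apply: eq_bigl => x.
rewrite inE; case: (boolP (x \in A)) => //= xA; apply/eqP/eqP => [<-|k].
  by have := rep_in xA; rewrite inE => /andP[_ /eqP].
by rewrite (rep_key xA k).
Qed.

Lemma reps_inj i j : i \in reps -> j \in reps -> key i = key j -> i = j.
Proof.
rewrite !inE => /andP[iA /eqP ri] /andP[jA /eqP rj] k.
by rewrite -ri -rj; apply: rep_key.
Qed.

(** Balls of different representatives are disjoint, so at most one index contributes at [x]. *)
Lemma sum_balls (L : {set V}) x (F : V -> R) (b : R) : L \subset reps -> 0 <= b ->
  (forall i, i \in L -> x \in ball i -> F i <= b) ->
  (forall i, i \in L -> x \notin ball i -> F i <= 0) -> \sum_(i in L) F i <= b.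
Proof.
move=> LR b0 Fb F0.
case: (pickP [pred i in L | x \in ball i]) => [i /andP[/= iL xi]|none].
  rewrite (bigD1 i)//= -[leRHS]addr0 lerD ?Fb//.
  apply: sumr_le0 => j /andP[jL ji]; apply: F0 => //; apply: contra ji => xj.
  apply/eqP/reps_inj; try exact: (fintype.subsetP LR).
  have RA : reps \subset A by apply/fintype.subsetP => z; rewrite inE => /andP[].
  by apply: (@ball_disjoint _ _ x); rewrite ?(fintype.subsetP RA)// (fintype.subsetP LR).
apply: le_trans b0; apply: sumr_le0 => j jL; apply: F0 => //.
by have := none j; rewrite /= jL/= => /negbT.
Qed.

Variable H : R.
Hypothesis H_ge0 : 0 <= H.
Hypothesis nrm_h : {in A, forall i, nrm i <= H * h i}.
Hypothesis M1_ge0 : 0 <= M1.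

(** [H] trades norms for radii: coarea in the ball of radius [h i] yields [h i] times Phi times the
    number of vertices of the cluster, and nrm <= H h turns this into Phi times mass. By [sum_balls]
    every ordered edge pays at most [D x y]. *)
Lemma clusters_expand :
  Phi * (m - Mloss - r%:R * M1) <= H * \sum_x \sum_y c x y * D x y.
Proof.
pose L := [set i in reps | (#|V| < #|ball i| * r)%N].
pose S := [set i in reps | (#|ball i| * r <= #|V|)%N].
have repsA : reps \subset A by apply/fintype.subsetP => z; rewrite inE => /andP[].
have cardL : (#|L| <= r)%N.
  have hb : \sum_(i in L) (#|ball i|%:R : R) <= #|V|%:R.
    have -> : \sum_(i in L) (#|ball i|%:R : R) = \sum_x \sum_(i in L) (x \in ball i)%:R.
      rewrite exchange_big/=; apply: eq_bigr => i _.
      by rewrite -sum1_card natr_sum big_mkcond/=; apply: eq_bigr => x _; case: (_ \in _).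
    rewrite -[X in _ <= X%:R]sum1_card natr_sum; apply: ler_sum => x _.
    apply: (@sum_balls L x) => //.
    - by apply/fintype.subsetP => z; rewrite inE => /andP[].
    - by move=> i _ ->.
    - by move=> i _ /negPf->.
  (* A large ball has [#|ball i| * r] at least [#|V|.+1] by integrality, so r + 1 disjoint large
     balls do not fit into [V]. *)
  have : (#|L|%:R * #|V|.+1%:R : R) <= r%:R * #|V|%:R.
    apply: le_trans (ler_wpM2l (ler0n _ r) hb).
    rewrite mulr_sumr -[#|L|]sum1_card natr_sum mulr_suml; apply: ler_sum => i.
    by rewrite inE mul1r -natrM ler_nat mulnC => /andP[].
  rewrite -!natrM ler_nat => hL; rewrite leqNgt; apply/negP => rL.
  have : (r.+1 * #|V|.+1 <= r * #|V|)%N by apply: leq_trans hL; rewrite leq_mul2r rL orbT.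
  by rewrite leqNgt => /negP; apply; rewrite mulnS mulSn; lia.
have smallm : m - Mloss - r%:R * M1 <= \sum_(i in S) \sum_(x in cluster i) nrm x.
  have e : \sum_(i in A) nrm i = \sum_(i in L) \sum_(x in cluster i) nrm x
     + \sum_(i in S) \sum_(x in cluster i) nrm x.
    rewrite sum_reps (bigID (mem L))/=; congr (_ + _); apply: eq_bigl => i; rewrite !inE.
      by case: (i \in A); case: (rep i == i).
    by case: (i \in A); case: (rep i == i) => //=; rewrite -leqNgt.
  have : \sum_(i in L) \sum_(x in cluster i) nrm x <= r%:R * M1.
    apply: (@le_trans _ _ (#|L|%:R * M1)); last by rewrite ler_wpM2r// ler_nat.
    rewrite -sum1_card natr_sum mulr_suml; apply: ler_sum => i iL; rewrite mul1r.
    by apply: light; move: iL; rewrite !inE => /andP[/andP[]].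
  by move: heavy; rewrite e; lra.
apply: le_trans (ler_wpM2l Phi_ge0 smallm) _.
rewrite mulr_sumr.
apply: (@le_trans _ _ (\sum_(i in S) H * \sum_x \sum_y c x y * Num.max 0 (dist_cluster i y - dist_cluster i x))).
  apply: ler_sum => i; rewrite inE => /andP[iR bi].
  have iA := fintype.subsetP repsA _ iR.
  have cA x : x \in cluster i -> x \in A /\ h x = h i.
    by rewrite inE => /andP[xA /eqP k]; split=> //; apply: h_key.
  apply: (@le_trans _ _ (H * (h i * (Phi * #|cluster i|%:R)))).
    have -> : H * (h i * (Phi * #|cluster i|%:R)) = Phi * \sum_(x in cluster i) H * h i.
      by rewrite sumr_const -[_ *+ _]mulr_natr; ring.
    rewrite ler_wpM2l//; apply: ler_sum => x /cA[xA <-]; exact: nrm_h.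
  rewrite ler_wpM2l//; apply: coarea => //; first exact: ltW.
    by move=> x; exact: dist_cluster_range.
  move=> t /andP[t0 th].
  set B := [set x | _].
  have CB : cluster i \subset B.
    apply/fintype.subsetP => x xc; rewrite inE /dist_cluster (bigD1 x)//= gt_min.
    by have [-> _ _] := Dm; rewrite t0.
  have BB : B \subset ball i.
    by apply/fintype.subsetP => x; rewrite !inE => /lt_le_trans; apply.
  apply: le_trans (_ : Phi * #|B|%:R <= _).
    by rewrite ler_wpM2l// ler_nat subset_leq_card.
  apply: expanding.
    by apply/set0Pn; exists i; apply: (fintype.subsetP CB); rewrite inE iA eqxx.
  by apply: leq_trans bi; rewrite leq_mul2r subset_leq_card ?orbT.
rewrite -mulr_sumr ler_wpM2l// exchange_big/=; apply: ler_sum => x _.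
rewrite exchange_big/=; apply: ler_sum => y _; rewrite -mulr_sumr ler_wpM2l//.
apply: (@sum_balls S x).
- by apply/fintype.subsetP => z; rewrite inE => /andP[].
- exact: pseudometric_ge0.
- move=> i _ _; rewrite ge_max pseudometric_ge0//= lerBlDl.
  exact: dist_cluster_lip.
- move=> i _; rewrite inE -leNgt => hx; rewrite ge_max lexx/= subr_le0.
  by apply: le_trans hx; have /andP[] := dist_cluster_range i y.
Qed.

End Clusters.

End Core.

(** Bernoulli's inequality in the form (1 - x)^k (1 + k x) <= 1. *)
Lemma pow_decay (R : realType) (x : R) (k : nat) : 0 <= x <= 1 -> 1 <= k%:R * x -> (1 - x) ^+ k <= 1 / 2.
Proof.
move=> /andP[x0 x1] kx.
have H j : (1 - x) ^+ j * (1 + j%:R * x) <= 1.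
  elim: j => [|j IH]; first by rewrite expr0 mul0r addr0 mul1r.
  apply: le_trans IH; rewrite exprSr -mulrA ler_wpM2l ?exprn_ge0 ?subr_ge0//.
  by rewrite -natr1; have : 0 <= (j%:R : R) by []; nra.
have := H k; have : 0 <= (1 - x) ^+ k by rewrite exprn_ge0 ?subr_ge0.
by nra.
Qed.

(** The partition argument for total mass exactly 1.5 r. Here l stands for log r, t is the number of
    rounds, Q = q + 1 is the inverse order of the loss per round, and Delta is the separation of the
    clusters. *)
Lemma core_scaled (R : realType) (N : nat) (V : finType) (c : V -> V -> R) (Phi : R) (r : nat)
    (v : V -> 'I_N -> R) (D : V -> V -> R) (s : V -> R) (l q T0 K : nat) (Delta BQ : R)
    (m := \sum_i nrm v i) (t := (T0 * (15 * l))%N) :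
  (forall i j, 0 <= c i j) -> 0 <= Phi ->
  (forall S : {set V}, S != finset.set0 -> (#|S| * r <= #|V|)%N -> Phi * #|S|%:R <= cut c S) ->
  (0 < r)%N ->
  (forall x : 'I_N -> R, \sum_i (\sum_k v i k * x k) ^+ 2 <= \sum_k x k ^+ 2) ->
  pseudometric D -> (forall i, 0 <= s i) ->
  (forall i j, sqd v i j <= s i + s j + D i j) ->
  m = 3 / 2 * r%:R -> (0 < l)%N -> (r <= 2 ^ l)%N -> (256 * 10 : R) <= T0%:R ->
  1280 * 1000 <= BQ -> BQ * t%:R <= q.+1%:R -> 0 <= Delta -> (0 < K)%N ->
  8 * ln #|V|%:R * q.+1%:R <= K%:R ^+ 2 :> R ->
  K%:R * Delta <= (4 * q.+1%:R ^+ 3)^-1 ->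
  \sum_i s i <= m / (32 * 100 * q.+1%:R ^+ 3) ->
  Phi * Delta * m <= 100 * \sum_x \sum_y c x y * D x y.
Proof.
move=> c_ge0 Phi_ge0 expanding r_gt0 isotropic Dm s_ge0 vD m_r l_gt0 r_l T0_ge hBQ Q_t.
have [b0 b0E] : exists b0 : R, b0 = 1280 * 1000 by eexists.
rewrite -b0E in hBQ.
move=> Delta_ge0 K_gt0 K_ln K_Delta s_small.
pose Q := q.+1; rewrite -/Q in Q_t K_ln K_Delta s_small.
have Qr : 0 < (Q%:R : R) by rewrite ltr0n.
have Q3 : 0 < (Q%:R : R) ^+ 3 by rewrite exprn_gt0.
have r1 : 1 <= (r%:R : R) by rewrite ler1n.
have m0 : 0 < m by rewrite m_r; lra.
have T0p : (0 < T0)%N by rewrite -(ltr0n R); move: T0_ge; lra.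
have t1 : (1 : R) <= t%:R by rewrite ler1n /t !muln_gt0 T0p l_gt0.
have B0 : 0 <= BQ by move: hBQ; rewrite b0E; clear; lra.
have Qb : b0 <= Q%:R.
  by apply: le_trans hBQ (le_trans _ Q_t); rewrite ler_peMr.
(* Chains have sigma^2 delta / 32 = 1/(2 Q^3) at their disposal; half of it goes to K Delta and half
   to 2 eta. *)
pose eta : R := (8 * Q%:R ^+ 3)^-1.
have eta0 : 0 < eta by rewrite invr_gt0 mulr_gt0.
have [A0 [cl [g [g0 gA sA gap loss]]]] := scale_classes v eta0 s_ge0.
pose sigma : R := 4 / Q%:R; pose delta : R := Q%:R^-1.
have sg0 : 0 < sigma by rewrite divr_gt0.
have dl0 : 0 < delta by rewrite invr_gt0.
have Qs : Q%:R * sigma = 4 by rewrite /sigma mulrC divfK ?lt0r_neq0.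
have Kln' : 8 * ln #|V|%:R <= K%:R ^+ 2 * delta by rewrite /delta ler_pdivlMr.
have KD : K%:R * Delta + 2 * eta <= sigma ^+ 2 * delta / 32.
  have -> : sigma ^+ 2 * delta / 32 = (4 * Q%:R ^+ 3)^-1 + 2 * eta.
    by rewrite /sigma /delta /eta; field; rewrite lt0r_neq0.
  by rewrite lerD2r.
have nlb : {in A0, forall i, g (cl i) ^+ 2 <= nrm v i} by move=> i /gA/andP[].
have nub : {in A0, forall i, nrm v i <= 4 * g (cl i) ^+ 2} by move=> i /gA/andP[].
have vD' : {in A0 &, forall i j, cl i = cl j -> sqd v i j <= D i j + 2 * eta * g (cl i) ^+ 2}.
  move=> i j iA jA e; apply: le_trans (vD i j) _.
  by have := sA i iA; have := sA j jA; rewrite -e; clear; lra.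
(* Then eps / 64 = 1/640 and 1/Q is far smaller, so a far pair is split with probability at least p
   >= 1/1280 in each round. *)
pose eps : R := 1 / 10.
pose p : R := eps / 64 - Q%:R^-1.
have Qi : 0 < (Q%:R^-1 : R) by rewrite invr_gt0.
have QQ : Q%:R^-1 * Q%:R = 1 :> R by rewrite mulVf// lt0r_neq0.
have Qi2 : Q%:R^-1 <= 1 / 1280 / 1000 :> R.
  have : Q%:R^-1 * b0 <= Q%:R^-1 * Q%:R by rewrite ler_wpM2l// ltW.
  by rewrite QQ b0E; move: (Q%:R^-1 : R); clear => y; lra.
have p_lb : 1 / 1280 <= p by rewrite /p /eps; move: (Q%:R^-1 : R) Qi2; clear => iQ; lra.
have p0 : 0 < p by move: p_lb; clear; lra.
have p1 : p < 1 by rewrite /p /eps; move: (Q%:R^-1 : R) Qi; clear => iQ; lra.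
have [D0|Dp] := eqVneq Delta 0.
  rewrite D0 mulr0 mul0r mulr_ge0//; do 2! apply: sumr_ge0 => ? _.
  by rewrite mulr_ge0// pseudometric_ge0.
have {}Dp : 0 < Delta by rewrite lt_def Dp.
pose mA := \sum_(i in A0) nrm v i.
have sumC (B : {set V}) : m = \sum_(i in B) nrm v i + \sum_(i in ~: B) nrm v i.
  rewrite /m (bigID (mem B))/=; congr (_ + _).
  by apply: eq_bigl => i; rewrite inE.
have n0 i : 0 <= nrm v i by exact: nrm_ge0.
have sum0 (B : {set V}) : 0 <= \sum_(i in B) nrm v i by apply: sumr_ge0.
have mA_m : mA <= m by rewrite (sumC A0) lerDl.
have mA_lb : m - m / 50 <= mA.
  have h : 4 / eta * \sum_i s i <= m / 100.
    rewrite /eta invrK; apply: le_trans (ler_wpM2l _ s_small) _; first by rewrite !mulr_ge0// ltW.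
    by rewrite le_eqVlt; apply/orP; left; apply/eqP; field; rewrite lt0r_neq0.
  by move: loss (sumC A0) h; rewrite -/m -/mA; clear; lra.
have mA0 : 0 < mA by move: mA_lb m0; clear; lra.
have [A [id [AA0 sep fm rem]]] := rounds Dm g0 nlb nub vD' Delta_ge0 sg0 dl0 K_gt0 Kln' KD Qs p0 p1 mA0 t.
rewrite -/p -/mA -/Q in fm rem; have mAE : mA = \sum_(i in A0) nrm v i by [].
clearbody p mA.
have [C CE C_lb] : exists2 C : R, C = 2 ^+ 14 & 15 * 1000 <= C.
  exists (128 * 128); last by clear; lra.
  have -> : (128 : R) = 2 ^+ 7 by clear; ring.
  by rewrite -exprD.
have C0 : 0 <= C by move: C_lb; clear; lra.
(* T0 rounds halve the far mass, so t rounds divide it by 2^(15 l) >= r 2^14. The factor r is needed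
   because the initial bound m^2 exceeds the target, a small multiple of m, by a factor of order
   r. *)
have half_t : (1 - p / 2) ^+ t * (r%:R * C) <= 1.
  have b1 : (1 - p / 2) ^+ T0 <= 1 / 2.
    apply: pow_decay; first by apply/andP; split; move: p0 p1; clear; lra.
    have : 256 * 10 * p <= T0%:R * p by rewrite ler_pM2r.
    by move: p_lb; clear; lra.
  have p2 : 0 <= 1 - p / 2 by move: p1; clear; lra.
  have b2 : (1 - p / 2) ^+ t <= (1 / 2) ^+ (15 * l).
    by rewrite /t exprM lerXn2r// nnegrE ?exprn_ge0// divr_ge0.
  have r0 : 0 <= r%:R * C by apply: mulr_ge0 => //; exact: ler0n.
  apply: le_trans (ler_wpM2r r0 b2) _.
  have -> : (1 / 2 : R) ^+ (15 * l) = (2 ^+ (15 * l))^-1 by rewrite div1r exprVn.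
  have e15 : (2 : R) ^+ (15 * l) = 2 ^+ l * 2 ^+ (14 * l) by rewrite -exprD -mulSn.
  rewrite ler_pdivrMl ?exprn_gt0// mulr1 e15.
  have l14 : C <= 2 ^+ (14 * l) by rewrite CE ler_weXn2l ?ler1n// leq_pmulr.
  apply: ler_pM l14; [exact: ler0n|exact: C0|].
  by rewrite -natrX ler_nat.
have fm' : far_mass v cl g eps A id <= m / 100 / 100.
  apply: le_trans fm _; set z := (1 - p / 2) ^+ t in half_t *.
  have z0 : 0 <= z by rewrite exprn_ge0//; move: p1; clear; lra.
  have : mA ^+ 2 <= m ^+ 2 by rewrite lerXn2r ?nnegrE// ltW.
  move=> /(ler_wpM2l z0) h; apply: le_trans h _.
  have -> : z * m ^+ 2 = (z * m) * m by ring.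
  have : z * m <= 1 / 100 / 100.
    rewrite m_r.
    have : z * (r%:R * (15 * 1000)) <= z * (r%:R * C) by rewrite ler_wpM2l// ler_wpM2l.
    by move: half_t; clear; lra.
  by move=> /(ler_wpM2r (ltW m0)); clear; lra.
pose farm i := \sum_(j in A | (cl i == cl j) && far v cl g eps i j && (id i == id j)) nrm v j.
(* Markov's inequality discards the vertices that see too much far mass in their own cluster. *)
pose A2 := [set i in A | farm i <= 1 / 100].
pose key i := (cl i, id i).
have A2A i : i \in A2 -> i \in A by rewrite inE => /andP[].
have A2A0 i : i \in A2 -> i \in A0 by move=> /A2A /(fintype.subsetP AA0).
pose h i := Delta * g (cl i) ^+ 2 / 2.
have g2p i : 0 < g (cl i) ^+ 2 by rewrite exprn_gt0.
have rem' : \sum_(i in A0 :\: A) nrm v i <= m / 100.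
  apply: le_trans rem _.
  have e : Q%:R^-1 + 4 * delta = 5 * Q%:R^-1 by rewrite /delta; ring.
  rewrite e.
  have pi : 2 / p <= 256 * 10.
    by rewrite ler_pdivrMr//; move: p_lb; clear; lra.
  have tq : t%:R * Q%:R^-1 <= 1 / 1280 / 1000 :> R.
    have h1 : Q%:R^-1 * (BQ * t%:R) <= Q%:R^-1 * Q%:R by rewrite ler_wpM2l// ltW.
    have h2 : b0 * (t%:R * Q%:R^-1) <= BQ * (t%:R * Q%:R^-1).
      by rewrite ler_wpM2r// mulr_ge0// ltW.
    by move: h1 h2; rewrite QQ b0E; move: (Q%:R^-1 : R) (t%:R : R); clear => y z; lra.
  have -> : t%:R * (2 / p * (5 * Q%:R^-1) * mA) = (t%:R * Q%:R^-1) * 5 * (2 / p * mA) by ring.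
  have k1 : 2 / p * mA <= 256 * 10 * m.
    by apply: ler_pM => //; [rewrite divr_ge0 ?ltW | rewrite ltW].
  have k0 : 0 <= 2 / p * mA by rewrite mulr_ge0 ?divr_ge0 ?ltW.
  have k2 : t%:R * Q%:R^-1 * 5 <= 5 / 1280 / 1000 :> R by move: (t%:R * _) tq; clear => y; lra.
  apply: le_trans (ler_pM _ k0 k2 k1) _; last by move: m0; clear; lra.
  by rewrite !mulr_ge0// ltW.
have farm0 i : 0 <= farm i by apply: sumr_ge0.
have lossA2 : \sum_(i in A :\: A2) nrm v i <= m / 100.
  have : \sum_(i in A :\: A2) nrm v i <= 100 * far_mass v cl g eps A id.
    rewrite /far_mass mulr_sumr big_mkcond [leRHS]big_mkcond/=; apply: ler_sum => i _.
    rewrite -mulr_sumr -/(farm i) !inE; case: (boolP (i \in A)) => //= iA.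
    rewrite andbT -ltNge; case: ltP => // hf; last by rewrite !mulr_ge0.
    by have := n0 i; have := ler_wpM2l (n0 i) (ltW hf); clear; lra.
  by move: fm'; clear; lra.
have heavy : m - m / 25 <= \sum_(i in A2) nrm v i.
  have e1 : mA = \sum_(i in A) nrm v i + \sum_(i in A0 :\: A) nrm v i.
    rewrite mAE (bigID (mem A))/=; congr (_ + _); apply: eq_bigl => i; rewrite ?inE 1?andbC//.
    by apply: andb_idr => /(fintype.subsetP AA0).
  have e2 : \sum_(i in A) nrm v i = \sum_(i in A2) nrm v i + \sum_(i in A :\: A2) nrm v i.
    rewrite (bigID (mem A2))/=; congr (_ + _); apply: eq_bigl => i; rewrite ?inE 1?andbC//.
    by case: (i \in A); rewrite ?andbF ?andbT.
  by move: e1 e2 rem' lossA2 mA_lb; clear; lra.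
(* Near vertices weigh at most (19/20)^-2 < 111/100 by isotropy, far ones at most 1/100. *)
have light : {in A2, forall i, \sum_(j in cluster A2 key i) nrm v j <= 112 / 100}.
  move=> i iA2; have iA0 := A2A0 i iA2.
  pose B := [set j in cluster A2 key i | ~~ far v cl g eps i j].
  have nB : \sum_(j in B) nrm v j <= 111 / 100.
    have [||hB|n00] := near_mass (A := B) (e := eps) (i := i) isotropic.
    - by rewrite /eps; apply/andP; split; clear; lra.
    - move=> j; rewrite inE => /andP[]; rewrite inE => /andP[jA2 /eqP[kc _]].
      rewrite /far -ltNge => /ltW hs.
      have e0 : 0 <= eps by rewrite /eps; clear; lra.
      split; apply: le_trans hs _; rewrite ler_wpM2l//; first exact: nlb.
      by rewrite -kc; exact: nlb (A2A0 j jA2).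
    - by have := sum0 B; move: hB; rewrite /eps; clear; lra.
    - by have := nlb i iA0; rewrite n00 leNgt g2p.
  have : \sum_(j in cluster A2 key i) nrm v j <= \sum_(j in B) nrm v j + farm i.
    rewrite big_mkcond [X in _ <= X + _]big_mkcond /farm [X in _ <= _ + X]big_mkcond -big_split/=.
    apply: ler_sum => j _; rewrite !inE; case: (boolP (j \in A)) => /=; last first.
      by rewrite addr0.
    move=> _; rewrite xpair_eqE ![_ == cl i]eq_sym ![_ == id i]eq_sym.
    case: (farm j <= _); case: (cl i == cl j); case: (id i == id j); case: (far v cl g eps i j); rewrite /= ?addr0 ?add0r//.
  by move: iA2 nB; rewrite inE => /andP[_]; clear; lra.
have hp i : 0 < h i by rewrite divr_gt0 ?mulr_gt0.
have hk : {in A2 &, forall i j, key i = key j -> h i = h j}.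
  by move=> i j _ _ [e _]; rewrite /h e.
have Q3l : b0 <= (Q%:R : R) ^+ 3.
  apply: le_trans Qb _; rewrite -[leLHS]expr1 ler_weXn2l//.
  by rewrite ler1n.
have small : Delta + 2 * eta <= 1 / 500 / 100.
  pose x : R := (4 * Q%:R ^+ 3)^-1.
  have d1 : Delta <= x by apply: le_trans K_Delta; rewrite ler_peMl// ler1n.
  have e1 : 2 * eta = x by rewrite /eta /x; field; rewrite lt0r_neq0.
  have xz : x * Q%:R ^+ 3 = 1 / 4 by rewrite /x; field; rewrite lt0r_neq0.
  have x0 : 0 <= x by rewrite invr_ge0 mulr_ge0// ltW.
  have : 0 <= x * (Q%:R ^+ 3 - b0) by apply: mulr_ge0 => //; rewrite subr_ge0.
  rewrite mulrBr xz e1 b0E; clearbody x; move: d1; clear; lra.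
(* In one class the rounds separate the clusters. Between classes the gap of the norms makes |v_i -
   v_j|^2 a constant fraction of the larger scale, which exceeds the slacks and Delta times that
   scale. *)
have sp : {in A2 &, forall i j, key i != key j -> h i + h j <= D i j}.
  have wl i j : i \in A2 -> j \in A2 -> cl i != cl j -> g (cl i) <= g (cl j) -> h i + h j <= D i j.
    move=> iA2 jA2 cij gij.
    have G := gap i j (A2A0 i iA2) (A2A0 j jA2) cij gij.
    have g12 : g (cl i) ^+ 2 <= g (cl j) ^+ 2 by apply: lerXn2r => //; rewrite nnegrE ltW.
    have := vD i j; have := sA i (A2A0 i iA2); have := sA j (A2A0 j jA2).
    have := ler_wpM2l (ltW eta0) g12; have := ler_wpM2l Delta_ge0 g12.
    have := ler_wpM2r (ltW (g2p j)) small.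
    by rewrite /h; move: G; clear; lra.
  move=> i j iA2 jA2; rewrite xpair_eqE negb_and => kij.
  have [cij|cij] := eqVneq (cl i) (cl j).
    move: kij; rewrite cij eqxx/= => idij.
    have := sep i j (A2A i iA2) (A2A j jA2) cij idij.
    by rewrite /h -cij; clear; lra.
  have [gij|/ltW gij] := leP (g (cl i)) (g (cl j)); first exact: wl.
  have [_ Ds _] := Dm; rewrite Ds addrC; apply: wl => //; by rewrite eq_sym.
have nh : {in A2, forall i, nrm v i <= 8 / Delta * h i}.
  move=> i iA2; have -> : 8 / Delta * h i = 4 * g (cl i) ^+ 2 by rewrite /h; field; rewrite lt0r_neq0.
  exact: nub (A2A0 i iA2).
have H0 : 0 <= 8 / Delta by rewrite divr_ge0// ltW.
have M0 : 0 <= 112 / 100 :> R by rewrite divr_ge0.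
have := clusters_expand c_ge0 Phi_ge0 expanding r_gt0 Dm hp hk sp light heavy H0 nh M0.
set W := \sum_x _.
rewrite mulrAC ler_pdivlMr// => fin.
have rm : r%:R = 2 / 3 * m by rewrite m_r; field.
(* With r = 2m/3 the remaining mass is (1 - 1/25 - 112/150) m, more than m/5. *)
have : Phi * (1 / 5 * m) <= Phi * (m - m / 25 - r%:R * (112 / 100)).
  by rewrite ler_wpM2l// rm; move: m0; clear; lra.
move=> /(ler_wpM2r (ltW Dp)) fin2.
have := le_trans fin2 fin.
have : 0 <= W by do 2! apply: sumr_ge0 => ? _; rewrite mulr_ge0// pseudometric_ge0.
by clear; lra.
Qed.

Lemma sqrt_ceil (R : realType) (X : R) : 4 <= X ->
  exists K : nat, [/\ (0 < K)%N, X <= K%:R ^+ 2 & K%:R ^+ 2 <= 3 * X].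
Proof.
move=> X4; have X0 : 0 <= X by lra.
pose y := Num.sqrt X; have y2 : y ^+ 2 = X by exact: sqr_sqrtr.
have y0 : 0 <= y by exact: sqrtr_ge0.
have yb : 2 <= y by rewrite -(ler_pXn2r (ltn0Sn 1)) ?nnegrE// y2; lra.
exists (Num.truncn y).+1.
have /andP[k1 k2] := Num.Theory.truncn_itv y0.
split=> //.
  by rewrite -y2 lerXn2r ?nnegrE// ltW.
have h : (Num.truncn y).+1%:R <= y + 1 by rewrite -natr1 lerD2r.
have : (Num.truncn y).+1%:R ^+ 2 <= (y + 1) ^+ 2 by rewrite lerXn2r ?nnegrE//; lra.
by rewrite -y2; nra.
Qed.

Lemma ln_card_ge (R : realType) (n : nat) : (1 < n)%N -> 1 / 2 <= ln (n%:R : R).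
Proof.
move=> n1; have e2 : expR (1 / 2) <= (2 : R).
  rewrite -[1 / 2 in X in X <= _]opprK expRN -[leRHS]invrK lef_pV2 ?posrE ?expR_gt0 ?invr_gt0//.
  by have := expR_ge1Dx (- (1 / 2) : R); lra.
rewrite -ler_expR lnK ?posrE ?ltr0n ?(ltn_trans _ n1)//.
by apply: le_trans e2 _; rewrite ler_nat.
Qed.

(** A larger mass is scaled down to 1.5 r, which preserves isotropy. Either the slacks exceed what
    [core_scaled] tolerates, a share of order 1/Q^3 of the mass with Q of order l, or its conclusion
    applies. *)
Lemma core_exists (R : realType) : exists (a1 CS : R), [/\ 0 < a1, 0 < CS &
  forall (V : finType) (N : nat) (c : V -> V -> R) (Phi d : R) (r l : nat)
    (v : V -> 'I_N -> R) (D : V -> V -> R) (s : V -> R) (m := \sum_i nrm v i),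
  (forall i j, 0 <= c i j) -> 0 < Phi -> 0 < d ->
  (forall S : {set V}, S != finset.set0 -> (#|S| * r <= #|V|)%N -> Phi * #|S|%:R <= cut c S) ->
  (0 < r)%N -> (0 < l)%N -> (r <= 2 ^ l)%N -> (1 < #|V|)%N ->
  d ^+ 2 * ln #|V|%:R <= a1 * Phi ^+ 2 * l%:R ->
  (forall x : 'I_N -> R, \sum_i (\sum_k v i k * x k) ^+ 2 <= \sum_k x k ^+ 2) ->
  pseudometric D -> (forall i, 0 <= s i) ->
  (forall i j, sqd v i j <= s i + s j + D i j) ->
  3 / 2 * r%:R <= m ->
  m <= CS * l%:R ^+ 3 * \sum_i s i \/
  d * m <= 100 * l%:R ^+ 5 * \sum_x \sum_y c x y * D x y].
Proof.
have archi (x : R) : exists n : nat, x <= n%:R.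
  exists (Num.bound x); have [x0|x0] := leP 0 x; first exact: ltW (archi_boundP x0).
  exact: le_trans (ltW x0) (ler0n _ _).
have [T0 T0_ge] := archi (256 * 10).
have [BQ BQE] : exists BQ : R, BQ = 1280 * 1000 by eexists.
have BQ0 : 0 <= BQ by rewrite BQE; clear; lra.
have [C0 C0_ge] := archi (BQ * (T0 * 15)%:R).
have [c32 c32E] : exists c32 : R, c32 = 32 * 100 by eexists.
have c32p : 0 < c32 by rewrite c32E; clear; lra.
pose CQ := C0.+1.
have CQ_ge : BQ * (T0 * 15)%:R <= CQ%:R :> R.
  by apply: le_trans C0_ge _; rewrite ler_nat.
have CQp : (0 < CQ)%N by [].
clearbody CQ; clear C0 C0_ge.
have CQ1 : 1 <= (CQ%:R : R) by rewrite ler1n.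
have CQ0 : CQ%:R != 0 :> R by rewrite pnatr_eq0 -lt0n.
have [c4 c4E] : exists c4 : R, c4 = 400 by eexists.
have c4p : 0 < c4 by rewrite c4E; clear; lra.
exists (c4 * CQ%:R ^+ 7)^-1, (c32 * CQ%:R ^+ 3); split.
- by rewrite invr_gt0 mulr_gt0 ?exprn_gt0 ?ltr0n.
- by rewrite mulr_gt0 ?exprn_gt0 ?ltr0n.
move=> V N c Phi d r l v D s m c0 Phi0 d0 ex r0 l0 rl V1 adm iso Dm s0 vD m_r.
have l1 : 1 <= (l%:R : R) by rewrite ler1n.
have lN : l%:R != 0 :> R by rewrite pnatr_eq0 -lt0n.
have [|small] := leP m (c32 * CQ%:R ^+ 3 * l%:R ^+ 3 * \sum_i s i); [by left|right].
have r1 : 1 <= (r%:R : R) by rewrite ler1n.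
have m0 : 0 < m by move: r1 m_r; clear; lra.
pose th := 3 / 2 * r%:R / m.
have th0 : 0 < th by rewrite divr_gt0// mulr_gt0 ?divr_gt0// ltr0n.
have th1 : th <= 1 by rewrite ler_pdivrMr// mul1r.
have thm : th * m = 3 / 2 * r%:R by rewrite divfK// lt0r_neq0.
pose w i k := Num.sqrt th * v i k.
have sq2 : Num.sqrt th ^+ 2 = th by rewrite sqr_sqrtr// ltW.
have nw i : nrm w i = th * nrm v i.
  by rewrite /nrm mulr_sumr; apply: eq_bigr => k _; rewrite exprMn sq2.
have sw i j : sqd w i j = th * sqd v i j.
  by rewrite /sqd mulr_sumr; apply: eq_bigr => k _; rewrite -mulrBr exprMn sq2.
have sumw : \sum_i nrm w i = th * m.
  by rewrite /m mulr_sumr; apply: eq_bigr => i _.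
pose Q := (CQ * l)%N; have Q0 : (0 < Q)%N by rewrite muln_gt0 CQp l0.
have QE : Q.-1.+1 = Q by rewrite prednK.
have Qr : (Q%:R : R) = CQ%:R * l%:R by rewrite natrM.
have Q1 : 1 <= (Q%:R : R) by rewrite ler1n.
have lnV : 1 / 2 <= ln (#|V|%:R : R) := ln_card_ge R V1.
have X4' : 4 <= 8 * ln #|V|%:R * (Q%:R : R).
  by move: (ln _) (Q%:R : R) lnV Q1; clear => x y; nra.
have [K [K0 Kl Ku]] := sqrt_ceil X4'.
(* With K of order sqrt(l ln n) and the bound on d, the product K Delta is at most of order l^-4,
   which stays within 1/(4 Q^3). *)
pose Delta := d / (Phi * l%:R ^+ 5).
have l5 : 0 < (l%:R : R) ^+ 5 by rewrite exprn_gt0// ltr0n.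
have D0 : 0 < Delta by rewrite divr_gt0// mulr_gt0.
have PhiN : Phi != 0 by rewrite lt0r_neq0.
have KD : K%:R * Delta <= (4 * Q%:R ^+ 3)^-1.
  have q3 : 0 < (Q%:R : R) ^+ 3 by rewrite exprn_gt0// ltr0n.
  have pl : 0 < Phi ^+ 2 * l%:R ^+ 10 by rewrite mulr_gt0 ?exprn_gt0// ltr0n.
  rewrite -(ler_pXn2r (ltn0Sn 1)) ?nnegrE; first last.
  - by rewrite invr_ge0 mulr_ge0// ltW.
  - by rewrite mulr_ge0// ltW.
  rewrite exprMn exprVn -[leRHS]mul1r ler_pdivlMr; last by rewrite exprn_gt0// mulr_gt0.
  have e1 : Delta ^+ 2 = d ^+ 2 / (Phi ^+ 2 * l%:R ^+ 10).
    by rewrite /Delta; field; rewrite PhiN lN.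
  have k1 : K%:R ^+ 2 * Delta ^+ 2 <= 24 * Q%:R * (d ^+ 2 * ln #|V|%:R) / (Phi ^+ 2 * l%:R ^+ 10).
    rewrite e1 mulrA ler_pM2r ?invr_gt0//.
    have -> : 24 * Q%:R * (d ^+ 2 * ln #|V|%:R) = 3 * (8 * ln #|V|%:R * Q%:R) * d ^+ 2 :> R by ring.
    by rewrite ler_wpM2r// sqr_ge0.
  have k2 : 24 * Q%:R * (d ^+ 2 * ln #|V|%:R) / (Phi ^+ 2 * l%:R ^+ 10) <=
     24 * Q%:R * ((c4 * CQ%:R ^+ 7)^-1 * Phi ^+ 2 * l%:R) / (Phi ^+ 2 * l%:R ^+ 10).
    by rewrite ler_pM2r ?invr_gt0// ler_wpM2l ?mulr_ge0.
  have x0 : 0 <= (4 * Q%:R ^+ 3 : R) ^+ 2 by exact: sqr_ge0.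
  apply: le_trans (ler_wpM2r x0 (le_trans k1 k2)) _.
  rewrite Qr.
  have -> : 24 * (CQ%:R * l%:R) * ((c4 * CQ%:R ^+ 7)^-1 * Phi ^+ 2 * l%:R) / (Phi ^+ 2 * l%:R ^+ 10) *
     (4 * (CQ%:R * l%:R) ^+ 3) ^+ 2 = 384 / c4 / l%:R ^+ 2.
    by field; rewrite CQ0 PhiN lN (lt0r_neq0 c4p).
  rewrite ler_pdivrMr ?exprn_gt0 ?ltr0n// mul1r.
  have : 1 <= (l%:R : R) ^+ 2 by rewrite exprn_ege1.
  by rewrite c4E; move: (_ ^+ 2); clear => y; lra.
have := @core_scaled R N V c Phi r w (fun x y => th * D x y) (fun i => th * s i) l Q.-1 T0 K Delta BQ.
rewrite QE sumw thm.
have [Dd Ds Dt] := Dm.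
have DE : \sum_x \sum_y c x y * (th * D x y) = th * \sum_x \sum_y c x y * D x y.
  rewrite mulr_sumr; apply: eq_bigr => x _; rewrite mulr_sumr; apply: eq_bigr => y _.
  by rewrite mulrCA.
have h1 x : \sum_i (\sum_k w i k * x k) ^+ 2 <= \sum_k x k ^+ 2.
  apply: le_trans (iso x); rewrite ler_sum// => i _.
  under eq_bigr do rewrite /w -mulrA.
  by rewrite -mulr_sumr exprMn sq2 ler_piMl// sqr_ge0.
have h2 : pseudometric (fun x y => th * D x y).
  split=> [i|i j|i j k]; rewrite ?Dd ?mulr0//; first by rewrite Ds.
  by rewrite -mulrDr ler_pM2l.
have h3 i : 0 <= th * s i by rewrite mulr_ge0// ltW.
have h4 i j : sqd w i j <= th * s i + th * s j + th * D i j.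
  by rewrite sw -!mulrDr ler_pM2l.
have h5 : BQ * (T0 * (15 * l))%:R <= Q%:R.
  by rewrite Qr mulnA natrM mulrA ler_wpM2r.
have h6 : \sum_i th * s i <= 3 / 2 * r%:R / (32 * 100 * Q%:R ^+ 3).
  rewrite -mulr_sumr -thm -c32E -[leRHS]mulrA ler_pM2l//.
  rewrite ler_pdivlMr; last by rewrite mulr_gt0// exprn_gt0// ltr0n.
  apply: ltW; apply: le_lt_trans small; rewrite Qr exprMn.
  by rewrite [leLHS]mulrC mulrA.
have hB : 1280 * 1000 <= BQ by rewrite BQE.
move=> /(_ c0 (ltW Phi0) ex r0 h1 h2 h3 h4 erefl l0 rl T0_ge hB h5 (ltW D0) K0 Kl KD h6).
rewrite DE -thm.
have e : Phi * Delta = d / l%:R ^+ 5 by rewrite /Delta; field; rewrite PhiN lN.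
rewrite e.
have -> : d / l%:R ^+ 5 * (th * m) = th * (d * m / l%:R ^+ 5) by ring.
have -> : forall W : R, 100 * (th * W) = th * (100 * W) by move=> W; ring.
rewrite ler_pM2l// ler_pdivrMr// => h; apply: le_trans h _.
by rewrite le_eqVlt; apply/orP; left; apply/eqP; ring.
Qed.

(** * Functional calculus of symmetric matrices *)

Lemma char_poly_conj (F : fieldType) n (P D : 'M[F]_n) : P \in unitmx ->
  char_poly (invmx P *m D *m P) = char_poly D.
Proof.
move=> uP; rewrite /char_poly /char_poly_mx.
have e : map_mx polyC (invmx P) *m map_mx polyC P = 1%:M by rewrite -map_mxM mulVmx// map_mx1.
have -> : 'X%:M - map_mx polyC (invmx P *m D *m P) =
    map_mx polyC (invmx P) *m ('X%:M - map_mx polyC D) *m map_mx polyC P.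
  rewrite mulmxBr mulmxBl !map_mxM; congr (_ - _).
  by rewrite mul_mx_scalar -scalemxAl e scalemx1.
by rewrite !det_mulmx mulrAC -det_mulmx e det1 mul1r.
Qed.

Lemma commute_change_basis (F : fieldType) n (P Q A S : 'M[F]_n) : P \in unitmx ->
  invmx P *m A *m P = S -> invmx Q *m A *m Q = S -> Q \in unitmx ->
  (Q *m invmx P) *m A = A *m (Q *m invmx P).
Proof.
move=> uP eP eQ uQ; have e1 : invmx P *m A = S *m invmx P by rewrite -eP mulmxK.
have e2 : Q *m S = A *m Q by rewrite -eQ -mulmxA mulKVmx.
by rewrite -mulmxA e1 mulmxA e2 -mulmxA.
Qed.

Lemma change_basis (F : fieldType) n (P Q A : 'M[F]_n) : P \in unitmx -> Q \in unitmx ->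
  (Q *m invmx P) *m A = A *m (Q *m invmx P) -> invmx Q *m A *m Q = invmx P *m A *m P.
Proof.
move=> uP uQ e; have -> : invmx Q *m A *m Q = invmx Q *m (A *m (Q *m invmx P)) *m P.
  by rewrite !mulmxA mulmxKV.
by rewrite -e -(mulmxA Q) mulKmx.
Qed.

Section SpectralCalculus.
Import complex.
Variables (R : realType) (n : nat).
Implicit Types (S : 'M[R]_n) (P : 'M[complex R]_n) (mu : 'I_n -> R).

Notation C := (complex R).
Notation iota := (@real_complex_def R (Phant R)).

Definition calc_diag mu (f : R -> R) : 'M[C]_n := diag_mx (\row_k iota (f (mu k))).
Definition calc_mx P mu (f : R -> R) : 'M[C]_n := invmx P *m calc_diag mu f *m P.

Lemma conj_iota (x : R) : Num.conj (iota x) = iota x.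
Proof. exact: conjc_real. Qed.

Lemma calc_diag_mul mu f (U : 'M[C]_n) i j : (calc_diag mu f *m U) i j = iota (f (mu i)) * U i j.
Proof. by rewrite mul_diag_mx !mxE. Qed.

Lemma mul_calc_diag mu f (U : 'M[C]_n) i j : (U *m calc_diag mu f) i j = U i j * iota (f (mu j)).
Proof. by rewrite mul_mx_diag !mxE. Qed.

Lemma hermitian_calc (A : 'M[C]_n) : A \is hermsymmx ->
  exists P mu, P \is unitarymx /\ A = calc_mx P mu idfun.
Proof.
move=> h; exists (spectralmx A), (fun k => complex.Re (spectral_diag A 0 k)).
split; first exact: spectral_unitarymx.
have e := orthomx_spectralP (hermitian_normalmx h); rewrite {1}e.
rewrite /calc_mx; suff -> : calc_diag (fun k => complex.Re (spectral_diag A 0 k)) idfun = diag_mx (spectral_diag A) by [].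
congr diag_mx; apply/rowP => k; rewrite mxE /=.
by rewrite RRe_real//; exact: (mxOverP (hermitian_spectral_diag_real h)).
Qed.

Lemma spectral_exists S : S^T = S ->
  exists P mu, P \is unitarymx /\ map_mx iota S = calc_mx P mu idfun.
Proof.
move=> symS; apply: hermitian_calc; apply: realsym_hermsym.
  by apply/eqP; rewrite expr0 scale1r map_mx_id_in // map_trmx symS.
by apply/mxOverP => i j; rewrite mxE; apply/complex_realP; exists (S i j).
Qed.

Lemma calc_diagC mu f : map_mx Num.conj (calc_diag mu f) = calc_diag mu f.
Proof.
rewrite /calc_diag map_diag_mx; congr diag_mx; apply/rowP => k.
by rewrite mxE mxE; exact: conj_iota.
Qed.

(* Conjugation changes the eigenbasis by a matrix commuting with the diagonal. *)
Lemma calc_mx_conj P mu S f : P \is unitarymx -> map_mx iota S = calc_mx P mu idfun ->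
  map_mx Num.conj (calc_mx P mu f) = calc_mx P mu f.
Proof.
move=> /unitarymx_unit unitP eS.
set Q := map_mx Num.conj P.
have unitQ : Q \in unitmx by rewrite map_unitmx.
have conjS : map_mx Num.conj (map_mx iota S) = map_mx iota S.
  by apply/matrixP => i j; rewrite mxE mxE conj_iota.
have eQ g : map_mx Num.conj (calc_mx P mu g) = invmx Q *m calc_diag mu g *m Q.
  by rewrite /calc_mx 2!map_mxM map_invmx calc_diagC.
have comm : Q *m invmx P *m calc_diag mu idfun = calc_diag mu idfun *m (Q *m invmx P).
  by apply: (commute_change_basis unitP (esym eS) _ unitQ); rewrite -eQ -eS.
rewrite eQ; apply: (change_basis unitP unitQ); move: comm; move: (Q *m invmx P) => U comm.
apply/matrixP => i j; move/matrixP: comm => /(_ i j) e.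
rewrite (calc_diag_mul mu f U i j) (mul_calc_diag mu f U i j).
rewrite (calc_diag_mul mu idfun U i j) (mul_calc_diag mu idfun U i j) in e.
have [->|u0] := eqVneq (U i j) 0; first by rewrite mul0r mulr0.
suff -> : mu i = mu j by rewrite mulrC.
by apply: complexI; apply: (mulfI u0); rewrite [RHS]e mulrC.
Qed.

Definition calc P mu (f : R -> R) : 'M[R]_n := map_mx (@complex.Re R) (calc_mx P mu f).

Lemma calc_iota P mu S f : P \is unitarymx -> map_mx iota S = calc_mx P mu idfun ->
  map_mx iota (calc P mu f) = calc_mx P mu f.
Proof.
move=> uP eS; apply/matrixP => i j; rewrite mxE mxE RRe_real//; apply/CrealP.
by have /matrixP/(_ i j) := calc_mx_conj f uP eS; rewrite mxE.
Qed.

Lemma calc_mxD P mu f g : calc_mx P mu (fun x => f x + g x) = calc_mx P mu f + calc_mx P mu g.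
Proof.
rewrite /calc_mx; have -> : calc_diag mu (fun x => f x + g x) = calc_diag mu f + calc_diag mu g.
  apply/matrixP => i j; rewrite /calc_diag mxE mxE [RHS]mxE 4!mxE.
  by rewrite -mulrnDl; congr (_ *+ _); exact: rmorphD.
by rewrite mulmxDr mulmxDl.
Qed.

Lemma calc_mxM P mu f g : P \is unitarymx ->
  calc_mx P mu (fun x => f x * g x) = calc_mx P mu f *m calc_mx P mu g.
Proof.
move=> /unitarymx_unit uP; rewrite /calc_mx.
have -> : calc_diag mu (fun x => f x * g x) = calc_diag mu f *m calc_diag mu g.
  rewrite /calc_diag mulmx_diag; congr diag_mx; apply/rowP => k; rewrite 4!mxE.
  exact: rmorphM.
set X := calc_diag mu f; set Y := calc_diag mu g.
by rewrite [RHS]mulmxA (mulmxA (_ *m P)) (mulmxK uP) (mulmxA _ X Y).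
Qed.

Lemma calc_mx_tr P mu S f : P \is unitarymx -> map_mx iota S = calc_mx P mu idfun ->
  (calc_mx P mu f)^T = calc_mx P mu f.
Proof.
move=> uP eS; rewrite -{1}(calc_mx_conj f uP eS) /calc_mx (invmx_unitary uP) map_mxM map_mxM calc_diagC.
have -> : map_mx Num.conj (map_mx Num.conj P^T) = P^T.
  by apply/matrixP => i j; rewrite mxE mxE conjCK.
by rewrite trmx_mul trmx_mul trmxK /calc_diag tr_diag_mx mulmxA map_trmx.
Qed.

Lemma mapiota_inj : injective (map_mx iota : 'M[R]_n -> 'M[C]_n).
Proof. exact: map_mx_inj. Qed.

End SpectralCalculus.

(** The interface through which the spectral theorem is used. It hides that the eigenbasis comes
    from a unitary diagonalization over the complex numbers. *)
Record calculus (R : realType) (n : nat) (S : 'M[R]_n) := Calculus {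
  eigv : 'I_n -> R;
  fmx : (R -> R) -> 'M[R]_n;
  fmx_id : fmx idfun = S;
  fmx_cst : forall c, fmx (fun=> c) = c%:M;
  fmxD : forall f g, fmx (fun x => f x + g x) = fmx f + fmx g;
  fmxM : forall f g, fmx (fun x => f x * g x) = fmx f *m fmx g;
  fmx_sym : forall f, (fmx f)^T = fmx f;
  eq_fmx : forall f g, (forall k, f (eigv k) = g (eigv k)) -> fmx f = fmx g;
  tr_fmx : forall f, \tr (fmx f) = \sum_k f (eigv k);
  char_fmx : char_poly S = \prod_k ('X - (eigv k)%:P)
}.

Section Existence.
Import complex.

Lemma calculus_exists (R : realType) (n : nat) (S : 'M[R]_n) : S^T = S -> inhabited (calculus S).
Proof.
move=> /spectral_exists[P [mu [uP eS]]]; have uP' := unitarymx_unit uP.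
have ci f := calc_iota f uP eS.
constructor; exists mu (calc P mu).
- by apply: mapiota_inj; rewrite ci.
- move=> c; apply: mapiota_inj; rewrite ci map_scalar_mx /calc_mx.
  have -> : calc_diag mu (fun=> c) = (real_complex R c)%:M.
    by apply/matrixP => i j; rewrite /calc_diag !mxE.
  by rewrite mul_mx_scalar -scalemxAl mulVmx// scalemx1.
- move=> f g; apply/matrixP => i j; rewrite /calc; move: (calc_mxD P mu f g); move: (calc_mx P mu f) (calc_mx P mu g) => X Y e.
  by rewrite mxE e mxE [RHS]mxE 2!mxE raddfD.
- move=> f g; apply: mapiota_inj.
  apply: (etrans (ci _)); apply: (etrans (calc_mxM _ _ _ uP)).
  by apply: esym; apply: (etrans (map_mxM _ _ _)); congr mulmx; exact: ci.
- move=> f; apply: mapiota_inj; apply: (etrans (esym (map_trmx _ _))).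
  by rewrite ci; exact: calc_mx_tr uP eS.
- move=> f g fg; rewrite /calc /calc_mx; suff -> : calc_diag mu f = calc_diag mu g by [].
  by rewrite /calc_diag; congr diag_mx; apply/rowP => k; rewrite 2!mxE fg.
- move=> f; apply: complexI; apply: (etrans (esym (trace_map_mx (real_complex R) _))).
  rewrite ci /calc_mx mxtrace_mulC mulmxA mulmxV// mul1mx mxtrace_diag.
  by rewrite [RHS]rmorph_sum; apply: eq_bigr => k _; rewrite mxE.
apply: (map_poly_inj (real_complex R)); apply: (etrans (map_char_poly _ _)).
rewrite eS /calc_mx char_poly_conj//.
rewrite char_poly_trig ?diag_mx_is_trig// rmorph_prod /=; apply: eq_bigr => k _.
by rewrite rmorphB /= map_polyX map_polyC /= /calc_diag 2!mxE eqxx mulr1n.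
Qed.

End Existence.

(** * Positive semidefinite matrices *)

Section Psd.
Variables (R : realType) (n : nat).
Implicit Types (A B G S : 'M[R]_n).

Definition qf A (x : 'I_n -> R) : R := \sum_i \sum_j x i * A i j * x j.
Definition psd A := forall x, 0 <= qf A x.

Lemma qfD A B (x : 'I_n -> R) : qf (A + B) x = qf A x + qf B x.
Proof.
rewrite /qf -big_split; apply: eq_bigr => i _; rewrite -big_split; apply: eq_bigr => j _.
by rewrite mxE /=; ring.
Qed.

Lemma qfZ a A (x : 'I_n -> R) : qf (a *: A) x = a * qf A x.
Proof.
rewrite /qf mulr_sumr; apply: eq_bigr => i _; rewrite mulr_sumr; apply: eq_bigr => j _.
by rewrite mxE /=; ring.
Qed.

Lemma qf1 (x : 'I_n -> R) : qf 1%:M x = \sum_i x i ^+ 2.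
Proof.
apply: eq_bigr => i _; rewrite (bigD1 i)//= big1 ?addr0; first by rewrite mxE eqxx mulr1 expr2.
by move=> j ji; rewrite mxE eq_sym (negbTE ji) mulr0 mul0r.
Qed.

Lemma psdD A B : psd A -> psd B -> psd (A + B).
Proof. by move=> hA hB x; rewrite qfD addr_ge0. Qed.

Lemma psdZ a A : 0 <= a -> psd A -> psd (a *: A).
Proof. by move=> a0 hA x; rewrite qfZ mulr_ge0. Qed.

Lemma qf_sqr G (x : 'I_n -> R) : G^T = G -> qf (G *m G) x = \sum_k (\sum_i G i k * x i) ^+ 2.
Proof.
move=> sG; have sGe i j : G i j = G j i by rewrite -{1}sG mxE.
under [RHS]eq_bigr do rewrite expr2 mulr_suml.
rewrite exchange_big; apply: eq_bigr => i _ /=.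
under [RHS]eq_bigr do rewrite mulr_sumr.
rewrite exchange_big; apply: eq_bigr => j _ /=.
rewrite mxE mulr_sumr mulr_suml; apply: eq_bigr => k _.
by rewrite (sGe k j); ring.
Qed.

Lemma psd_sqr G : G^T = G -> psd (G *m G).
Proof. by move=> sG x; rewrite qf_sqr// sumr_ge0// => k _; exact: sqr_ge0. Qed.

Lemma tr_conj A G : G^T = G -> \tr (G *m A *m G) = \sum_k qf A (fun i => G i k).
Proof.
move=> sG; apply: eq_bigr => k _; rewrite mxE /qf.
have sGe i j : G i j = G j i by rewrite -{1}sG mxE.
under eq_bigr do rewrite mxE mulr_suml.
rewrite exchange_big; apply: eq_bigr => i _; apply: eq_bigr => j _.
by rewrite (sGe k i).
Qed.

Lemma tr_conj_ge0 A G : G^T = G -> psd A -> 0 <= \tr (G *m A *m G).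
Proof. by move=> sG hA; rewrite tr_conj// sumr_ge0. Qed.

Lemma tr_sqr A : A^T = A -> \tr (A *m A) = \sum_i \sum_j A i j ^+ 2.
Proof.
move=> sA; apply: eq_bigr => i _; rewrite mxE; apply: eq_bigr => j _.
by rewrite -{2}sA mxE expr2.
Qed.

Section Calculus.
Variables (S : 'M[R]_n) (c : calculus S).
Implicit Types f g : R -> R.

Lemma fmxZ a f : fmx c (fun x => a * f x) = a *: fmx c f.
Proof. by rewrite fmxM fmx_cst mul_scalar_mx. Qed.

Lemma fmx_mulr f : fmx c f *m S = fmx c (fun x => f x * x).
Proof. by rewrite fmxM; congr mulmx; rewrite fmx_id. Qed.

Lemma fmx1 : fmx c (fun=> 1) = 1%:M. Proof. exact: fmx_cst. Qed.

Lemma fmxB f g : fmx c (fun x => f x - g x) = fmx c f - fmx c g.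
Proof.
rewrite fmxD; congr (_ + _); rewrite -scaleN1r -fmxZ; apply: eq_fmx => k.
by rewrite mulN1r.
Qed.

Lemma fmx_sqrt f : (forall k, 0 <= f (eigv c k)) ->
  fmx c f = fmx c (fun x => Num.sqrt (f x)) *m fmx c (fun x => Num.sqrt (f x)).
Proof.
by move=> f0; rewrite -fmxM; apply: eq_fmx => k; rewrite -expr2 sqr_sqrtr.
Qed.

Lemma psd_fmx f : (forall k, 0 <= f (eigv c k)) -> psd (fmx c f).
Proof. by move=> f0; rewrite fmx_sqrt//; apply: psd_sqr; exact: fmx_sym. Qed.

Lemma tr_fmx_ge0 f A : (forall k, 0 <= f (eigv c k)) -> psd A -> 0 <= \tr (fmx c f *m A).
Proof.
move=> f0 hA; rewrite fmx_sqrt// -mulmxA mxtrace_mulC.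
by apply: tr_conj_ge0 => //; exact: fmx_sym.
Qed.

(** Tested on the spectral projection of the eigenvalue in question. *)
Lemma eigv_le a k : psd (a%:M - S) -> eigv c k <= a.
Proof.
move=> h; pose e := fun x : R => (x == eigv c k)%:R : R.
have : 0 <= \tr (fmx c e *m (a%:M - S)) by apply: tr_fmx_ge0 => // j; rewrite ler0n.
rewrite mulmxBr -(fmx_cst c) -fmxM fmx_mulr -fmxB tr_fmx.
have -> : \sum_j (e (eigv c j) * a - e (eigv c j) * eigv c j) = (a - eigv c k) * \sum_j e (eigv c j).
  rewrite mulr_sumr; apply: eq_bigr => j _; rewrite /e /=; case: eqVneq => [->|_]; rewrite ?mul1r ?mulr1 ?mul0r ?mulr0 ?subr0 ?subrr//.
rewrite pmulr_lge0 ?subr_ge0// (bigD1 k)//= /e eqxx ltr_pwDl// sumr_ge0//.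
Qed.

(** The matrix of eps^2 - f^2 is positive semidefinite, and its i-th diagonal entry bounds the
    Euclidean norm of the i-th row of [fmx c f]. *)
Lemma fmx_entry f eps i j : (forall k, `|f (eigv c k)| <= eps) -> `|fmx c f i j| <= eps.
Proof.
move=> fe; have e0 : 0 <= eps by apply: le_trans (fe i).
have h0 k : 0 <= eps ^+ 2 - f (eigv c k) ^+ 2.
  by rewrite subr_ge0 -[f _ ^+ 2]real_normK ?num_real// lerXn2r ?nnegrE.
have := @psd_fmx (fun x => eps ^+ 2 - f x ^+ 2) h0 (fun k => (k == i)%:R).
have -> : fmx c (fun x => eps ^+ 2 - f x ^+ 2) = (eps ^+ 2)%:M - fmx c f *m fmx c f.
  by rewrite fmxB fmx_cst -fmxM; congr (_ - _); apply: eq_fmx => k; rewrite expr2.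
have -> A : qf A (fun k => (k == i)%:R) = A i i.
  rewrite /qf (bigD1 i)//= [X in _ + X]big1 ?addr0.
    rewrite (bigD1 i)//= big1 ?addr0; first by rewrite eqxx mul1r mulr1.
    by move=> k ki; rewrite (negbTE ki) mulr0.
  by move=> k ki; rewrite big1// => l _; rewrite (negbTE ki) !mul0r.
rewrite mxE [X in X + _]mxE eqxx mulr1n [X in _ + X]mxE mxE subr_ge0 => h.
rewrite -(@ler_pXn2r _ 2)// ?nnegrE// real_normK ?num_real//; apply: le_trans h.
have sGe k l : fmx c f k l = fmx c f l k by rewrite -{1}(fmx_sym c f) mxE.
rewrite (bigD1 j)//= (sGe j i) -expr2 lerDl sumr_ge0// => k _.
by rewrite (sGe k i) -expr2 sqr_ge0.
Qed.

End Calculus.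

Lemma eigv_sub_le S (c : calculus S) A k : S = 1%:M - A -> psd A -> eigv c k <= 1.
Proof. by move=> e h; apply: eigv_le; rewrite e opprB addrCA subrr addr0. Qed.

End Psd.

Section Counting.
Variables (R : realType) (n : nat).

(* With G the spectral projection of L below x/10: tr G <= tr P + tr G / 10. *)
Lemma kth_eigenvalue_lower (L P : 'M[R]_n) (x t : R) (k : nat) :
  L^T = L -> 0 < x -> psd P -> psd (L - x *: (1%:M - P)) -> \tr P <= t ->
  10 * t < 9 * k%:R -> kth_eigenvalue_ge L k (x / 10).
Proof.
move=> /calculus_exists[c] x0 hP hL tP tk.
pose e := fun y : R => (y < x / 10)%R%:R : R.
pose s := sort <=%R [seq eigv c i | i <- enum 'I_n].
have ps : perm_eq s [seq eigv c i | i <- enum 'I_n] by rewrite perm_sort.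
exists s; first split.
- by apply: sort_sorted; exact: le_total.
- by rewrite (char_fmx c) (perm_big _ ps)/= big_map big_enum.
move=> kn; rewrite leNgt; apply/negP => lt.
have sizes : size s = n by rewrite (perm_size ps) size_map size_enum_ord.
have k0 : (0 < k)%N.
  case: (k) tk => // tk0; have : 0 <= \tr P.
    have := tr_fmx_ge0 (c := c) (f := fun=> 1) (A := P) (fun=> ler01) hP.
    by rewrite fmx1 mul1mx.
  by lra.
have cnt : (k <= count (fun y => y < x / 10)%R s)%N.
  rewrite -[s](cat_take_drop k) count_cat; apply: leq_trans (leq_addr _ _).
  have st : size (take k s) = k by rewrite size_takel// sizes.
  suff /eqP -> : count (fun y => y < x / 10)%R (take k s) == size (take k s) by rewrite st.
  rewrite -all_count; apply/(all_nthP 0) => i; rewrite st => ik.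
  rewrite nth_take//; apply: le_lt_trans lt.
  apply: (sorted_leq_nth (@le_trans _ _) (@lexx _ _)).
  - by apply: sort_sorted; exact: le_total.
  - by rewrite inE sizes (leq_trans ik).
  - by rewrite inE sizes; case: (k) k0 kn.
  - by case: (k) k0 ik.
have trG : \tr (fmx c e) = (count (fun y => y < x / 10) s)%:R.
  rewrite tr_fmx (permP ps) count_map -sum1_count natr_sum [RHS]big_mkcond [RHS]big_enum /=.
  by apply: eq_bigr => i _; rewrite /e /=; case: ifP.
have kG : k%:R <= \tr (fmx c e) by rewrite trG ler_nat.
have e0 i : 0 <= e (eigv c i) by rewrite ler0n.
have := tr_fmx_ge0 (c := c) e0 hL.
have hPG : 0 <= \tr (fmx c (fun y => 1 - e y) *m P).
  by apply: tr_fmx_ge0 => // i; rewrite subr_ge0 lern1 leq_b1.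
move: hPG; rewrite fmxB fmx1 mulmxBl mul1mx raddfB /= => hPG.
rewrite mulmxBr raddfB /= -scalemxAr mulmxBr mulmx1 linearZ /= raddfB /=.
have : \tr (fmx c e *m L) <= x / 10 * \tr (fmx c e).
  rewrite fmx_mulr !tr_fmx mulr_sumr; apply: ler_sum => i _.
  by rewrite /e /=; case: ltP => h; rewrite ?mul1r ?mul0r ?mulr1 ?mulr0// ltW.
move: hPG kG tP tk; move: (\tr (fmx c e)) (\tr (fmx c e *m L)) (\tr (fmx c e *m P)) (\tr P) (k%:R).
clear -x0 => g gl gp p k' h1 h2 h3 h4 h5 h6.
have : x * (9 * g - 10 * p) <= 0 by nra.
by rewrite pmulr_rle0//; lra.
Qed.

End Counting.

(** * The spectral potential and its Gram vectors *)

Section PositivePart.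
Variables (R : realType) (n : nat).
Implicit Types (S A : 'M[R]_n).

Definition pos_part (x : R) := Num.max x 0.
Definition neg_part (x : R) := Num.max (- x) 0.

Lemma pos_part_ge0 x : 0 <= pos_part x. Proof. by rewrite le_max lexx orbT. Qed.
Lemma neg_part_ge0 x : 0 <= neg_part x. Proof. by rewrite le_max lexx orbT. Qed.
Lemma pos_neg x : pos_part x - neg_part x = x.
Proof. by rewrite /pos_part /neg_part; case: (leP x 0) => ?; case: (leP (- x) 0) => ?; lra. Qed.
Lemma pos_neg0 x : pos_part x * neg_part x = 0.
Proof. by rewrite /pos_part /neg_part; case: (leP x 0) => ?; case: (leP (- x) 0) => ?; rewrite ?mulr0 ?mul0r//; nra. Qed.

Lemma fmx_pos_neg S (c : calculus S) : fmx c pos_part - fmx c neg_part = S.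
Proof. by rewrite -fmxB; apply: etrans (fmx_id c); apply: eq_fmx => k; rewrite pos_neg. Qed.

Lemma fmx_pos_neg0 S (c : calculus S) : fmx c pos_part *m fmx c neg_part = 0.
Proof. rewrite -fmxM; apply: etrans (raddf0 (@scalar_mx R n)); apply: etrans (fmx_cst c 0).
by apply: eq_fmx => k; rewrite pos_neg0. Qed.

Definition potential S (c : calculus S) : R := \tr (fmx c pos_part *m fmx c pos_part).

(* The potential is the squared distance of S to the negative semidefinite cone. *)
Lemma potential_smooth S S' (c : calculus S) (c' : calculus S') (H := S' - S) :
  potential c' <= potential c + 2 * \tr (fmx c pos_part *m H) + \tr (H *m H).
Proof.
rewrite /potential.
set P := fmx c pos_part; set N := fmx c neg_part; set P' := fmx c' pos_part; set N' := fmx c' neg_part.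
have e1 : S' + N = P + H.
  have := fmx_pos_neg c; rewrite -/P -/N => /eqP; rewrite subr_eq => /eqP ->.
  by rewrite /H addrAC [S + _]addrC subrK.
have e2 : S' + N = P' + (N - N').
  have := fmx_pos_neg c'; rewrite -/P' -/N' => /eqP; rewrite subr_eq => /eqP ->.
  by rewrite -addrA; congr (_ + _); rewrite addrC subrK.
have tr2 (X Y : 'M[R]_n) : \tr ((X + Y) *m (X + Y)) = \tr (X *m X) + 2 * \tr (X *m Y) + \tr (Y *m Y).
  rewrite mulmxDr !mulmxDl !raddfD /= (mxtrace_mulC Y X); ring.
have := congr1 (fun X => \tr (X *m X)) (etrans (esym e2) e1).
rewrite (tr2 P' (N - N')) (tr2 P H) => <-; rewrite mulmxBr fmx_pos_neg0 subr0.
have h1 : 0 <= \tr (P' *m N).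
  apply: tr_fmx_ge0; first by move=> k; exact: pos_part_ge0.
  by apply: psd_fmx => k; exact: neg_part_ge0.
have h2 : 0 <= \tr ((N - N') *m (N - N')).
  by rewrite tr_sqr ?raddfB /= ?fmx_sym// sumr_ge0// => i _; rewrite sumr_ge0// => j _; exact: sqr_ge0.
by move: h1 h2; set u := \tr (P' *m N); set w := \tr (_ *m (N - N')); lra.
Qed.

Lemma tr_pos_mul S (c : calculus S) : \tr (fmx c pos_part *m S) = potential c.
Proof.
rewrite fmx_mulr /potential -fmxM; congr mxtrace; apply: eq_fmx => k.
by rewrite -[X in _ * X = _]pos_neg mulrBr pos_neg0 subr0.
Qed.

Lemma tr_pos_le S (c : calculus S) : (\tr (fmx c pos_part)) ^+ 2 <= n%:R * potential c.
Proof.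
rewrite /potential -fmxM !tr_fmx; set y := fun k => pos_part (eigv c k).
rewrite -/(\sum_k y k); have : 0 <= \sum_i \sum_j (y i - y j) ^+ 2.
  by rewrite sumr_ge0// => i _; rewrite sumr_ge0// => j _; exact: sqr_ge0.
have -> : \sum_i \sum_j (y i - y j) ^+ 2 = 2 * (n%:R * (\sum_k y k * y k)) - 2 * (\sum_k y k) ^+ 2.
  transitivity (\sum_i (y i * y i * n%:R + \sum_k y k * y k - 2 * y i * \sum_k y k)).
    apply: eq_bigr => i _; rewrite mulr_sumr -[n in n%:R]card_ord -sum1_card natr_sum mulr_sumr.
    by rewrite -big_split -sumrB; apply: eq_bigr => j _ /=; ring.
  rewrite sumrB big_split /= -mulr_suml -mulr_suml -mulr_sumr sumr_const card_ord.
  by rewrite -[_ *+ n]mulr_natl; ring.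
by lra.
Qed.

End PositivePart.

Section GramVectors.
Variables (R : realType) (n : nat) (A : 'M[R]_n) (c : calculus (1%:M - A)).
Hypothesis psdA : psd A.

(** The rows of the square root of the positive part; their Gram matrix is the gradient of the
    potential up to the factor 2. *)
Definition gram (i k : 'I_n) : R := fmx c (fun x => Num.sqrt (pos_part x)) i k.
Notation P := (fmx c (@pos_part R)).

Lemma gramE i j : P i j = \sum_k gram i k * gram j k.
Proof.
rewrite fmx_sqrt => [|k]; last exact: pos_part_ge0.
rewrite mxE; apply: eq_bigr => k _; rewrite /gram; congr (_ * _).
by rewrite -{1}(fmx_sym c) mxE.
Qed.

Lemma nrm_gram i : nrm gram i = P i i.
Proof. by rewrite gramE; apply: eq_bigr => k _; rewrite expr2. Qed.

Lemma sqd_gram i j : sqd gram i j = P i i + P j j - 2 * P i j.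
Proof.
rewrite !gramE mulr_sumr -big_split -sumrB; apply: eq_bigr => k _ /=; ring.
Qed.

(** Isotropy holds because 1 - A has no eigenvalue above 1 when A is positive semidefinite. *)
Lemma gram_isometry (x : 'I_n -> R) : \sum_i (\sum_k gram i k * x k) ^+ 2 <= \sum_k x k ^+ 2.
Proof.
have h : psd (1%:M - P).
  have <- : fmx c (fun x => 1 - pos_part x) = 1%:M - P by rewrite fmxB fmx1.
  apply: psd_fmx => k; rewrite subr_ge0 ge_max ler01 andbT.
  by apply: (eigv_sub_le c k _ psdA).
have := h x; rewrite qfD -scaleN1r qfZ qf1 mulN1r subr_ge0; apply: le_trans.
rewrite fmx_sqrt => [|k]; last exact: pos_part_ge0.
rewrite qf_sqr ?fmx_sym//; apply: ler_sum => i _.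
by under eq_bigr => k _ do rewrite /gram -(fmx_sym c) mxE.
Qed.

End GramVectors.

(** * Newton-Schulz iteration *)

Section ScalarNewtonSchulz.
Variable R : realType.
Implicit Types s h : R.

Definition ns_map h : R := h * (3 - h ^+ 2) / 2.
Definition ns (k : nat) s : R := iter k ns_map s.

Lemma ns_mapN h : ns_map (- h) = - ns_map h.
Proof. by rewrite /ns_map sqrrN; ring. Qed.

Lemma nsN k s : ns k (- s) = - ns k s.
Proof. by elim: k => //= k ->; exact: ns_mapN. Qed.

Lemma ns_itv k s : 0 <= s <= 1 -> 0 <= ns k s <= 1.
Proof.
move=> hs; elim: k => [//|k]; rewrite /ns iterS -/(ns k s) /ns_map.
move: (ns k s) => h /andP[h0 h1]; apply/andP; split; first by nra.
have : 0 <= (1 - h) ^+ 2 * (2 + h) by rewrite mulr_ge0 ?sqr_ge0//; lra.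
by rewrite expr2 => ?; nra.
Qed.

(** Below 1/2 the map multiplies by (3 - h^2)/2 >= 11/8, and a value above 1/2 stays above. *)
Lemma ns_fast k s : 0 <= s <= 1 -> 1 / 2 <= ns k s \/ s * (11 / 8) ^+ k <= ns k s.
Proof.
move=> hs; elim: k => [|k IH]; first by right; rewrite expr0 mulr1.
have := ns_itv k hs; rewrite /ns iterS -/(ns k s) => /andP[h0 h1].
case: (leP (1 / 2) (ns k s)) => hh.
  by left; rewrite /ns_map; move: (ns k s) hh h0 h1 => h *; nra.
case: IH => [|IH]; first by lra.
right; rewrite exprSr (mulrA s) /ns_map; move: IH; move: (s * _) => z IH.
move: (ns k s) hh h0 h1 IH => h hh h0 h1 IH.
have : h ^+ 2 <= 1 / 4 by nra.
nra.
Qed.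

(** The gap 1 - h is multiplied by (1 - h)(2 + h)/2 <= 5/8; the weaker rate 8/11 is the inverse of
    the growth rate below 1/2. *)
Lemma ns_gap k s : 0 <= s <= 1 -> 1 / 2 <= s -> 1 - ns k s <= (8 / 11) ^+ k.
Proof.
move=> hs s2; suff : 1 - ns k s <= (8 / 11) ^+ k /\ 1 / 2 <= ns k s by case.
elim: k => [|k [IH h2]]; first by split=> //=; rewrite expr0; lra.
have := ns_itv k hs; rewrite /ns iterS -/(ns k s) exprS /ns_map.
move: ((8 / 11) ^+ k) IH; move: (ns k s) h2 => h h2 z IH /andP[h0 h1].
split; last by nra.
have -> : 1 - h * (3 - h ^+ 2) / 2 = (1 - h) * ((1 - h) * (2 + h) / 2) by field.
have : (1 - h) * (2 + h) / 2 <= 8 / 11 by nra.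
have : 0 <= (1 - h) * (2 + h) / 2 by nra.
nra.
Qed.

(** Near 0 the sign is not approximated, but there the factor s is small: either k steps reach 1/2
    and k more close the gap, or s itself is at most (8/11)^k. *)
Lemma ns_approx_ge0 k s : 0 <= s <= 1 -> s * (1 - ns (k + k) s) <= (8 / 11) ^+ k.
Proof.
move=> hs; rewrite /ns iterD -/(ns k s) -/(ns k (ns k s)).
have hk := ns_itv k hs; have hkk := ns_itv k hk.
case: (ns_fast k hs) => h.
  have := ns_gap k hk h; case/andP: hs => s0 s1; case/andP: hkk => a0 a1.
  by move: (ns k (ns k s)) a0 a1 => y ? ? ?; nra.
have s8 : s <= (8 / 11) ^+ k.
  have p : (8 / 11 : R) ^+ k * (11 / 8) ^+ k = 1.
    by rewrite -exprMn_comm; [rewrite (_ : _ * _ = 1) ?expr1n//; field | exact: mulrC].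
  have p0 : 0 < (11 / 8 : R) ^+ k by rewrite exprn_gt0//; lra.
  rewrite -(ler_pM2r p0) p; apply: le_trans h _; by case/andP: hk.
apply: le_trans s8; case/andP: hs => s0 s1; case/andP: hkk => a0 a1.
by move: (ns k (ns k s)) a0 a1 => y ? ?; nra.
Qed.

Lemma ns_approx k s : `|s| <= 1 -> `|s * (1 + ns (k + k) s) / 2 - pos_part s| <= (8 / 11) ^+ k.
Proof.
move=> hs; have key u : 0 <= u <= 1 -> 0 <= u * (1 - ns (k + k) u) / 2 <= (8 / 11) ^+ k.
  move=> hu; have := ns_approx_ge0 k hu; have := ns_itv (k + k) hu; case/andP: hu => u0 u1 /andP[a0 a1].
  have : 0 <= u * (1 - ns (k + k) u) by rewrite mulr_ge0// subr_ge0.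
  by move: (u * _) ((8 / 11) ^+ k) => y z *; lra.
rewrite /pos_part; case: (leP s 0) => s0.
  rewrite subr0; have /key /andP[h1 h2] : 0 <= - s <= 1 by move: hs; rewrite ler0_norm//; lra.
  rewrite nsN in h1 h2; rewrite ler_norml; move: (ns _ _) h1 h2 => y h1 h2.
  by apply/andP; split; move: h1 h2; move: ((8 / 11) ^+ k) => z; rewrite opprK; nra.
have /key /andP[h1 h2] : 0 <= s <= 1 by move: hs; rewrite gtr0_norm//; lra.
rewrite ler_norml; move: (ns _ _) h1 h2 => y h1 h2.
by apply/andP; split; move: h1 h2; move: ((8 / 11) ^+ k) => z; nra.
Qed.

End ScalarNewtonSchulz.

Section Laplacian.
Variables (R : realType) (n : nat) (w : 'M[R]_n).
Hypothesis symw : forall i j, w i j = w j i.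

Lemma laplacianE i j : laplacian w i j = (if i == j then \sum_k w i k else 0) - w i j.
Proof. by rewrite !mxE; case: eqP => _; rewrite ?mulr1n ?mulr0n. Qed.

Lemma laplacian_sym : (laplacian w)^T = laplacian w.
Proof.
apply/matrixP => i j; rewrite mxE !laplacianE eq_sym symw.
by case: eqVneq => [->|].
Qed.

Lemma qf_laplacian x : qf (laplacian w) x = (\sum_i \sum_j w i j * (x i - x j) ^+ 2) / 2.
Proof.
have e1 : qf (laplacian w) x = \sum_i \sum_j w i j * x i ^+ 2 - \sum_i \sum_j w i j * (x i * x j).
  rewrite -sumrB; apply: eq_bigr => i _.
  transitivity (\sum_j ((if i == j then (\sum_k w i k) * x i ^+ 2 else 0) - w i j * (x i * x j))).
    apply: eq_bigr => j _; rewrite laplacianE; case: eqVneq => [->|_]; ring.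
  rewrite sumrB; congr (_ - _); rewrite -big_mkcond (eq_bigl (pred1 i)) => [|j]; last exact: eq_sym.
  by rewrite big_pred1_eq mulr_suml.
have e2 : \sum_i \sum_j w i j * x j ^+ 2 = \sum_i \sum_j w i j * x i ^+ 2.
  by rewrite exchange_big; apply: eq_bigr => i _; apply: eq_bigr => j _; rewrite symw.
have -> : \sum_i \sum_j w i j * (x i - x j) ^+ 2 =
    \sum_i \sum_j w i j * x i ^+ 2 - 2 * (\sum_i \sum_j w i j * (x i * x j)) + \sum_i \sum_j w i j * x j ^+ 2.
  rewrite mulr_sumr -sumrB -big_split; apply: eq_bigr => i _; rewrite mulr_sumr -sumrB -big_split.
  by apply: eq_bigr => j _ /=; ring.
by rewrite e2 e1; field.
Qed.

Hypothesis w0 : forall i j, 0 <= w i j.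

Lemma psd_laplacian : psd (laplacian w).
Proof.
move=> x; rewrite qf_laplacian divr_ge0// sumr_ge0// => i _; rewrite sumr_ge0// => j _.
by rewrite mulr_ge0 ?sqr_ge0.
Qed.

Lemma laplacian_le a : (forall i, \sum_j w i j <= a) -> psd ((2 * a)%:M - laplacian w).
Proof.
move=> ha x; rewrite qfD -scaleN1r qfZ qf_laplacian -scalemx1 qfZ qf1 mulN1r subr_ge0.
rewrite ler_pdivrMr// [leRHS](_ : _ = \sum_i (2 * a * x i ^+ 2) + \sum_j (2 * a * x j ^+ 2)); last first.
  by rewrite -mulr_sumr; ring.
apply: le_trans (_ : \sum_i \sum_j (2 * (w i j * x i ^+ 2) + 2 * (w i j * x j ^+ 2)) <= _).
  apply: ler_sum => i _; apply: ler_sum => j _; have -> : 2 * (w i j * x i ^+ 2) + 2 * (w i j * x j ^+ 2) = w i j * (2 * (x i ^+ 2 + x j ^+ 2)) by ring.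
  rewrite ler_wpM2l//.
  by have := sqr_ge0 (x i + x j); rewrite !expr2; nra.
rewrite (eq_bigr (fun i => \sum_j 2 * (w i j * x i ^+ 2) + \sum_j 2 * (w i j * x j ^+ 2))) => [|i _]; last by rewrite big_split.
rewrite big_split /=; apply: lerD.
  apply: ler_sum => i _; rewrite -mulr_sumr -mulr_suml -mulrA ler_wpM2l// ler_wpM2r ?sqr_ge0//.
rewrite exchange_big; apply: ler_sum => i _; rewrite -mulr_sumr -mulr_suml -mulrA ler_wpM2l// ler_wpM2r ?sqr_ge0//.
by rewrite (eq_bigr (fun j => w i j)).
Qed.

End Laplacian.

(** * The integer iteration as a function of a real matrix *)

Section IntegerTables.
Variables (R : realType) (n : nat).
Notation idx := (iota 0 n).

Definition tab_mx (t : seq (seq int)) : 'M[R]_n := \matrix_(i, j) (entry 0 t i j)%:~R.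

Lemma entry_iota X (d : X) f (i j : 'I_n) : entry d (tab idx f) i j = f i j.
Proof. by rewrite entry_tab size_iota !ltn_ord /= !nth_iota. Qed.

Lemma tab_mxE f : tab_mx (tab idx f) = \matrix_(i, j) (f i j)%:~R.
Proof. by apply/matrixP => i j; rewrite !mxE entry_iota. Qed.

Lemma tab_mxI t (i j : 'I_n) : tab_mx t i j = (entry 0 t i j)%:~R.
Proof. by rewrite mxE. Qed.

Lemma scaleDE (a : R) (X Y : 'M[R]_n) i j : (a *: X + Y) i j = a * X i j + Y i j.
Proof. by rewrite !mxE. Qed.

Lemma scaleBE (a : R) (X Y : 'M[R]_n) i j : (a *: X - Y) i j = a * X i j - Y i j.
Proof. by rewrite !mxE. Qed.

Lemma dot_sum (u v : seq int) : size u = n -> size v = n ->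
  dot u v = \sum_(k < n) nth 0 u k * nth 0 v k.
Proof.
move=> su sv; rewrite /dot sumzE big_map (big_nth (0, 0)) size_zip su sv minnn big_mkord.
by apply: eq_bigr => k _; rewrite nth_zip ?su.
Qed.

Lemma size_row f (i : 'I_n) : size (nth [::] (tab idx f) i : seq int) = n.
Proof. by rewrite (nth_map 0%N) ?size_iota// size_map size_iota. Qed.

Lemma tab_mul f g : tab_mx (mul_tr idx (tab idx f) (tab idx g)) = tab_mx (tab idx f) *m (tab_mx (tab idx g))^T.
Proof.
rewrite /mul_tr [LHS]tab_mxE; apply/matrixP => i j; rewrite mxE [RHS]mxE dot_sum ?size_row// rmorph_sum.
by apply: eq_bigr => k _; rewrite !mxE rmorphM.
Qed.

Lemma tab_mul_eq A B f g : A = tab idx f -> B = tab idx g ->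
  tab_mx (mul_tr idx A B) = tab_mx A *m (tab_mx B)^T.
Proof. by move=> -> ->; exact: tab_mul. Qed.

Variables (lam : nat) (st : seq (seq nat)).
Notation t := (size st).

Definition pair_mx : 'M[R]_n := \matrix_(i, j) (if i == j then 0 else (pair_count st i j)%:R).

Lemma pair_countC i j : pair_count st i j = pair_count st j i.
Proof. by apply: eq_count => p; rewrite orbC. Qed.

Lemma pair_mx_sym i j : pair_mx i j = pair_mx j i.
Proof. by rewrite !mxE eq_sym pair_countC. Qed.

Lemma pair_mx_ge0 i j : 0 <= pair_mx i j.
Proof. by rewrite mxE; case: ifP. Qed.

Lemma deg_countE (i : 'I_n) : (deg_count idx st i)%:R = \sum_j pair_mx i j.
Proof.
have e : iota 0 n = index_iota 0 n by rewrite /index_iota subn0.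
rewrite /deg_count sumnE big_map natr_sum {1}e big_mkord; apply: eq_bigr => j _.
by rewrite mxE -(inj_eq val_inj) eq_sym; case: ifP.
Qed.

Definition scaled_lap : 'M[R]_n := (n%:R * lam%:R / (16 * t%:R)) *: laplacian pair_mx.

Lemma base_mxE : (0 < t)%N -> tab_mx (base_mx idx lam st) = (16 * t%:R) *: (1%:M - scaled_lap).
Proof.
move=> t0; rewrite /base_mx tab_mxE scalerBr scalerA size_iota.
have t1 : (t%:R : R) != 0 by rewrite pnatr_eq0 -lt0n.
rewrite mulrCA mulfV ?mulr1 ?mulf_neq0//; apply/matrixP => i j.
have eR (a b : R) (X Y : 'M[R]_n) : (a *: X - b *: Y) i j = a * X i j - b * Y i j by rewrite !mxE.
rewrite [LHS]mxE eR laplacianE -deg_countE 2!mxE.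
rewrite -(inj_eq val_inj); case: ifP => [/eqP/val_inj ->|h].
  by rewrite mulr1 rmorphB /= -!pmulrn !natrM subr0.
by rewrite mulr0 !sub0r mulrN opprK -pmulrn !natrM.
Qed.

Lemma psd_scaled_lap : psd scaled_lap.
Proof.
apply: psdZ; first by rewrite divr_ge0// mulr_ge0.
by apply: psd_laplacian; [exact: pair_mx_sym | exact: pair_mx_ge0].
Qed.

Lemma scaled_lap_sym : scaled_lap^T = scaled_lap.
Proof. by rewrite /scaled_lap linearZ /= laplacian_sym//; exact: pair_mx_sym. Qed.

(* 16 t times this number is the initial denominator. *)
Definition spread : R := 1 + (n * n)%:R * lam%:R / 8.

Lemma spread_gt0 : 0 < spread.
Proof. by rewrite /spread ltr_pwDl// divr_ge0// mulr_ge0. Qed.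

Lemma eigv_ge (S : 'M[R]_n) (c : calculus S) a k : psd (S - a%:M) -> a <= eigv c k.
Proof.
move=> h; pose e := fun x : R => (x == eigv c k)%:R : R.
have : 0 <= \tr (fmx c e *m (S - a%:M)) by apply: tr_fmx_ge0 => // j; rewrite ler0n.
rewrite mulmxBr -(fmx_cst c) -fmxM fmx_mulr -fmxB tr_fmx.
have -> : \sum_j (e (eigv c j) * eigv c j - e (eigv c j) * a) = (eigv c k - a) * \sum_j e (eigv c j).
  rewrite mulr_sumr; apply: eq_bigr => j _; rewrite /e /=; case: eqVneq => [->|_]; rewrite ?mul1r ?mulr1 ?mul0r ?mulr0 ?subr0 ?subrr//.
by rewrite pmulr_lge0 ?subr_ge0// (bigD1 k)//= /e eqxx ltr_pwDl// sumr_ge0//.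
Qed.

Lemma pair_mx_deg i : \sum_j pair_mx i j <= n%:R * t%:R.
Proof.
apply: le_trans (_ : \sum_(j < n) (t%:R : R) <= _); last by rewrite sumr_const card_ord -[_ *+ n]mulr_natl.
by apply: ler_sum => j _; rewrite mxE; case: ifP => _; rewrite ?ler0n// ler_nat count_size.
Qed.

Lemma eigv_spread (c : calculus (1%:M - scaled_lap)) k : (0 < t)%N -> `|eigv c k| <= spread.
Proof.
move=> t0; rewrite ler_norml; apply/andP; split; last first.
  apply: le_trans (eigv_sub_le c k erefl psd_scaled_lap) _.
  by rewrite /spread lerDl divr_ge0// mulr_ge0.
apply: eigv_ge; have t1 : (t%:R : R) != 0 by rewrite pnatr_eq0 -lt0n.
have a0 : 0 <= n%:R * lam%:R / (16 * t%:R) :> R by rewrite divr_ge0// mulr_ge0.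
have h := psdZ a0 (laplacian_le pair_mx_sym pair_mx_ge0 pair_mx_deg).
have h2 : psd (2 *: 1%:M : 'M[R]_n) by apply: psdZ => // x; rewrite qf1 sumr_ge0// => i _; exact: sqr_ge0.
have e (L : 'M[R]_n) (a u s : R) : u * a + 2 = 1 + s -> u *: a%:M - L + 2 *: 1%:M = 1%:M - L - (- s)%:M.
  move=> e; apply/matrixP => i j; rewrite !mxE; case: (i == j); rewrite ?mulr1n ?mulr0n ?mulr0 ?mulr1 ?oppr0; last by ring.
  have -> : u * a = 1 + s - 2 by lra.
  ring.
have := psdD h h2; rewrite scalerBr -/scaled_lap (e _ _ _ spread)//.
by rewrite /spread natrM; field; rewrite t1.
Qed.

(** No rounding occurs: the tables hold exact numerators, so the iteration is a function of the real
    matrix and the scalar analysis applies to each eigenvalue. *)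
Lemma ns_iter_real (c : calculus (1%:M - scaled_lap)) (kk : seq unit) (s := ns_iter idx lam kk st) : (0 < t)%N ->
  [/\ exists f, s.1 = tab idx f, 0 < (s.2%:~R : R) &
    tab_mx s.1 = fmx c (fun x => s.2%:~R * ns (size kk) (x / spread))].
Proof.
move=> t0; have t1 : 0 < (t%:R : R) by rewrite ltr0n.
have s0 := spread_gt0.
rewrite {}/s /ns_iter; elim/last_ind: kk => [|kk u]; last first.
  rewrite foldl_rcons size_rcons; move: (foldl _ _ _) => [Z den] /= [[f ->] d0 eZ].
  split; first by eexists; reflexivity.
    by rewrite !rmorphM /= !mulr_gt0.
  have eZs : (tab_mx (tab idx f))^T = tab_mx (tab idx f) by rewrite eZ fmx_sym.
  set g := fun x : R => _; have -> : tab_mx (tab idx (fun i j => (3 * den * den * entry 0 (tab idx f) i j -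
      entry 0 (mul_tr idx (mul_tr idx (tab idx f) (tab idx f)) (tab idx f)) i j)%R)) =
      (3 * den%:~R ^+ 2) *: tab_mx (tab idx f) -
      tab_mx (tab idx f) *m tab_mx (tab idx f) *m tab_mx (tab idx f).
    have -> : tab_mx (tab idx f) *m tab_mx (tab idx f) *m tab_mx (tab idx f) =
        tab_mx (mul_tr idx (mul_tr idx (tab idx f) (tab idx f)) (tab idx f)).
      by rewrite (tab_mul_eq erefl erefl) (tab_mul_eq erefl erefl) !eZs.
    apply/matrixP => i j.
    by rewrite scaleBE !tab_mxI entry_iota rmorphB !rmorphM /= expr2 mulrA.
  rewrite eZ -fmxZ -!fmxM -fmxB; apply: eq_fmx => k.
  rewrite /g !rmorphM /= /ns_map; move: (ns _ _) => h; rewrite !expr2.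
  by field.
split; first by eexists; reflexivity.
  by rewrite /base_den /= ltr0n addn_gt0 muln_gt0 t0.
rewrite base_mxE//= -{1}(fmx_id c) -fmxZ; apply: eq_fmx => k; rewrite /=.
rewrite /base_den -pmulrn size_iota natrD !natrM.
have -> : 16%:R * t%:R + 2%:R * (n%:R * n%:R) * lam%:R * t%:R = 16 * t%:R * spread :> R.
  by rewrite /spread natrM; field.
by field; rewrite gt_eqF.
Qed.

(** The scalar error holds for eigenvalues divided by [spread]. As the positive part is homogeneous,
    it is multiplied by [spread], and [fmx_entry] passes from eigenvalues to entries. *)
Lemma proj_approx (c : calculus (1%:M - scaled_lap)) (kk : seq unit) m : (0 < t)%N -> size kk = (m + m)%N ->
  0 < ((proj_den idx lam kk st)%:~R : R) /\
  forall i j : 'I_n, `|(entry 0 (proj_num idx lam kk st) i j)%:~R / (proj_den idx lam kk st)%:~R - fmx c (@pos_part R) i j|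
    <= spread * (8 / 11) ^+ m.
Proof.
move=> t0 sk; have t1 : 0 < (t%:R : R) by rewrite ltr0n.
have s0 := spread_gt0.
have [[f ef] d0 eZ] := ns_iter_real c kk t0.
have Xd0 : 0 < ((proj_den idx lam kk st)%:~R : R).
  by rewrite /proj_den rmorphM /= mulr_gt0// ltr0n muln_gt0.
split=> // i j; set den := (ns_iter idx lam kk st).2 in d0 eZ *.
have eX : tab_mx (proj_num idx lam kk st) =
    (proj_den idx lam kk st)%:~R *: fmx c (fun x => x * (1 + ns (m + m) (x / spread)) / 2).
  have -> : tab_mx (proj_num idx lam kk st) = den%:~R *: tab_mx (base_mx idx lam st) +
      tab_mx (base_mx idx lam st) *m (tab_mx (ns_iter idx lam kk st).1)^T.
    rewrite ef -(tab_mul_eq (A := base_mx idx lam st) erefl erefl); apply/matrixP => i' j'.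
    by rewrite scaleDE !tab_mxI /proj_num entry_iota rmorphD rmorphM /= ef.
  rewrite eZ fmx_sym base_mxE// -{1 2}(fmx_id c) -!fmxZ -fmxM -fmxD sk; apply: eq_fmx => k /=.
  rewrite /proj_den rmorphM /= -/den -pmulrn natrM; by move: (ns _ _) => h; field.
have e1 : (entry 0 (proj_num idx lam kk st) i j)%:~R = (tab_mx (proj_num idx lam kk st)) i j by rewrite mxE.
rewrite e1 eX mxE mulrAC mulfV ?gt_eqF// mul1r.
have -> (X Y : 'M[R]_n) : X i j - Y i j = (X - Y) i j by rewrite !mxE.
rewrite -fmxB; apply: fmx_entry => k.
have hk : `|eigv c k / spread| <= 1 by rewrite normrM normfV (gtr0_norm s0) ler_pdivrMr// mul1r eigv_spread.
have := ns_approx m hk; move: (ns _ _) => h.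
have -> : pos_part (eigv c k / spread) = pos_part (eigv c k) / spread.
  by rewrite /pos_part maxr_pMl ?mul0r// invr_ge0 ltW.
set y := eigv c k; have -> : y / spread * (1 + h) / 2 - pos_part y / spread = (y * (1 + h) / 2 - pos_part y) / spread.
  by field; rewrite gt_eqF.
by rewrite normrM normfV (gtr0_norm s0) ler_pdivrMr// [_ * spread]mulrC.
Qed.

End IntegerTables.

(** * Analysis of the Frank-Wolfe iteration *)

Lemma pos_part_sqr (R : realType) (u e : R) :
  pos_part (u + e) ^+ 2 <= pos_part u ^+ 2 + 2 * pos_part u * e + e ^+ 2.
Proof.
rewrite /pos_part; case: (leP u 0) => hu; case: (leP (u + e) 0) => h; rewrite ?expr0n /= ?mulr0 ?mul0r ?add0r ?addr0.
- exact: sqr_ge0.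
- by nra.
- have -> : u ^+ 2 + 2 * u * e + e ^+ 2 = (u + e) ^+ 2 by ring. exact: sqr_ge0.
- by have -> : u ^+ 2 + 2 * u * e + e ^+ 2 = (u + e) ^+ 2 by ring.
Qed.

Lemma natr_subn_pos (R : realType) (a b : nat) : ((a - b)%N%:R : R) = pos_part (a%:R - b%:R).
Proof.
rewrite /pos_part; case: (leqP b a) => h.
  by rewrite natrB//; case: leP => // h'; apply/eqP; rewrite eq_le h' subr_ge0 ler_nat.
by rewrite (eqP (ltnW h : (a - b)%N == 0%N)); case: leP => //; rewrite subr_gt0 ltr_nat ltnNge (ltnW h).
Qed.

Lemma sum_const (R : pzRingType) m (x : R) : \sum_(i < m) x = m%:R * x.
Proof. by rewrite sumr_const card_ord mulr_natl. Qed.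

Section State.
Variables (R : realType) (n lam big : nat) (q : seq (seq nat)).
Notation idx := (iota 0 n).
Implicit Types (st : seq (seq nat)) (p : seq nat).

(** By [g_edgeE] and [h_vtxE] these are the positive parts of scaled congestion and degree minus
    their bounds. The definitions keep the integers of the program. *)
Definition g_edge st (i j : nat) : R := (entry 0%N (edge_excess idx big q st) i j)%:R / (4 * (size st)%:R).
Definition h_vtx st (i : nat) : R := (deg_excess idx st i)%:R / (2 * (size st)%:R).
Definition a_edge st (i j : nat) : R := (edge_count st i j)%:R * (n%:R * big%:R) / (4 * (size st)%:R).
Definition b_vtx st (i : nat) : R := (deg_count idx st i)%:R * n%:R / (2 * (size st)%:R).
Notation cap i j := ((entry 0%N q i j)%:R : R).

Lemma g_edgeE st (i j : 'I_n) : (0 < size st)%N -> g_edge st i j = pos_part (a_edge st i j - cap i j).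
Proof.
move=> t0; rewrite /g_edge /edge_excess entry_iota natr_subn_pos size_iota !natrM /a_edge.
have t1 : 0 < 4 * (size st)%:R :> R by rewrite mulr_gt0// ltr0n.
rewrite -[(4 * (size st)%:R)^-1]ger0_norm ?invr_ge0 ?ltW// /pos_part.
rewrite ger0_norm ?invr_ge0 ?ltW// maxr_pMl ?invr_ge0 ?ltW// mul0r; congr Num.max.
by rewrite mulrBl mulrA; congr (_ - _); rewrite mulrAC mulfV ?gt_eqF// mul1r.
Qed.

Lemma h_vtxE st (i : nat) : (0 < size st)%N -> h_vtx st i = pos_part (b_vtx st i - 1).
Proof.
move=> t0; rewrite /h_vtx /deg_excess natr_subn_pos size_iota !natrM /b_vtx.
have t1 : 0 < 2 * (size st)%:R :> R by rewrite mulr_gt0// ltr0n.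
rewrite /pos_part maxr_pMl ?invr_ge0 ?ltW// mul0r; congr Num.max.
by rewrite mulrBl; congr (_ - _); rewrite mulfV ?gt_eqF.
Qed.

Lemma g_edge_ge0 st i j : 0 <= g_edge st i j. Proof. by rewrite divr_ge0// mulr_ge0. Qed.
Lemma h_vtx_ge0 st i : 0 <= h_vtx st i. Proof. by rewrite divr_ge0// mulr_ge0. Qed.

Lemma avg_step (k : nat) (a b x : R) (t : nat) : (0 < k)%N -> (0 < t)%N ->
  (a + b) * x / (k%:R * t.+1%:R) = b * x / (k%:R * t%:R) + (a * x / (k%:R * 1) - b * x / (k%:R * t%:R)) / t.+1%:R.
Proof.
rewrite -(ltr0n R) -[(0 < t)%N](ltr0n R) -natr1; move: (k%:R : R) (t%:R : R) => y z y0 z0.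
have z1 : 0 < z + 1 by rewrite ltr_wpDl// ltW.
by field; rewrite ?gt_eqF.
Qed.

Lemma a_edge_cons st p i j : (0 < size st)%N ->
  a_edge (p :: st) i j = a_edge st i j + (a_edge [:: p] i j - a_edge st i j) / (size st).+1%:R.
Proof. by move=> t0; rewrite /a_edge /edge_count /= addn0 natrD -/(edge_count st i j) avg_step. Qed.

Lemma pair_mx_cons st p : pair_mx R n (p :: st) = pair_mx R n [:: p] + pair_mx R n st.
Proof.
apply/matrixP => i j; rewrite !mxE; case: ifP => _; first by rewrite addr0.
by rewrite /pair_count /= addn0 natrD.
Qed.

Lemma deg_count_cons st p (i : 'I_n) : deg_count idx (p :: st) i = (deg_count idx [:: p] i + deg_count idx st i)%N.
Proof.
apply/eqP; rewrite -(eqr_nat R) natrD !deg_countE pair_mx_cons -big_split; apply/eqP.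
by apply: eq_bigr => j _; rewrite mxE.
Qed.

Lemma b_vtx_cons st p (i : 'I_n) : (0 < size st)%N ->
  b_vtx (p :: st) i = b_vtx st i + (b_vtx [:: p] i - b_vtx st i) / (size st).+1%:R.
Proof.
by move=> t0; rewrite /b_vtx deg_count_cons natrD /= avg_step.
Qed.

Lemma laplacianD (u v : 'M[R]_n) : laplacian (u + v) = laplacian u + laplacian v.
Proof.
apply/matrixP => i j; rewrite [RHS]mxE !laplacianE [(u + v) i j]mxE.
have -> : \sum_k (u + v) i k = \sum_k u i k + \sum_k v i k by rewrite -big_split; apply: eq_bigr => k _; rewrite mxE.
by case: eqP => _; ring.
Qed.

Lemma scaled_lap_cons st p : (0 < size st)%N ->
  scaled_lap R n lam (p :: st) = scaled_lap R n lam st +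
    (size st).+1%:R^-1 *: (scaled_lap R n lam [:: p] - scaled_lap R n lam st).
Proof.
move=> t0; rewrite /scaled_lap pair_mx_cons laplacianD /=.
move: (laplacian (pair_mx R n [:: p])) (laplacian (pair_mx R n st)) => X Y.
apply/matrixP => i j; rewrite !mxE /=; move: t0; rewrite -(ltr0n R) -[(size st).+1%:R]natr1.
move: ((size st)%:R : R) (X i j) (Y i j) (n%:R * lam%:R : R) => t x y z t0.
have t1 : 0 < t + 1 by rewrite ltr_wpDl// ltW.
by field; rewrite ?gt_eqF.
Qed.

Lemma a_edge_itv st i j : 0 <= a_edge st i j <= n%:R * big%:R / 4.
Proof.
rewrite divr_ge0 ?mulr_ge0//=; have [t0|t0] := posnP (size st).
  by rewrite /a_edge t0 mulr0 invr0 mulr0 divr_ge0 ?mulr_ge0.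
have t1 : 0 < 4 * (size st)%:R :> R by rewrite mulr_gt0// ltr0n.
rewrite /a_edge ler_pdivrMr//; set z := n%:R * _.
have -> : z / 4 * (4 * (size st)%:R) = (size st)%:R * z by field.
by rewrite ler_wpM2r ?mulr_ge0// ler_nat count_size.
Qed.

Lemma deg_count_le st (i : 'I_n) : (deg_count idx st i)%:R <= n%:R * (size st)%:R :> R.
Proof. by rewrite deg_countE pair_mx_deg. Qed.

Lemma b_vtx_itv st (i : 'I_n) : 0 <= b_vtx st i <= n%:R ^+ 2.
Proof.
rewrite divr_ge0 ?mulr_ge0//=; have [t0|t0] := posnP (size st).
  by rewrite /b_vtx t0 mulr0 invr0 mulr0 exprn_ge0.
have t1 : 0 < 2 * (size st)%:R :> R by rewrite mulr_gt0// ltr0n.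
rewrite /b_vtx ler_pdivrMr//; apply: le_trans (ler_wpM2r (ler0n _ _) (deg_count_le st i)) _.
have : 0 <= (n%:R : R) ^+ 2 * (size st)%:R by rewrite mulr_ge0// exprn_ge0.
by move: (size st)%:R => t h; lra.
Qed.

Lemma scaled_lap_entry st (i j : 'I_n) : (0 < size st)%N -> `|scaled_lap R n lam st i j| <= n%:R ^+ 2 * lam%:R / 8.
Proof.
move=> t0; have t1 : 0 < (size st)%:R :> R by rewrite ltr0n.
rewrite mxE normrM ger0_norm ?divr_ge0 ?mulr_ge0//.
have h : `|laplacian (pair_mx R n st) i j| <= 2 * (n%:R * (size st)%:R).
  rewrite laplacianE; have h2 : `|pair_mx R n st i j| <= n%:R * (size st)%:R.
    rewrite ger0_norm ?pair_mx_ge0//; apply: le_trans (pair_mx_deg _ _ i).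
    by rewrite (bigD1 j)//= lerDl sumr_ge0// => k _; exact: pair_mx_ge0.
  apply: le_trans (ler_normB _ _) _; rewrite mulr_natl mulr2n lerD//.
  case: eqP => _; last by rewrite normr0 mulr_ge0.
  by rewrite ger0_norm ?sumr_ge0 ?pair_mx_deg// => k _; exact: pair_mx_ge0.
apply: le_trans (ler_wpM2l _ h) _; first by rewrite divr_ge0// mulr_ge0.
by rewrite le_eqVlt; apply/orP; left; apply/eqP; field; rewrite gt_eqF.
Qed.

Notation lapA st := (scaled_lap R n lam st).

(** In [margin] a violation by 1 has to outweigh tr P <= n, hence the weights of order n. The factor
    2 at the degrees lets the vertex terms n h fit into tr P / 2 together with half of the
    margin. *)
Definition psi st (c : calculus (1%:M - lapA st)) : R :=
  n%:R * (\sum_(i < n) \sum_(j < n) g_edge st i j ^+ 2) + 2 * n%:R * (\sum_(i < n) h_vtx st i ^+ 2) + potential c.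

(* Half the derivative of psi in the direction of the state [st']. *)
Definition gain st (c : calculus (1%:M - lapA st)) st' : R :=
  n%:R * (\sum_(i < n) \sum_(j < n) g_edge st i j * a_edge st' i j) +
  2 * n%:R * (\sum_(i < n) h_vtx st i * b_vtx st' i) - \tr (fmx c (@pos_part R) *m lapA st').

Definition curvature : R := n%:R ^+ 5 * big%:R ^+ 2 + 2 * n%:R ^+ 6 + n%:R ^+ 6 * lam%:R ^+ 2.

Lemma pos_part_mul (u : R) : pos_part u * u = pos_part u ^+ 2.
Proof. by rewrite /pos_part; case: leP => _; rewrite ?mul0r ?expr0n// expr2. Qed.

(** As pos_part u * u is the square of pos_part u, the linear functional returns at the state itself
    the potential plus the contribution of the bounds; this is psi minus the later [margin]. *)
Lemma gain_self st (c : calculus (1%:M - lapA st)) : (0 < size st)%N ->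
  gain c st = psi c + n%:R * (\sum_(i < n) \sum_(j < n) g_edge st i j * cap i j) +
    2 * n%:R * (\sum_(i < n) h_vtx st i) - \tr (fmx c (@pos_part R)).
Proof.
move=> t0; rewrite /gain /psi.
have -> : \sum_(i < n) \sum_(j < n) g_edge st i j * a_edge st i j =
    \sum_(i < n) \sum_(j < n) g_edge st i j ^+ 2 + \sum_(i < n) \sum_(j < n) g_edge st i j * cap i j.
  rewrite -big_split; apply: eq_bigr => i _; rewrite -big_split; apply: eq_bigr => j _ /=.
  by rewrite g_edgeE// -pos_part_mul; ring.
have -> : \sum_(i < n) h_vtx st i * b_vtx st i = \sum_(i < n) h_vtx st i ^+ 2 + \sum_(i < n) h_vtx st i.
  rewrite -big_split; apply: eq_bigr => i _ /=.
  by rewrite h_vtxE// -pos_part_mul; ring.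
have -> : \tr (fmx c (@pos_part R) *m lapA st) = \tr (fmx c (@pos_part R)) - potential c.
  rewrite -(tr_pos_mul c) mulmxBr mulmx1 raddfB /=; ring.
ring.
Qed.

(** The descent inequality of Frank-Wolfe: a squared positive part lies below its linear expansion
    plus the full quadratic term, and [curvature] bounds the quadratic terms. *)
Lemma psi_cons st p (c : calculus (1%:M - lapA st)) (c' : calculus (1%:M - lapA (p :: st))) :
  (0 < size st)%N ->
  psi c' <= psi c + 2 / (size st).+1%:R * (gain c [:: p] - gain c st) + curvature / (size st).+1%:R ^+ 2.
Proof.
move=> t0; set T := (size st).+1%:R : R.
have T0 : 0 < T by rewrite ltr0n.
have E1 : \sum_(i < n) \sum_(j < n) g_edge (p :: st) i j ^+ 2 <=
   \sum_(i < n) \sum_(j < n) g_edge st i j ^+ 2 +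
   2 / T * (\sum_(i < n) \sum_(j < n) g_edge st i j * a_edge [:: p] i j -
      \sum_(i < n) \sum_(j < n) g_edge st i j * a_edge st i j) + (n%:R ^+ 4 * big%:R ^+ 2) / T ^+ 2.
  have -> : (n%:R ^+ 4 * big%:R ^+ 2) / T ^+ 2 = \sum_(i < n) \sum_(j < n) (n%:R * big%:R) ^+ 2 / T ^+ 2.
    by rewrite !sum_const; move: (n%:R : R) (big%:R : R) (T ^+ 2)^-1 => x y z; ring.
  rewrite -sumrB mulr_sumr -!big_split; apply: ler_sum => i _ /=.
  rewrite -sumrB mulr_sumr -!big_split; apply: ler_sum => j _ /=.
  rewrite !g_edgeE//= a_edge_cons// [X in pos_part X ^+ 2 <= _]addrAC.
  apply: le_trans (pos_part_sqr _ _) _; set u := pos_part (_ - _).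
  have /andP[x0 x1] := a_edge_itv [:: p] i j; have /andP[y0 y1] := a_edge_itv st i j.
  move: (a_edge _ i j) (a_edge _ i j) x0 x1 y0 y1 => y x x0 x1 y0 y1.
  rewrite -/T; have -> : u ^+ 2 + 2 * u * ((x - y) / T) + ((x - y) / T) ^+ 2 =
    u ^+ 2 + 2 / T * (u * x - u * y) + (x - y) ^+ 2 / T ^+ 2 by field; rewrite gt_eqF.
  rewrite lerD2l ler_wpM2r ?invr_ge0 ?exprn_ge0 ?(ltW T0)//.
  have z0 : 0 <= n%:R * big%:R :> R by rewrite mulr_ge0.
  by move: (n%:R * big%:R) z0 x1 y1 => z z0 x1 y1; nra.
have E2 : \sum_(i < n) h_vtx (p :: st) i ^+ 2 <= \sum_(i < n) h_vtx st i ^+ 2 +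
   2 / T * (\sum_(i < n) h_vtx st i * b_vtx [:: p] i - \sum_(i < n) h_vtx st i * b_vtx st i) + n%:R ^+ 5 / T ^+ 2.
  have -> : n%:R ^+ 5 / T ^+ 2 = \sum_(i < n) (n%:R ^+ 2) ^+ 2 / T ^+ 2.
    by rewrite sum_const; move: (n%:R : R) (T ^+ 2)^-1 => x z; ring.
  rewrite -sumrB mulr_sumr -!big_split; apply: ler_sum => i _ /=.
  rewrite !h_vtxE//= b_vtx_cons// [X in pos_part X ^+ 2 <= _]addrAC.
  apply: le_trans (pos_part_sqr _ _) _; set u := pos_part (_ - _).
  have /andP[x0 x1] := b_vtx_itv [:: p] i; have /andP[y0 y1] := b_vtx_itv st i.
  move: (b_vtx _ i) (b_vtx _ i) x0 x1 y0 y1 => y x x0 x1 y0 y1.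
  rewrite -/T; have -> : u ^+ 2 + 2 * u * ((x - y) / T) + ((x - y) / T) ^+ 2 =
    u ^+ 2 + 2 / T * (u * x - u * y) + (x - y) ^+ 2 / T ^+ 2 by field; rewrite gt_eqF.
  rewrite lerD2l ler_wpM2r ?invr_ge0 ?exprn_ge0 ?(ltW T0)//.
  by move: (n%:R ^+ 2) x1 y1 => z x1 y1; nra.
have E3 : potential c' <= potential c + 2 / T * (\tr (fmx c (@pos_part R) *m lapA st) - \tr (fmx c (@pos_part R) *m lapA [:: p])) +
    n%:R ^+ 6 * lam%:R ^+ 2 / T ^+ 2.
  apply: le_trans (potential_smooth c c') _.
  have -> : 1%:M - lapA (p :: st) - (1%:M - lapA st) = T^-1 *: (lapA st - lapA [:: p]).
    rewrite scaled_lap_cons// -/T; move: (lapA st) (lapA [:: p]) => X Y.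
    by apply/matrixP => i j; rewrite !mxE; ring.
  have sD : (lapA st - lapA [:: p])^T = lapA st - lapA [:: p] by rewrite raddfB /= !scaled_lap_sym.
  have hD : \tr ((lapA st - lapA [:: p]) *m (lapA st - lapA [:: p])) <= n%:R ^+ 6 * lam%:R ^+ 2.
    rewrite tr_sqr//; apply: le_trans (_ : \sum_(i < n) \sum_(j < n) (n%:R ^+ 2 * lam%:R / 4) ^+ 2 <= _); last first.
      rewrite !sum_const.
      have : 0 <= (n%:R : R) ^+ 6 * lam%:R ^+ 2 by rewrite mulr_ge0// exprn_ge0.
      rewrite [X in _ -> X <= _](_ : _ = (n%:R ^+ 6 * lam%:R ^+ 2) / 16); last by move: (n%:R : R) (lam%:R : R) => x y; field.
      by move: (_ * _) => z; lra.
    apply: ler_sum => i _; apply: ler_sum => j _.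
    have -> : (lapA st - lapA [:: p]) i j = lapA st i j - lapA [:: p] i j by rewrite !mxE.
    have := scaled_lap_entry (st := [:: p]) i j isT; have := scaled_lap_entry i j t0.
    move=> h1 h2; rewrite -[leLHS]real_normK ?num_real//; rewrite lerXn2r ?nnegrE ?divr_ge0 ?mulr_ge0 ?exprn_ge0//.
    apply: le_trans (ler_normB _ _) _; move: h1 h2; move: `|_| `|_| (n%:R ^+ 2 * lam%:R : R) => a b z *; lra.
  move: hD {sD}; rewrite -2!scalemxAr -scalemxAl scalerA !mxtraceZ.
  have -> : \tr (fmx c (@pos_part R) *m (lapA st - lapA [:: p])) =
    \tr (fmx c (@pos_part R) *m lapA st) - \tr (fmx c (@pos_part R) *m lapA [:: p]) by rewrite mulmxBr raddfB.
  move: (\tr ((_ - _) *m (_ - _))) (\tr (fmx _ _ *m _)) (\tr (fmx _ _ *m _)) => z x y hD.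
  rewrite -[leLHS]addrA -[leRHS]addrA lerD2l lerD//; first by rewrite mulrA.
  by rewrite mulrC expr2 invfM ler_wpM2r// mulr_ge0// invr_ge0 ltW.
rewrite /psi /gain /curvature; move: E1 E2 E3.
move: (\sum_(i < n) \sum_(j < n) g_edge (p :: st) i j ^+ 2) (\sum_(i < n) h_vtx (p :: st) i ^+ 2) (potential c').
move: (\sum_(i < n) \sum_(j < n) g_edge st i j ^+ 2) (\sum_(i < n) h_vtx st i ^+ 2) (potential c).
move: (\sum_(i < n) \sum_(j < n) g_edge st i j * a_edge [:: p] i j) (\sum_(i < n) \sum_(j < n) g_edge st i j * a_edge st i j).
move: (\sum_(i < n) h_vtx st i * b_vtx [:: p] i) (\sum_(i < n) h_vtx st i * b_vtx st i) (\tr _) (\tr _).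
move=> x1 x2 x3 x4 x5 x6 x7 x8 x9 y1 y2 y3 E1 E2 E3.
have n0 : 0 <= n%:R :> R by [].
have F1 := ler_wpM2l n0 E1; have F2 := ler_wpM2l (mulr_ge0 (ler0n R 2) n0) E2.
apply: le_trans (lerD (lerD F1 F2) E3) _; rewrite le_eqVlt; apply/orP; left; apply/eqP.
by move: (n%:R : R) => m; field; rewrite gt_eqF.
Qed.

End State.

Section DeltaSums.
Variables (R : realType) (n : nat).

Lemma sum_delta_le (f : nat -> R) (a : nat) : (forall i, 0 <= f i) ->
  \sum_(i < n) f i * (a == i)%:R <= f a.
Proof.
move=> f0; case: (ltnP a n) => h.
  rewrite (bigD1 (Ordinal h))//= eqxx mulr1 big1 ?addr0// => i ih.
  by rewrite (_ : (a == i) = false) ?mulr0//; apply: contraNF ih => /eqP e; apply/eqP/val_inj.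
by rewrite big1// => i _; rewrite (_ : (a == i) = false) ?mulr0//; apply/eqP => e; move: h; rewrite e leqNgt ltn_ord.
Qed.

Lemma sum_delta2_le (g : nat -> nat -> R) (a b : nat) : (forall i j, 0 <= g i j) ->
  \sum_(i < n) \sum_(j < n) g i j * ((a == i) && (b == j))%:R <= g a b.
Proof.
move=> g0; apply: le_trans (sum_delta_le b (g0 a)).
apply: le_trans (sum_delta_le (f := fun i => \sum_(j < n) g i j * (b == j)%:R) a _); last first.
  by move=> i; rewrite sumr_ge0// => j _; rewrite mulr_ge0.
apply: ler_sum => i _; rewrite mulr_suml; apply: ler_sum => j _.
by rewrite -mulnb natrM mulrA -!mulrA [_%:R * _%:R]mulrC.
Qed.

Lemma sum_crosses_le (g : nat -> nat -> R) (p : seq nat) : (forall i j, 0 <= g i j) ->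
  \sum_(i < n) \sum_(j < n) g i j * (crosses p i j || crosses p j i)%:R <=
  \sum_(e <- zip p (behead p)) (g e.1 e.2 + g e.2 e.1).
Proof.
move=> g0; rewrite /crosses; elim: (zip p (behead p)) => [|e z IH].
  by rewrite big_nil big1// => i _; rewrite big1// => j _; rewrite mulr0.
rewrite big_cons; apply: le_trans (lerD (lerD (sum_delta2_le e.1 e.2 g0) (sum_delta2_le e.2 e.1 g0)) IH).
rewrite -!big_split; apply: ler_sum => i _ /=; rewrite -!big_split; apply: ler_sum => j _ /=.
rewrite -!mulrDr ler_wpM2l// -!natrD ler_nat.
rewrite [(e.2 == i) && _]andbC.
have F (a b x y : bool) : (((a || x) || (b || y)) <= a + b + (x || y))%N by case: a; case: b; case: x; case: y.
exact: F.
Qed.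

End DeltaSums.

Section PathGain.
Variables (R : realType) (n lam big : nat) (q : seq (seq nat)).
Notation idx := (iota 0 n).
Implicit Types (st : seq (seq nat)) (p : seq nat).
Hypothesis symq : forall i j, entry 0%N q i j = entry 0%N q j i.
Notation lapA st := (scaled_lap R n lam st).
Notation w st := (edge_excess idx big q st).

Lemma edge_countC st i j : edge_count st i j = edge_count st j i.
Proof. by apply: eq_count => p; rewrite orbC. Qed.

Lemma edge_excess_sym st i j : entry 0%N (w st) i j = entry 0%N (w st) j i.
Proof.
rewrite !entry_tab !size_iota andbC; case: ifP => // /andP[hi hj].
by rewrite !nth_iota// !add0n edge_countC symq.
Qed.

Lemma pair_mx1 p (a b i j : 'I_n) : head 0%N p = a -> last 0%N p = b ->
  pair_mx R n [:: p] i j = (a != b)%:R * ((a == i)%:R * (b == j)%:R + (a == j)%:R * (b == i)%:R).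
Proof.
move=> ha hb; rewrite mxE /pair_count /= addn0 /links ha hb !(inj_eq val_inj).
case: (eqVneq a b) => [->|ab]; rewrite ?mul0r ?mul1r.
  by case: (eqVneq i j) => [//|ij]; case: (eqVneq b i) => [e|_] //=; rewrite ?andbF// e (negbTE ij).
case: (eqVneq a i) ab => [->|ai] ab; case: (eqVneq i j) ab => [<-|ij] ab /=; rewrite ?(eqxx, andbF, andbT, orbF, mulr0, mul0r, mul1r, mulr1, addr0, add0r)//.
- by rewrite (eq_sym b i) (negbTE ab) addr0.
- by rewrite (negbTE ai) mul0r.
- by rewrite -natrM mulnb.
Qed.

Lemma tr_laplacian_pair (P : 'M[R]_n) p (a b : 'I_n) : P^T = P -> head 0%N p = a -> last 0%N p = b ->
  \tr (P *m laplacian (pair_mx R n [:: p])) = P a a + P b b - 2 * P a b.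
Proof.
move=> sP ha hb; have sPe i j : P i j = P j i by rewrite -{1}sP mxE.
have -> : \tr (P *m laplacian (pair_mx R n [:: p])) = \sum_i \sum_j pair_mx R n [:: p] i j * (P i i - P i j).
  apply: eq_bigr => i _; rewrite mxE.
  transitivity (\sum_j (P i j * (if j == i then \sum_k pair_mx R n [:: p] i k else 0) - P i j * pair_mx R n [:: p] i j)).
    by apply: eq_bigr => j _; rewrite laplacianE mulrBr (pair_mx_sym _ _ _ j); case: eqP => [->|].
  have -> (d : R) : \sum_j (P i j * (if j == i then d else 0) - P i j * pair_mx R n [:: p] i j) =
      P i i * d - \sum_j P i j * pair_mx R n [:: p] i j.
    rewrite sumrB; congr (_ - _); rewrite (bigD1 i)//= eqxx big1 ?addr0// => j ji.
    by rewrite (negbTE ji) mulr0.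
  by rewrite mulr_sumr -sumrB; apply: eq_bigr => j _; ring.
have [ab|ab] := eqVneq a b.
  rewrite big1 => [|i _]; first by rewrite ab; ring.
  by rewrite big1 => // j _; rewrite (pair_mx1 i j ha hb) ab eqxx !mul0r.
have dl (f : 'I_n -> R) (x : 'I_n) : \sum_i (x == i)%:R * f i = f x.
  by rewrite (bigD1 x)//= eqxx mul1r big1 ?addr0// => i /negbTE; rewrite eq_sym => ->; rewrite mul0r.
transitivity (\sum_i ((a == i)%:R * \sum_j (b == j)%:R * (P i i - P i j) + (b == i)%:R * \sum_j (a == j)%:R * (P i i - P i j))).
  apply: eq_bigr => i _; rewrite !mulr_sumr -big_split; apply: eq_bigr => j _ /=.
  have e1 : ((a != b)%:R : R) = 1 by rewrite ab.
  by rewrite (pair_mx1 i j ha hb) e1; ring.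
by rewrite big_split /= !dl (sPe b a); ring.
Qed.

Variables (st : seq (seq nat)) (c : calculus (1%:M - lapA st)).
Hypothesis t0 : (0 < size st)%N.
Notation P := (fmx c (@pos_part R)).
Notation t := ((size st)%:R : R).

Definition path_value (a b : 'I_n) (cost : nat) : R :=
  n%:R * big%:R * cost%:R / (8 * t) + n%:R * (h_vtx R n st a + h_vtx R n st b) -
  lam%:R / 16 * (P a a + P b b - 2 * P a b).

(** An inequality, since [path_cost] counts an edge at each traversal and [edge_count] once per
    path. *)
Lemma gain_path p (a b : 'I_n) : head 0%N p = a -> last 0%N p = b ->
  gain big q c [:: p] <= n%:R * path_value a b (path_cost (w st) p).
Proof.
move=> ha hb; have t1 : 0 < t by rewrite ltr0n.
have E1 : \sum_(i < n) \sum_(j < n) g_edge R n big q st i j * a_edge R n big [:: p] i j <=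
    n%:R * big%:R * (path_cost (w st) p)%:R / (8 * t).
  have -> : \sum_(i < n) \sum_(j < n) g_edge R n big q st i j * a_edge R n big [:: p] i j =
     n%:R * big%:R / 4 * \sum_(i < n) \sum_(j < n) g_edge R n big q st i j * (crosses p i j || crosses p j i)%:R.
    rewrite mulr_sumr; apply: eq_bigr => i _; rewrite mulr_sumr; apply: eq_bigr => j _.
    by rewrite /a_edge /edge_count /= addn0; field.
  apply: le_trans (ler_wpM2l _ (sum_crosses_le n p _)) _; first by rewrite divr_ge0// mulr_ge0.
    by move=> i j; exact: g_edge_ge0.
  have -> : \sum_(e <- zip p (behead p)) (g_edge R n big q st e.1 e.2 + g_edge R n big q st e.2 e.1) =
      2 / (4 * t) * (path_cost (w st) p)%:R.
    rewrite /path_cost sumnE big_map natr_sum mulr_sumr; apply: eq_bigr => e _.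
    by rewrite /g_edge (edge_excess_sym st e.2 e.1); field; rewrite gt_eqF.
  by rewrite le_eqVlt; apply/orP; left; apply/eqP; field; rewrite gt_eqF.
have E2 : 2 * \sum_(i < n) h_vtx R n st i * b_vtx R n [:: p] i <= n%:R * (h_vtx R n st a + h_vtx R n st b).
  have -> : 2 * \sum_(i < n) h_vtx R n st i * b_vtx R n [:: p] i =
      n%:R * \sum_(i < n) \sum_(j < n) h_vtx R n st i * pair_mx R n [:: p] i j.
    rewrite !mulr_sumr; apply: eq_bigr => i _; by rewrite /b_vtx deg_countE -mulr_sumr /=; field.
  rewrite ler_wpM2l//; apply: le_trans (lerD (sum_delta2_le n (g := fun i _ => h_vtx R n st i) a b _) (sum_delta2_le n (g := fun i _ => h_vtx R n st i) b a _)).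
  - rewrite -big_split; apply: ler_sum => i _; rewrite -big_split; apply: ler_sum => j _ /=.
    rewrite -mulrDr ler_wpM2l ?h_vtx_ge0// (pair_mx1 i j ha hb) -!mulnb !natrM !(inj_eq val_inj).
    by case: (a != b) => /=; rewrite ?mul1r ?mul0r ?addr_ge0 ?mulr_ge0// lerD// mulrC.
  - by move=> *; exact: h_vtx_ge0.
  - by move=> *; exact: h_vtx_ge0.
have E3 : \tr (P *m lapA [:: p]) = n%:R * (lam%:R / 16 * (P a a + P b b - 2 * P a b)).
  rewrite /scaled_lap -scalemxAr mxtraceZ (tr_laplacian_pair _ ha hb) ?fmx_sym//=.
  by move: (_ - _) => z; field.
rewrite /gain E3 /path_value [leRHS]mulrBr [X in _ <= X - _]mulrDr lerB// lerD ?ler_wpM2l//.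
by rewrite [2 * _]mulrC -mulrA ler_wpM2l.
Qed.

Lemma gain_nil : gain big q c [:: [::]] = 0.
Proof.
have p0 : pair_mx R n [:: [::]] = 0.
  apply/matrixP => i j; rewrite !mxE; case: eqVneq => // ij; rewrite /pair_count /= /links /= addn0.
  have F (x y : 'I_n) : x != y -> (0%N == x) && (0%N == y) = false.
    by move=> xy; apply: contraNF xy => /andP[/eqP h1 /eqP h2]; apply/eqP/val_inj; exact: etrans (esym h1) h2.
  by rewrite !F// eq_sym.
have l0 : laplacian (0 : 'M[R]_n) = 0.
  by apply/matrixP => i j; rewrite laplacianE !mxE subr0 big1 ?if_same// => k _; rewrite mxE.
rewrite /gain /scaled_lap p0 l0 scaler0 mulmx0 raddf0 subr0.
rewrite big1 => [|i _]; last by rewrite big1// => j _; rewrite /a_edge /edge_count /= !mul0r mulr0.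
rewrite big1 => [|i _]; first by rewrite !mulr0 addr0.
by rewrite /b_vtx deg_countE p0 big1 ?mul0r ?mulr0// => j _; rewrite mxE.
Qed.

Variables (X : seq (seq int)) (Xd : int) (delta : R).
Hypothesis Xd0 : 0 < (Xd%:~R : R).
Hypothesis XP : forall i j : 'I_n, `|(entry 0 X i j)%:~R / Xd%:~R - P i j| <= delta.

(** Minus [path_value], with the projection replaced by its computed approximation. *)
Definition real_score p : R := (score idx lam big st X Xd (w st) p)%:~R / (16 * t * Xd%:~R).

Lemma real_score_path p (a b : 'I_n) : ~~ nilp p -> head 0%N p = a -> last 0%N p = b ->
  `|real_score p + path_value a b (path_cost (w st) p)| <= lam%:R * delta / 4.
Proof.
move=> pn ha hb; have t1 : 0 < t by rewrite ltr0n.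
have -> : real_score p = lam%:R / 16 * ((entry 0 X a a)%:~R / Xd%:~R + (entry 0 X b b)%:~R / Xd%:~R - 2 * ((entry 0 X a b)%:~R / Xd%:~R)) -
   (n%:R * big%:R * (path_cost (w st) p)%:R / (8 * t) + n%:R * (h_vtx R n st a + h_vtx R n st b)).
  have key (A B C x y z D : int) : (A * (x + y - 2 * z) - B * D - C * D)%:~R =
      A%:~R * (x%:~R + y%:~R - 2 * z%:~R) - B%:~R * D%:~R - C%:~R * D%:~R :> R.
    by rewrite !(rmorphB, rmorphM, rmorphD).
  rewrite /real_score /score (negbTE pn) ha hb size_iota /h_vtx key -!pmulrn !(natrM, natrD).
  move: (entry 0 X a a)%:~R (entry 0 X b b)%:~R (entry 0 X a b)%:~R => x y z.
  move: (n%:R : R) (lam%:R : R) (big%:R : R) (path_cost _ p)%:R (deg_excess idx st a)%:R (deg_excess idx st b)%:R => n' l' b' u v v'.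
  by field; rewrite !gt_eqF.
have := XP a a; have := XP b b; have := XP a b; rewrite /path_value.
move: (_ / Xd%:~R) (_ / Xd%:~R) (_ / Xd%:~R) (P a a) (P b b) (P a b) => x1 x2 x3 p1 p2 p3 h3 h2 h1.
have -> : forall U V : R, lam%:R / 16 * (x1 + x2 - 2 * x3) - U + (U - lam%:R / 16 * V) = lam%:R / 16 * (x1 + x2 - 2 * x3 - V).
  by move=> U V; ring.
rewrite normrM ger0_norm ?divr_ge0//.
have -> : lam%:R * delta / 4 = lam%:R / 16 * (4 * delta) by field.
rewrite ler_wpM2l ?divr_ge0//.
by move: h1 h2 h3; rewrite !ler_norml => /andP[? ?] /andP[? ?] /andP[? ?]; apply/andP; split; lra.
Qed.

Lemma real_score_nil : real_score [::] = 0.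
Proof. by rewrite /real_score /= mul0r. Qed.

Lemma real_score_le p p' : (real_score p <= real_score p') =
  (score idx lam big st X Xd (w st) p <= score idx lam big st X Xd (w st) p').
Proof. by rewrite ler_pM2r ?ler_int// invr_gt0 !mulr_gt0// ltr0n. Qed.

End PathGain.

Section Candidates.
Variables (n : nat) (q w : seq (seq nat)).
Notation idx := (iota 0 n).

Definition valid (st : seq (seq nat)) : bool := all (fun p => nilp p || walk n q p && uniq p) st.

Lemma size_paths_from i : size (paths_from idx q w i) = n.
Proof.
rewrite /paths_from; set a := map _ _; suff H (l : seq nat) : size (foldl (fun tbl _ => relax idx q w tbl) a l) = n by [].
elim/last_ind: l => [|l x IH]; first by rewrite size_map size_iota.
by rewrite foldl_rcons size_map size_iota.
Qed.

Lemma route_candidate i j : (i < n)%N -> (j < n)%N -> erase_loops (route n q w i j) \in candidates idx q w.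
Proof.
move=> hi hj; apply/flattenP; exists [seq erase_loops p | p <- paths_from idx q w i].
  by apply/mapP; exists i => //; rewrite mem_iota.
by apply: map_f; rewrite mem_nth// size_paths_from.
Qed.

Lemma candidatesP p : p \in candidates idx q w -> nilp p || walk n q p && uniq p.
Proof.
move=> /flattenP[l /mapP[i]]; rewrite mem_iota => /andP[_ hi] -> /mapP[p' hp' ->].
have [k kn <-] : exists2 k, (k < n)%N & route n q w i k = p'.
  exists (index p' (paths_from idx q w i)); last by rewrite /route nth_index.
  by rewrite -[X in (_ < X)%N](size_paths_from i) index_mem.
case: (boolP (nilp (route n q w i k))) => [/nilP -> //|nk].
have [hw _ _] := routeP hi kn nk.
by have [-> -> _ _ _] := erase_loopsP w hw; rewrite orbT.
Qed.

Lemma walk_crosses p i j : walk n q p -> crosses p i j -> [&& (i < n)%N, (j < n)%N & adj q i j].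
Proof.
rewrite /crosses; case: p => // x s; elim: s x => [|y s IH] x //=.
move=> /andP[/andP[hx hs] /andP[xy hp]] /orP[/andP[/eqP <- /eqP <-]|h].
  by rewrite hx xy; case/andP: hs => ->.
by apply: IH h => /=; rewrite hs.
Qed.

Lemma edge_count_adj st i j : (forall i j, entry 0%N q i j = entry 0%N q j i) ->
  valid st -> (0 < edge_count st i j)%N -> adj q i j.
Proof.
move=> symq /allP hv; rewrite -has_count => /hasP[p hp]; have := hv _ hp.
case: (boolP (nilp p)) => [/nilP -> //|_] /= /andP[hw _] /orP[] /(walk_crosses hw) /and3P[_ _] //.
by rewrite /adj symq.
Qed.

End Candidates.

Section Progress.
Variables (R : realType) (n lam big r : nat) (q : seq (seq nat)) (kk : seq unit) (k : nat).
Notation idx := (iota 0 n).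
Notation lapA st := (scaled_lap R n lam st).
Notation w st := (edge_excess idx big q st).
Hypothesis symq : forall i j, entry 0%N q i j = entry 0%N q j i.
Hypothesis sizek : size kk = (k + k)%N.
Variables (st : seq (seq nat)) (c : calculus (1%:M - lapA st)).
Hypothesis t0 : (0 < size st)%N.
Hypothesis r0 : (0 < r)%N.
Notation P := (fmx c (@pos_part R)).
Notation t := ((size st)%:R : R).
Notation X := (proj_num idx lam kk st).
Notation Xd := (proj_den idx lam kk st).
Notation delta := (spread R n lam * (8 / 11) ^+ k).
Notation cap i j := ((entry 0%N q i j)%:R : R).
Notation g i j := (g_edge R n big q st i j).
Notation h i := (h_vtx R n st i).
Hypothesis small : n%:R * delta <= 1 / 10.

(** The gain at the current state is psi minus this number, so a path with gain at most minus the
    margin makes the potential decrease at a rate proportional to psi. *)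
Definition margin : R := \tr P - n%:R * (\sum_(i < n) \sum_(j < n) g i j * cap i j) - 2 * n%:R * \sum_(i < n) h i.

Let Xd0 : 0 < (Xd%:~R : R). Proof. by have [] := proj_approx c t0 sizek. Qed.
Let XP (i j : 'I_n) : `|(entry 0 X i j)%:~R / Xd%:~R - P i j| <= delta.
Proof. by have [] := proj_approx c t0 sizek. Qed.

Lemma trace_test (a d : int) (b : nat) :
  (10 * a <= Posz (16 * b) * d) = (10 * a%:~R <= 16 * b%:R * d%:~R :> R).
Proof. by rewrite -(ler_int R) !rmorphM /= -!pmulrn natrM. Qed.

Lemma trX_approx : `|(sumz [seq entry 0 X i i | i <- idx])%:~R / Xd%:~R - \tr P| <= n%:R * delta.
Proof.
have e : iota 0 n = index_iota 0 n by rewrite /index_iota subn0.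
rewrite sumzE big_map rmorph_sum {1}e big_mkord mulr_suml -sumrB.
apply: le_trans (ler_norm_sum _ _ _) _; rewrite -(sum_const n delta).
by apply: ler_sum => i _; exact: XP.
Qed.

Lemma pos_eigv_le1 j : pos_part (eigv c j) <= 1.
Proof. by rewrite ge_max ler01 andbT; apply: (eigv_sub_le c j erefl); exact: psd_scaled_lap. Qed.

Lemma trP_le : \tr P <= n%:R.
Proof.
rewrite tr_fmx -[leRHS]mulr1 -sum_const; apply: ler_sum => j _; exact: pos_eigv_le1.
Qed.

Lemma sum_gq_ge (i j : 'I_n) : g i j * cap i j <= \sum_(i < n) \sum_(j < n) g i j * cap i j.
Proof.
have F a b : 0 <= g a b * cap a b by rewrite mulr_ge0// g_edge_ge0.
rewrite (bigD1 i)//= (bigD1 j)//= -addrA lerDl addr_ge0// ?sumr_ge0// => a _.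
by rewrite sumr_ge0.
Qed.

Lemma sum_h_ge (i : 'I_n) : h i <= \sum_(i < n) h i.
Proof. by rewrite (bigD1 i)//= lerDl sumr_ge0// => a _; exact: h_vtx_ge0. Qed.

Lemma sum_gq_ge0 : 0 <= \sum_(i < n) \sum_(j < n) g i j * cap i j.
Proof. by rewrite sumr_ge0// => i _; rewrite sumr_ge0// => j _; rewrite mulr_ge0// g_edge_ge0. Qed.

Lemma sum_h_ge0 : 0 <= \sum_(i < n) h i.
Proof. by rewrite sumr_ge0// => i _; exact: h_vtx_ge0. Qed.

Lemma g_edge_gt1 (i j : 'I_n) : (4 * size st * entry 0 q i j + 4 * size st < edge_count st i j * size idx * big)%N -> 1 < g i j.
Proof.
rewrite size_iota => hlt; rewrite /g_edge entry_iota size_iota ltr_pdivlMr ?mulr_gt0 ?ltr0n// mul1r.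
rewrite -natrM ltr_nat; lia.
Qed.

Lemma h_vtx_gt1 (i : 'I_n) : (4 * size st < deg_count idx st i * size idx)%N -> 1 < h i.
Proof.
rewrite size_iota => hlt; rewrite /h_vtx /deg_excess size_iota ltr_pdivlMr ?mulr_gt0 ?ltr0n// mul1r.
rewrite -natrM ltr_nat; lia.
Qed.

(** Every violation would contribute at least 1/n to psi: an excess above 1 directly, a trace of at
    least 1 by Cauchy-Schwarz. *)
Lemma finished_psi : n%:R * psi big q c < 1 -> finished idx r big q st X Xd.
Proof.
move=> hpsi.
have psiE : 0 <= \sum_(i < n) \sum_(j < n) g i j ^+ 2 /\ 0 <= \sum_(i < n) h i ^+ 2 /\ 0 <= potential c.
  split; first by rewrite sumr_ge0// => i _; rewrite sumr_ge0// => j _; exact: sqr_ge0.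
  split; first by rewrite sumr_ge0// => i _; exact: sqr_ge0.
  by rewrite /potential -fmxM tr_fmx sumr_ge0// => j _; rewrite -expr2 sqr_ge0.
have [G0 [H0 P0]] := psiE; have n0 : 0 <= n%:R :> R by [].
apply/and3P; split.
- have trP1 : \tr P < 1.
    have := tr_pos_le c; rewrite ltNge => h1; apply/negP => h2.
    have : 1 <= n%:R * potential c by apply: le_trans h1; rewrite exprn_ege1.
    apply/negP; rewrite -ltNge; apply: le_lt_trans hpsi; rewrite ler_wpM2l//.
    by rewrite /psi lerDr addr_ge0// !mulr_ge0.
  have := trX_approx; rewrite ler_norml => /andP[_]; rewrite lerBlDr => hX.
  have {}hX : (sumz [seq entry 0 X i i | i <- idx])%:~R / Xd%:~R < 11 / 10 :> R.
    apply: le_lt_trans hX _; move: (n%:R * delta) small trP1 => a; lra.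
  rewrite trace_test; move: hX; rewrite ltr_pdivrMr// => hX.
  have r1 : 1 <= r%:R :> R by rewrite ler1n.
  have : Xd%:~R <= r%:R * Xd%:~R :> R by rewrite ler_peMl// ltW.
  move: hX; rewrite -[(16 * _) * _]mulrA; move: (r%:R * (Xd%:~R : R)) ((sumz _)%:~R : R) (Xd%:~R : R) Xd0 => a b d *; lra.
- apply/allP => i; rewrite mem_iota => /andP[_ hi]; apply/allP => j; rewrite mem_iota => /andP[_ hj].
  rewrite leqNgt; apply/negP => /(@g_edge_gt1 (Ordinal hi) (Ordinal hj)) /= g1.
  move: hpsi; apply/negP; rewrite -leNgt.
  have n1 : 1 <= n%:R :> R by rewrite ler1n (leq_ltn_trans _ hi).
  have : 1 <= \sum_(i < n) \sum_(j < n) g i j ^+ 2.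
    rewrite (bigD1 (Ordinal hi))//= (bigD1 (Ordinal hj))//= -addrA.
    apply: le_trans (_ : g i j ^+ 2 <= _); first by rewrite exprn_ege1// ltW.
    rewrite lerDl addr_ge0 ?sumr_ge0// => a _; first exact: sqr_ge0.
    by rewrite sumr_ge0// => b _; exact: sqr_ge0.
  move=> G1; rewrite /psi.
  have : n%:R * 1 <= n%:R * (\sum_(i < n) \sum_(j < n) g i j ^+ 2) by rewrite ler_wpM2l.
  have : 0 <= 2 * n%:R * (\sum_(i < n) h i ^+ 2) by rewrite !mulr_ge0.
  rewrite mulr1; move: (_ * (\sum_(i < n) \sum_(j < n) _)) (2 * n%:R * _) (potential c) P0 n1 => a b d d0 n1 a0 b0; rewrite -[1]mulr1 ler_pM//; lra.
- apply/allP => i; rewrite mem_iota => /andP[_ hi].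
  rewrite leqNgt; apply/negP => /(@h_vtx_gt1 (Ordinal hi)) /= g1.
  move: hpsi; apply/negP; rewrite -leNgt.
  have n1 : 1 <= n%:R :> R by rewrite ler1n (leq_ltn_trans _ hi).
  have : 1 <= \sum_(i < n) h i ^+ 2.
    rewrite (bigD1 (Ordinal hi))//=.
    apply: le_trans (_ : h i ^+ 2 <= _); first by rewrite exprn_ege1// ltW.
    by rewrite lerDl sumr_ge0// => a _; exact: sqr_ge0.
  move=> H1; rewrite /psi.
  have : 2 * n%:R * 1 <= 2 * n%:R * (\sum_(i < n) h i ^+ 2) by rewrite ler_wpM2l// mulr_ge0.
  have : 0 <= n%:R * (\sum_(i < n) \sum_(j < n) g i j ^+ 2) by rewrite mulr_ge0.
  rewrite mulr1; move=> a0 b0; move: a0 b0; move: (n%:R * (\sum_(i < n) \sum_(j < n) g i j ^+ 2)) (2 * n%:R * (\sum_(i < n) h i ^+ 2)) (potential c) P0 n1 => a b d d0 n1 a0 b0; rewrite -[1]mulr1 ler_pM//; lra.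
Qed.

(** An excess above 1 costs at least n, and the trace is at most n. For an edge this uses that the
    paths only run along edges of quantized capacity at least 1. *)
Lemma violation_margin : valid n q st ->
  ~~ finished idx r big q st X Xd -> margin <= 0 \/ 3 / 2 * r%:R <= \tr P.
Proof.
move=> hv; have n0 : 0 <= n%:R :> R by [].
have N1 : 0 <= 2 * n%:R * \sum_(i < n) h i by rewrite !mulr_ge0// sum_h_ge0.
have N2 : 0 <= n%:R * \sum_(i < n) \sum_(j < n) g i j * cap i j by rewrite mulr_ge0// sum_gq_ge0.
have N3 := trP_le; rewrite /finished 2!negb_and => /or3P[hX|hE|hD].
- right; have := trX_approx; rewrite ler_norml => /andP[_]; rewrite lerBlDr => hX'.
  move: hX; rewrite trace_test -ltNge => hX.
  have r1 : 1 <= r%:R :> R by rewrite ler1n.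
  have : 16 * r%:R / 10 < (sumz [seq entry 0 X i i | i <- idx])%:~R / Xd%:~R :> R.
    rewrite ltr_pdivlMr// mulrAC ltr_pdivrMr// [ltRHS]mulrC; exact: hX.
  move: hX' small; move: (_ / Xd%:~R) (n%:R * delta) (\tr P) (r%:R : R) r1 => a b d e *; lra.
- left; move: hE => /allPn[i]; rewrite mem_iota => /andP[_ hi] /allPn[j]; rewrite mem_iota => /andP[_ hj].
  rewrite -ltnNge => hlt; have g1 := @g_edge_gt1 (Ordinal hi) (Ordinal hj) hlt.
  have e0 : (0 < edge_count st i j)%N by case: (edge_count st i j) hlt.
  have a1 : 1 <= cap i j by rewrite ler1n; exact: edge_count_adj symq hv e0.
  have : 1 <= g i j * cap i j by exact: (mulr_ege1 (ltW g1) a1).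
  move=> h1; have := le_trans h1 (sum_gq_ge (Ordinal hi) (Ordinal hj)) => h2.
  have : n%:R * 1 <= n%:R * \sum_(i < n) \sum_(j < n) g i j * cap i j by rewrite ler_wpM2l.
  rewrite /margin mulr1; move: (_ * _) (_ * _) N1 N3 => a b *; lra.
- left; move: hD => /allPn[i]; rewrite mem_iota => /andP[_ hi].
  rewrite -ltnNge => hlt; have g1 := @h_vtx_gt1 (Ordinal hi) hlt.
  have h2 := le_trans (ltW g1) (sum_h_ge (Ordinal hi)).
  have : 2 * n%:R * 1 <= 2 * n%:R * \sum_(i < n) h i by rewrite ler_wpM2l// mulr_ge0.
  rewrite /margin mulr1; move: (_ * (\sum_(i < n) _)) (_ * (\sum_(i < n) _)) N1 N2 N3 n0 => a b *; lra.
Qed.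

End Progress.

(* The conclusion of core_exists for the capacities a, with z = 100 l^5. *)
Definition spread_out (R : realType) (n : nat) (a : 'M[R]_n) (d y z : R) (r : nat) : Prop :=
  forall (v : 'I_n -> 'I_n -> R) (D : 'I_n -> 'I_n -> R) (s : 'I_n -> R) (m := \sum_i nrm v i),
  (forall x : 'I_n -> R, \sum_i (\sum_k v i k * x k) ^+ 2 <= \sum_k x k ^+ 2) ->
  pseudometric D -> (forall i, 0 <= s i) ->
  (forall i j, sqd v i j <= s i + s j + D i j) ->
  3 / 2 * r%:R <= m ->
  m <= y * \sum_i s i \/ d * m <= z * \sum_i \sum_j a i j * D i j.

(** * Existence of a profitable path *)

Section Routing.
Variables (R : realType) (n lam big r : nat) (q : seq (seq nat)).
Notation idx := (iota 0 n).
Notation lapA st := (scaled_lap R n lam st).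
Notation w st := (edge_excess idx big q st).
Notation cap i j := ((entry 0%N q i j)%:R : R).
Hypothesis symq : forall i j, entry 0%N q i j = entry 0%N q j i.
Variables (a : 'M[R]_n) (d y z : R).
Hypothesis a0 : forall i j, 0 <= a i j.
Hypothesis d0 : 0 < d.
Hypothesis core : spread_out a d y z r.
Hypothesis capP : forall i j, a i j * big%:R <= d * (2 * cap i j + 1).
Hypothesis y0 : 0 < y.
Hypothesis z0 : 0 < z.
Hypothesis lamy : 8 * y < lam%:R.
Hypothesis lamz : 48 * z <= lam%:R.
Hypothesis bigz : 10 * n%:R ^+ 2 * z <= big%:R.
Hypothesis n0 : (0 < n)%N.
Hypothesis r0 : (0 < r)%N.

Variables (st : seq (seq nat)) (c : calculus (1%:M - lapA st)).
Hypothesis t0 : (0 < size st)%N.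
Notation P := (fmx c (@pos_part R)).
Notation t := ((size st)%:R : R).
Notation g i j := (g_edge R n big q st i j).
Notation h i := (h_vtx R n st i).
Notation M := (margin big q c).

Let lam0 : 0 < lam%:R :> R. Proof. by apply: lt_le_trans lamz; rewrite mulr_gt0. Qed.
Let nR : 0 < n%:R :> R. Proof. by rewrite ltr0n. Qed.
Let big0 : 0 < big%:R :> R. Proof. by apply: lt_le_trans bigz; rewrite !mulr_gt0// exprn_gt0. Qed.

(** The scaling 16 / lam makes the length of a path comparable with |v_i - v_j|^2 in
    [path_value]. *)
Definition path_dist (i j : 'I_n) : R := 16 / lam%:R * (n%:R * big%:R * (dst n q (w st) i j)%:R / (8 * t)).
(** The entries of the projection are at most 1 in absolute value, so 4 bounds every |v_i - v_j|^2.
    Truncation at 4 keeps the bound by distances and gives unreachable pairs a finite distance. *)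
Definition cut_dist (i j : 'I_n) : R := if routed n q (w st) i j then Num.min 4 (path_dist i j) else 4.

Lemma path_dist_ge0 i j : 0 <= path_dist i j.
Proof. by rewrite !(mulr_ge0, divr_ge0). Qed.

Lemma cut_dist_itv i j : 0 <= cut_dist i j <= 4.
Proof.
rewrite /cut_dist; case: ifP => _; last by rewrite lexx ler0n.
by rewrite le_min path_dist_ge0 ler0n ge_min lexx.
Qed.

Lemma le_path_dist (i j : 'I_n) (u v : nat) :
  (dst n q (w st) i j <= u + v)%N -> path_dist i j <=
  16 / lam%:R * (n%:R * big%:R * u%:R / (8 * t)) + 16 / lam%:R * (n%:R * big%:R * v%:R / (8 * t)).
Proof.
move=> hl; rewrite -mulrDr ler_wpM2l ?divr_ge0// -mulrDl -mulrDr -natrD.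
by rewrite ler_wpM2r ?invr_ge0 ?mulr_ge0// ler_wpM2l ?mulr_ge0// ler_nat.
Qed.

Lemma cut_dist_pseudometric : pseudometric cut_dist.
Proof.
have symw := edge_excess_sym n big symq st.
split=> [i|i j|i j k].
- rewrite /cut_dist; have /andP[-> /eqP e] := reach_refl q (w st) (ltn_ord i).
  by rewrite /path_dist e mulr0 mul0r mulr0; case: leP => //; lra.
- have S (x y' : 'I_n) : routed n q (w st) x y' -> routed n q (w st) y' x && (dst n q (w st) y' x <= dst n q (w st) x y')%N.
    exact: reach_sym.
  rewrite /cut_dist /path_dist; case: (boolP (routed _ _ _ i j)) => h1.
    have /andP[h2 l2] := S _ _ h1; have /andP[_ l1] := S _ _ h2; rewrite h2.
    by have -> : dst n q (w st) i j = dst n q (w st) j i by apply/eqP; rewrite eqn_leq l1 l2.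
  by case: (boolP (routed _ _ _ j i)) => // h2; case/negP: h1; case/andP: (S _ _ h2).
- have /andP[_ F1] := cut_dist_itv i k; have /andP[G1 _] := cut_dist_itv i j; have /andP[G2 _] := cut_dist_itv j k.
  have far (x y' : 'I_n) : ~~ routed n q (w st) x y' -> cut_dist x y' = 4 by rewrite /cut_dist => /negbTE ->.
  case: (boolP (routed n q (w st) i j)) => h1; last by rewrite (far _ _ h1); lra.
  case: (boolP (routed n q (w st) j k)) => h2; last by rewrite (far _ _ h2); lra.
  have /andP[h3 l3] := routed_trans (ltn_ord i) (ltn_ord j) (ltn_ord k) h1 h2.
  rewrite /cut_dist h1 h2 h3.
  have := le_path_dist l3; rewrite -/(path_dist i j) -/(path_dist j k).
  move: (path_dist_ge0 i j) (path_dist_ge0 j k).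
  move: (path_dist _ _) (path_dist _ _) (path_dist _ _) => x1 x2 x3.
  by case: (leP 4 x1) => ?; case: (leP 4 x2) => ?; case: (leP 4 x3) => ? *; lra.
Qed.

(** When no path attains the margin M, the surplus of |v_i - v_j|^2 over the distance is covered by
    the degree penalties of both ends and a term M/n, of which each end takes half. *)
Definition vtx_slack (i : 'I_n) : R := 16 / lam%:R * (n%:R * h i + M / (2 * n%:R)).

(** An edge of quantized capacity 0 has capacity at most d / big and distance at most 4. For the
    others rounding loses at most a factor 3, and the distance is at most the edge length. *)
Lemma capacity_dist i j : a i j * cut_dist i j <= 24 * d / lam%:R * (n%:R * (g i j * cap i j)) + 4 * d / big%:R.
Proof.
have b4 : 0 <= 4 * d / big%:R by rewrite divr_ge0 ?mulr_ge0// ltW.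
have aE : a i j <= d * (2 * cap i j + 1) / big%:R by rewrite ler_pdivlMr.
have /andP[D0 D4] := cut_dist_itv i j.
case: (posnP (entry 0 q i j)) => q0.
  rewrite q0 !mulr0 add0r; apply: le_trans (_ : a i j * 4 <= _).
    by rewrite ler_wpM2l.
  move: aE; rewrite q0 mulr0 add0r mulr1; set x := d / _; have -> : 4 * d / big%:R = x * 4 by rewrite /x; ring.
  by move=> h'; rewrite ler_wpM2r.
rewrite -[leLHS]addr0 lerD//.
have q1 : 1 <= cap i j by rewrite ler1n.
have aE' : a i j <= 3 * d * cap i j / big%:R.
  apply: le_trans aE _; rewrite ler_pM2r ?invr_gt0// -mulrA mulrCA ler_wpM2l ?(ltW d0)//; lra.
have De : cut_dist i j <= 8 * n%:R * big%:R / lam%:R * g i j.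
  have aji : adj q j i by rewrite /adj symq.
  have /andP[hr hd] := @adj_reach n q (w st) i j (ltn_ord i) (ltn_ord j) aji.
  rewrite /cut_dist hr ge_min; apply/orP; right.
  apply: le_trans (_ : 16 / lam%:R * (n%:R * big%:R * (entry 0%N (w st) j i)%:R / (8 * t)) <= _).
    by rewrite ler_wpM2l ?divr_ge0// ler_wpM2r ?invr_ge0 ?mulr_ge0// ler_wpM2l ?mulr_ge0// ler_nat.
  have t1 : 0 < t by rewrite ltr0n.
  rewrite /g_edge (edge_excess_sym n big symq st i j) le_eqVlt; apply/orP; left; apply/eqP.
  by field; rewrite !gt_eqF.
apply: le_trans (ler_pM (a0 i j) D0 aE' De) _; rewrite le_eqVlt; apply/orP; left; apply/eqP.
by field; rewrite !gt_eqF.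
Qed.

(** Otherwise the Gram vectors satisfy the hypotheses of [core]. Its first alternative fails by lam
    > 8 y, since the slacks sum up to at most 8 tr P / lam. The second fails by lam >= 48 z and big
    >= 10 n^2 z, as tr P / 2 + 2/5 < tr P. *)
Lemma routing_exists : 3 / 2 * r%:R <= \tr P -> 0 < M ->
  exists i j : 'I_n, routed n q (w st) i j /\
    M <= - (n%:R * path_value big c j i (dst n q (w st) i j)).
Proof.
move=> hP M0; apply: contrapT => no.
have sqdP (i j : 'I_n) : routed n q (w st) i j -> sqd (gram c) i j <= vtx_slack i + vtx_slack j + path_dist i j.
  move=> hr; have nm : - (n%:R * path_value big c j i (dst n q (w st) i j)) <= M.
    by rewrite leNgt; apply/negP => lt; apply: no; exists i, j; split=> //; exact: ltW.
  rewrite sqd_gram; have sP : P j i = P i j by rewrite -{1}(fmx_sym c) mxE.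
  have F (S x : R) : lam%:R / 16 * S <= x -> S <= 16 / lam%:R * x.
    have e : S = 16 / lam%:R * (lam%:R / 16 * S) by field; rewrite gt_eqF.
    by move=> Sx; rewrite e ler_wpM2l ?divr_ge0.
  rewrite /vtx_slack /path_dist -!mulrDr; apply: F.
  move: nm; rewrite /path_value sP -/(path_dist i j); set e := _ / (8 * t).
  set f := h i; set f' := h j; set p := P i i; set p' := P j j; set pp := P i j; move: e f f' p p' pp => e f f' p p' pp.
  have -> : - (n%:R * (e + n%:R * (f' + f) - lam%:R / 16 * (p' + p - 2 * pp))) =
    n%:R * (lam%:R / 16 * (p' + p - 2 * pp) - (e + n%:R * (f' + f))) by ring.
  rewrite mulrC -ler_pdivlMr// => h'.
  have -> : n%:R * f + M / (2 * n%:R) + (n%:R * f' + M / (2 * n%:R)) + e = M / n%:R + (e + n%:R * (f' + f)).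
    by field; rewrite gt_eqF.
  have -> : p + p' - 2 * pp = p' + p - 2 * pp by ring.
  by rewrite -lerBlDr.
have vs0 i : 0 <= vtx_slack i.
  rewrite mulr_ge0 ?divr_ge0// addr_ge0//; first by rewrite mulr_ge0 ?h_vtx_ge0.
  by rewrite divr_ge0 ?mulr_ge0 ?(ltW M0).
have sq4 i j : sqd (gram c) i j <= 4.
  rewrite sqd_gram; have F (x y' : 'I_n) : `|P x y'| <= 1.
    by apply: fmx_entry => k; rewrite ger0_norm ?pos_part_ge0// pos_eigv_le1.
  have := F i i; have := F j j; have := F i j; rewrite !ler_norml.
  by move: (P i i) (P j j) (P i j) => x1 x2 x3 *; lra.
have mE : \sum_i nrm (gram c) i = \tr P by apply: eq_bigr => i _; rewrite nrm_gram.
have iso := @gram_isometry R n _ c (@psd_scaled_lap R n lam st).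
have sqdD i j : sqd (gram c) i j <= vtx_slack i + vtx_slack j + cut_dist i j.
  rewrite /cut_dist; case: ifP => hr; last by apply: le_trans (sq4 i j) _; rewrite lerDr addr_ge0.
  by case: (leP 4 _) => _; [apply: le_trans (sq4 i j) _; rewrite lerDr addr_ge0| exact: sqdP].
have := core iso cut_dist_pseudometric vs0 sqdD; rewrite mE => /(_ hP)[|].
- have -> : \sum_i vtx_slack i = 16 / lam%:R * (n%:R * (\sum_(i < n) h i) + M / 2).
    rewrite -mulr_sumr big_split /= -mulr_sumr sum_const; congr (_ * (_ + _)).
    by field; rewrite gt_eqF.
  have GQ := sum_gq_ge0 R n big q st; have nGQ : 0 <= n%:R * (\sum_(i < n) \sum_(j < n) g i j * cap i j) by rewrite mulr_ge0// ltW.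
  have le2 : n%:R * (\sum_(i < n) h i) + M / 2 <= \tr P / 2.
    rewrite /margin; have -> : 2 * n%:R * \sum_(i < n) h i = 2 * (n%:R * \sum_(i < n) h i) by rewrite mulrA.
    by move: nGQ; move: (n%:R * (\sum_(i < n) \sum_(j < n) g i j * cap i j)) (n%:R * (\sum_(i < n) h i)) (\tr P) => *; lra.
  apply/negP; rewrite -ltNge; have P0 : 0 < \tr P.
    by apply: lt_le_trans hP; rewrite mulr_gt0// ltr0n.
  apply: le_lt_trans (_ : y * (16 / lam%:R * (\tr P / 2)) < _).
    by rewrite ler_pM2l// ler_wpM2l ?divr_ge0.
  have -> : y * (16 / lam%:R * (\tr P / 2)) = 8 * y * \tr P / lam%:R by field; rewrite gt_eqF.
  by rewrite ltr_pdivrMr// mulrC ltr_pM2l.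
- apply/negP; rewrite -ltNge.
  have H0 : 0 <= 2 * n%:R * \sum_(i < n) h i by rewrite !mulr_ge0 ?sum_h_ge0// ltW.
  have le2 : n%:R * (\sum_(i < n) \sum_(j < n) g i j * cap i j) <= \tr P.
    by move: M0; rewrite /margin; move: H0; move: (n%:R * (\sum_(i < n) \sum_(j < n) g i j * cap i j)) (2 * n%:R * (\sum_(i < n) h i)) (\tr P) => *; lra.
  have le3 : \sum_i \sum_j a i j * cut_dist i j <= 24 * d / lam%:R * \tr P + n%:R ^+ 2 * (4 * d / big%:R).
    apply: le_trans (_ : 24 * d / lam%:R * (n%:R * (\sum_(i < n) \sum_(j < n) g i j * cap i j)) + n%:R ^+ 2 * (4 * d / big%:R) <= _).
      have -> (u : R) : n%:R ^+ 2 * u = \sum_(i < n) \sum_(j < n) u by rewrite !sum_const mulrA -expr2.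
      rewrite !mulr_sumr -big_split; apply: ler_sum => i _ /=.
      rewrite !mulr_sumr -big_split; apply: ler_sum => j _ /=; exact: capacity_dist.
    by rewrite lerD2r ler_wpM2l// divr_ge0 ?mulr_ge0// ltW.
  have P1 : 3 / 2 <= \tr P.
    by apply: le_trans hP; rewrite ler_peMr ?divr_ge0// ler1n.
  apply: le_lt_trans (ler_wpM2l (ltW z0) le3) _.
  have e1 : 24 * z / lam%:R <= 1 / 2 by rewrite ler_pdivrMr//; move: lamz; lra.
  have e2 : 4 * n%:R ^+ 2 * z / big%:R <= 2 / 5 by rewrite ler_pdivrMr//; move: bigz; move: (n%:R ^+ 2) => u; lra.
  have -> : z * (24 * d / lam%:R * \tr P + n%:R ^+ 2 * (4 * d / big%:R)) =
     d * (24 * z / lam%:R * \tr P + 4 * n%:R ^+ 2 * z / big%:R) by field; rewrite !gt_eqF.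
  rewrite ltr_pM2l//; have e3 : 24 * z / lam%:R * \tr P <= 1 / 2 * \tr P.
    by rewrite ler_wpM2r//; move: P1; move: (\tr P) => x; lra.
  move: e2 e3 P1; move: (4 * n%:R ^+ 2 * z / big%:R) (24 * z / lam%:R * \tr P) (\tr P) => u v x e2 e3 P1; lra.
Qed.

End Routing.

(** * Convergence in polynomially many steps *)

Section Convergence.
Variables (R : realType) (n lam big r : nat) (q : seq (seq nat)) (kk : seq unit) (k T : nat).
Notation idx := (iota 0 n).
Notation lapA st := (scaled_lap R n lam st).
Notation w st := (edge_excess idx big q st).
Notation cap i j := ((entry 0%N q i j)%:R : R).
Hypothesis symq : forall i j, entry 0%N q i j = entry 0%N q j i.
Variables (a : 'M[R]_n) (d y z : R).
Hypothesis a0 : forall i j, 0 <= a i j.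
Hypothesis d0 : 0 < d.
Hypothesis core : spread_out a d y z r.
Hypothesis capP : forall i j, a i j * big%:R <= d * (2 * cap i j + 1).
Hypothesis y0 : 0 < y.
Hypothesis z0 : 0 < z.
Hypothesis lamy : 8 * y < lam%:R.
Hypothesis lamz : 48 * z <= lam%:R.
Hypothesis bigz : 10 * n%:R ^+ 2 * z <= big%:R.
Hypothesis n0 : (0 < n)%N.
Hypothesis r0 : (0 < r)%N.
Hypothesis sizek : size kk = (k + k)%N.
Notation delta := (spread R n lam * (8 / 11) ^+ k).
Notation K := (curvature R n lam big).
Hypothesis small : n%:R * delta <= 1 / 10.
Hypothesis tiny : n%:R * lam%:R * delta * (T + 2)%:R <= 1.
Hypothesis long : n%:R * (n%:R + K + 1) < (T + 1)%:R.

Let delta0 : 0 <= delta.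
Proof. by rewrite mulr_ge0 ?exprn_ge0 ?divr_ge0// ltW// spread_gt0. Qed.

Notation fin st := (finished idx r big q st (proj_num idx lam kk st) (proj_den idx lam kk st)).
Notation best st := (best_path idx lam big st (proj_num idx lam kk st) (proj_den idx lam kk st)
         (w st) (candidates idx q (w st))).

Lemma valid_best st : valid n q st -> valid n q (best st :: st).
Proof.
move=> hv; rewrite /valid /= -/(valid n q st) hv andbT.
have [[->//|h] _] := best_pathP idx lam big st (proj_num idx lam kk st) (proj_den idx lam kk st) (w st) (candidates idx q (w st)).
exact: candidatesP h.
Qed.

Lemma walk_ends p : walk n q p -> exists i j : 'I_n, head 0%N p = i /\ last 0%N p = j.
Proof.
case: p => // x s /andP[ha _].
by exists (Ordinal (allP ha x (mem_head x s))), (Ordinal (allP ha _ (mem_last x s))).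
Qed.

Let err0 : 0 <= n%:R * lam%:R * delta.
Proof. by rewrite mulr_ge0// mulr_ge0. Qed.

(** The empty path, with score 0, is good enough unless the margin is positive. In that case an
    unfinished state has a large trace, and [routing_exists] provides a path. *)
Lemma good_candidate st (c : calculus (1%:M - lapA st)) : (0 < size st)%N -> valid n q st -> ~~ fin st ->
  exists2 p, p \in [::] :: candidates idx q (w st) &
    margin big q c - n%:R * lam%:R * delta / 4 <=
      n%:R * real_score R n lam big q st (proj_num idx lam kk st) (proj_den idx lam kk st) p.
Proof.
move=> t0 hv hf; have [Xd0 XP] := proj_approx c t0 sizek.
have nil_ok : margin big q c <= 0 -> exists2 p, p \in [::] :: candidates idx q (w st) &
    margin big q c - n%:R * lam%:R * delta / 4 <=
      n%:R * real_score R n lam big q st (proj_num idx lam kk st) (proj_den idx lam kk st) p.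
  move=> hM; exists [::]; first exact: mem_head.
  by rewrite real_score_nil mulr0 subr_le0 (le_trans hM)// divr_ge0.
case: (violation_margin symq sizek c t0 r0 small hv hf) => hM; first exact: nil_ok.
case: (leP (margin big q c) 0) => M0; first exact: nil_ok.
have [i [j [hr hM']]] := routing_exists symq a0 d0 core capP y0 z0 lamy lamz bigz n0 r0 t0 hM M0.
exists (erase_loops (route n q (w st) i j)).
  by rewrite inE route_candidate ?orbT.
have [hw hh hl] := routeP (ltn_ord i) (ltn_ord j) hr.
have [w1 u1 h1 l1 c1] := erase_loopsP (w st) hw.
have nn : ~~ nilp (erase_loops (route n q (w st) i j)) by case: (erase_loops _) w1.
have := real_score_path big q t0 Xd0 XP nn (etrans h1 hh) (etrans l1 hl).
rewrite ler_norml => /andP[h _].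
set S := real_score _ _ _ _ _ _ _ _ _ in h *.
have pv : path_value big c j i (path_cost (w st) (erase_loops (route n q (w st) i j))) <= path_value big c j i (dst n q (w st) i j).
  rewrite /path_value lerB// lerD2r ler_wpM2r ?invr_ge0 ?mulr_ge0// ler_wpM2l ?mulr_ge0// ler_nat.
  exact: c1.
apply: le_trans (lerB hM' (lexx _)) _.
have nR : 0 <= n%:R :> R by [].
have -> : n%:R * lam%:R * delta / 4 = n%:R * (lam%:R * delta / 4) by ring.
rewrite -mulrN -mulrBr ler_wpM2l//; move: h pv; move: (path_value _ _ _ _ _) (path_value _ _ _ _ _) (lam%:R * delta / 4) => *; lra.
Qed.

(** The error of the computed projection enters twice, through the score of the good candidate and
    through that of the path chosen. *)
Lemma gain_best st (c : calculus (1%:M - lapA st)) : (0 < size st)%N -> valid n q st -> ~~ fin st ->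
  gain big q c [:: best st] <= - margin big q c + n%:R * lam%:R * delta / 2.
Proof.
move=> t0 hv hf; have [Xd0 XP] := proj_approx c t0 sizek.
have [p hp hM] := good_candidate c t0 hv hf.
have [bb bmax] := best_pathP idx lam big st (proj_num idx lam kk st) (proj_den idx lam kk st) (w st) (candidates idx q (w st)).
have {}bmax := bmax _ hp; rewrite -(@real_score_le R n lam big q st t0 _ _ Xd0) in bmax.
have nR : 0 <= n%:R :> R by [].
have {hM bmax}hM := le_trans hM (ler_wpM2l nR bmax).
have := valid_best hv; rewrite /valid /= => /andP[hb _]; move: hM hb; move: (best st) => b hM /orP[/nilP e|/andP[hw _]].
  rewrite e gain_nil; move: hM; rewrite e real_score_nil mulr0.
  by move: err0; move: (n%:R * lam%:R * delta) (margin _ _ _) => *; lra.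
have [i [j [hi hj]]] := walk_ends hw.
have nn : ~~ nilp b by case: b hw {hM hi hj}.
have := real_score_path big q t0 Xd0 XP nn hi hj; rewrite ler_norml => /andP[_ h].
apply: le_trans (@gain_path R n lam big q symq st c t0 b i j hi hj) _.
have := ler_wpM2l nR h; move: hM; rewrite mulrDr.
have -> : n%:R * (lam%:R * delta / 4) = n%:R * lam%:R * delta / 4 by ring.
move: (n%:R * lam%:R * delta) (margin _ _ _) (n%:R * real_score _ _ _ _ _ _ _ _ _) (n%:R * path_value _ _ _ _ _) => *; lra.
Qed.

Lemma psi_ge0 st (c : calculus (1%:M - lapA st)) : 0 <= psi big q c.
Proof.
rewrite /psi !addr_ge0//.
- by rewrite mulr_ge0// sumr_ge0// => i _; rewrite sumr_ge0// => j _; exact: sqr_ge0.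
- by rewrite !mulr_ge0// sumr_ge0// => i _; exact: sqr_ge0.
- by rewrite /potential -fmxM tr_fmx sumr_ge0// => j _; rewrite -expr2 sqr_ge0.
Qed.

(** As (t + 1)^2 (1 - 2/(t + 1)) <= t^2, weighting psi by t^2 turns the descent inequality into one
    that telescopes. The 1 added to the curvature absorbs the approximation error. *)
Lemma psi_step st (c : calculus (1%:M - lapA st)) (c' : calculus (1%:M - lapA (best st :: st))) :
  (0 < size st)%N -> (size st <= T + 1)%N -> valid n q st -> ~~ fin st ->
  ((size st).+1%:R) ^+ 2 * psi big q c' <= (size st)%:R ^+ 2 * psi big q c + (K + 1).
Proof.
move=> t0 tT hv hf; have tp : 0 < (size st).+1%:R :> R by rewrite ltr0n.
have := psi_cons big q c c' t0; have := gain_best c t0 hv hf; rewrite gain_self// -/(margin big q c).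
set M := margin big q c; set Psi := psi big q c.
have -> : Psi + n%:R * (\sum_(i < n) \sum_(j < n) g_edge R n big q st i j * cap i j) +
   2 * n%:R * (\sum_(i < n) h_vtx R n st i) - \tr (fmx c (@pos_part R)) = Psi - M.
  by rewrite /M /margin; move: (n%:R * _) (2 * n%:R * _) (\tr _) => *; ring.
set G := gain _ _ _ _; set Psi' := psi _ _ _; set err := n%:R * lam%:R * delta => hG hP.
have hErr : err * (size st).+1%:R <= 1.
  apply: le_trans tiny; rewrite ler_wpM2l ?ler_nat//.
  by rewrite addn2 ltnS -addn1.
have tE : (size st).+1%:R = (size st)%:R + 1 :> R by rewrite natr1.
have Psi0 : 0 <= Psi by exact: psi_ge0.
move: hErr hP tp Psi0; clearbody err M Psi G Psi'; rewrite {}tE; move: ((size st)%:R : R) => t hErr hP tp Psi0.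
have h1 := ler_wpM2l (ltW (exprn_gt0 2 tp)) hP.
apply: le_trans h1 _.
have -> : (t + 1) ^+ 2 * (Psi + 2 / (t + 1) * (G - (Psi - M)) + K / (t + 1) ^+ 2) =
  (t + 1) ^+ 2 * Psi + 2 * (t + 1) * (G - (Psi - M)) + K by field; rewrite gt_eqF.
have h2 : 2 * (t + 1) * (G - (Psi - M)) <= 2 * (t + 1) * (err / 2 - Psi).
  by rewrite ler_wpM2l ?mulr_ge0 ?(ltW tp)//; move: hG; lra.
have h3 : 2 * (t + 1) * (err / 2 - Psi) = err * (t + 1) - 2 * (t + 1) * Psi by field.
have h4 : (t + 1) ^+ 2 * Psi = t ^+ 2 * Psi + 2 * (t + 1) * Psi - Psi by ring.
move: h2 h3 h4 hErr Psi0; move: (_ * (G - _)) (2 * (t + 1) * (err / 2 - Psi)) (2 * (t + 1) * Psi) (err * (t + 1)) ((t + 1) ^+ 2 * Psi) (t ^+ 2 * Psi) => *; lra.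
Qed.

Lemma psi_init (c : calculus (1%:M - lapA [:: [::]])) : psi big q c <= n%:R.
Proof.
rewrite /psi big1 => [|i _]; last first.
  rewrite big1// => j _; rewrite /g_edge entry_iota /edge_count /= !mul0n sub0n mul0r expr0n//.
rewrite big1 => [|i _]; last first.
  have p0 : deg_count idx [:: [::]] i = 0%N.
    rewrite /deg_count sumnE big_map big1_seq// => j _.
    case: eqVneq => // ij; rewrite /pair_count /= /links /= addn0.
    by case: (nat_of_ord i) j ij => [|i'] [|j'].
  by rewrite /h_vtx /deg_excess p0 mul0n sub0n mul0r expr0n.
rewrite !mulr0 !add0r /potential -fmxM tr_fmx -[leRHS]mulr1 -sum_const; apply: ler_sum => j _.
have := pos_eigv_le1 c j; have := pos_part_ge0 (eigv c j); move: (pos_part _) => x x0 x1.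
by rewrite -[1]mulr1 ler_pM.
Qed.

Lemma frank_wolfe_inv (s : seq unit) (st := frank_wolfe idx r lam big q kk s) : (size s <= T)%N ->
  [/\ valid n q st, (0 < size st)%N & fin st \/
     size st = (size s).+1 /\ forall c : calculus (1%:M - lapA st),
       (size st)%:R ^+ 2 * psi big q c <= n%:R + (size s)%:R * (K + 1)].
Proof.
rewrite {}/st /frank_wolfe; elim/last_ind: s => [|s u IH] hs.
  split=> //; right; split=> //= c; rewrite expr1n mul1r mul0r addr0; exact: psi_init.
rewrite size_rcons in hs; have [hv t0 h] := IH (ltnW hs); rewrite foldl_rcons.
move: hv t0 h; move: (foldl _ _ _) => st hv t0 h; rewrite /fw_step; case: ifP => [hf|/negbT hf].
  by split=> //; left.
split=> //; first exact: valid_best.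
right; case: h => [h|[e h]]; first by rewrite h in hf.
split; first by rewrite /= e size_rcons.
move=> c'; have [c] : inhabited (calculus (1%:M - lapA st)).
  by apply: calculus_exists; rewrite raddfB /= trmx1 scaled_lap_sym.
have tT : (size st <= T + 1)%N by rewrite e addn1 ltnS ltnW.
apply: le_trans (psi_step c c' t0 tT hv hf) _.
apply: le_trans (lerD (h c) (lexx _)) _.
by rewrite size_rcons -[(size s).+1%:R]natr1 mulrDl mul1r -[leLHS]addrA.
Qed.

(** After T ticks either a finished state was met and kept, or psi <= (n + K + 1)/(T + 1) < 1/n, and
    such a state is finished. *)
Theorem frank_wolfe_finished (s : seq unit) (st := frank_wolfe idx r lam big q kk s) : size s = T ->
  [/\ valid n q st, (0 < size st)%N & fin st].
Proof.
move=> sT; have [hv t0 h] := @frank_wolfe_inv s (eq_leq sT); rewrite -/st in hv t0 h; split=> //.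
case: h => // -[e h]; have [c] : inhabited (calculus (1%:M - lapA st)).
  by apply: calculus_exists; rewrite raddfB /= trmx1 scaled_lap_sym.
apply: (finished_psi sizek (c := c)) => //; have {}h := h c.
move: h long; rewrite sT in e *; rewrite e addn1 => h lg.
have T0 : 0 < T.+1%:R :> R by rewrite ltr0n.
have K0 : 0 <= K by rewrite /curvature !addr_ge0 ?mulr_ge0 ?exprn_ge0.
have h1 : T.+1%:R * (T.+1%:R * psi big q c) <= T.+1%:R * (n%:R + K + 1).
  rewrite mulrA -expr2; apply: le_trans h _.
  have -> : T.+1%:R = T%:R + 1 :> R by rewrite natr1.
  rewrite -subr_ge0; have -> : (T%:R + 1) * (n%:R + K + 1) - (n%:R + T%:R * (K + 1)) = T%:R * n%:R + (K + 1) by ring.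
  by rewrite addr_ge0 ?mulr_ge0// addr_ge0.
rewrite ler_pM2l// in h1; rewrite -(ltr_pM2l T0) mulr1; apply: le_lt_trans lg.
by rewrite mulrCA ler_wpM2l.
Qed.

End Convergence.

(** * The routing *)

Definition ords n (p : seq nat) : seq 'I_n := pmap insub p.

Lemma val_ords n p : all (fun v => (v < n)%N) p -> map val (ords n p) = p.
Proof.
move=> h; rewrite /ords (pmap_filter (insubK _)) -[RHS](all_filterP h); apply: eq_filter => i.
by rewrite /= isSome_insub.
Qed.

Definition pair_weight (R : nmodType) n (sel : rel 'I_n) (wt : 'I_n -> 'I_n -> R) (i j : 'I_n) : R :=
  if (i < j)%N && sel i j then wt i j else 0.

(** Paths without an edge are dropped because a vertex has no demand to itself, and [i < j] lists
    each edge once. The type of amounts is a parameter, so that the rational output and its real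
    image have the same form. *)
Definition flow_of (R : nmodType) n (om : R) (sel : rel 'I_n) (wt : 'I_n -> 'I_n -> R) (st : seq (seq nat)) : routing R n :=
  [seq (ords n p, om) | p <- st & (1 < size p)%N] ++
  [seq ([:: i; j], wt i j) | i : 'I_n <- enum 'I_n, j : 'I_n <- [seq j : 'I_n <- enum 'I_n | (i < j)%N && sel i j]].

Section FlowSums.
Variables (R : numDomainType) (n : nat) (q : seq (seq nat)) (om : R) (sel : rel 'I_n) (wt : 'I_n -> 'I_n -> R).
Variable st : seq (seq nat).
Hypothesis hv : valid n q st.

Lemma valid_walk p : p \in st -> (1 < size p)%N -> walk n q p && uniq p.
Proof. by move=> /(allP hv); case: p. Qed.

Lemma val_ords_valid p : p \in st -> (1 < size p)%N -> map val (ords n p) = p.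
Proof. by move=> /valid_walk h /h /andP[]; case: p h => // x s _ /andP[ha _] _; exact: val_ords. Qed.

Lemma zip_val (p : seq 'I_n) (i j : 'I_n) : ((i, j) \in zip p (behead p)) = crosses (map val p) i j.
Proof.
rewrite /crosses; have -> : zip (map val p) (behead (map val p)) = [seq (val e.1, val e.2) | e <- zip p (behead p)].
  by case: p => // x s; rewrite /=; elim: s x => //= y s IH x; rewrite IH.
rewrite has_map -has_pred1; apply: eq_has => -[u v] /=; first by rewrite xpair_eqE !(inj_eq val_inj).
Qed.

Lemma traverses_ords p (i j : 'I_n) : p \in st -> (1 < size p)%N ->
  traverses (ords n p) i j = crosses p i j || crosses p j i.
Proof. by move=> h1 h2; rewrite /traverses !zip_val val_ords_valid. Qed.

Lemma joins_ords p (i j : 'I_n) : p \in st -> (1 < size p)%N ->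
  joins (ords n p) i j = links p i j || links p j i.
Proof.
move=> h1 h2; have := val_ords_valid h1 h2; case: (ords n p) => [|x s] e; rewrite -e // in h2 *.
by rewrite /links /= (last_map val) !xpair_eqE !(inj_eq val_inj).
Qed.

Lemma crosses_size p i j : crosses p i j -> (1 < size p)%N.
Proof. by case: p => [|x [|y s]]. Qed.

Lemma links_size p i j : i != j -> links p i j -> (1 < size p)%N.
Proof.
by case: p => [|x [|y s]] //= ij /andP[/eqP e1 /eqP e2]; move: ij; rewrite -e1 -e2 eqxx.
Qed.

Lemma sum_paths (P : pred (seq 'I_n)) (Q : pred (seq nat)) :
  {in st, forall p, (1 < size p)%N -> P (ords n p) = Q p} -> (forall p, Q p -> (1 < size p)%N) ->
  \sum_(pw <- [seq (ords n p, om) | p <- st & (1 < size p)%N] | P pw.1) pw.2 = (count Q st)%:R * om.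
Proof.
move=> h hQ; rewrite big_map big_filter_cond /= big_const_seq iter_addr_0 mulr_natl; congr (_ *+ _).
apply: eq_in_count => p hp /=; case: (boolP (1 < size p)%N) => [/(h _ hp) //|] sp.
by case: (boolP (Q p)) => [/hQ e|//]; rewrite e in sp.
Qed.

Lemma sum_pairs (P : 'I_n -> 'I_n -> bool) (a b : 'I_n) :
  (forall i j, P i j = (i == a) && (j == b) || (i == b) && (j == a)) ->
  \sum_(pw <- [seq ([:: i; j], wt i j) | i : 'I_n <- enum 'I_n, j : 'I_n <- [seq j : 'I_n <- enum 'I_n | (i < j)%N && sel i j]] |
     P (head a pw.1) (last a pw.1)) pw.2 = pair_weight sel wt a b + pair_weight sel wt b a.
Proof.
move=> hP; rewrite big_mkcond /= big_allpairs_dep /= big_enum /=.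
transitivity (\sum_i \sum_j (if P i j then pair_weight sel wt i j else 0)).
  apply: eq_bigr => i _; rewrite big_filter big_enum_cond /= big_mkcond; apply: eq_bigr => j _.
  by rewrite /pair_weight; case: ifP => //; case: ifP.
have dl (F : 'I_n -> 'I_n -> R) (x y : 'I_n) : \sum_i \sum_j (if (i == x) && (j == y) then F i j else 0) = F x y.
  rewrite (bigD1 x)//= (bigD1 y)//= !eqxx big1 ?addr0; last by move=> j /negbTE ->.
  by rewrite big1 ?addr0// => i /negbTE hi; rewrite big1// => j _; rewrite hi.
rewrite -(dl (pair_weight sel wt) a b) -(dl (pair_weight sel wt) b a) -big_split; apply: eq_bigr => i _.
rewrite -big_split; apply: eq_bigr => j _ /=; rewrite hP.
case: (boolP ((i == a) && (j == b))) => [/andP[/eqP -> /eqP ->]|_] /=; last by rewrite add0r.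
case: ifP => [/andP[/eqP e _]|_]; last by rewrite addr0.
by rewrite /pair_weight e ltnn /= addr0.
Qed.

Lemma flow_traverses (a b : 'I_n) : \sum_(pw <- flow_of om sel wt st | traverses pw.1 a b) pw.2 =
  (edge_count st a b)%:R * om + (pair_weight sel wt a b + pair_weight sel wt b a).
Proof.
rewrite /flow_of big_cat (sum_paths (P := fun p => traverses p a b) (Q := fun p => crosses p a b || crosses p b a)).
- congr (_ + _); rewrite -(sum_pairs (P := fun i j => (i == a) && (j == b) || (i == b) && (j == a)) (fun _ _ => erefl)).
  rewrite -[LHS]big_filter -[RHS]big_filter; congr (\sum_(_ <- _) _); apply: eq_in_filter => pw.
  move=> /allpairsPdep[i [j [_ _ ->]]] /=; rewrite /traverses /= !inE !xpair_eqE.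
  by rewrite !(eq_sym a) !(eq_sym b).
- by move=> p hp sp; exact: traverses_ords.
- by move=> p /orP[] /crosses_size.
Qed.

Lemma flow_joins (a b : 'I_n) : a != b -> \sum_(pw <- flow_of om sel wt st | joins pw.1 a b) pw.2 =
  (pair_count st a b)%:R * om + (pair_weight sel wt a b + pair_weight sel wt b a).
Proof.
move=> ab; have ab' : (a : nat) != b by rewrite (inj_eq val_inj).
rewrite /flow_of big_cat (sum_paths (P := fun p => joins p a b) (Q := fun p => links p a b || links p b a)).
- congr (_ + _); rewrite -(sum_pairs (P := fun i j => (i == a) && (j == b) || (i == b) && (j == a)) (fun _ _ => erefl)).
  rewrite -[LHS]big_filter -[RHS]big_filter; congr (\sum_(_ <- _) _); apply: eq_in_filter => pw.
  by move=> /allpairsPdep[i [j [_ _ ->]]] /=; rewrite !xpair_eqE.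
- by move=> p hp sp; exact: joins_ords.
- by move=> p /orP[] /links_size; rewrite ?(eq_sym (b : nat)); apply.
Qed.

Lemma uniq_ends (T : eqType) (x y : T) s : uniq (x :: y :: s) -> x != last x (y :: s).
Proof. by move=> /andP[hx _]; apply/eqP => /= e; rewrite {1}e mem_last in hx. Qed.

Lemma flow_joins_diag (a : 'I_n) : \sum_(pw <- flow_of om sel wt st | joins pw.1 a a) pw.2 = 0.
Proof.
rewrite big_seq_cond big1// => pw /andP[]; rewrite mem_cat => /orP[|].
  move=> /mapP[p]; rewrite mem_filter => /andP[sp hp] -> /=; rewrite joins_ords// orbb.
  move: (valid_walk hp sp); case: p sp {hp} => [|x [|y s]] // _ /andP[_ hu].
  by rewrite /links => /andP[/eqP h1 /eqP h2]; move: (uniq_ends hu); rewrite -[x]/(head 0%N (x :: y :: s)) h1 -[last _ _]/(last 0%N (x :: y :: s)) h2 eqxx.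
move=> /allpairsPdep[i [j [_]]]; rewrite mem_filter => /andP[/andP[ij _] _] -> /=.
by rewrite !xpair_eqE orbb => /andP[/eqP e1 /eqP e2]; move: ij; rewrite e1 e2 ltnn.
Qed.

End FlowSums.

Lemma real_routing_flow (R : realType) n (om : rat) (sel : rel 'I_n) (wt : 'I_n -> 'I_n -> rat) st :
  real_routing R (flow_of om sel wt st) = flow_of (ratr om) sel (fun i j => ratr (wt i j)) st.
Proof. by rewrite /real_routing /flow_of map_cat -map_comp map_allpairs. Qed.

Section SpectralFlow.
Variables (R : realType) (n lam big r : nat) (q : seq (seq nat)) (kk : seq unit) (k : nat).
Notation idx := (iota 0 n).
Notation lapA st := (scaled_lap R n lam st).
Hypothesis symq : forall i j, entry 0%N q i j = entry 0%N q j i.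
Variables (a : 'M[R]_n) (d : R).
Hypothesis reg : regular_graph a.
Hypothesis d0 : 0 < d.
Hypothesis d1 : d <= 2 / 3.
Hypothesis qcap : forall i j : 'I_n, (entry 0%N q i j)%:R * d <= a i j * big%:R.
Hypothesis big0 : (0 < big)%N.
Hypothesis lam0 : (0 < lam)%N.
Hypothesis r0 : (0 < r)%N.
Hypothesis sizek : size kk = (k + k)%N.
Notation delta := (spread R n lam * (8 / 11) ^+ k).
Hypothesis small : n%:R * delta <= 1 / 10.
Variable st : seq (seq nat).
Hypothesis hv : valid n q st.
Hypothesis t0 : (0 < size st)%N.
Hypothesis hf : finished idx r big q st (proj_num idx lam kk st) (proj_den idx lam kk st).
Notation t := ((size st)%:R : R).
Variables (om : R) (sel : rel 'I_n) (wt : 'I_n -> 'I_n -> R).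
Hypothesis omP : n%:R * d / (32 * t) <= om <= n%:R * d / (16 * t).
Hypothesis selP : forall i j : 'I_n, (i < j)%N -> sel i j = (0 < a i j).
Hypothesis wtP : forall i j : 'I_n, (i < j)%N -> 0 < a i j -> a i j * d / 2 <= wt i j <= 3 / 4 * a i j * d.
Notation f := (flow_of om sel wt st).

Definition demand : 'M[R]_n := \matrix_(i, j) \sum_(pw <- f | joins pw.1 i j) pw.2.
Notation W i j := (pair_weight sel wt i j + pair_weight sel wt j i).

Let a0 i j : 0 <= a i j. Proof. by case: reg. Qed.
Let asym i j : a i j = a j i. Proof. by case: reg. Qed.
Let adiag i : a i i = 0. Proof. by case: reg. Qed.
Let arow i : \sum_j a i j = 1. Proof. by case: reg. Qed.
Let tR : 0 < t. Proof. by rewrite ltr0n. Qed.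
Let bigR : 0 < big%:R :> R. Proof. by rewrite ltr0n. Qed.
Let om0 : 0 <= om.
Proof. by case/andP: omP => h _; apply: le_trans h; rewrite divr_ge0 ?mulr_ge0// ltW. Qed.

Lemma pair_weight_itv (i j : 'I_n) : (i < j)%N -> a i j * d / 2 <= pair_weight sel wt i j <= 3 / 4 * a i j * d.
Proof.
move=> ij; rewrite /pair_weight ij selP//=; case: ltP => h; first exact: wtP.
have -> : a i j = 0 by apply/eqP; rewrite eq_le h a0.
by rewrite !mulr0 !mul0r lexx.
Qed.

Lemma pair_weight_eq0 (i j : 'I_n) : (j <= i)%N -> pair_weight sel wt i j = 0.
Proof. by rewrite /pair_weight leqNgt => /negbTE ->. Qed.

Lemma W_itv i j : a i j * d / 2 <= W i j <= 3 / 4 * a i j * d.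
Proof.
case: (ltngtP i j) => ij.
- by rewrite (pair_weight_eq0 (ltnW ij)) addr0 pair_weight_itv.
- by rewrite (pair_weight_eq0 (ltnW ij)) add0r asym pair_weight_itv.
- have -> : i = j by exact: val_inj.
  by rewrite !pair_weight_eq0// adiag !mulr0 !mul0r addr0 lexx.
Qed.

Lemma W_ge0 i j : 0 <= W i j.
Proof. by have /andP[h _] := W_itv i j; apply: le_trans h; rewrite divr_ge0// mulr_ge0// ltW. Qed.

(** The paths receive half of each capacity. The direct demand is at most 3/4 a d <= a/2, because d
    <= 2/3, and fits into the other half. *)
Lemma edge_flow_le (i j : 'I_n) : (edge_count st i j)%:R * om <= a i j / 2.
Proof.
have [e0|e0] := posnP (edge_count st i j); first by rewrite e0 mul0r divr_ge0.
have q1 : 1 <= (entry 0%N q i j)%:R :> R by rewrite ler1n; exact: edge_count_adj symq hv e0.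
have n1 : 0 < n%:R :> R by rewrite ltr0n (leq_ltn_trans _ (ltn_ord i)).
have /and3P[_ /allP hE _] := hf; have := hE i; rewrite mem_iota => /(_ (ltn_ord i)) /allP /(_ (j : nat)).
rewrite mem_iota => /(_ (ltn_ord j)); rewrite size_iota -(ler_nat R) !(natrM, natrD) => hE'.
have {}hE' : (edge_count st i j)%:R * n%:R * big%:R <= 8 * t * (entry 0%N q i j)%:R :> R.
  apply: le_trans hE' _; have : t <= t * (entry 0%N q i j)%:R by rewrite ler_peMr// ltW.
  rewrite -!mulrA; move: (t * _) => u; lra.
case/andP: omP => _ h2; apply: le_trans (ler_wpM2l (ler0n _ _) h2) _.
have -> : (edge_count st i j)%:R * (n%:R * d / (16 * t)) =
  (edge_count st i j)%:R * n%:R * big%:R * (d / (16 * t * big%:R)) by field; rewrite !gt_eqF.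
have dp : 0 <= d / (16 * t * big%:R) by rewrite divr_ge0 ?mulr_ge0// ltW.
apply: le_trans (ler_wpM2r dp hE') _.
have -> : 8 * t * (entry 0%N q i j)%:R * (d / (16 * t * big%:R)) = (entry 0%N q i j)%:R * d / big%:R / 2.
  by field; rewrite !gt_eqF.
by rewrite ler_pM2r ?invr_gt0// ler_pdivrMr.
Qed.

Lemma adj_capacity (i j : 'I_n) : adj q i j -> 0 < a i j.
Proof.
rewrite /adj => h; have := qcap i j; rewrite lt_neqAle a0 andbT eq_sym => h'.
apply/eqP => e; move: h'; rewrite e mul0r leNgt => /negP; apply.
by rewrite mulr_gt0// ltr0n.
Qed.

Lemma demandE i j : i != j -> demand i j = pair_mx R n st i j * om + W i j.
Proof. by move=> ij; rewrite !mxE (negbTE ij) (flow_joins _ _ _ hv ij). Qed.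

Lemma demand_diag i : demand i i = 0.
Proof. by rewrite mxE (flow_joins_diag _ _ _ hv). Qed.

Lemma demandE' : demand = om *: pair_mx R n st + \matrix_(i, j) W i j.
Proof.
apply/matrixP => i j; rewrite scaleDE [X in _ = _ + X]mxE.
have [<-|ij] := eqVneq i j; last by rewrite demandE// mulrC.
by rewrite demand_diag mxE eqxx mulr0 pair_weight_eq0// addr0 addr0.
Qed.

Lemma walk_simple (p : seq 'I_n) : walk n q (map val p) -> uniq (map val p) -> simple_path a p.
Proof.
rewrite map_inj_uniq; last exact: val_inj.
case: p => // x s /= /andP[_ hp] -> ; rewrite andbT; rewrite path_map in hp.
by apply: sub_path hp => i j /=; exact: adj_capacity.
Qed.

Lemma flow_multicommodity : multicommodity_flow a demand f.
Proof.
split.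
- split=> [i j|i j|i].
  + have [<-|ij] := eqVneq i j; first by rewrite demand_diag.
    by rewrite demandE// addr_ge0 ?mulr_ge0 ?pair_mx_ge0 ?W_ge0.
  + have [->//|ij] := eqVneq i j; rewrite !demandE// 1?eq_sym//.
    by rewrite pair_mx_sym [X in _ + X = _]addrC.
  + exact: demand_diag.
- move=> pw; rewrite mem_cat => /orP[/mapP[p]|/allpairsPdep[i [j [_]]]].
    rewrite mem_filter => /andP[sp hp] -> /=; split=> //.
    have /andP[h1 h2] := valid_walk hv hp sp.
    by apply: walk_simple; rewrite (val_ords_valid hv).
  rewrite mem_filter => /andP[/andP[ij]]; rewrite selP// => aij _ -> /=.
  rewrite aij /= inE andbT; split.
    by apply/eqP => e; move: ij; rewrite e ltnn.
  by have /andP[h _] := wtP ij aij; apply: le_trans h; rewrite divr_ge0// mulr_ge0// ltW.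
- by move=> i j; rewrite mxE.
- move=> i j; rewrite (flow_traverses _ _ _ hv); have /andP[_ h] := W_itv i j.
  have h2 : 3 / 4 * a i j * d <= a i j / 2.
    have -> : a i j / 2 = 3 / 4 * a i j * (2 / 3) by field.
    by rewrite ler_wpM2l// mulr_ge0// divr_ge0.
  have := edge_flow_le i j; move: (_ * om) (W i j) (a i j) h h2 => *; lra.
Qed.

(** By regularity the direct demand gives each vertex a degree between d/2 and 3d/4; the paths add
    at most d/4. *)
Lemma flow_degrees i : d / 2 <= \sum_j demand i j <= d.
Proof.
rewrite demandE'; have -> : \sum_j (om *: pair_mx R n st + \matrix_(i, j) W i j) i j =
   om * (deg_count idx st i)%:R + \sum_j W i j.
  by rewrite deg_countE mulr_sumr -big_split; apply: eq_bigr => j _; rewrite scaleDE [X in _ + X = _]mxE.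
have w1 : d / 2 <= \sum_j W i j.
  have -> : d / 2 = \sum_j a i j * d / 2 by rewrite -!mulr_suml arow mul1r.
  by apply: ler_sum => j _; have /andP[h _] := W_itv i j.
have w2 : \sum_j W i j <= 3 / 4 * d.
  have -> : 3 / 4 * d = \sum_j 3 / 4 * a i j * d by rewrite -mulr_suml -mulr_sumr arow mulr1.
  by apply: ler_sum => j _; have /andP[_ h] := W_itv i j.
have n1 : 0 < n%:R :> R by rewrite ltr0n (leq_ltn_trans _ (ltn_ord i)).
have w3 : om * (deg_count idx st i)%:R <= d / 4.
  have /and3P[_ _ /allP hD] := hf; have := hD i; rewrite mem_iota => /(_ (ltn_ord i)).
  rewrite size_iota -(ler_nat R) !natrM => hD'.
  case/andP: omP => _ h2; apply: le_trans (ler_wpM2r (ler0n _ _) h2) _.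
  have -> : n%:R * d / (16 * t) * (deg_count idx st i)%:R = (deg_count idx st i)%:R * n%:R * (d / (16 * t)).
    by field; rewrite !gt_eqF.
  have dp : 0 <= d / (16 * t) by rewrite divr_ge0 ?mulr_ge0// ltW.
  apply: le_trans (ler_wpM2r dp hD') _; rewrite le_eqVlt; apply/orP; left; apply/eqP.
  by field; rewrite !gt_eqF.
have w4 : 0 <= om * (deg_count idx st i)%:R by rewrite mulr_ge0.
by move: w1 w2 w3 w4; move: (om * _) (\sum_j _) => u v *; apply/andP; split; lra.
Qed.

(** The lower bound on [om] makes the Laplacian at least d / (2 lam) times A, and A >= 1 - P for the
    positive part P of 1 - A. With tr P <= 1.7 r the condition of [kth_eigenvalue_lower] reads 17 r
    < 18 r. *)
Lemma flow_spectrum m : (2 * r <= m)%N -> kth_eigenvalue_ge (laplacian demand) m (d * (1 / (20 * lam%:R))).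
Proof.
move=> rm; have [c] : inhabited (calculus (1%:M - lapA st)).
  by apply: calculus_exists; rewrite raddfB /= trmx1 scaled_lap_sym.
have lamR : 0 < lam%:R :> R by rewrite ltr0n.
have r1 : 1 <= r%:R :> R by rewrite ler1n.
have -> : d * (1 / (20 * lam%:R)) = d / (2 * lam%:R) / 10 by field; rewrite gt_eqF.
have Wsym i j : (\matrix_(i, j) W i j : 'M[R]_n) i j = (\matrix_(i, j) W i j : 'M[R]_n) j i.
  by rewrite !mxE addrC.
have W0 i j : 0 <= (\matrix_(i, j) W i j : 'M[R]_n) i j by rewrite mxE W_ge0.
have x0 : 0 < d / (2 * lam%:R) by rewrite divr_gt0// mulr_gt0.
apply: (@kth_eigenvalue_lower R n (laplacian demand) (fmx c (@pos_part R)) _ (17 / 10 * r%:R)).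
- apply: laplacian_sym => i j; have [->//|ij] := eqVneq i j.
  by rewrite !demandE// 1?eq_sym// pair_mx_sym [X in _ + X = _]addrC.
- exact: x0.
- by apply: psd_fmx => j; exact: pos_part_ge0.
- have lapE : laplacian demand = om *: laplacian (pair_mx R n st) + laplacian (\matrix_(i, j) W i j).
    rewrite demandE' laplacianD; congr (_ + _).
    apply/matrixP => i j; have sE (X : 'M[R]_n) i' j' : (om *: X) i' j' = om * X i' j' by rewrite mxE.
    rewrite laplacianE !sE laplacianE mulrBr; congr (_ - _).
    by case: eqP => _; rewrite ?mulr0// mulr_sumr; apply: eq_bigr => l _; rewrite sE.
  rewrite lapE addrAC; apply: psdD; last exact: psd_laplacian.
  have psdL : psd (laplacian (pair_mx R n st)) by apply: psd_laplacian; [exact: pair_mx_sym|exact: pair_mx_ge0].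
  have psdN : psd (fmx c (@neg_part R)) by apply: psd_fmx => j; exact: neg_part_ge0.
  have e1 : 1%:M - fmx c (@pos_part R) = lapA st - fmx c (@neg_part R).
    have -> : fmx c (@pos_part R) = (1%:M - lapA st) + fmx c (@neg_part R).
      by apply/eqP; rewrite -subr_eq (fmx_pos_neg c).
    by rewrite opprD addrA subKr.
  have e2 (X Y N : 'M[R]_n) u : X - u *: (Y - N) = (X - u *: Y) + u *: N by rewrite scalerBr opprB addrA addrAC.
  rewrite e1 e2; apply: psdD; last by apply: psdZ => //; exact: ltW.
  have -> : om *: laplacian (pair_mx R n st) - (d / (2 * lam%:R)) *: lapA st =
     (om - n%:R * d / (32 * t)) *: laplacian (pair_mx R n st).
    rewrite /scaled_lap scalerA -scalerBl; congr (_ *: _); congr (_ - _).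
    by field; rewrite !gt_eqF.
  by apply: psdZ => //; rewrite subr_ge0; case/andP: omP.
- have := trX_approx sizek c t0; rewrite ler_norml => /andP[h _].
  have [Xd0 _] := proj_approx c t0 sizek.
  have /and3P[hX _ _] := hf; move: hX; rewrite (trace_test R) => hX.
  have : (sumz [seq entry 0 (proj_num idx lam kk st) i i | i <- idx])%:~R / (proj_den idx lam kk st)%:~R <= 16 / 10 * r%:R :> R.
    rewrite ler_pdivrMr//; move: hX; rewrite -!mulrA; move: (r%:R * _) (sumz _)%:~R => u v; lra.
  move: h small r1; move: (_ / (proj_den idx lam kk st)%:~R) (n%:R * delta) (\tr _) (r%:R : R) => *; lra.
- apply: lt_le_trans (_ : 9 * (2 * r)%:R <= _); last by rewrite ler_wpM2l// ler_nat.
  by rewrite natrM; move: (r%:R : R) r1 => *; lra.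
Qed.

Theorem flow_correct m : (2 * r <= m)%N -> spectral_SSE_flow a m d (1 / (20 * lam%:R)) demand f.
Proof.
by move=> rm; split; [exact: flow_multicommodity|exact: flow_degrees|exact: flow_spectrum].
Qed.

End SpectralFlow.

(** * Choice of the constants *)

Section Constants.
Local Open Scope nat_scope.
Definition unary_mul (u v : seq unit) : seq unit := flatten [seq v | _ <- u].
Definition scale_of (r : nat) : nat := 100 * size (bin r) ^ 5.
Definition lam_of (kL r : nat) : nat := kL * scale_of r.
Definition big_of (n r : nat) : nat := 10 * (n * n) * scale_of r.
(** Lists of units are unary counters for the folds. With B = O(log n) the length 2 m B provides the
    k + k steps of the error bound and keeps 3^length polynomial. *)
Definition newton_steps (m n : nat) : seq unit := unary_mul [seq tt | _ <- true :: bin n] (nseq (m + m) tt).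
Definition unary_size (idx : seq nat) (r : nat) : seq unit := [seq tt | _ <- idx] ++ [seq tt | _ <- bin r].
(** The number of ticks has to exceed about n times the curvature, whose leading term is of order
    n^10 l^10 after this multiplication; (n + l)^20 dominates it. *)
Definition ticks_of (C : nat) (idx : seq nat) (r : nat) : seq unit :=
  iter 20 (unary_mul (unary_size idx r)) (nseq C tt).

Lemma size_unary_mul u v : size (unary_mul u v) = size u * size v.
Proof. by rewrite size_flatten /shape -map_comp; elim: u => //= _ u ->; rewrite mulSn. Qed.

Lemma size_newton_steps m n : size (newton_steps m n) = m * (size (bin n)).+1 + m * (size (bin n)).+1.
Proof. by rewrite size_unary_mul size_nseq /= size_map; nia. Qed.

Lemma size_ticks C idx r : size (ticks_of C idx r) = C * (size idx + size (bin r)) ^ 20.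
Proof.
rewrite /ticks_of; set u := unary_size idx r; have su : size u = size idx + size (bin r) by rewrite size_cat !size_map.
elim: 20 => [|k IH]; first by rewrite expn0 muln1 size_nseq.
by rewrite iterS size_unary_mul su IH expnS mulnCA.
Qed.

Definition tick_const (z kL : nat) : nat := (10 * z) ^ 2 + (kL * z) ^ 2 + 4.

Lemma leq_expn x y a : x <= y -> x ^ a <= y ^ a.
Proof. by case: a => // a; rewrite leq_exp2r. Qed.

Lemma ticks_long z kL n l : 0 < n ->
  n * (n + (n ^ 5 * (10 * (n * n) * (z * l ^ 5)) ^ 2 + 2 * n ^ 6 + n ^ 6 * (kL * (z * l ^ 5)) ^ 2) + 1) <= tick_const z kL * (n + l) ^ 20.
Proof.
move=> n0; set S := n + l; have nS : n <= S by exact: leq_addr.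
have lS : l <= S by exact: leq_addl.
have S0 : 0 < S by apply: leq_trans nS.
have mon a b : a + b <= 20 -> n ^ a * l ^ b <= S ^ 20.
  move=> ab; apply: leq_trans (_ : S ^ a * S ^ b <= _); first by apply: leq_mul; exact: leq_expn.
  by rewrite -expnD leq_pexp2l.
have h1 := mon 2 0 isT; have h2 := mon 10 10 isT; have h3 := mon 7 0 isT; have h4 := mon 7 10 isT; have h5 := mon 1 0 isT.
rewrite expn0 muln1 in h1 h3 h5; rewrite /tick_const.
apply: leq_trans (_ : (10 * z) ^ 2 * (n ^ 10 * l ^ 10) + (kL * z) ^ 2 * (n ^ 7 * l ^ 10) + (n ^ 2 + 2 * n ^ 7 + n ^ 1) <= _).
  by rewrite leq_eqVlt; apply/orP; left; apply/eqP; ring.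
rewrite 2!mulnDl; apply: leq_add; first by apply: leq_add; rewrite leq_mul2l ?h2 ?h4 orbT.
move: h1 h3 h5; move: (n ^ 2) (n ^ 7) (n ^ 1) (S ^ 20) => *; lia.
Qed.

(** The exponents add up as 1 + 5 + 7 + 40 = 53, and the constant factor D is absorbed by D <=
    N^D. *)
Lemma newton_enough A C n l N : 1 < N -> n <= N -> l <= N ->
  (n * (A * l ^ 5) * (8 + n * n * (A * l ^ 5)) * (C * (n + l) ^ 20 + 2) <= N ^ (53 + (A + 10) * (A + 8) * (C + 2))) /\
  (10 * n * (8 + n * n * (A * l ^ 5)) <= N ^ (53 + (A + 10) * (A + 8) * (C + 2))).
Proof.
move=> N1 nN lN; have N0 : 0 < N by exact: ltnW.
have pow1 a : 0 < N ^ a by rewrite expn_gt0 N0.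
have l5 : A * l ^ 5 <= A * N ^ 5 by rewrite leq_mul2l leq_expn ?orbT.
have e1 : 8 + n * n * (A * l ^ 5) <= (A + 8) * N ^ 7.
  have : n * n * (A * l ^ 5) <= N * N * (A * N ^ 5) by apply: leq_mul => //; apply: leq_mul.
  have -> : N * N * (A * N ^ 5) = A * N ^ 7 by ring.
  by have := pow1 7; move: (N ^ 7) (n * n * _) => *; nia.
have e2 : C * (n + l) ^ 20 + 2 <= (C + 2) * N ^ 40.
  have : C * (n + l) ^ 20 <= C * N ^ 40.
    have -> : N ^ 40 = (N * N) ^ 20 by rewrite expnMn -expnD.
    by rewrite leq_mul2l leq_expn ?orbT//; nia.
  by have := pow1 40; move: (N ^ 40) (C * _ ^ 20) => *; nia.
set D := (A + 10) * (A + 8) * (C + 2).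
have DN : D * N ^ 53 <= N ^ (53 + D).
  rewrite expnD mulnC leq_mul2l; apply/orP; right.
  by apply: leq_trans (ltnW (ltn_expl D (isT : 1 < 2))) _; exact: leq_expn.
split; apply: leq_trans DN.
  apply: leq_trans (_ : N * (A * N ^ 5) * ((A + 8) * N ^ 7) * ((C + 2) * N ^ 40) <= _).
    by apply: leq_mul => //; apply: leq_mul => //; exact: leq_mul.
  have -> : N * (A * N ^ 5) * ((A + 8) * N ^ 7) * ((C + 2) * N ^ 40) = A * (A + 8) * (C + 2) * N ^ 53 by ring.
  by rewrite leq_mul2r /D !leq_mul ?orbT// leq_addr.
apply: leq_trans (_ : 10 * N * ((A + 8) * N ^ 7) <= _).
  by apply: leq_mul => //; rewrite leq_mul2l nN orbT.
have -> : 10 * N * ((A + 8) * N ^ 7) = 10 * (A + 8) * N ^ 8 by ring.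
apply: leq_mul; last by rewrite leq_pexp2l.
by rewrite /D -[leqLHS]muln1; apply: leq_mul; [apply: leq_mul => //; exact: leq_addl | lia].
Qed.
End Constants.

(** The factor 3 comes from 2 (8/11)^3 <= 1: with N = 2^B, an error of N^-M takes 3 M B steps. *)
Definition newton_const (z kL : nat) : nat :=
  3 * (53 + (kL * z + 10) * (kL * z + 8) * (tick_const z kL + 2)).

Section Solve.
Variable R : realType.

Lemma spread_le n lam : spread R n lam <= (8 + n * n * lam)%N%:R.
Proof.
rewrite /spread natrD !natrM; have : 0 <= n%:R * n%:R * lam%:R :> R by rewrite !mulr_ge0.
by move: (_ * _) => x; lra.
Qed.

Lemma newton_decay (m N b : nat) : (N = 2 ^ b)%N -> N%:R ^+ m * (8 / 11 : R) ^+ (3 * m * b) <= 1.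
Proof.
move=> ->; rewrite natrX -exprM [(b * m)%N]mulnC -mulnA [X in _ * X]exprM -exprMn.
apply: exprn_ile1; first by rewrite mulr_ge0// exprn_ge0// divr_ge0.
by rewrite !exprS expr0; lra.
Qed.

(* The constant a1 absorbs the constants of the vector partition theorem, kL the
   loss in the eigenvalue. *)
Theorem solve_correct : exists (a1 : R) (kL : nat), [/\ 0 < a1, (0 < kL)%N &
  forall (n : nat) (a : 'M[R]_n) (Phi d : R) (r : nat) (q : seq (seq nat))
    (idx := iota 0 n) (lam := lam_of kL r) (big := big_of n r)
    (m := newton_const 100 kL) (kk := newton_steps m n)
    (st := frank_wolfe idx r lam big q kk (ticks_of (tick_const 100 kL) idx r)),
  (1 < n)%N -> (1 < r <= n)%N ->
  (forall i j, 0 <= a i j) -> 0 < Phi -> 0 < d ->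
  (forall S : {set 'I_n}, S != finset.set0 -> (#|S| * r <= n)%N -> Phi * #|S|%:R <= cut a S) ->
  d ^+ 2 * ln n%:R <= a1 * Phi ^+ 2 * (size (bin r))%:R ->
  (forall i j, entry 0%N q i j = entry 0%N q j i) ->
  (forall i j : 'I_n, a i j * big%:R <= d * (2 * (entry 0%N q i j)%:R + 1)) ->
  [/\ n%:R * (spread R n lam * (8 / 11) ^+ (m * (size (bin n)).+1)) <= 1 / 10,
      valid n q st, (0 < size st)%N
    & finished idx r big q st (proj_num idx lam kk st) (proj_den idx lam kk st)]].
Proof.
have [a1 [CS [a10 CS0 core]]] := core_exists R.
have [kL kL1 kL2] : exists2 kL : nat, 48 <= kL%:R :> R & 8 * CS < kL%:R.
  exists (48 + Num.bound (8 * CS))%N; rewrite natrD; first by rewrite lerDl.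
  by apply: lt_le_trans (archi_boundP _) _; rewrite ?mulr_ge0 ?(ltW CS0)// lerDr.
have kL0 : (0 < kL)%N by rewrite -(ltr0n R); apply: lt_le_trans kL1.
exists a1, kL; split=> // n a Phi d r q idx lam big m kk st n1 /andP[r1 rn] a0 Phi0 d0 cutP dP symq capP.
have l0 : (0 < size (bin r))%N.
  by rewrite lt0n; apply/negP => /eqP e; have := ltn_bin r; rewrite e ltnNge (ltnW r1).
have lb : (size (bin r) <= size (bin n))%N by rewrite size_bin_leP (leq_ltn_trans rn (ltn_bin n)).
set B := (size (bin n)).+1; have [N NE] : exists N, (N = 2 ^ B)%N by eexists.
have nN : (n <= N)%N by rewrite NE ltnW// (ltn_trans (ltn_bin n))// ltn_exp2l.
have lN : (size (bin r) <= N)%N by rewrite NE ltnW// (leq_ltn_trans lb)// (ltn_trans (ltnSn _))// ltn_expl.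
have N1 : (1 < N)%N by apply: leq_trans nN.
have lamE : lam = (kL * 100 * size (bin r) ^ 5)%N by rewrite /lam /lam_of /scale_of mulnA.
have [P1 P2] := newton_enough (kL * 100) (tick_const 100 kL) N1 nN lN.
rewrite -lamE in P1 P2; have dec := newton_decay (53 + (kL * 100 + 10) * (kL * 100 + 8) * (tick_const 100 kL + 2)) NE.
have mE : (3 * (53 + (kL * 100 + 10) * (kL * 100 + 8) * (tick_const 100 kL + 2)) = m)%N by [].
rewrite mE in dec; move: P1 P2 dec; set M := (53 + _)%N; move=> P1 P2 dec.
have e8 : 0 <= (8 / 11 : R) ^+ (m * B) by rewrite exprn_ge0// divr_ge0.
have small : n%:R * (spread R n lam * (8 / 11) ^+ (m * B)) <= 1 / 10.
  rewrite mulrA ler_pdivlMr// mulrC !mulrA; apply: le_trans dec; rewrite ler_wpM2r// -natrX.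
  apply: le_trans (ler_wpM2l (_ : 0 <= 10 * n%:R) (spread_le n lam)) _; first by rewrite mulr_ge0.
  by rewrite -!natrM ler_nat.
have tR : size (ticks_of (tick_const 100 kL) idx r) = (tick_const 100 kL * (n + size (bin r)) ^ 20)%N.
  by rewrite size_ticks size_iota.
have tiny : n%:R * lam%:R * (spread R n lam * (8 / 11) ^+ (m * B)) * (tick_const 100 kL * (n + size (bin r)) ^ 20 + 2)%:R <= 1.
  rewrite -!mulrA [_ ^+ _ * _]mulrC !mulrA; apply: le_trans dec; rewrite ler_wpM2r// -natrX.
  rewrite -[_ * _ * spread _ _ _ * _]mulrA -mulrA.
  apply: le_trans (_ : n%:R * (lam%:R * ((8 + n * n * lam)%N%:R * (tick_const 100 kL * (n + size (bin r)) ^ 20 + 2)%:R)) <= _).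
    by rewrite ler_wpM2l// ler_wpM2l// ler_wpM2r// spread_le.
  have e (u v : nat) : (n * (lam * (u * v)) = n * lam * u * v)%N by rewrite !mulnA.
  by rewrite -!natrM ler_nat e.
have long : n%:R * (n%:R + curvature R n lam big + 1) < (tick_const 100 kL * (n + size (bin r)) ^ 20 + 1)%:R :> R.
  have := ticks_long 100 kL (size (bin r)) (ltnW n1); rewrite -(ler_nat R) => h; rewrite natrD ltr_pwDr// (le_trans _ h)//.
  rewrite /curvature /lam /big /lam_of /big_of /scale_of; set z := (100 * _)%N; set b := (10 * (n * n) * z)%N.
  by rewrite !(natrM, natrD, natrX).
have scale0 : (0 < scale_of r)%N by rewrite muln_gt0 expn_gt0 l0.
have sE : (scale_of r)%:R = 100 * (size (bin r))%:R ^+ 5 :> R by rewrite natrM natrX.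
have y0 : 0 < CS * (size (bin r))%:R ^+ 3 by rewrite mulr_gt0// exprn_gt0// ltr0n.
have z0 : 0 < (scale_of r)%:R :> R by rewrite ltr0n.
have core' : spread_out a d (CS * (size (bin r))%:R ^+ 3) (scale_of r)%:R r.
  move=> v D s mm iso Dm s0 sq m32; rewrite sE.
  apply: (core 'I_n n a Phi d r (size (bin r)) v D s) => //; rewrite ?card_ord//.
  - exact: ltnW.
  - exact: ltnW (ltn_bin r).
have lamR : lam%:R = kL%:R * (scale_of r)%:R :> R by exact: natrM.
have bigR : big%:R = 10 * (n%:R * n%:R) * (scale_of r)%:R :> R by rewrite -!natrM.
have lamz : 48 * (scale_of r)%:R <= lam%:R :> R by rewrite lamR ler_wpM2r// ltW.
have lamy : 8 * (CS * (size (bin r))%:R ^+ 3) < lam%:R.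
  apply: lt_le_trans (_ : kL%:R * (size (bin r))%:R ^+ 3 <= _).
    by rewrite mulrA ltr_pM2r// exprn_gt0// ltr0n.
  rewrite lamR ler_wpM2l// sE; have h : 1 <= (size (bin r))%:R :> R by rewrite ler1n.
  have h3 : (size (bin r))%:R ^+ 3 <= (size (bin r))%:R ^+ 5 :> R by rewrite ler_weXn2l.
  apply: le_trans h3 _; have h5 : 0 <= (size (bin r))%:R ^+ 5 :> R by rewrite exprn_ge0.
  have -> : 100 = 1 + 99 :> R by rewrite -natr1 addrC.
  by rewrite mulrDl mul1r lerDl mulr_ge0.
have bigz : 10 * n%:R ^+ 2 * (scale_of r)%:R <= big%:R :> R by rewrite bigR expr2.
have := @frank_wolfe_finished R n lam big r q kk (m * B) (tick_const 100 kL * (n + size (bin r)) ^ 20)%N symq a d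
  (CS * (size (bin r))%:R ^+ 3) (scale_of r)%:R a0 d0 core' capP y0 z0 lamy lamz bigz (ltnW n1) (ltnW r1)
  (size_newton_steps m n) small tiny long _ tR.
by move=> [h1 h2 h3]; split.
Qed.

End Solve.

(** * Consequences of admissibility *)

Section Admissible.
Variables (R : realType) (n : nat) (a : 'M[R]_n) (r : nat).
Hypothesis reg : regular_graph a.
Hypothesis r2 : (2 <= r)%N.

Let a0 i j : 0 <= a i j. Proof. by case: reg. Qed.

Lemma expansion_ge0 (S : {set 'I_n}) : 0 <= expansion a S.
Proof. by rewrite divr_ge0// sumr_ge0// => i _; rewrite sumr_ge0. Qed.

Lemma phi_local_le (S : {set 'I_n}) : S != finset.set0 -> (#|S| * r <= n)%N -> phi_local a r <= expansion a S.
Proof.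
move=> S0 Sr; apply: ge_inf; first by exists 0 => _ [U _ <-]; exact: expansion_ge0.
exists S => //; split; first by rewrite card_gt0.
by rewrite ler_pdivlMr ?ltr0n 1?ltnW// -natrM ler_nat.
Qed.

Lemma phi_local_ge0 : 0 <= phi_local a r.
Proof.
rewrite /phi_local; set E := (X in inf X).
case: (pselect (E !=set0)%classic) => h; last first.
  by rewrite inf_out// => -[].
by apply: lb_le_inf => // _ [U _ <-]; exact: expansion_ge0.
Qed.

Lemma phi_local_gt0_size : 0 < phi_local a r -> (r <= n)%N.
Proof.
rewrite ltNge; apply: contraNleq => nr; rewrite /phi_local inf_out// => -[[x [S [S0 Sr] _]] _].
move: Sr; rewrite ler_pdivlMr ?ltr0n 1?ltnW// -natrM ler_nat leqNgt => /negP; apply.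
by apply: leq_trans nr _; rewrite leq_pmull.
Qed.

Lemma phi_local_cut (S : {set 'I_n}) : S != finset.set0 -> (#|S| * r <= n)%N -> phi_local a r * #|S|%:R <= cut a S.
Proof.
move=> S0 Sr; have S1 : (0 < #|S|)%N by rewrite card_gt0.
rewrite -ler_pdivlMr ?ltr0n//; apply: le_trans (phi_local_le S0 Sr) _.
(* As r >= 2, the set has at most n/2 vertices, so the minimum is its own size. *)
rewrite /expansion (minn_idPl _)//; move: (#|S|) Sr S1 => s; nia.
Qed.

Lemma phi_local_le1 : (r <= n)%N -> phi_local a r <= 1.
Proof.
move=> rn; have n0 : (0 < n)%N by apply: leq_trans rn; apply: leq_trans r2.
pose i := Ordinal n0; have c1 : #|[set i]| = 1%N by rewrite cards1.
apply: le_trans (phi_local_le (S := [set i]) _ _) _; rewrite ?c1 ?mul1n//.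
  by rewrite -card_gt0 c1.
rewrite /expansion c1 big_set1; have -> : minn 1 (n - 1) = 1%N by apply/minn_idPl; lia.
rewrite divr1; have [_ _ _ /(_ i) <-] := reg.
by rewrite [leRHS](bigID (mem (~: [set i]))) /= lerDl sumr_ge0.
Qed.

Lemma ln_nat_gt0 m : 0 < ln (m%:R : R) -> (1 < m)%N.
Proof. by rewrite ltNge; apply: contraNltn => m1; apply: ln_le0; rewrite lern1. Qed.

Lemma ln_le_bits m : (0 < m)%N -> ln (m%:R : R) <= (size (bin m))%:R.
Proof.
move=> m0; have two : ln (2 : R) <= 1.
  have -> : 2 = 1 + 1 :> R by []. apply: le_ln1Dx; lra.
apply: le_trans (_ : ln ((2 : R) ^+ size (bin m)) <= _).
  rewrite ler_ln ?posrE ?ltr0n ?exprn_gt0//.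
  by rewrite -natrX ler_nat ltnW// ltn_bin.
by rewrite lnXn// -[leLHS]mulr_natl ler_piMr.
Qed.

Lemma admissible_facts (c1 a1 d : R) : 0 < c1 -> c1 <= 1 / 2 -> c1 <= a1 -> admissible c1 a r d -> d != 0 ->
  [/\ (1 < n)%N, (r <= n)%N, 0 < phi_local a r, 0 < d <= 2 / 3 &
   d ^+ 2 * ln n%:R <= a1 * phi_local a r ^+ 2 * (size (bin r))%:R].
Proof.
move=> c10 c1h c1a [_ _ d0 dP] dn; have {d0 dn}d0 : 0 < d by rewrite lt_neqAle eq_sym dn.
have P0 := phi_local_ge0; set Phi := phi_local a r in dP P0 *.
have L0 : 0 < Num.sqrt (ln (n%:R : R)).
  rewrite lt_neqAle sqrtr_ge0 andbT eq_sym; apply: contraTneq (lt_le_trans d0 dP) => ->.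
  by rewrite invr0 mulr0 ltxx.
have L1 : 0 < ln (n%:R : R) by rewrite -sqrtr_gt0.
have n1 : (1 < n)%N by exact: ln_nat_gt0.
have Phi0 : 0 < Phi.
  rewrite lt_neqAle P0 andbT eq_sym; apply: contraTneq (lt_le_trans d0 dP) => ->.
  by rewrite mulr0 !mul0r ltxx.
have rn := phi_local_gt0_size Phi0; have Phi1 := phi_local_le1 rn.
have r0 : (0 < r)%N by exact: ltnW.
have R0 : 0 <= ln (r%:R : R) by rewrite ln_ge0// ler1n.
have RN : ln (r%:R : R) <= ln n%:R by rewrite ler_ln ?posrE ?ltr0n ?ler_nat// ltnW.
rewrite ler_pdivlMr// in dP.
split=> //.
  rewrite d0 /=; apply: le_trans (_ : c1 * Phi <= _); last first.
    apply: le_trans (_ : 1 / 2 * 1 <= _); last by lra.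
    by rewrite ler_pM// ltW.
  rewrite -(ler_pM2r L0); apply: le_trans dP _.
  by rewrite ler_pM2l ?mulr_gt0//; exact: ler_wsqrtr.
have : (d * Num.sqrt (ln n%:R)) ^+ 2 <= (c1 * Phi * Num.sqrt (ln r%:R)) ^+ 2.
  by rewrite lerXn2r// nnegrE !mulr_ge0 ?sqrtr_ge0// ltW.
rewrite !exprMn !sqr_sqrtr//; last exact: ltW.
move=> h; apply: le_trans h _; apply: ler_pM; rewrite ?mulr_ge0 ?exprn_ge0 ?(ltW c10)//; last exact: ln_le_bits.
rewrite ler_wpM2r ?exprn_ge0//; apply: le_trans c1a; rewrite expr2 ler_piMl ?(ltW c10)//.
by apply: le_trans c1h _; lra.
Qed.

End Admissible.

Lemma laplacian0 (R : pzRingType) n : laplacian (0 : 'M[R]_n) = 0.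
Proof.
rewrite /laplacian subr0; apply/matrixP => i j; rewrite !mxE big1 ?mul0rn// => k _; rewrite mxE//.
Qed.

Lemma zero_flow (R : realType) n (a : 'M[R]_n) m lambda : regular_graph a ->
  spectral_SSE_flow a m 0 lambda 0 [::].
Proof.
move=> [a0 _ _ _]; split.
- by split=> //; [split=> *; rewrite ?mxE | move=> *; rewrite big_nil ?mxE | move=> *; rewrite big_nil].
- by move=> i; rewrite mul0r big1 ?lexx// => j _; rewrite mxE.
- exists (nseq n 0); last by move=> _; rewrite mul0r nth_nseq if_same.
  split; first by elim: (n) => // -[|k] //= ->; rewrite lexx.
  rewrite laplacian0 -(scale0r 1%:M) scalemx1 /char_poly /char_poly_mx map_scalar_mx -raddfB /= det_scalar.
  by rewrite big_nseq iter_mulr_1.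
Qed.

(** The program measures log r by the number of bits of r, at most (2 / ln 2) ln r for r >= 2; the
    fifth power of this factor goes into the constant. *)
Lemma loss_bound (R : realType) (kL r : nat) : (0 < kL)%N -> (2 <= r)%N ->
  (20 * kL%:R * 100 * (2 / ln 2) ^+ 5)^-1 * (ln (r%:R : R)) ^- 5 <= 1 / (20 * (lam_of kL r)%:R).
Proof.
move=> kL0 r2; have l2 : 0 < ln (2 : R) by rewrite ln_gt0// ltr1n.
have lr2 : ln 2 <= ln (r%:R : R) by rewrite ler_ln ?posrE ?ltr0n ?ler_nat// ltnW.
have lr0 : 0 < ln (r%:R : R) by exact: lt_le_trans lr2.
have l0 : (0 < size (bin r))%N.
  by rewrite lt0n; apply/negP => /eqP e; have := ltn_bin r; rewrite e ltnNge (ltnW r2).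
have lb : (size (bin r))%:R <= 2 / ln 2 * ln (r%:R : R).
  rewrite mulrAC ler_pdivlMr//; case: (size (bin r)) l0 (size_bin_leP r (size (bin r)).-1) => // l _ /=.
  rewrite ltnn => /esym /negbT; rewrite -leqNgt => h.
  have h' : l%:R * ln (2 : R) <= ln (r%:R : R).
    by rewrite mulr_natl -lnXn// ler_ln ?posrE ?ltr0n ?exprn_gt0 1?ltnW// -natrX ler_nat.
  have -> : l.+1%:R = l%:R + 1 :> R by rewrite natr1.
  rewrite mulrDl mul1r; move: h' lr2; move: (l%:R * ln (2 : R)) (ln (2 : R)) (ln (r%:R : R)) => *; lra.
have kR : 0 < kL%:R :> R by rewrite ltr0n.
have lR : 0 < (size (bin r))%:R :> R by rewrite ltr0n.
have -> : (lam_of kL r)%:R = kL%:R * (100 * (size (bin r))%:R ^+ 5) :> R by rewrite /lam_of natrM /scale_of natrM natrX.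
rewrite mul1r -invfM; have H (u : R) : 0 < u -> 0 < u ^+ 5 by exact: exprn_gt0.
have c100 : 0 < 100 :> R by rewrite ltr0n.
rewrite lef_pV2 ?posrE; first last.
- exact: (mulr_gt0 _ (mulr_gt0 kR (mulr_gt0 c100 (H _ lR)))).
- by apply: (mulr_gt0 (mulr_gt0 (mulr_gt0 (mulr_gt0 _ kR) c100) (H _ _)) (H _ lr0)) => //; exact: divr_gt0.
have h5 : (size (bin r))%:R ^+ 5 <= (2 / ln 2) ^+ 5 * ln (r%:R : R) ^+ 5.
  by rewrite -exprMn lerXn2r// nnegrE ltW// mulr_gt0// divr_gt0.
move: h5; move: ((2 / ln (2 : R)) ^+ 5) ((size (bin r))%:R ^+ 5 : R) (ln (r%:R : R) ^+ 5) => x y z h5.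
have e u : 20 * (kL%:R * (100 * u)) = 20 * kL%:R * 100 * u :> R by rewrite !mulrA.
have c20 : 0 < 20 * kL%:R * 100 :> R by apply: (mulr_gt0 _ c100); exact: (mulr_gt0 _ kR).
by rewrite e -[leRHS]mulrA ler_pM2l.
Qed.

Section MainFlow.
Variable R : realType.

(** What both parts of the theorem share. The quantized capacities, the amount [om] per path and the
    direct demands are left open, since the program has to round them to fractions that it can write
    in lowest terms. *)
Definition is_flow_constants (c1 c2 : R) (kL : nat) : Prop :=
  [/\ 0 < c1, 0 < c2 & forall (n : nat) (a : 'M[R]_n) (d : R) (r : nat),
    admissible c1 a r d -> d != 0 ->
    [/\ (1 < n)%N, (r <= n)%N, 0 < d <= 2 / 3, c2 * (ln r%:R) ^- 5 <= 1 / (20 * (lam_of kL r)%:R) &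
    forall (q : seq (seq nat))
      (st := frank_wolfe (iota 0 n) r (lam_of kL r) (big_of n r) q (newton_steps (newton_const 100 kL) n)
               (ticks_of (tick_const 100 kL) (iota 0 n) r)),
    (forall i j, entry 0%N q i j = entry 0%N q j i) ->
    (forall i j : 'I_n, (entry 0%N q i j)%:R * d <= a i j * (big_of n r)%:R <= d * (2 * (entry 0%N q i j)%:R + 1)) ->
    [/\ (0 < size st)%N, valid n q st, forall p, p \in st -> (1 < size p)%N -> (n <= 4 * size st)%N &
    forall om sel wt m, n%:R * d / (32 * (size st)%:R) <= om <= n%:R * d / (16 * (size st)%:R) ->
      (forall i j : 'I_n, (i < j)%N -> sel i j = (0 < a i j)) ->
      (forall i j : 'I_n, (i < j)%N -> 0 < a i j -> a i j * d / 2 <= wt i j <= 3 / 4 * a i j * d) ->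
      (2 * r <= m)%N ->
      exists delta, spectral_SSE_flow a m d (1 / (20 * (lam_of kL r)%:R)) delta (flow_of om sel wt st)]]].

Lemma flow_constants_exist : exists c1 c2 kL, is_flow_constants c1 c2 kL.
Proof.
have [a1 [kL [a10 kL0 main]]] := solve_correct R.
pose c1 := Num.min (1 / 2) a1.
have c10 : 0 < c1 by rewrite lt_min a10 andbT; lra.
have c1h : c1 <= 1 / 2 by rewrite ge_min lexx.
have c1a : c1 <= a1 by rewrite ge_min lexx orbT.
have l2 : 0 < ln (2 : R) by rewrite ln_gt0// ltr1n.
exists c1, (20 * kL%:R * 100 * (2 / ln 2) ^+ 5)^-1, kL; split=> //.
  have [c20 c100] : 0 < 20 :> R /\ 0 < 100 :> R by rewrite !ltr0n.
  have kR : 0 < kL%:R :> R by rewrite ltr0n.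
  have p5 : 0 < (2 / ln (2 : R)) ^+ 5 by rewrite exprn_gt0// divr_gt0.
  by rewrite invr_gt0; exact: (mulr_gt0 (mulr_gt0 (mulr_gt0 c20 kR) c100) p5).
move=> n a d r adm dn; have [reg r2 _ _] := adm.
have [n1 rn Phi0 d0 dP] := admissible_facts reg r2 c10 c1h c1a adm dn.
have r0 : (0 < r)%N by exact: ltnW.
split=> //; first exact: loss_bound.
move=> q st symq capq; have /andP[dp d1] := d0.
have a0 i j : 0 <= a i j by case: reg.
have l0 : (0 < size (bin r))%N.
  by rewrite lt0n; apply/negP => /eqP e; have := ltn_bin r; rewrite e ltnNge (ltnW r2).
have z0 : (0 < scale_of r)%N by rewrite muln_gt0 expn_gt0 l0.
have lam0 : (0 < lam_of kL r)%N by rewrite muln_gt0 kL0.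
have big0 : (0 < big_of n r)%N by rewrite muln_gt0 z0 !muln_gt0 (ltnW n1).
have r1n : (1 < r <= n)%N by rewrite r2.
have capP (i j : 'I_n) : a i j * (big_of n r)%:R <= d * (2 * (entry 0%N q i j)%:R + 1) by have /andP[] := capq i j.
have [small hv t0 hf] := main n a (phi_local a r) d r q n1 r1n a0 Phi0 dp (phi_local_cut reg r2) dP symq capP.
(* A path with distinct ends gives its first vertex a positive degree count, and the degree test
   then bounds n by 4 [size st]. *)
split=> // [p hp sp|om sel wt m omP selP wtP rm].
  have /andP[hw hu] := valid_walk hv hp sp.
  have [i [j [hi hj]]] := walk_ends hw.
  have ij : i != j.
    apply/eqP => e; case: p sp hu hi hj {hp hw} => [|x [|y s]] // _ hu hi hj.
    by move: (uniq_ends hu); rewrite -[x]/(head 0%N (x :: y :: s)) hi -[last _ _]/(last 0%N (x :: y :: s)) hj e eqxx.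
  have /and3P[_ _ /allP hD] := hf; have := hD i; rewrite mem_iota size_iota => /(_ (ltn_ord i)).
  apply: leq_trans; rewrite leq_pmull// -(ltr0n R) deg_countE (bigD1 j)//= ltr_wpDr//.
    by rewrite sumr_ge0// => k _; exact: pair_mx_ge0.
  rewrite mxE (negbTE ij) ltr0n -has_count; apply/hasP; exists p => //=.
  by rewrite /links hi hj !eqxx.
have qcap (i j : 'I_n) : (entry 0%N q i j)%:R * d <= a i j * (big_of n r)%:R by have /andP[] := capq i j.
exists (demand st om sel wt).
exact: (flow_correct symq reg dp d1 qcap big0 lam0 r0 (size_newton_steps _ n) small hv t0 hf omP selP wtP rm).
Qed.

(** Over the reals the floor quantizes the capacities, and the upper ends of the allowed ranges
    serve as amounts. *)
Lemma real_flow_exists (c1 c2 : R) kL : is_flow_constants c1 c2 kL ->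
  forall (n : nat) (c : 'M[R]_n) (r : nat) (d : R), admissible c1 c r d ->
  exists (lambda : R) (delta : 'M[R]_n) (f : routing R n),
    c2 * (ln r%:R) ^- 5 <= lambda /\ spectral_SSE_flow c (2 * r) d lambda delta f.
Proof.
move=> [c10 c20 main] n c r d adm; have [reg r2 _ _] := adm.
have [->|dn] := eqVneq d 0.
  by exists (c2 * (ln r%:R) ^- 5), 0, [::]; split=> //; exact: zero_flow.
have [n1 rn /andP[d0 _] lb {}main] := main n c d r adm dn.
have c0 i j : 0 <= c i j by case: reg.
have csym i j : c i j = c j i by case: reg.
pose val2 i j : nat := if (insub i : option 'I_n, insub j : option 'I_n) is (Some i', Some j')
  then Num.truncn (c i' j' * (big_of n r)%:R / d) else 0%N.
pose q := tab (iota 0 n) val2.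
have qE (i j : 'I_n) : entry 0%N q i j = Num.truncn (c i j * (big_of n r)%:R / d).
  by rewrite entry_iota /val2 !valK.
have symq i j : entry 0%N q i j = entry 0%N q j i.
  rewrite !entry_tab andbC; case: ifP => // /andP[hi hj]; rewrite !size_iota in hi hj.
  by rewrite !nth_iota// !add0n /val2; case: insubP => [i' _ _|]; case: insubP => [j' _ _|] //; rewrite csym.
have capq (i j : 'I_n) : (entry 0%N q i j)%:R * d <= c i j * (big_of n r)%:R <= d * (2 * (entry 0%N q i j)%:R + 1).
  rewrite qE; set x := c i j * _ / d; have x0 : 0 <= x by rewrite divr_ge0 ?mulr_ge0// ltW.
  have -> : c i j * (big_of n r)%:R = x * d by rewrite /x divfK// gt_eqF.
  have /andP[h1 h2] := truncn_itv x0; rewrite ler_pM2r// h1 /= mulrC ler_pM2l//.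
  apply: le_trans (ltW h2) _; rewrite -natr1 lerD2r ler_peMl//; lra.
have [t0 _ _ flow] := main q symq capq.
set st := frank_wolfe _ _ _ _ _ _ _ in t0 flow.
have tR : 0 < (size st)%:R :> R by rewrite ltr0n.
have nR : 0 < n%:R :> R by rewrite ltr0n ltnW.
have [||||delta hd] := flow (n%:R * d / (16 * (size st)%:R)) (fun i j => 0 < c i j) (fun i j => 3 / 4 * c i j * d) (2 * r)%N.
- rewrite lexx andbT ler_pM2l ?mulr_gt0// lef_pV2 ?posrE ?mulr_gt0// ler_pM2r//; lra.
- by [].
- move=> i j _ cij; rewrite lexx andbT; have : 0 < c i j * d by rewrite mulr_gt0.
  have -> : 3 / 4 * c i j * d = 3 / 4 * (c i j * d) by rewrite mulrA.
  by move: (c i j * d) => u; lra.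
- by [].
by exists (1 / (20 * (lam_of kL r)%:R)), delta, (flow_of (n%:R * d / (16 * (size st)%:R)) (fun i j => 0 < c i j) (fun i j => 3 / 4 * c i j * d) st).
Qed.

End MainFlow.

Local Close Scope ring_scope.

(** * The program *)

Definition token_step (a : seq (seq bool) * seq bool) (s : option bool) : seq (seq bool) * seq bool :=
  if s is Some b then (a.1, b :: a.2) else (a.2 :: a.1, [::]).
Definition tokens (w : seq (option bool)) : seq nat :=
  [seq unbin (rev s) | s <- rev (foldl token_step ([::], [::]) w).1].

(** The number n is given in binary, and counting up to a binary number takes exponential time in
    general. The token list contains the capacities and is longer than n, so it serves as a unary
    bound that [vertices] cuts down to n. *)
Definition range (s : seq nat) : seq nat := rev (foldl (fun a _ => size a :: a) [::] s).
Definition vertices (tok : seq nat) : seq nat := [seq i <- range tok | i < nth 0 tok 0].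

(** The first four tokens are n, r and the two parts of d; numerators and denominators of the
    capacities alternate after them, row by row. *)
Definition cap_num (tok idx : seq nat) (i j : nat) : nat := nth 0 tok (4 + 2 * (i * size idx + j)).
Definition cap_den (tok idx : seq nat) (i j : nat) : nat := nth 0 tok (5 + 2 * (i * size idx + j)).

(* The largest power of 2 below x / y, or 0. *)
Definition pow2_floor (x y : nat) : nat :=
  if y <= x then foldl (fun z _ => if (z + z) * y <= x then z + z else z) 1 (bin x) else 0.
(* The smallest power of 2 above x / y. *)
Definition pow2_ceil (x y : nat) : nat :=
  foldl (fun z _ => if x <= z * y then z else z + z) 1 (bin x).

Definition quantized (tok idx : seq nat) : seq (seq nat) :=
  tab idx (fun i j => pow2_floor
    (cap_num tok idx i j * big_of (size idx) (nth 0 tok 1) * nth 0 tok 3) (cap_den tok idx i j * nth 0 tok 2)).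

(** A fraction in lowest terms between x/2 and 3x/4, where x is capacity times d. Let z be the least
    power of 2 with z >= 4/(3x). If z <= 2/x, then 1/z will do; otherwise 3/(2z) does, as z <
    8/(3x). This avoids computing a gcd. *)
Definition edge_weight (tok idx : seq nat) (i j : nat) : nat * nat :=
  if pow2_ceil (4 * (cap_den tok idx i j * nth 0 tok 3)) (3 * (cap_num tok idx i j * nth 0 tok 2)) *
      (cap_num tok idx i j * nth 0 tok 2) <= 2 * (cap_den tok idx i j * nth 0 tok 3)
  then (1, pow2_ceil (4 * (cap_den tok idx i j * nth 0 tok 3)) (3 * (cap_num tok idx i j * nth 0 tok 2)))
  else (3, pow2_ceil (4 * (cap_den tok idx i j * nth 0 tok 3)) (3 * (cap_num tok idx i j * nth 0 tok 2)) +
           pow2_ceil (4 * (cap_den tok idx i j * nth 0 tok 3)) (3 * (cap_num tok idx i j * nth 0 tok 2))).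

(** The denominator of the amount per path. The bounds on [om] differ by a factor 2, so that a power
    of 2 can meet them. *)
Definition path_weight (tok idx : seq nat) (st : seq (seq nat)) : nat :=
  pow2_ceil (16 * size st * nth 0 tok 3) (size idx * nth 0 tok 2).

Definition state_of (m C kL : nat) (tok idx : seq nat) : seq (seq nat) :=
  frank_wolfe idx (nth 0 tok 1) (lam_of kL (nth 0 tok 1)) (big_of (size idx) (nth 0 tok 1))
    (quantized tok idx) (newton_steps m (size idx)) (ticks_of C idx (nth 0 tok 1)).

Definition path_tokens (y : nat) (p : seq nat) : seq nat := [:: 1, y, size p & p].
Definition edge_tokens (tok idx : seq nat) (i j : nat) : seq nat :=
  [:: (edge_weight tok idx i j).1; (edge_weight tok idx i j).2; 2; i; j].

Definition report (tok idx : seq nat) (st : seq (seq nat)) : seq nat :=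
  flatten [seq path_tokens (path_weight tok idx st) p | p <- [seq p <- st | 1 < size p]] ++
  flatten (flatten [seq [seq edge_tokens tok idx i j | j <- [seq j <- idx | (i < j) && (1 <= cap_num tok idx i j)]] | i <- idx]).

Definition answer (m C kL : nat) (tok : seq nat) : seq nat :=
  if nth 0 tok 2 == 0 then [::] else report tok (vertices tok) (state_of m C kL tok (vertices tok)).

Definition word_of (s : seq nat) : seq (option bool) := flatten [seq [seq Some b | b <- bin m] ++ [:: None] | m <- s].

Definition program (m C kL : nat) (w : seq (option bool)) : seq (option bool) := word_of (answer m C kL (tokens w)).

Section Running.
Context {E : Type} {EE : Enc E}.

Lemma PT_tokens (w : E -> seq (option bool)) : PT w -> PT (fun e => tokens (w e)).
Proof.
move=> hw; rewrite /tokens; pts.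
apply: (PT_foldl_incr (f := fun _ => token_step) (a := fun _ => ([::], [::])) (l := w)); pts.
  rewrite /token_step; apply: (PT_match_option (o := fun p : E * (seq (seq bool) * seq bool) * option bool => p.2)
    (f := fun p => (p.1.2.2 :: p.1.2.1, [::])) (g := fun p b => (p.1.2.1, b :: p.1.2.2))); pts.
exists (fun _ => 10); first by pb.
move=> e [s t] [b|] /=; rewrite !sz_pair !sz_cons ?sz_nil; last by lia.
by have := sz_bool b; lia.
Qed.

Lemma rangeE s : range s = iota 0 (size s).
Proof.
rewrite /range; suff -> : foldl (fun a _ => size a :: a) [::] s = rev (iota 0 (size s)) by rewrite revK.
elim/last_ind: s => // s x IH; rewrite foldl_rcons IH size_rev size_iota size_rcons.
by rewrite -[in RHS]addn1 iotaD rev_cat.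
Qed.

Lemma PT_range (s : E -> seq nat) : PT s -> PT (fun e => range (s e)).
Proof.
move=> hs; rewrite /range; pts.
apply: (PT_foldl (f := fun (_ : E) (a : seq nat) (_ : nat) => size a :: a)); pts.
have ps := PT_size hs; exists (fun e => 1 + sz (s e) * (4 * sz (s e) + 2)); first by pb.
move=> e j js; have js' : j <= sz (s e) by apply: leq_trans js (size_le_sz _).
pose g (a : seq nat) (_ : nat) := size a :: a.
assert (H : forall i, i <= j -> size (foldl g [::] (take i (s e))) = i /\
   sz (foldl g [::] (take i (s e))) <= 1 + i * (4 * sz (s e) + 2)); last first.
  have [_ h] := H j (leqnn j); apply: leq_trans h _.
  by rewrite leq_add2l leq_mul2r js' orbT.
elim=> [_|i IH ij]; first by rewrite take0 sz_nil.
have [h1 h2] := IH (ltnW ij); rewrite (take_nth 0) ?(leq_trans ij js)// foldl_rcons /g -/g h1 /= h1; split=> //.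
rewrite sz_cons; have hi : i < 2 ^ sz (s e) by apply: leq_ltn_trans (ltn_expl _ _); first exact: leq_trans (ltnW ij) js'.
have := sz_nat_bound hi; move: h2; move: (sz (foldl _ _ _)) (sz i) (sz (s e)) => *; nia.
Qed.

Lemma PT_succn (f : E -> nat) : PT f -> PT (fun e => (f e).+1).
Proof. by move=> hf; apply: (eq_PT (f := fun e => f e + 1)); [move=> e; rewrite addn1 | pts]. Qed.

Lemma PT_expn (f : E -> nat) k : PT f -> PT (fun e => f e ^ k).
Proof.
move=> hf; elim: k => [|k IH]; first exact: PT_cst.
by apply: (eq_PT (f := fun e => f e * f e ^ k)); [move=> e; rewrite expnS | pts].
Qed.

Lemma pow2_iter (c : nat -> bool) (s : seq bool) :
  foldl (fun z (_ : bool) => if c z then z + z else z) 1 s <= 2 ^ size s.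
Proof.
elim/last_ind: s => // s x IH; rewrite foldl_rcons size_rcons expnS; case: ifP => _; lia.
Qed.

Lemma PT_pow2_loop (c : E -> nat -> bool) (s : E -> seq bool) :
  PT (fun p : E * nat => c p.1 p.2) -> PT s ->
  PT (fun e => foldl (fun z (_ : bool) => if c e z then z + z else z) 1 (s e)).
Proof.
move=> hc hs; apply: (PT_foldl (f := fun e z (_ : bool) => if c e z then z + z else z)); pts.
have ps := PT_size hs; exists (fun e => 4 * (sz (s e) + 1) + 1); first by pb.
move=> e j js; apply: sz_nat_bound; apply: leq_ltn_trans (pow2_iter _ _) _.
by rewrite ltn_exp2l// size_takel// addn1 ltnS (leq_trans js) ?size_le_sz.
Qed.

Lemma PT_pow2_floor (x y : E -> nat) : PT x -> PT y -> PT (fun e => pow2_floor (x e) (y e)).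
Proof.
move=> hx hy; rewrite /pow2_floor; apply: PT_if; [by pts | | by pts].
by apply: (PT_pow2_loop (c := fun e z => (z + z) * y e <= x e)); pts.
Qed.

Lemma PT_pow2_ceil (x y : E -> nat) : PT x -> PT y -> PT (fun e => pow2_ceil (x e) (y e)).
Proof.
move=> hx hy; rewrite /pow2_ceil.
apply: (eq_PT (f := fun e => foldl (fun z (_ : bool) => if ~~ (x e <= z * y e) then z + z else z) 1 (bin (x e)))).
  by move=> e; congr foldl; apply: funext => z; apply: funext => b; rewrite if_neg.
by apply: (PT_pow2_loop (c := fun e z => ~~ (x e <= z * y e))); pts.
Qed.

End Running.

Section CapacityLookup.
Context {E : Type} {EE : Enc E}.
Implicit Types (tok idx : E -> seq nat) (i j r n : E -> nat).

Lemma PT_cap_num tok idx i j : PT tok -> PT idx -> PT i -> PT j -> PT (fun e => cap_num (tok e) (idx e) (i e) (j e)).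
Proof. by move=> *; rewrite /cap_num; pts. Qed.

Lemma PT_cap_den tok idx i j : PT tok -> PT idx -> PT i -> PT j -> PT (fun e => cap_den (tok e) (idx e) (i e) (j e)).
Proof. by move=> *; rewrite /cap_den; pts. Qed.

Lemma PT_scale_of r : PT r -> PT (fun e => scale_of (r e)).
Proof. by move=> hr; rewrite /scale_of; apply: PT_muln; [pts | apply: PT_expn; pts]. Qed.

End CapacityLookup.

Ltac pt_t9 := lazymatch goal with
  | |- PT (fun x => S (@?f x)) => apply: (PT_succn (f := f))
  | |- PT (fun x => range (@?f x)) => apply: (PT_range (s := f))
  | |- PT (fun x => cap_num (@?t x) (@?d x) (@?i x) (@?j x)) => apply: (PT_cap_num (tok := t) (idx := d) (i := i) (j := j))
  | |- PT (fun x => cap_den (@?t x) (@?d x) (@?i x) (@?j x)) => apply: (PT_cap_den (tok := t) (idx := d) (i := i) (j := j))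
  | |- PT (fun x => pow2_floor (@?f x) (@?g x)) => apply: (PT_pow2_floor (x := f) (y := g))
  | |- PT (fun x => pow2_ceil (@?f x) (@?g x)) => apply: (PT_pow2_ceil (x := f) (y := g))
  | |- PT (fun x => scale_of (@?f x)) => apply: (PT_scale_of (r := f))
  end.
Ltac pt_user ::= first [pt_flow | pt_t9].

Section Quantization.
Context {E : Type} {EE : Enc E}.
Implicit Types (tok idx : E -> seq nat) (i j r n : E -> nat).

Lemma PT_lam_of kL r : PT r -> PT (fun e => lam_of kL (r e)).
Proof. by move=> hr; rewrite /lam_of; pts. Qed.

Lemma PT_big_of n r : PT n -> PT r -> PT (fun e => big_of (n e) (r e)).
Proof. by move=> hn hr; rewrite /big_of; pts. Qed.

Lemma PT_vertices tok : PT tok -> PT (fun e => vertices (tok e)).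
Proof. by move=> h; rewrite /vertices; pts. Qed.

Lemma PT_edge_weight tok idx i j : PT tok -> PT idx -> PT i -> PT j ->
  PT (fun e => edge_weight (tok e) (idx e) (i e) (j e)).
Proof. by move=> ht hidx hi hj; rewrite /edge_weight; apply: PT_if; pts. Qed.

Lemma PT_path_weight tok idx (st : E -> seq (seq nat)) : PT tok -> PT idx -> PT st ->
  PT (fun e => path_weight (tok e) (idx e) (st e)).
Proof. by move=> ht hidx hst; rewrite /path_weight; pts. Qed.

End Quantization.

Ltac pt_t10 := lazymatch goal with
  | |- PT (fun x => big_of (@?n x) (@?f x)) => apply: (PT_big_of (n := n) (r := f))
  | |- PT (fun x => edge_weight (@?t x) (@?d x) (@?i x) (@?j x)) => apply: (PT_edge_weight (tok := t) (idx := d) (i := i) (j := j))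
  | |- PT (fun x => path_weight (@?t x) (@?d x) (@?s x)) => apply: (PT_path_weight (tok := t) (idx := d) (st := s))
  end.
Ltac pt_user ::= first [pt_flow | pt_t9 | pt_t10].

Section RunningProgram.
Context {E : Type} {EE : Enc E}.
Implicit Types (tok idx : E -> seq nat) (i j r n : E -> nat) (u v : E -> seq unit).

Lemma PT_unary_mul u v : PT u -> PT v -> PT (fun e => unary_mul (u e) (v e)).
Proof. by move=> *; rewrite /unary_mul; pts. Qed.

Lemma PT_newton_steps m n : PT n -> PT (fun e => newton_steps m (n e)).
Proof. by move=> hn; rewrite /newton_steps; apply: PT_unary_mul; pts. Qed.

Lemma PT_ticks_of C idx r : PT idx -> PT r -> PT (fun e => ticks_of C (idx e) (r e)).
Proof.
move=> hidx hr; rewrite /ticks_of.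
have hu : PT (fun e => unary_size (idx e) (r e)) by rewrite /unary_size; pts.
by elim: 20 => [|k IH]; [exact: PT_cst | exact: PT_unary_mul].
Qed.

(** Bounding 3 by 4 gives a power of 2 to the number of bits of n, which is at most 2 n for n >
    0. *)
Lemma pow3_newton_steps m (n : nat) : 3 ^ size (newton_steps m n) <= ((4 * n + 2) ^ 2) ^ (m + m).
Proof.
rewrite size_newton_steps -mulnDl mulnC expnM; apply: leq_expn.
apply: leq_trans (_ : 4 ^ (size (bin n)).+1 <= _); first exact: leq_expn.
rewrite -[4]/(2 ^ 2) -expnM mulnC expnM; apply: leq_expn.
case: (posnP n) => [->|n0]; first by [].
case: (size (bin n)) (size_bin_leP n (size (bin n)).-1) => [|k] /=; first by move=> _; lia.
by rewrite ltnn => /esym /negbT; rewrite -leqNgt !expnS; lia.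
Qed.

Lemma PT_quantized tok idx : PT tok -> PT idx -> PT (fun e => quantized (tok e) (idx e)).
Proof. by move=> ht hi; rewrite /quantized; pts. Qed.

Lemma PT_state_of m C kL tok idx : PT tok -> PT idx -> PT (fun e => state_of m C kL (tok e) (idx e)).
Proof.
move=> ht hidx; rewrite /state_of; have hn : PT (fun e => size (idx e)) by pts.
have hr : PT (fun e => nth 0 (tok e) 1) by pts.
apply: PT_frank_wolfe; pts.
- exact: PT_lam_of.
- exact: PT_quantized.
- exact: PT_newton_steps.
- exact: PT_ticks_of.
apply: (pb_le (u := fun e => ((4 * sz (idx e) + 2) ^ 2) ^ (m + m))).
  move=> e; apply: leq_trans (pow3_newton_steps _ _) _; apply: leq_expn; apply: leq_expn.
  by rewrite leq_add2r leq_mul2l size_le_sz.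
by have pi := PT_size hidx; pb.
Qed.

Lemma PT_report tok idx (st : E -> seq (seq nat)) : PT tok -> PT idx -> PT st ->
  PT (fun e => report (tok e) (idx e) (st e)).
Proof.
by move=> ht hidx hst; rewrite /report /path_tokens /edge_tokens; pts.
Qed.

Lemma PT_answer m C kL tok : PT tok -> PT (fun e => answer m C kL (tok e)).
Proof.
move=> ht; rewrite /answer; have hv := PT_vertices ht; have hs := PT_state_of m C kL ht hv.
by have hr := PT_report ht hv hs; pts.
Qed.

Lemma PT_program m C kL (w : E -> seq (option bool)) : PT w -> PT (fun e => program m C kL (w e)).
Proof.
move=> hw; rewrite /program /word_of; have ha := PT_answer m C kL (PT_tokens hw); pts.
Qed.

End RunningProgram.

Lemma encode_natE m : encode_nat m = [seq Some b | b <- bin m] ++ [:: None].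
Proof. by rewrite cats1 /encode_nat /bin -map_comp. Qed.

Lemma word_ofE s : word_of s = encode_nats s.
Proof. by congr flatten; apply: eq_map => m; rewrite encode_natE. Qed.

Lemma tokensK s : tokens (encode_nats s) = s.
Proof.
have H (a : seq (seq bool)) : foldl token_step (a, [::]) (encode_nats s) = (catrev [seq rev (bin m) | m <- s] a, [::]).
  elim: s a => // m s IH a; rewrite -[encode_nats _]/(encode_nat m ++ encode_nats s) encode_natE foldl_cat foldl_cat.
  have -> : forall u, foldl token_step (a, u) [seq Some b | b <- bin m] = (a, catrev (bin m) u).
    by elim: (bin m) => //= b t IHt u; rewrite IHt.
  by rewrite /= IH.
rewrite /tokens H /= catrevE cats0 revK -map_comp -[RHS]map_id; apply: eq_map => m /=.
by rewrite revK binK.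
Qed.

Section Pow2.
Implicit Types x y z : nat.

(** The loop has as many turns as [x] has bits, so it cannot double at every turn. The term 1 covers
    the value 0 taken when x < y. *)
Lemma pow2_floorP x y : 0 < y -> pow2_floor x y * y <= x <= (2 * pow2_floor x y + 1) * y.
Proof.
move=> y0; rewrite /pow2_floor; case: (leqP y x) => [yx|xy]; last by rewrite mul0n muln0 add0n mul1n /= ltnW.
set f := fun z (_ : bool) => if (z + z) * y <= x then z + z else z.
have H s : foldl f 1 s * y <= x /\ (foldl f 1 s = 2 ^ size s \/ x < (foldl f 1 s + foldl f 1 s) * y).
  elim/last_ind: s => [|s b [h1 h2]]; first by split; [rewrite mul1n|left].
  rewrite foldl_rcons size_rcons expnS; move: h1 h2; move: (foldl f 1 s) => z h1 h2.
  rewrite /f; case: (leqP ((z + z) * y) x) => h; split=> //; last by right.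
  by case: h2 => [->|]; [left; lia | rewrite ltnNge h].
have [h1 h2] := H (bin x); rewrite h1 /=; case: h2 => [e|h2].
  by have := ltn_bin x; move: h1; rewrite e; nia.
by move: h2; move: (foldl f 1 (bin x)) => z h2; rewrite mulnDl mul1n; move: h2; rewrite addnn -mul2n => /ltnW /leq_trans; apply; exact: leq_addr.
Qed.

Lemma pow2_ceilP x y (z := pow2_ceil x y) : 0 < y ->
  [/\ exists k, z = 2 ^ k, x <= z * y & z = 1 \/ z * y < 2 * x].
Proof.
rewrite {}/z => y0; rewrite /pow2_ceil; set f := fun z (_ : bool) => if x <= z * y then z else z + z.
have H s : [/\ exists k, foldl f 1 s = 2 ^ k, x <= foldl f 1 s * y \/ foldl f 1 s = 2 ^ size s
   & foldl f 1 s = 1 \/ foldl f 1 s * y < 2 * x].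
  elim/last_ind: s => [|s b [[k hk] h2 h3]]; first by split; [exists 0 | right | left].
  rewrite foldl_rcons size_rcons expnS; move: h2 h3 hk; move: (foldl f 1 s) => z h2 h3 hk.
  rewrite /f; case: (leqP x _) => h; first by split; [exists k | left | ].
  split; first by exists k.+1; rewrite expnS hk; lia.
    case: h2 => h2; first by move: h; rewrite ltnNge h2.
    by right; rewrite h2; lia.
  by right; lia.
have [h1 h2 h3] := H (bin x); split=> //; case: h2 => // e.
by have := ltn_bin x; rewrite e; nia.
Qed.

End Pow2.

Section RatCode.
Local Open Scope ring_scope.

Lemma rat_code_frac (a b : nat) : coprime a b -> (0 < b)%N -> rat_code (a%:R / b%:R) = [:: a; b].
Proof.
move=> co b0; have b1 : (b%:Z == 0) = false by rewrite eqz_nat; case: (b) b0.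
have e : (a%:R / b%:R : rat) = (a%:Z)%:~R / (b%:Z)%:~R by rewrite -!pmulrn.
by rewrite /rat_code e coprimeq_num// coprimeq_den// b1 gtr0_sg ?ltz_nat// mul1r.
Qed.

Lemma ratr_code (R : numFieldType) (x : rat) : 0 <= x -> ratr x = `|numq x|%N%:R / `|denq x|%N%:R :> R.
Proof.
move=> x0; rewrite /ratr; congr (_ / _).
  by rewrite [in LHS](_ : numq x = `|numq x|%N) // gez0_abs// numq_ge0.
by rewrite [in LHS](_ : denq x = `|denq x|%N) // gez0_abs// ltW// denq_gt0.
Qed.

End RatCode.

Lemma nth_flatten_rows (X : Type) (d : X) (rows : seq (seq X)) n i j :
  all (fun s => size s == n) rows -> j < n -> nth d (flatten rows) (i * n + j) = nth d (nth [::] rows i) j.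
Proof.
elim: rows i => [|s rows IH] i; first by rewrite !nth_nil.
move=> /= /andP[/eqP hs hr] jn; case: i => [|i].
  by rewrite mul0n add0n nth_cat hs jn.
by rewrite nth_cat hs mulSn -addnA ltnNge leq_addr /= addKn IH.
Qed.

(** * Reading the instance and writing the routing *)

Section Instance.
Variable x : instance.
Notation n := (inst_n x).
Notation idx := (iota 0 n).
Definition inst_tokens : seq nat := [:: n; inst_r x] ++ rat_code (inst_d x) ++
    flatten [seq rat_code (inst_c x i j) | i <- enum 'I_n, j <- enum 'I_n].

Lemma tokens_instance : tokens (encode_instance x) = inst_tokens.
Proof. exact: tokensK. Qed.

Lemma iota_ord m : iota 0 m = map val (enum 'I_m).
Proof. by rewrite val_enum_ord. Qed.

Lemma pairs_flatten : flatten [seq rat_code (inst_c x i j) | i <- enum 'I_n, j <- enum 'I_n] =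
  flatten [seq flatten [seq rat_code (inst_c x i j) | j <- enum 'I_n] | i <- enum 'I_n].
Proof. by elim: (enum 'I_n) {1 3}(enum 'I_n) => [|i s IH] t //=; rewrite flatten_cat IH. Qed.

Lemma nth_pairs (i j : 'I_n) k : k < 2 ->
  nth 0 (flatten [seq rat_code (inst_c x i j) | i <- enum 'I_n, j <- enum 'I_n]) (2 * (i * n + j) + k) =
  nth 0 (rat_code (inst_c x i j)) k.
Proof.
move=> k2; rewrite pairs_flatten mulnDr mulnCA mulnA [i * 2 * n](_ : _ = i * (n * 2)); last by lia.
rewrite -addnA nth_flatten_rows; last 1 first.
- by have := ltn_ord j; lia.
- rewrite (nth_map i) ?size_enum_ord// nth_ord_enum mulnC nth_flatten_rows//.
    by rewrite (nth_map j) ?size_enum_ord// nth_ord_enum.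
  by apply/allP => s /mapP[j' _ ->].
apply/allP => s /mapP[i' _ ->]; rewrite size_flatten /shape -map_comp sumnE big_map /=.
by rewrite big_const_seq count_predT size_enum_ord iter_addn_0 mulnC.
Qed.

Lemma size_inst_tokens : size inst_tokens = 4 + n * (n * 2).
Proof.
rewrite /inst_tokens pairs_flatten !size_cat /= size_flatten /shape -map_comp sumnE big_map /=.
rewrite (eq_bigr (fun=> n * 2)) => [|i _ /=].
  by rewrite big_const_seq count_predT size_enum_ord iter_addn_0 mulnC.
by rewrite size_flatten /shape -map_comp sumnE big_map /= big_const_seq count_predT size_enum_ord iter_addn_0 mulnC.
Qed.

Lemma vertices_inst : vertices inst_tokens = idx.
Proof.
rewrite /vertices rangeE size_inst_tokens [nth _ _ _]/=; have -> : 4 + n * (n * 2) = n + (4 + n * (n * 2) - n) by nia.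
rewrite iotaD filter_cat add0n [X in _ ++ X](_ : _ = [::]) ?cats0.
  by apply/all_filterP/allP => i; rewrite mem_iota.
rewrite -[RHS](filter_pred0 (iota n (4 + n * (n * 2) - n))); apply: eq_in_filter => i; rewrite mem_iota => /andP[ni _]; rewrite ltnNge ni.
by [].
Qed.

Lemma nth_inst k : nth 0 inst_tokens (4 + k) =
  nth 0 (flatten [seq rat_code (inst_c x i j) | i <- enum 'I_n, j <- enum 'I_n]) k.
Proof. by []. Qed.

Lemma cap_num_inst (i j : 'I_n) : cap_num inst_tokens idx i j = `|numq (inst_c x i j)|.
Proof. by rewrite /cap_num size_iota nth_inst -[2 * _]addn0 nth_pairs. Qed.

Lemma cap_den_inst (i j : 'I_n) : cap_den inst_tokens idx i j = `|denq (inst_c x i j)|.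
Proof.
rewrite /cap_den size_iota; have -> : 5 + 2 * (i * n + j) = 4 + (2 * (i * n + j) + 1) by lia.
by rewrite nth_inst nth_pairs.
Qed.

(** The condition on [om] concerns the case that some path has an edge, as otherwise the amount does
    not occur in the output. *)
Lemma report_encode (st : seq (seq nat)) (sel : rel 'I_n) (om : rat) (wt : 'I_n -> 'I_n -> rat) (q : seq (seq nat)) :
  valid n q st ->
  (has (fun p => 1 < size p) st -> rat_code om = [:: 1; path_weight inst_tokens idx st]) ->
  (forall i j : 'I_n, i < j -> sel i j = (1 <= cap_num inst_tokens idx i j)) ->
  (forall i j : 'I_n, i < j -> sel i j ->
     rat_code (wt i j) = [:: (edge_weight inst_tokens idx i j).1; (edge_weight inst_tokens idx i j).2]) ->
  encode_routing (flow_of om sel wt st) = word_of (report inst_tokens idx st).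
Proof.
move=> hv hom hsel hwt; rewrite word_ofE /encode_routing; congr encode_nats.
rewrite /flow_of map_cat flatten_cat /report; congr (_ ++ _).
  rewrite -map_comp; congr flatten; apply/eq_in_map => p; rewrite mem_filter => /andP[sp hp].
  transitivity (rat_code om ++ size (ords n p) :: map val (ords n p)); first by [].
  rewrite hom; last by apply/hasP; exists p.
  have e := val_ords_valid hv hp sp; by rewrite e /path_tokens -{3}e size_map.
congr flatten; rewrite iota_ord map_allpairs -[RHS]/(flatten _) -map_comp; congr flatten; apply: eq_map => i /=.
rewrite filter_map -map_comp.
rewrite (eq_filter (a2 := fun j : 'I_n => (i < j) && sel i j)); last first.
  by move=> j /=; rewrite -iota_ord; case: (ltnP i j) => //= ij; rewrite hsel.
apply/eq_in_map => j; rewrite mem_filter => /andP[/andP[ij sij] _].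
transitivity (rat_code (wt i j) ++ [:: 2; val i; val j]); first by [].
by rewrite hwt// [RHS]/= -iota_ord.
Qed.

End Instance.

Local Open Scope ring_scope.

Section RationalInstance.
Variables (R : realType) (x : instance).
Notation n := (inst_n x).
Notation r := (inst_r x).
Notation idx := (iota 0 n).
Notation tok := (inst_tokens x).
Notation a := (map_mx (@ratr R) (inst_c x)).
Notation d := (ratr (inst_d x) : R).
Notation cn i j := (cap_num tok idx i j).
Notation cd i j := (cap_den tok idx i j).
Notation dn := `|numq (inst_d x)|%N.
Notation dd := `|denq (inst_d x)|%N.

Hypothesis reg : regular_graph a.
Hypothesis d0 : 0 < d <= 2 / 3.

Let dP : d = dn%:R / dd%:R.
Proof. by apply: ratr_code; have /andP[/ltW h _] := d0; rewrite -(ler0q R). Qed.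

Let aP (i j : 'I_n) : a i j = (cn i j)%:R / (cd i j)%:R.
Proof.
rewrite cap_num_inst cap_den_inst mxE; apply: ratr_code; have [h _ _ _] := reg.
by have := h i j; rewrite mxE ler0q.
Qed.

Let dd0 : (0 < dd)%N. Proof. by rewrite absz_gt0 denq_neq0. Qed.
Let cd0 (i j : 'I_n) : (0 < cd i j)%N. Proof. by rewrite cap_den_inst absz_gt0 denq_neq0. Qed.
Let ddR : 0 < dd%:R :> R. Proof. by rewrite ltr0n. Qed.
Let cdR (i j : 'I_n) : 0 < (cd i j)%:R :> R. Proof. by rewrite ltr0n. Qed.
Let dn0 : (0 < dn)%N.
Proof. by have /andP[h _] := d0; move: h; rewrite dP lt0n; case: (dn == 0)%N / eqP => // ->; rewrite mul0r ltxx. Qed.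

Lemma capacity_sym (i j : 'I_n) : inst_c x i j = inst_c x j i.
Proof. by have [_ h _ _] := reg; have := h i j; rewrite !mxE => /fmorph_inj. Qed.

Lemma quantized_sym i j : entry 0%N (quantized tok idx) i j = entry 0%N (quantized tok idx) j i.
Proof.
rewrite !entry_tab !size_iota andbC; case: ifP => // /andP[hj hi]; rewrite !nth_iota// !add0n.
rewrite -[i]/(val (Ordinal hi)) -[j]/(val (Ordinal hj)) !cap_num_inst !cap_den_inst.
by rewrite capacity_sym.
Qed.

Lemma quantized_capacity (i j : 'I_n) (q := quantized tok idx) :
  (entry 0%N q i j)%:R * d <= a i j * (big_of n r)%:R <= d * (2 * (entry 0%N q i j)%:R + 1).
Proof.
rewrite /q entry_iota size_iota.
have := @pow2_floorP (cn i j * big_of n r * dd) (cd i j * dn); rewrite muln_gt0 cd0 dn0 => /(_ isT).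
set z := pow2_floor _ _ => /andP[h1 h2].
rewrite dP aP; move: (big_of n r) h1 h2 => b h1 h2; move: h1 h2 (cdR i j) ddR; rewrite -!(ler_nat R) !(natrM, natrD).
move: ((cn i j)%:R : R) ((cd i j)%:R : R) (dn%:R : R) (dd%:R : R) (z%:R : R) (b%:R : R) => A B U V Z G h1 h2 B0 V0.
have BV : 0 < B * V by exact: mulr_gt0.
have -> : A / B * G = A * G * V / (B * V) by field; rewrite !gt_eqF.
have -> : Z * (U / V) = Z * (B * U) / (B * V) by field; rewrite !gt_eqF.
have -> : U / V * (2 * Z + 1) = (2 * Z + 1) * (B * U) / (B * V) by field; rewrite !gt_eqF.
by rewrite !ler_pM2r ?invr_gt0// h1.
Qed.

Lemma pow2_coprime (k : nat) (z := (2 ^ k)%N) : coprime 1 z /\ coprime 3 (z + z).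
Proof. by split; rewrite ?coprime1n// addnn -mul2n -expnS coprimeXr. Qed.

Lemma capacity_le1 (i j : 'I_n) : a i j <= 1.
Proof. by have [a0 _ _ /(_ i) <-] := reg; rewrite (bigD1 j)//= lerDl sumr_ge0. Qed.

Lemma edge_weight_code (i j : 'I_n) (e := edge_weight tok idx i j) : 0 < a i j ->
  rat_code (e.1%:R / e.2%:R) = [:: e.1; e.2] /\
  a i j * d / 2 <= ratr (e.1%:R / e.2%:R) <= 3 / 4 * a i j * d.
Proof.
move=> a0; have cn0 : (0 < cn i j)%N.
  by move: a0; rewrite aP lt0n; case: (cn i j == 0)%N / eqP => // ->; rewrite mul0r ltxx.
have ad : a i j * d <= 2 / 3.
  have /andP[d1 d2] := d0; rewrite -[leRHS]mul1r; apply: ler_pM (capacity_le1 i j) d2; exact: ltW.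
rewrite {}/e /edge_weight -[nth _ _ 3]/dd -[nth _ _ 2]/dn.
have adE : a i j * d = (cn i j * dn)%:R / (cd i j * dd)%:R by rewrite aP dP mulf_div -!natrM.
have -> : 3 / 4 * a i j * d = 3 / 4 * (a i j * d) by rewrite mulrA.
rewrite adE; rewrite adE in ad.
have W0 : (0 < cd i j * dd)%N by rewrite muln_gt0 cd0.
have X0 : (0 < cn i j * dn)%N by rewrite muln_gt0 cn0.
move: ad W0 X0; move: (cn i j * dn)%N (cd i j * dd)%N => X W ad W0 X0.
have WR : 0 < W%:R :> R by rewrite ltr0n.
have XW : (3 * X <= 2 * W)%N.
  by rewrite -(ler_nat R) !natrM; move: ad; rewrite ler_pdivrMr//; move: (X%:R : R) (W%:R : R) => u v; lra.
have [] := @pow2_ceilP (4 * W) (3 * X); first by rewrite muln_gt0.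
(* The value z = 1 is excluded by a d <= 2/3, so z is less than twice its lower bound. *)
move: (pow2_ceil _ _) => z [k ->] h1 [h2|h2]; first by move: h1; rewrite h2; lia.
have [co1 co3] := pow2_coprime k; move: co1 co3 (expn_gt0 2 k) h1 h2; move: (2 ^ k)%N => {}z co1 co3 /= z0 h1 h2.
have zR : 0 < z%:R :> R by rewrite ltr0n.
case: (leqP (z * X) (2 * W)) => zX /=; (split; first by apply: rat_code_frac => //; lia);
  rewrite (fmorph_div (@ratr R)) ?rmorph1 ?rmorph_nat.
- move: zX h1; rewrite -!(ler_nat R) !natrM; move: (z%:R : R) (X%:R : R) (W%:R : R) zR WR => p u v p0 v0 h h1.
  have e : p^-1 = 1 / p by rewrite div1r.
  have -> : 3 / 4 * (u / v) = 3 / 4 * u / v by rewrite mulrA.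
  rewrite e mul1r; apply/andP; split.
    by rewrite -mulrA -invfM ler_pdivrMr ?mulr_gt0// mulrAC ler_pdivlMr//; lra.
  by rewrite ler_pdivrMr// mulrAC ler_pdivlMr//; lra.
- move: zX h2; rewrite -!(ltr_nat R) !natrM natrD; move: (z%:R : R) (X%:R : R) (W%:R : R) zR WR => p u v p0 v0 h h2.
  have pp : 0 < p + p by rewrite addr_gt0.
  have -> : 3 / 4 * (u / v) = 3 / 4 * u / v by rewrite mulrA.
  apply/andP; split.
    by rewrite -mulrA -invfM ler_pdivrMr ?mulr_gt0// mulrAC ler_pdivlMr//; lra.
  by rewrite ler_pdivrMr// mulrAC ler_pdivlMr//; lra.
Qed.

Lemma path_weight_code (st : seq (seq nat)) (y := path_weight tok idx st) : (0 < n)%N -> (0 < size st)%N ->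
  rat_code (1%:R / y%:R) = [:: 1%N; y] /\
  ((n <= 4 * size st)%N -> n%:R * d / (32 * (size st)%:R) <= ratr (1%:R / y%:R) <= n%:R * d / (16 * (size st)%:R)).
Proof.
move=> n0 t0; rewrite {}/y /path_weight size_iota -[nth _ _ 3]/dd -[nth _ _ 2]/dn.
have [] := @pow2_ceilP (16 * size st * dd) (n * dn); first by rewrite muln_gt0 n0.
move: (pow2_ceil _ _) => y [k ->] h1 h2.
move: (expn_gt0 2 k) h1 h2; move: (2 ^ k)%N => {}y /= y0 h1 h2.
split; first by apply: rat_code_frac => //; rewrite coprime1n.
move=> nt; have dR : (3 * dn <= 2 * dd)%N.
  have /andP[_] := d0; rewrite dP ler_pdivrMr// -(ler_nat R) !natrM.
  by move: (dn%:R : R) (dd%:R : R) => u v; lra.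
(* A denominator 1 would mean n d >= 16 [size st], against n <= 4 [size st] and d <= 2/3. *)
case: h2 => h2; first by move: h1; rewrite h2; move: dR nt t0 dn0 dd0; clear; move: (size st) dn dd => t u v; nia.
have -> : ratr (1 / y%:R) = 1 / y%:R :> R by rewrite (fmorph_div (@ratr R)) rmorph1 rmorph_nat.
rewrite dP.
have yR : 0 < y%:R :> R by rewrite ltr0n.
have tR : 0 < (size st)%:R :> R by rewrite ltr0n.
move: h1 h2; rewrite -(ler_nat R) -(ltr_nat R) !natrM.
move: (y%:R : R) ((size st)%:R : R) (n%:R : R) (dn%:R : R) (dd%:R : R) yR tR ddR => p t u w v p0 t0' v0 h1 h2.
rewrite mulrA -!mulrA -!invfM !mulrA.
by apply/andP; split; rewrite ler_pdivrMr ?mulr_gt0// mulrAC ler_pdivlMr ?mulr_gt0//; lra.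
Qed.

End RationalInstance.

Theorem theorem5p6 (R : realType) :
  exists c1 c2 : R,
    [/\ 0 < c1, 0 < c2,
        forall (n : nat) (c : 'M[R]_n) (r : nat) (d : R),
          admissible c1 c r d ->
          exists (lambda : R) (delta : 'M[R]_n) (f : routing R n),
            c2 * (ln r%:R) ^- 5 <= lambda /\
            spectral_SSE_flow c (2 * r) d lambda delta f
      & @poly_time_solvable _ instance (fun x => routing rat (inst_n x))
          encode_instance (fun x f => encode_routing f)
          (fun x => admissible c1 (map_mx ratr (inst_c x)) (inst_r x)
                      (ratr (inst_d x)))
          (fun x f => exists (lambda' : R) (delta : 'M[R]_(inst_n x)),
            c2 * (ln (inst_r x)%:R) ^- 5 <= lambda' /\
            spectral_SSE_flow (map_mx ratr (inst_c x)) (4 * inst_r x)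
              (ratr (inst_d x)) lambda' delta (real_routing R f))].
Proof.
have [c1 [c2 [kL consts]]] := flow_constants_exist R; have [c10 c20 main] := consts.
exists c1, c2; split=> //; first exact: real_flow_exists consts.
pose F := program (newton_const 100 kL) (tick_const 100 kL) kL.
have [M [p run]] := poly_time_word (PT_program (newton_const 100 kL) (tick_const 100 kL) kL (w := id) PT_id).
exists M, p => x adm; rewrite run /program tokens_instance.
have [reg r2 _ _] := adm.
(* For d = 0 the empty routing is correct, and [answer] tests for this case before it divides by
   d. *)
have [dz|dn] := eqVneq (inst_d x) 0.
  exists [::]; last by rewrite /answer /= dz.
  exists (c2 * (ln (inst_r x)%:R) ^- 5), 0; split=> //; rewrite dz rmorph0; exact: zero_flow.
have dR : ratr (inst_d x) != 0 :> R by rewrite fmorph_eq0.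
have [n1 rn d01 lb flow] := main _ _ _ _ adm dR.
have /andP[dpos _] := d01.
have [t0 hv tn {}flow] := flow _ (quantized_sym reg) (quantized_capacity reg d01).
have stE : state_of (newton_const 100 kL) (tick_const 100 kL) kL (inst_tokens x) (iota 0 (inst_n x)) =
  frank_wolfe (iota 0 (inst_n x)) (inst_r x) (lam_of kL (inst_r x)) (big_of (inst_n x) (inst_r x))
    (quantized (inst_tokens x) (iota 0 (inst_n x))) (newton_steps (newton_const 100 kL) (inst_n x))
    (ticks_of (tick_const 100 kL) (iota 0 (inst_n x)) (inst_r x)) by rewrite /state_of size_iota.
set st := frank_wolfe _ _ _ _ _ _ _ in stE t0 hv tn flow.
have ansE : answer (newton_const 100 kL) (tick_const 100 kL) kL (inst_tokens x) =
    report (inst_tokens x) (iota 0 (inst_n x)) st.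
  by rewrite /answer vertices_inst stE /= absz_eq0 numq_eq0 (negbTE dn).
pose sel : rel 'I_(inst_n x) := fun i j => (1 <= cap_num (inst_tokens x) (iota 0 (inst_n x)) i j)%N.
pose wt (i j : 'I_(inst_n x)) : rat := (edge_weight (inst_tokens x) (iota 0 (inst_n x)) i j).1%:R /
  (edge_weight (inst_tokens x) (iota 0 (inst_n x)) i j).2%:R.
pose om : rat := 1%:R / (path_weight (inst_tokens x) (iota 0 (inst_n x)) st)%:R.
have selE (i j : 'I_(inst_n x)) : sel i j = (0 < map_mx (@ratr R) (inst_c x) i j).
  have [h _ _ _] := reg; have := h i j; rewrite mxE ler0q => c0.
  by rewrite /sel cap_num_inst ltr0q -numq_gt0 absz_gt0 lt_neqAle numq_ge0 c0 andbT eq_sym.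
have [omC omP] := path_weight_code d01 (ltnW n1) t0.
exists (flow_of om sel wt st); last first.
  rewrite ansE (report_encode hv (om := om) (sel := sel) (wt := wt))//.
  by move=> i j ij; rewrite selE => /(edge_weight_code reg d01)[].
have wtP (i j : 'I_(inst_n x)) : (i < j)%N -> 0 < map_mx (@ratr R) (inst_c x) i j ->
    map_mx (@ratr R) (inst_c x) i j * ratr (inst_d x) / 2 <= ratr (wt i j) <= 3 / 4 * map_mx (@ratr R) (inst_c x) i j * ratr (inst_d x).
  by move=> _ /(edge_weight_code reg d01)[].
(* The flow found meets the bound for every index from 2 r on, here for 4 r. *)
have rm : (2 * inst_r x <= 4 * inst_r x)%N by rewrite leq_mul2r orbT.
rewrite real_routing_flow; exists (1 / (20 * (lam_of kL (inst_r x))%:R)).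
have tR : 0 < (size st)%:R :> R by rewrite ltr0n.
have nR : 0 < (inst_n x)%:R :> R by rewrite ltr0n ltnW.
case: (boolP (has (fun p => 1 < size p)%N st)) => [/hasP[p' hp sp]|no].
  have [delta hd] := flow (ratr om) sel (fun i j => ratr (wt i j)) (4 * inst_r x)%N (omP (tn _ hp sp)) (fun i j _ => selE i j) wtP rm.
  by exists delta.
have omR : ((inst_n x)%:R * ratr (inst_d x) / (32 * (size st)%:R) : R) <= (inst_n x)%:R * ratr (inst_d x) / (16 * (size st)%:R) <=
    ((inst_n x)%:R * ratr (inst_d x) / (16 * (size st)%:R) : R).
  rewrite lexx andbT; apply: ler_wpM2l; first by rewrite mulr_ge0// ltW.
  by rewrite lef_pV2 ?posrE ?mulr_gt0// ler_pM2r// ler_nat.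
have [delta hd] := flow _ sel (fun i j => ratr (wt i j)) (4 * inst_r x)%N omR (fun i j _ => selE i j) wtP rm.
exists delta; split=> //.
rewrite has_filter negbK in no.
by move: hd; rewrite /flow_of (eqP no).
Qed.
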